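(* Let $n$, $K=S+R$ and $u$ satisfy the following. (1) $n\in C^1([0,\infty))$ and $n(0)=0$. (2) $K\in L^1(\mathbb{R})$ is even, positive, and convex on $(0,\infty)$, and $K=S+R$, where either $S(x)=L(x)=\log(1/|x|)$ or $S(x)=H(x)=|x|^{-1/2}$, and $R$ has a weak second derivative $R''\in L^1(\mathbb{R})$. (3) $u\in C([0,\infty))$ is bounded, nonnegative, satisfies $u(0)=0$, is for sufficiently small $x>0$ both continuously differentiable and increasing, and solves $$(1+n(u(x)))\,u(x)^2=\int_0^\infty \delta_x^2K(y)\,u(y)\,dy\qquad\text{for all } x\ge 0 .$$ If $S=L$, then $$\lim_{x\to 0}\frac{u(x)}{x\log(1/x)}=\frac12\quad\text{and}\quad \lim_{x\to 0}\frac{u'(x)}{\log(1/x)}=\frac12 ,$$ while if $S=H$, then $$\lim_{x\to 0}\frac{u(x)}{x^{1/2}}=\frac{\pi}{2}\quad\text{and}\quad \lim_{x\to 0}\frac{u'(x)}{x^{-1/2}}=\frac{\pi}{4}.$$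
   Context: Here $\delta_x^2K(y)=K(y+x)+K(y-x)-2K(y)$ is the second-order central difference. All limits $x\to0$ are taken through $x>0$. ''Increasing'' means strictly increasing. *)

(* Defs.v *)
From HB Require Import structures.
From mathcomp Require Import all_boot all_order all_algebra.
From mathcomp Require Import all_classical all_reals all_analysis.

Set Implicit Arguments.
Unset Strict Implicit.
Unset Printing Implicit Defensive.

Import Order.TTheory GRing.Theory Num.Theory.
Import numFieldNormedType.Exports.

Local Open Scope classical_set_scope.
Local Open Scope ring_scope.

(* At 0 both singular parts take an arbitrary finite value (that of [ln] and of
   [powR] at their singular point); nothing depends on it. *)
Definition log_part (R : realType) (x : R) : R := ln (1 / `|x|).

Definition sqrt_part (R : realType) (x : R) : R := `|x| `^ (- (1 / 2)).

Definition central_diff2 (R : realType) (f : R -> R) (x y : R) : R :=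
  f (y + x) + f (y - x) - 2 * f y.

(* [n] is a total function of which only the values on [0, +oo[ matter: the
   difference quotients are restricted to the half-line, hence the derivative
   is one-sided at 0 and the usual one at x > 0. *)
Definition C1_halfline (R : realType) (n : R -> R) : Prop :=
  exists2 dn : R -> R, {within `[0, +oo[, continuous dn} &
    forall x : R, 0 <= x ->
      (n y - n x) / (y - x) @[y --> within `[0, +oo[ x^'] --> dn x.

Definition test_function (R : realType) (phi : R -> R) : Prop :=
  (forall (k : nat) (x : R), derivable (phi^`(k))%classic x 1) /\
  compact (closure [set x | phi x != 0]).

Definition is_weak_derivative (R : realType) (k : nat) (f g : R -> R) : Prop :=
  [/\ locally_integrable [set: R] f, locally_integrable [set: R] g &
    forall phi : R -> R, test_function phi ->
      \int[lebesgue_measure]_x (f x * (phi^`(k))%classic x) =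
      (-1) ^+ k * \int[lebesgue_measure]_x (g x * phi x)].

(* Main.v *)
Require Import Defs.
From HB Require Import structures.
From mathcomp Require Import all_boot all_order all_algebra.
From mathcomp Require Import all_classical all_reals all_analysis.
From mathcomp Require Import measurable_realfun real_interval.
From mathcomp Require Import ring lra zify.

Import Order.TTheory GRing.Theory Num.Theory.
Import numFieldNormedType.Exports.

Local Open Scope classical_set_scope.
Local Open Scope ring_scope.

(* Let [A x] be the integral on the right-hand side. Since [n 0 = 0] and [n] is
   C^1, [A = (1 + o(1)) u^2] and [A' = (2 + o(1)) u u'], so it suffices to find
   the asymptotics of [A] and [A']. The weak second derivative of the remainder
   is integrable, so replacing [K] by its singular part [S] changes the integral
   of the second difference over a half-line by [O(x^2)], and of its increment
   from [x] to [x'] by [O(x'^2 - x^2)]. The a priori bounds on [u] come from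
   convexity of [K], monotonicity of [u] and Chebyshev's sum inequality, those
   on [u'] from a weighted maximum argument.
   For [S = L], [A x = x^2 phi x + O(x^2 t)] and [A' x = 2 x phi x + O(x t)] with
   [phi x] the integral of [u y / y^2] over [(x, e)] and [t = sqrt (phi x)], hence
   [u ~ x t]; then [phi' = - u / x^2] gives [t' ~ - 1 / (2 x)], i.e.
   [t ~ ln (1 / x) / 2].
   For [S = H], the profile [sqrt y] is mapped to [c x] with [c = pi / 2]. Let [m]
   and [M] be the lower and upper limits of [u x / sqrt x]. Inserting
   [m sqrt y <= u y <= M sqrt y] and the monotonicity of [u] gives two
   inequalities which combine to [(c - 4 / 3) (1 - m / M) <= 0], and [8 / 3 < pi]
   forces [m = M = c]. *)


(** * Integration on the line *)

(** The kernel [central_diff2 K x] has integral zero over the half-line, so [u x] may be subtracted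
    from [u], which tames the sign change of the kernel on []0, x[]. The singular part cannot be
    differentiated under the integral sign, because [S'] is not integrable at 0. But [A] is
    differentiable since the equation expresses it through [n] and [u], and its derivative can be
    read off from the right increments [A (x + h) - A x], in which the singular term acts on
    [u y - u x]. That costs a Lipschitz constant of [u] near [x], the very quantity to be bounded.
    The circle is broken by shrinking the window around [x] to a small fraction of [x]: the local
    term becomes a small multiple of [u u'] and is absorbed by [A' ~ 2 u u']. For [H], inserting
    [m sqrt y <= u y <= M sqrt y] alone would still allow [m < M]. On the part of []0, x[] where
    [M sqrt y] exceeds [u x], monotonicity replaces it by [u x], and this gain is what produces the
    constant [4 / 3]. *)

Section IntegralToolkit.
Context {R : realType}.
Notation mu := (@lebesgue_measure R).
Notation Itg D f := (mu.-integrable D (EFin \o f)).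
Notation mR := (@measurable _ (measurableTypeR R)).
Implicit Types (D E : set R) (f g w : R -> R).

Lemma Itg_measurable D f : Itg D f -> measurable_fun D f.
Proof. by move/measurable_int/measurable_EFinP. Qed.

Lemma ItgD D f g : measurable D -> Itg D f -> Itg D g ->
  Itg D (fun x => f x + g x).
Proof. by move=> mD fi gi; apply: (eq_integrable (mD : mR D) _ _ _ (integrableD (mD : mR D) fi gi)). Qed.

Lemma ItgB D f g : measurable D -> Itg D f -> Itg D g ->
  Itg D (fun x => f x - g x).
Proof. by move=> mD fi gi; apply: (eq_integrable (mD : mR D) _ _ _ (integrableB (mD : mR D) fi gi)). Qed.

Lemma ItgZl D f c : measurable D -> Itg D f -> Itg D (fun x => c * f x).
Proof. by move=> mD fi; apply: (eq_integrable (mD : mR D) _ _ _ (integrableZl (mD : mR D) c fi)). Qed.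

Lemma ItgZr D f c : measurable D -> Itg D f -> Itg D (fun x => f x * c).
Proof.
by move=> mD fi; apply: (eq_integrable (mD : mR D) _ _ _ (ItgZl D f c mD fi)) => x _ /=; rewrite mulrC.
Qed.

Lemma Itg_sub D E f : measurable E -> measurable D -> D `<=` E ->
  Itg E f -> Itg D f.
Proof. by move=> mE mD; exact: (@integrableS _ (measurableTypeR R) R mu E D). Qed.

Lemma Itg_eq D f g : measurable D -> (forall x, D x -> f x = g x) ->
  Itg D f -> Itg D g.
Proof.
by move=> mD fg; apply: (eq_integrable (mD : mR D)) => x /[!inE] Dx; rewrite /= fg.
Qed.

Lemma Itg_le D f g : measurable D -> measurable_fun D f ->
  (forall x, D x -> `|f x| <= g x) -> Itg D g -> Itg D f.
Proof.
move=> mD mf fg; apply: le_integrable => //; first exact/measurable_EFinP.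
by move=> x Dx /=; rewrite lee_fin (le_trans (fg _ Dx))// ler_norm.
Qed.

Lemma Itg_mkcond D f : measurable D -> Itg D f <-> Itg setT (f \_ D).
Proof.
move=> mD; have := @integrable_mkcond _ (measurableTypeR R) R mu D (EFin \o f) mD.
by rewrite restrict_EFin.
Qed.

Lemma Itg_norm D f : Itg D f -> Itg D (fun x => `|f x|).
Proof. exact: integrable_norm. Qed.

Lemma Itg_mulr_bounded D f w B : measurable D -> Itg D f ->
  measurable_fun D w -> (forall x, D x -> `|w x| <= B) ->
  Itg D (fun x => f x * w x).
Proof.
move=> mD fi mw wB; have fi' : Itg D (fun x => `|f x| * B).
  by apply: ItgZr => //; exact: Itg_norm.
apply: Itg_le fi' => //.
  by apply: measurable_funM => //; exact: Itg_measurable fi.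
by move=> x Dx; rewrite normrM ler_wpM2l// wB.
Qed.

Lemma Itg_cst (a b c : R) : Itg `]a, b[ (fun=> c).
Proof.
apply: measurable_bounded_integrable => //=; last exact: bounded_cst.
by rewrite lebesgue_measure_itv/=; case: ifPn => // _; rewrite -EFinB ltry.
Qed.

Lemma Rint_cst (a b c : R) : a <= b -> \int[mu]_(x in `]a, b[) c = c * (b - a).
Proof.
move=> ab; rewrite Rintegral_cst//= lebesgue_measure_itv/= lte_fin.
by move: ab; rewrite le_eqVlt => /predU1P[->|->//]; rewrite ltxx subrr.
Qed.

Lemma Itg_bounded (a b : R) f B : measurable_fun `]a, b[ f ->
  (forall x, a < x < b -> `|f x| <= B) -> Itg `]a, b[ f.
Proof.
move=> mf fB; by apply: (Itg_le `]a, b[ f (fun=> B)) => //; exact: Itg_cst.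
Qed.

(** The bounds on the singular kernels fail at one point of the domain. A singleton is null, so this
    and the next variants ignore it. *)
Lemma Itg_but D f p : measurable D -> measurable_fun D f ->
  Itg (D `\ p) f -> Itg D f.
Proof.
move=> mD mf; have := @negligible_integrable _ _ _ mu D [set p] (EFin \o f).
case=> //; [exact/measurable_EFinP|exact: lebesgue_measure_set1].
Qed.

Lemma Rint_but D f p : measurable D -> Itg D f ->
  \int[mu]_(x in D `\ p) f x = \int[mu]_(x in D) f x.
Proof.
move=> mD fi; rewrite /Rintegral integral_setD1//; first exact: measurableD.
apply: measurable_funS (measurable_int _ fi) => //; exact: measurableD.
Qed.

Lemma le_Rint_but D f g p : measurable D -> Itg D f -> Itg D g ->
  (forall x, D x -> x != p -> f x <= g x) ->
  \int[mu]_(x in D) f x <= \int[mu]_(x in D) g x.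
Proof.
move=> mD fi gi fg; rewrite -(Rint_but D f p)// -(Rint_but D g p)//.
have mDp : measurable (D `\ p) by exact: measurableD.
apply: le_Rintegral => //; [exact: Itg_sub fi|exact: Itg_sub gi|].
by move=> x [Dx /eqP xp]; exact: fg.
Qed.

Lemma le_Rint D f g : measurable D -> Itg D f -> Itg D g ->
  (forall x, D x -> f x <= g x) ->
  \int[mu]_(x in D) f x <= \int[mu]_(x in D) g x.
Proof. by move=> mD; exact: (@le_Rintegral _ (measurableTypeR R) R mu D). Qed.

Lemma eq_Rint D f g : (forall x, D x -> f x = g x) ->
  \int[mu]_(x in D) f x = \int[mu]_(x in D) g x.
Proof. by move=> fg; apply: eq_Rintegral => x /[!inE]; exact: fg. Qed.

Lemma normr_Rint_le_but D f g p : measurable D -> Itg D f -> Itg D g ->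
  (forall x, D x -> x != p -> `|f x| <= g x) ->
  `|\int[mu]_(x in D) f x| <= \int[mu]_(x in D) g x.
Proof.
move=> mD fi gi fg; apply: (le_trans (@le_normr_Rintegral _ (measurableTypeR R) R mu D f mD fi)).
by apply: (le_Rint_but _ _ _ p) => //; exact: Itg_norm.
Qed.

Lemma normr_Rint_le D f g : measurable D -> Itg D f -> Itg D g ->
  (forall x, D x -> `|f x| <= g x) ->
  `|\int[mu]_(x in D) f x| <= \int[mu]_(x in D) g x.
Proof.
by move=> mD fi gi fg; apply: (normr_Rint_le_but _ _ _ 0) => // x Dx _; exact: fg.
Qed.

Lemma Rint_sub_le D E f : measurable E -> measurable D -> D `<=` E ->
  Itg E f -> (forall x, E x -> 0 <= f x) ->
  \int[mu]_(x in D) f x <= \int[mu]_(x in E) f x.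
Proof.
move=> mE mD DE fi f0; rewrite /Rintegral fine_le//.
- by apply: integrable_fin_num => //; exact: Itg_sub fi.
- exact: integrable_fin_num.
- apply: ge0_subset_integral => //; exact: measurable_int fi.
Qed.

(** The upper end is an arbitrary interval bound, so that bounded intervals and half-lines are cut
    by one statement. *)
Lemma Rint_split (a c : R) (b : itv_bound R) f : a <= c -> (BRight c <= b)%O ->
  Itg [set` Interval (BRight a) b] f ->
  \int[mu]_(x in [set` Interval (BRight a) b]) f x =
  \int[mu]_(x in `]a, c[) f x + \int[mu]_(x in [set` Interval (BRight c) b]) f x.
Proof.
move=> ac cb fi; have := @Rintegral_itvB R f (BRight a) b c fi.
rewrite bnd_simp => /(_ ac cb) <-; rewrite Rintegral_itv_bndo_bndc.
  by rewrite addrC subrK.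
apply: Itg_sub fi => //; apply: subset_itvl.
by apply: le_trans cb; rewrite bnd_simp.
Qed.

Lemma Rint_split_oo (a c b : R) f : a <= c <= b -> Itg `]a, b[ f ->
  \int[mu]_(x in `]a, b[) f x =
  \int[mu]_(x in `]a, c[) f x + \int[mu]_(x in `]c, b[) f x.
Proof.
move=> /andP[ac]; rewrite le_eqVlt => /predU1P[-> _|cb fi].
  by rewrite (@set_itv_ge _ _ (BRight b)) ?bnd_simp ?ltxx// Rintegral_set0 addr0.
by rewrite (Rint_split a c) ?bnd_simp.
Qed.

Lemma Rint_split_oy (a c : R) f : a <= c -> Itg `]a, +oo[ f ->
  \int[mu]_(x in `]a, +oo[) f x =
  \int[mu]_(x in `]a, c[) f x + \int[mu]_(x in `]c, +oo[) f x.
Proof. by move=> ac fi; rewrite (Rint_split a c) ?bnd_simp. Qed.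

Lemma Itg_split (a c : R) (b : itv_bound R) f :
  measurable_fun [set` Interval (BRight a) b] f ->
  Itg `]a, c[ f -> Itg [set` Interval (BRight c) b] f ->
  Itg [set` Interval (BRight a) b] f.
Proof.
move=> mf f1 f2; apply: (Itg_but _ _ c) => //.
have mD x : measurable (`]a, c[ `|` [set` Interval (BRight c) b] `|` [set x]).
  by apply: measurableU => //; exact: measurableU.
have : Itg (`]a, c[ `|` [set` Interval (BRight c) b]) f.
  move/integrableP : f1 => [mf1 if1]; move/integrableP : f2 => [mf2 if2].
  apply/integrableP; split; first exact/measurable_funU.
  rewrite ge0_integral_setU//=.
  - exact: lte_add_pinfty.
  - have mU : measurable_fun (`]a, c[ `|` [set` Interval (BRight c) b])
        (EFin \o f : measurableTypeR R -> \bar R).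
      exact/measurable_funU.
    by apply/measurable_EFinP/measurableT_comp => //; exact/measurable_EFinP.
  - apply/disj_setPS => y [/=]; rewrite in_itv/= => /andP[_ yc].
    case: b {mf mf2 if2 mD} => [[] b|[]] /=; rewrite in_itv/= => /andP[cy _];
      by move: (lt_trans yc cy); rewrite ltxx.
apply: Itg_sub.
- exact: measurableU.
- exact: measurableD.
- move=> y [/= yab /eqP yc]; move: yab.
  have [ylt|cy|] := ltgtP y c; last by move=> /eqP; rewrite (negbTE yc).
  + by move=> yab; left => /=; rewrite in_itv/= ylt andbT; move: yab; rewrite itv_boundlr bnd_simp => /andP[].
  + by move=> yab; right => /=; move: yab; rewrite !itv_boundlr !bnd_simp => /andP[_ ->]; rewrite cy.
Qed.

End IntegralToolkit.

(** * Change of variables by translations and reflections *)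

Section MeasurePreserving.
Context {R : realType}.
Notation mu := (@lebesgue_measure R).
Notation Itg D f := (mu.-integrable D (EFin \o f)).
Notation mR := (measurableTypeR R).

Section Generic.
Context (phi : R -> R).
Hypothesis mphi : measurable_fun [set: mR] (phi : mR -> mR).
Hypothesis phi_mu : forall A : set R, measurable A ->
  pushforward mu (phi : mR -> mR) A = mu A.

Lemma Itg_measure_preserving (D : set R) (f : R -> R) : measurable D ->
  Itg D f -> Itg (phi @^-1` D) (f \o phi).
Proof.
move=> mD /integrableP[mf fi]; apply/integrableP; split.
  apply: (@measurable_comp _ _ _ mR mR _ D (EFin \o f : mR -> \bar R)) => //.
    by move=> _ [x Dx <-].
  exact: measurable_funS mphi.
apply: le_lt_trans fi.
rewrite -(@ge0_integral_pushforward _ _ mR mR _ phi mphi mu D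
  (fun x => `|(EFin \o f) x|)%E)//; last first.
  by apply: measurableT_comp.
rewrite le_eqVlt; apply/orP; left; apply/eqP.
apply: eq_measure_integral => A mA _; exact: phi_mu.
Qed.

Lemma Rint_measure_preserving (D : set R) (f : R -> R) : measurable D ->
  Itg D f -> \int[mu]_(x in D) f x = \int[mu]_(x in phi @^-1` D) f (phi x).
Proof.
move=> mD fi; rewrite [LHS]Rintegral_mkcond [RHS]Rintegral_mkcond.
have fDi : Itg setT (f \_ D).
  exact: (Itg_mkcond D f mD).1.
have := @integral_pushforward _ _ mR mR _ phi mphi mu setT (EFin \o (f \_ D)).
move=> /(_ _ _ measurableT); rewrite preimage_setT => H.
rewrite /Rintegral; congr fine.
transitivity (\int[pushforward mu (phi : mR -> mR)]_x ((f \_ D) x)%:E)%E.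
  by apply: eq_measure_integral => A mA _; exact/esym/phi_mu.
rewrite H.
- by apply: eq_integral => x _ /=; congr EFin; rewrite !patchE.
- exact: measurable_int fDi.
- exact: (Itg_measure_preserving setT (f \_ D) measurableT fDi).
Qed.
End Generic.

Lemma lebesgue_measure_shift (c : R) (A : set R) : measurable A ->
  pushforward mu ((fun t => t + c) : mR -> mR) A = mu A.
Proof.
move=> mA; have mphi : measurable_fun [set: mR] ((fun t => t + c) : mR -> mR).
  exact: measurable_funD.
apply/esym/(@lebesgue_measure_unique R (pushforward mu ((fun t => t + c) : mR -> mR))) => //= _ [[a b]] _ <-.
rewrite /pushforward.
rewrite (_ : _ @^-1` _ = `](a - c), (b - c)]%classic); last first.
  by apply/seteqP; split => x /=; rewrite !in_itv/= ltrBlDr lerBrDr.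
by rewrite !lebesgue_measure_itv/= !lte_fin ltrD2r -!EFinB; congr (if _ then _%:E else _); ring.
Qed.

Lemma lebesgue_measure_reflect (c : R) (A : set R) : measurable A ->
  pushforward mu ((fun t => c - t) : mR -> mR) A = mu A.
Proof.
move=> mA; have mphi : measurable_fun [set: mR] ((fun t => c - t) : mR -> mR).
  exact: measurable_funB.
apply/esym/(@lebesgue_measure_unique R (pushforward mu ((fun t => c - t) : mR -> mR))) => //= _ [[a b]] _ <-.
rewrite /pushforward.
(* Reflection moves the closed end of the interval to the other side, which leaves its length
   unchanged. *)
rewrite (_ : _ @^-1` _ = `[(c - b), (c - a)[%classic); last first.
  apply/seteqP; split => x /=; rewrite !in_itv/= => /andP[]; lra.
by rewrite !lebesgue_measure_itv/= !lte_fin ltrD2l ltrN2 -!EFinB; congr (if _ then _%:E else _); ring.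
Qed.

Lemma preimage_shift_itvoo (a b c : R) :
  (fun t => t + c) @^-1` `]a, b[%classic = `](a - c), (b - c)[%classic.
Proof.
by apply/seteqP; split => x /=; rewrite !in_itv/= => /andP[]; lra.
Qed.

Lemma preimage_reflect_itvoo (a b c : R) :
  (fun t => c - t) @^-1` `]a, b[%classic = `](c - b), (c - a)[%classic.
Proof.
by apply/seteqP; split => x /=; rewrite !in_itv/= => /andP[]; lra.
Qed.

Let mshift c : measurable_fun [set: mR] ((fun t => t + c) : mR -> mR).
Proof. exact: measurable_funD. Qed.

Let mreflect c : measurable_fun [set: mR] ((fun t => c - t) : mR -> mR).
Proof. exact: measurable_funB. Qed.

Lemma Itg_shift (c a b : R) (f : R -> R) :
  Itg `]a, b[ f -> Itg `](a - c), (b - c)[ (fun t => f (t + c)).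
Proof.
rewrite -preimage_shift_itvoo => fi.
exact: (Itg_measure_preserving _ (mshift c) (lebesgue_measure_shift c)).
Qed.

Lemma Rint_shift (c a b : R) (f : R -> R) : Itg `]a, b[ f ->
  \int[mu]_(x in `]a, b[) f x = \int[mu]_(t in `](a - c), (b - c)[) f (t + c).
Proof.
rewrite -preimage_shift_itvoo => fi.
exact: (Rint_measure_preserving _ (mshift c) (lebesgue_measure_shift c)).
Qed.

Lemma Itg_reflect (c a b : R) (f : R -> R) :
  Itg `]a, b[ f -> Itg `](c - b), (c - a)[ (fun t => f (c - t)).
Proof.
rewrite -preimage_reflect_itvoo => fi.
exact: (Itg_measure_preserving _ (mreflect c) (lebesgue_measure_reflect c)).
Qed.

Lemma Rint_reflect (c a b : R) (f : R -> R) : Itg `]a, b[ f ->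
  \int[mu]_(x in `]a, b[) f x = \int[mu]_(t in `](c - b), (c - a)[) f (c - t).
Proof.
rewrite -preimage_reflect_itvoo => fi.
exact: (Rint_measure_preserving _ (mreflect c) (lebesgue_measure_reflect c)).
Qed.

Lemma Itg_shiftT (c : R) (f : R -> R) :
  Itg setT f -> Itg setT (fun t => f (t + c)).
Proof.
move=> fi; have := Itg_measure_preserving _ (mshift c) (lebesgue_measure_shift c) setT f.
by rewrite preimage_setT; apply.
Qed.

End MeasurePreserving.

(** * The fundamental theorem of calculus with singular or infinite ends *)

Section SingularFTC.
Context {R : realType}.
Notation mu := (@lebesgue_measure R).
Notation Itg D f := (mu.-integrable D (EFin \o f)).

(** The ordinary theorem applies on each compact [[s n, t n]], and monotone convergence passes to
    the union because [f] is nonnegative. Only limits of [F] along the ends are needed, so a pole of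
    [f] and an infinite end are handled alike. *)
Lemma FTC_exhaustion (D : set R) (s t : nat -> R) (la lb : R) (f F : R -> R) :
  (forall n, s n < t n) -> (forall n, s n.+1 <= s n) ->
  (forall n, t n <= t n.+1) ->
  D = \bigcup_n `[s n, t n]%classic ->
  (forall x, D x -> 0 <= f x) -> (forall x, D x -> {for x, continuous f}) ->
  (forall x, D x -> is_derive x 1 F (f x)) ->
  F (s n) @[n --> \oo] --> la -> F (t n) @[n --> \oo] --> lb ->
  Itg D f /\ \int[mu]_(x in D) f x = lb - la.
Proof.
move=> st ds it DE f0 cf dF Fla Flb.
have sub n : `[s n, t n]%classic `<=` D by rewrite DE => x xn; exists n.
have nd : nondecreasing_seq (fun n => `[s n, t n]%classic).
  apply/nondecreasing_seqP => n; rewrite subsetEset => x /=; rewrite !in_itv/=.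
  by move=> /andP[/(le_trans (ds n)) -> /le_trans ->].
have cw n : {within `[s n, t n], continuous f}.
  apply: continuous_in_subspaceT => x /[!inE] xst; exact/cf/(sub n).
have mf n : measurable_fun `[s n, t n] f.
  exact: subspace_continuous_measurable_fun (cw n).
have mD : measurable D by rewrite DE; apply: bigcup_measurable.
have mfD : measurable_fun D f.
  by rewrite DE; apply/measurable_fun_bigcup.
have eqI n : (\int[mu]_(x in `[s n, t n]) (f x)%:E = (F (t n) - F (s n))%:E)%E.
  rewrite (@continuous_FTC2 _ f F)//.
  - have cF x : D x -> {for x, continuous F}.
      by move=> /dF[dFx _]; apply/differentiable_continuous/derivable1_diffP.
    split.
    + by move=> x /subset_itv_oo_cc /sub /dF[].
    + by apply: cvg_at_right_filter; apply: cF; apply: (sub n); rewrite /= in_itv/= lexx ltW.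
    + by apply: cvg_at_left_filter; apply: cF; apply: (sub n); rewrite /= in_itv/= lexx ltW.
  - move=> x /subset_itv_oo_cc /sub /dF dFx; rewrite derive1E; exact: derive_val.
have := @ge0_nondecreasing_set_cvg_integral _ (measurableTypeR R) R (fun n => `[s n, t n]%classic)
  (EFin \o f) mu nd.
rewrite -DE => H.
have {}H : (\int[mu]_(x in D) (f x)%:E = (lb - la)%:E)%E.
  have : (\int[mu]_(x in `[s n, t n]) (f x)%:E)%E @[n --> \oo] --> (lb - la)%:E.
    under eq_fun do rewrite eqI.
    by apply: cvg_EFin; [exact: nearW|exact: cvgB].
  apply: cvg_unique => //; apply: H => //.
  - by move=> n; apply/measurable_EFinP; exact: mf.
  - by move=> n x /sub Dx; rewrite lee_fin f0.
split; last by rewrite /Rintegral H.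
apply/integrableP; split; first exact/measurable_EFinP.
under eq_integral => x /[!inE] Dx.
  rewrite gee0_abs; last by rewrite lee_fin f0.
  over.
by rewrite [ltLHS]H ltry.
Qed.

(** The shift by two makes the exhausting intervals nondegenerate already at index 0, in the bounded
    and in the unbounded case. *)
Lemma cvg_harmonic_scale (c : R) : c / n.+2%:R @[n --> \oo] --> (0 : R).
Proof.
rewrite -[X in _ --> X](mulr0 c); apply: cvgMr.
by have := @cvg_harmonic R; rewrite -cvg_shiftS.
Qed.

Lemma FTC_oo (a b la lb : R) (f F : R -> R) : a < b ->
  (forall x, a < x < b -> 0 <= f x) ->
  (forall x, a < x < b -> {for x, continuous f}) ->
  (forall x, a < x < b -> is_derive x 1 F (f x)) ->
  F x @[x --> a^'+] --> la -> F x @[x --> b^'-] --> lb ->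
  Itg `]a, b[ f /\ \int[mu]_(x in `]a, b[) f x = lb - la.
Proof.
move=> ab f0 cf dF Fa Fb.
have n2 n : (0 : R) < n.+2%:R by rewrite ltr0n.
have d0 n : 0 < (b - a) / 2 / n.+2%:R by rewrite !divr_gt0 ?subr_gt0.
have dlt n : (b - a) / 2 / n.+2%:R <= (b - a) / 4.
  rewrite ler_pdivrMr// (_ : (b - a) / 2 = (b - a) / 4 * 2); last by field.
  by rewrite ler_pM2l ?ler_nat// divr_gt0// subr_gt0.
have dn n : (b - a) / 2 / n.+3%:R <= (b - a) / 2 / n.+2%:R.
  by rewrite ler_pM2l ?divr_gt0 ?subr_gt0// lef_pV2 ?posrE ?ler_nat.
apply: (FTC_exhaustion _ (fun n => a + (b - a) / 2 / n.+2%:R)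
  (fun n => b - (b - a) / 2 / n.+2%:R) la lb f F).
- by move=> n; move: (dlt n); move: (_ / n.+2%:R) => d; lra.
- by move=> n; rewrite lerD2l.
- by move=> n; rewrite lerD2l lerN2.
- apply/seteqP; split => x /=; rewrite in_itv/=.
  + move=> /andP[ax xb].
    pose m := Order.min (x - a) (b - x).
    have m0 : 0 < m by rewrite lt_min !subr_gt0 ax.
    have /cvgrPdist_le /(_ _ m0)[N _ /(_ N)] := cvg_harmonic_scale ((b - a) / 2).
    rewrite /= leqnn => /(_ isT); rewrite sub0r normrN gtr0_norm// le_min => /andP[h1 h2].
    by exists N => //=; rewrite in_itv/=; move: (_ / N.+2%:R) h1 h2 => d; lra.
  + move=> [n _] /=; rewrite in_itv/= => /andP[h1 h2]; move: (d0 n) h1 h2; move: (_ / n.+2%:R) => d; lra.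
- by move=> x /=; rewrite in_itv/=; exact: f0.
- by move=> x /=; rewrite in_itv/=; exact: cf.
- apply: ((cvg_at_rightP F a la).1 Fa (fun n => a + (b - a) / 2 / n.+2%:R)); split; first by move=> n; rewrite ltrDl.
  rewrite -[X in _ --> X]addr0; apply: cvgD; first exact: cvg_cst.
  exact: cvg_harmonic_scale.
- apply: ((cvg_at_leftP F b lb).1 Fb (fun n => b - (b - a) / 2 / n.+2%:R)); split; first by move=> n; rewrite ltrBlDr ltrDl.
  rewrite -[X in _ --> X]subr0; apply: cvgB; first exact: cvg_cst.
  exact: cvg_harmonic_scale.
Qed.

Lemma FTC_oy (a la lb : R) (f F : R -> R) :
  (forall x, a < x -> 0 <= f x) ->
  (forall x, a < x -> {for x, continuous f}) ->
  (forall x, a < x -> is_derive x 1 F (f x)) ->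
  F x @[x --> a^'+] --> la -> F x @[x --> +oo] --> lb ->
  Itg `]a, +oo[ f /\ \int[mu]_(x in `]a, +oo[) f x = lb - la.
Proof.
move=> f0 cf dF Fa Fb.
have n2 n : (0 : R) < n.+2%:R by rewrite ltr0n.
have d0 n : 0 < 1 / n.+2%:R :> R by rewrite divr_gt0.
apply: (FTC_exhaustion _ (fun n => a + 1 / n.+2%:R) (fun n => a + n.+2%:R) la lb f F).
- by move=> n; rewrite ltrD2l ltr_pdivrMr// -natrM ltr1n; lia.
- by move=> n; rewrite lerD2l ler_pM2l// lef_pV2 ?posrE// ler_nat.
- by move=> n; rewrite lerD2l ler_nat.
- apply/seteqP; split => x /=; rewrite in_itv/= ?andbT.
  + move=> ax; have m0 : 0 < x - a by rewrite subr_gt0.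
    have /cvgrPdist_le /(_ _ m0)[N _ /(_ (maxn N (Num.truncn (x - a))))] := cvg_harmonic_scale 1.
    rewrite /= leq_maxl => /(_ isT); rewrite sub0r normrN gtr0_norm// => h1.
    exists (maxn N (Num.truncn (x - a))) => //=; rewrite in_itv/=; apply/andP; split.
      by move: (_ / _) h1 => d; lra.
    rewrite -lerBlDl; apply: le_trans (ltW (truncnS_gt _)) _.
    by rewrite ler_nat ltnS leqW// leq_maxr.
  + by move=> [n _] /=; rewrite in_itv/= => /andP[h1 h2]; move: (d0 n) h1 h2; move: (_ / n.+2%:R) => d; lra.
- by move=> x /=; rewrite in_itv/= andbT; exact: f0.
- by move=> x /=; rewrite in_itv/= andbT; exact: cf.
- by move=> x /=; rewrite in_itv/= andbT; exact: dF.
- apply: ((cvg_at_rightP F a la).1 Fa (fun n => a + 1 / n.+2%:R)); split; first by move=> n; rewrite ltrDl.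
  rewrite -[X in _ --> X]addr0; apply: cvgD; first exact: cvg_cst.
  exact: cvg_harmonic_scale.
- apply: ((cvg_pinftyP F lb).1 Fb (fun n => a + n.+2%:R)).
  apply: (cvg_comp (fun n => n.+2%:R) (fun r : R => a + r)); last exact: cvg_addrl.
  by have := @cvgr_idn R; rewrite -(cvg_shiftn 2)/=; under eq_fun do rewrite addn2.
Qed.
End SingularFTC.

(** * Derivative rules at a point *)

Section PointwiseDerivatives.
Context {R : realType}.
Implicit Types (f g : R -> R) (x a b : R).

Lemma dcst (c : R) x : is_derive x 1 (fun=> c) (0 : R).
Proof. exact: is_derive_cst. Qed.

Lemma did x : is_derive x 1 (fun t : R => t) (1 : R).
Proof. exact: is_derive_id. Qed.

Lemma dD {f g x a b} : is_derive x 1 f a -> is_derive x 1 g b ->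
  is_derive x 1 (fun t => f t + g t) (a + b).
Proof. by move=> fa gb; exact: (is_deriveD fa gb). Qed.

Lemma dB {f g x a b} : is_derive x 1 f a -> is_derive x 1 g b ->
  is_derive x 1 (fun t => f t - g t) (a - b).
Proof. by move=> fa gb; exact: (is_deriveB fa gb). Qed.

Lemma dN {f x a} : is_derive x 1 f a -> is_derive x 1 (fun t => - f t) (- a).
Proof. by move=> fa; exact: (is_deriveN fa). Qed.

Lemma dM {f g x a b} : is_derive x 1 f a -> is_derive x 1 g b ->
  is_derive x 1 (fun t => f t * g t) (a * g x + f x * b).
Proof.
move=> fa gb; apply: is_derive_eq (is_deriveM fa gb) _.
by rewrite /GRing.scale/= addrC [g x * a]mulrC.
Qed.

Lemma dZ {f x a} (c : R) : is_derive x 1 f a ->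
  is_derive x 1 (fun t => c * f t) (c * a).
Proof. by move=> fa; exact: (is_deriveZ c fa). Qed.

Lemma dcomp {f g x a b} : is_derive (g x) 1 f a -> is_derive x 1 g b ->
  is_derive x 1 (fun t => f (g t)) (a * b).
Proof. by move=> fa gb; apply: is_derive_eq (is_derive1_comp fa gb) _; rewrite /GRing.scale/= mulrC. Qed.

Lemma dV {f x a} : f x != 0 -> is_derive x 1 f a ->
  is_derive x 1 (fun t => (f t)^-1) (- a / f x ^+ 2).
Proof.
move=> fx fa; apply: is_derive_eq (is_deriveV _ fa) _ => //.
by rewrite /GRing.scale/= mulrC mulrN mulNr.
Qed.

Lemma deq {f x a} (b : R) : is_derive x 1 f a -> a = b -> is_derive x 1 f b.
Proof. by move=> fa <-. Qed.

Lemma dext {f} g {x a} : is_derive x 1 f a -> f =1 g -> is_derive x 1 g a.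
Proof. by move=> fa /funext <-. Qed.

Lemma dX {f x a} (n : nat) : is_derive x 1 f a ->
  is_derive x 1 (fun t => f t ^+ n) (n%:R * f x ^+ n.-1 * a).
Proof.
move=> fa; elim: n => [|n IH].
  by rewrite !mul0r; apply: dext (dcst 1 x) _ => t; rewrite expr0.
apply: dext (deq _ (dM fa IH) _) _ => [|t]; last by rewrite exprS.
case: n {IH} => [|n] /=; first by rewrite expr0; ring.
by rewrite exprS -[n.+2]addn2 -[n.+1]addn1 !natrD; ring.
Qed.

Lemma dcontinuous {f x a} : is_derive x 1 f a -> {for x, continuous f}.
Proof.
by move=> [fx _]; apply/differentiable_continuous/derivable1_diffP.
Qed.

Lemma MVT_pt f df a b : a < b ->
  (forall x, a <= x <= b -> is_derive x 1 f (df x)) ->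
  exists2 c, a < c < b & f b - f a = df c * (b - a).
Proof.
move=> ab fdf; have [||c cab ->] := @MVT R f df a b ab.
- by move=> x /subset_itv_oo_cc; rewrite /= in_itv/=; exact: fdf.
- apply: continuous_in_subspaceT => x /[!inE]; rewrite /= in_itv/= => /fdf.
  exact: dcontinuous.
by exists c.
Qed.

Lemma dsqrt {x} : 0 < x -> is_derive x 1 Num.sqrt (2 * Num.sqrt x)^-1.
Proof. exact: is_derive1_sqrt. Qed.

Lemma sqrt_sqr (x : R) : 0 <= x -> Num.sqrt x * Num.sqrt x = x.
Proof. by move=> x0; rewrite -expr2 sqr_sqrtr. Qed.

End PointwiseDerivatives.

(** * Explicit integrals of powers *)

Section BasicIntegrals.
Context {R : realType}.
Notation mu := (@lebesgue_measure R).
Notation Itg D f := (mu.-integrable D (EFin \o f)).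
Notation sqrt := (@Num.sqrt R).

Lemma measurable_invr : measurable_fun [set: R] (@GRing.inv R).
Proof.
rewrite -(setUv [set (0 : R)]); apply/measurable_funU => //.
  exact: measurableC.
split; first exact: measurable_fun_set1.
apply: open_continuous_measurable_fun; first exact: closed_openC.
move=> x /[!inE] /eqP x0; exact: inv_continuous.
Qed.

Lemma measurable_sqrt : measurable_fun [set: R] sqrt.
Proof. by apply: continuous_measurable_fun; exact: sqrt_continuous. Qed.

Lemma invsqrt_itv0 (r : R) : 0 < r ->
  Itg `]0, r[ (fun z => (sqrt z)^-1) /\
  \int[mu]_(z in `]0, r[) (sqrt z)^-1 = 2 * sqrt r.
Proof.
move=> r0.
have cS (z : R) : {for z, continuous (fun t : R => 2 * sqrt t)}.
  by apply: cvgM; [exact: cvg_cst|exact: sqrt_continuous].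
have [] := @FTC_oo R 0 r 0 (2 * sqrt r) (fun z => (sqrt z)^-1) (fun z => 2 * sqrt z) r0.
- by move=> z _; rewrite invr_ge0 sqrtr_ge0.
- move=> z /andP[z0 _]; apply: cvgV; last exact: sqrt_continuous.
  by rewrite gt_eqF// sqrtr_gt0.
- move=> z /andP[z0 _]; apply: (deq _ (dZ 2 (dsqrt z0))).
  by rewrite invfM mulrA divff ?mul1r.
- rewrite -{2}(mulr0 2) -{2}(sqrtr0 R); apply: cvg_at_right_filter; exact: cS.
- apply: cvg_at_left_filter; exact: cS.
by rewrite subr0.
Qed.

Lemma sqrt_itv0 (r : R) : 0 < r ->
  Itg `]0, r[ sqrt /\ \int[mu]_(z in `]0, r[) sqrt z = 2 / 3 * (r * sqrt r).
Proof.
move=> r0.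
have cS (z : R) : {for z, continuous (fun t : R => 2 / 3 * (t * sqrt t))}.
  apply: cvgM; first exact: cvg_cst.
  by apply: cvgM; [exact: cvg_id|exact: sqrt_continuous].
have [] := @FTC_oo R 0 r 0 (2 / 3 * (r * sqrt r)) sqrt (fun z => 2 / 3 * (z * sqrt z)) r0.
- by move=> z _; rewrite sqrtr_ge0.
- move=> z /andP[z0 _]; exact: sqrt_continuous.
- move=> z /andP[z0 _]; apply: (deq _ (dZ (2 / 3) (dM (did z) (dsqrt z0)))).
  have s0 : sqrt z != 0 by rewrite gt_eqF// sqrtr_gt0.
  by rewrite -{2}(sqrt_sqr z (ltW z0)); field.
- have /cvg_at_right_filter := cS 0.
  by rewrite mul0r mulr0.
- apply: cvg_at_left_filter; exact: cS.
by rewrite subr0.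
Qed.

Lemma invsqr_itvy (a : R) : 0 < a ->
  Itg `]a, +oo[ (fun y => (y ^+ 2)^-1) /\
  \int[mu]_(y in `]a, +oo[) (y ^+ 2)^-1 = a^-1.
Proof.
move=> a0.
have [] := @FTC_oy R a (- a^-1) 0 (fun y => (y ^+ 2)^-1) (fun y => - y^-1).
- by move=> y _; rewrite invr_ge0 sqr_ge0.
- move=> y ay; apply: cvgV; last exact: exprn_continuous.
  by rewrite expf_neq0// gt_eqF// (lt_trans a0).
- move=> y ay; have y0 : y != 0 by rewrite gt_eqF// (lt_trans a0).
  by apply: (deq _ (dN (dV _ (did y)))) => //; rewrite mulN1r opprK.
- apply: cvg_at_right_filter; apply: cvgN; apply: cvgV; last exact: cvg_id.
  by rewrite gt_eqF.
- rewrite -oppr0; apply: cvgN; apply/gtr0_cvgV0 => //; exact: nbhs_pinfty_gt.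
by rewrite opprK add0r.
Qed.

(** This weight dominates both kernels near their singularity. Each side of [p] contributes at most
    [2 * sqrt (b - a)], so the bound does not depend on the position of [p]. *)
Lemma invsqrt_dist_Itg (p a b : R) : a <= p <= b ->
  Itg `]a, b[ (fun y => (sqrt `|y - p|)^-1) /\
  \int[mu]_(y in `]a, b[) (sqrt `|y - p|)^-1 <= 4 * sqrt (b - a).
Proof.
move=> /andP[ap pb].
pose f y := (sqrt `|y - p|)^-1.
have mf : measurable_fun setT f.
  apply: (measurableT_comp measurable_invr).
  apply: (measurableT_comp measurable_sqrt).
  by apply: measurableT_comp => //; exact: measurable_funB.
have L : Itg `]a, p[ f /\ \int[mu]_(y in `]a, p[) f y = 2 * sqrt (p - a).
  move: ap; rewrite le_eqVlt => /predU1P[->|ap].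
    rewrite subrr sqrtr0 mulr0 set_itv_ge ?bnd_simp ?ltxx// Rintegral_set0.
    by split => //; exact: integrable_set0.
  have [i1 i2] := invsqrt_itv0 (p - a) ltac:(lra).
  have E : forall y, `]a, p[%classic y -> (sqrt (p - y))^-1 = f y.
    by move=> y; rewrite /= in_itv/= => /andP[_ yp]; rewrite /f distrC gtr0_norm// subr_gt0.
  have i3 := Itg_reflect p 0 (p - a) _ i1.
  have i4 := Rint_reflect p 0 (p - a) _ i1.
  move: i3 i4; rewrite subr0 subKr => i3 i4; split.
    by apply: Itg_eq i3.
  by rewrite -i2 i4; apply: eq_Rint => y /E.
have U : Itg `]p, b[ f /\ \int[mu]_(y in `]p, b[) f y = 2 * sqrt (b - p).
  move: pb; rewrite le_eqVlt => /predU1P[->|pb].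
    rewrite subrr sqrtr0 mulr0 set_itv_ge ?bnd_simp ?ltxx// Rintegral_set0.
    by split => //; exact: integrable_set0.
  have [i1 i2] := invsqrt_itv0 (b - p) ltac:(lra).
  have E : forall y, `]p, b[%classic y -> (sqrt (y - p))^-1 = f y.
    by move=> y; rewrite /= in_itv/= => /andP[yp _]; rewrite /f gtr0_norm// subr_gt0.
  have i3 := Itg_shift (- p) 0 (b - p) _ i1.
  have i4 := Rint_shift (- p) 0 (b - p) _ i1.
  move: i3 i4; rewrite opprK add0r subrK => i3 i4; split.
    by apply: Itg_eq i3.
  by rewrite -i2 i4; apply: eq_Rint => y /E.
have [L1 L2] := L; have [U1 U2] := U.
have fi : Itg `]a, b[ f.
  by apply: (Itg_split a p) => //; exact: measurable_funS mf.
split=> //; rewrite (Rint_split_oo a p) ?ap// -/f.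
rewrite L2 U2.
have : sqrt (p - a) <= sqrt (b - a) by rewrite ler_sqrt; lra.
have : sqrt (b - p) <= sqrt (b - a) by rewrite ler_sqrt; lra.
by lra.
Qed.

End BasicIntegrals.

(** * Smooth test functions and weak second derivatives *)

Section SmoothBump.
Context {R : realType}.
Implicit Types (f g : R -> R) (x a b : R).

(** Derivatives are carried as witnesses, so that closure under sums, products and affine
    substitutions is an induction on [k] with no iterated derivative to compute. *)
Fixpoint nderivable (k : nat) f : Prop := if k is k'.+1
  then exists2 f', (forall x, is_derive x 1 f (f' x)) & nderivable k' f'
  else True.

Lemma nderivableW k f : nderivable k.+1 f -> nderivable k f.
Proof. by elim: k f => [//|k IH] f [f' ff' /IH kf']; exists f'. Qed.

Lemma nderivable_derivable k f : nderivable k.+1 f ->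
  forall x, derivable (f^`(k))%classic x 1.
Proof.
elim: k f => [|k IH] f [f' ff' kf'] x; first by rewrite derive1n0; case: (ff' x).
rewrite derive1Sn (_ : f^`()%classic = f'); first exact: IH.
by apply/funext => y; rewrite derive1E; exact: derive_val.
Qed.

Lemma nderivableD k f g : nderivable k f -> nderivable k g ->
  nderivable k (fun x => f x + g x).
Proof.
elim: k f g => [//|k IH] f g [f' ff' kf'] [g' gg' kg'].
exists (fun x => f' x + g' x); last exact: IH.
by move=> x; exact: dD (ff' x) (gg' x).
Qed.

Lemma nderivableZ k f c : nderivable k f -> nderivable k (fun x => c * f x).
Proof.
elim: k f => [//|k IH] f [f' ff' kf'].
exists (fun x => c * f' x); last exact: IH.
by move=> x; exact: dZ (ff' x).
Qed.

Lemma nderivableM k f g : nderivable k f -> nderivable k g ->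
  nderivable k (fun x => f x * g x).
Proof.
elim: k f g => [//|k IH] f g fk gk.
have fk' := nderivableW _ _ fk; have gk' := nderivableW _ _ gk.
move: fk gk => [f' ff' kf'] [g' gg' kg'].
exists (fun x => f' x * g x + f x * g' x).
  by move=> x; exact: dM (ff' x) (gg' x).
by apply: nderivableD; exact: IH.
Qed.

Lemma nderivable_affine k f a b : nderivable k f ->
  nderivable k (fun x => f (a * x + b)).
Proof.
elim: k f => [//|k IH] f [f' ff' kf'].
exists (fun x => a * f' (a * x + b)); last exact/nderivableZ/IH.
move=> x; have d := dD (dZ a (did x)) (dcst b x).
by apply: (deq _ (dcomp (ff' _) d)); rewrite mulr1 addr0 mulrC.
Qed.

(** Serves at the point 0, where [flat] changes its defining formula and no derivative rule
    applies. *)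
Lemma is_derive_sqr_bound f x C : (forall h, `|f (h + x) - f x| <= C * h ^+ 2) ->
  is_derive x 1 f 0.
Proof.
move=> fC.
have H : h^-1 *: ((f \o shift x) (h *: (1 : R)) - f x) @[h --> 0^'] --> (0 : R).
  apply/cvgr0Pnorm_le => e e0.
  have C0 : 0 <= C by have := fC 1; rewrite expr1n mulr1; apply: le_trans.
  near=> h.
  have h0 : h != 0 by near: h; exact: nbhs_dnbhs_neq.
  rewrite /= normrZ normfV [h *: 1]mulr1.
  rewrite ler_pdivrMl ?normr_gt0// (le_trans (fC h))//.
  rewrite -real_normK ?num_real// expr2 mulrA [leRHS]mulrC ler_wpM2r//.
  have hle : `|h| <= e / (C + 1).
    near: h; apply: dnbhs0_le; by rewrite divr_gt0// ltr_wpDl.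
  apply: (@le_trans _ _ ((C + 1) * `|h|)); first by rewrite ler_wpM2r// lerDl.
  by rewrite mulrC -ler_pdivlMr// ltr_wpDl.
by split; [apply/cvg_ex; exists 0|exact/cvg_lim].
Unshelve. all: by end_near. Qed.

(* The functions x^-n exp(-1/x), extended by 0, are closed under
   differentiation up to linear combinations, and vanish to second order at 0. *)
Definition flat (n : nat) x : R := if 0 < x then x^-1 ^+ n * expR (- x^-1) else 0.

(** With [y = 1 / x] this is [y^(n+2) <= (n+2)! exp y], a single term of the exponential series. *)
Lemma flat_le n x : `|flat n x| <= (n.+2)`!%:R * x ^+ 2.
Proof.
rewrite /flat; case: ifPn => x0; last by rewrite normr0 mulr_ge0// sqr_ge0.
have y0 : 0 < x^-1 by rewrite invr_gt0.
rewrite ger0_norm ?mulr_ge0 ?expR_ge0 ?exprn_ge0 ?(ltW y0)// expRN.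
rewrite ler_pdivrMr ?expR_gt0//.
have := @expR_ge1Dxn R x^-1 n.+1 (ltW y0).
set f := (n.+2)`!%:R; have f0 : 0 < f by rewrite ltr0n fact_gt0.
set E := expR _ => H.
have {}H : x^-1 ^+ n.+2 <= f * E.
  rewrite mulrC -ler_pdivrMr//; apply: le_trans H; by rewrite lerDr.
have x2 : 0 < x ^+ 2 by rewrite exprn_gt0.
apply: le_trans (_ : x^-1 ^+ n.+2 * x ^+ 2 <= _).
  by rewrite -addn2 exprD -mulrA -exprMn mulVf ?gt_eqF// expr1n mulr1.
by have := ler_wpM2r (ltW x2) H; rewrite [f * E * _]mulrAC.
Qed.

Lemma is_derive_flat n x :
  is_derive x 1 (flat n) (- n%:R * flat n.+1 x + flat n.+2 x).
Proof.
have [x0|x0|->] := ltgtP x 0.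
- have fl m : flat m x = 0 by rewrite /flat ltNge ltW.
  rewrite !fl mulr0 addr0.
  apply: (@near_eq_is_derive _ _ _ (cst 0)).
    by near=> y; rewrite /flat ltNge ltW//; near: y; exact: lt_nbhsl.
- have xn0 : x != 0 by rewrite gt_eqF.
  apply: (@near_eq_is_derive _ _ _ (fun x => x^-1 ^+ n * expR (- x^-1))).
  + by near=> y; rewrite /flat ifT//; near: y; exact: lt_nbhsr.
  + have dv : is_derive x 1 (fun t : R => t^-1) (- x^-1 ^+ 2).
      by apply: (deq _ (dV xn0 (did x))); rewrite mulN1r exprVn.
    apply: (deq _ (dM (dX n dv) (dcomp (is_derive_expR _) (dN dv)))).
    rewrite /flat x0; case: n => [|n] /=; rewrite ?exprS; ring.
- rewrite {2 3}/flat ltxx mulr0 addr0.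
  apply: (is_derive_sqr_bound _ _ (n.+2)`!%:R) => h.
  by rewrite addr0 [flat n 0]/flat ltxx subr0; exact: flat_le.
Unshelve. all: by end_near. Qed.

Lemma nderivable_flat k n : nderivable k (flat n).
Proof.
elim: k n => [//|k IH] n; exists (fun x => - n%:R * flat n.+1 x + flat n.+2 x).
  exact: is_derive_flat.
by apply: nderivableD => //; exact: nderivableZ.
Qed.

(** The factors vanish for [x <= -1] and for [x >= 1] respectively. The arguments are spelled as
    [a * x + b] to fit [nderivable_affine]. *)
Definition bump x : R := flat 0 (1 * x + 1) * flat 0 (- 1 * x + 1).

Lemma nderivable_bump k : nderivable k bump.
Proof. by apply: nderivableM; apply: nderivable_affine; exact: nderivable_flat. Qed.

Lemma flat_ge0 n x : 0 <= flat n x.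
Proof.
rewrite /flat; case: ifPn => // x0.
by rewrite mulr_ge0 ?expR_ge0// exprn_ge0// invr_ge0 ltW.
Qed.

Lemma bump_ge0 x : 0 <= bump x.
Proof. by rewrite mulr_ge0// flat_ge0. Qed.

Lemma bump_eq0 x : 1 <= `|x| -> bump x = 0.
Proof.
rewrite ler_normr => /orP[x1|x1]; rewrite /bump /flat.
  by rewrite [X in _ * X]ifF ?mulr0//; apply/negbTE; rewrite -leNgt; lra.
by rewrite ifF ?mul0r//; apply/negbTE; rewrite -leNgt; lra.
Qed.

Lemma bump_gt0 x : `|x| < 1 -> 0 < bump x.
Proof.
rewrite ltr_norml => /andP[x1 x2]; rewrite /bump /flat !ifT; [|lra|lra].
by rewrite !expr0 !mul1r mulr_gt0// expR_gt0.
Qed.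

Lemma continuous_bump : continuous bump.
Proof.
by move=> x; have [f' ff' _] := nderivable_bump 1; exact: dcontinuous (ff' x).
Qed.

(** Since [f] vanishes to the left of [a], it is integrable on []-oo, u]]. Integrating from minus
    infinity makes the primitive vanish there without any normalisation. *)
Lemma exists_primitive f a : continuous f -> (forall x, x <= a -> f x = 0) ->
  exists2 F : R -> R, (forall x, is_derive x 1 F (f x)) &
    forall x, x <= a -> F x = 0.
Proof.
move=> cf fa.
have fi (u : R) : (@lebesgue_measure R).-integrable `]-oo, u] (EFin \o f).
  have i1 : (@lebesgue_measure R).-integrable `[a, u] (EFin \o f).
    apply: continuous_compact_integrable; first exact: segment_compact.
    exact: continuous_subspaceT.
  have i2 : (@lebesgue_measure R).-integrable setT (EFin \o (f \_ `[a, u])).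
    exact: (Itg_mkcond _ _ (measurable_itv `[a, u])).1.
  apply: (Itg_eq _ (f \_ `[a, u])) => //; last exact: Itg_sub i2.
  move=> x /=; rewrite patchE in_itv/= => xu; case: ifPn => //.
  rewrite notin_setE /= in_itv/= xu andbT => /negP; rewrite -ltNge => /ltW xa.
  by rewrite fa.
pose F x := (\int[@lebesgue_measure R]_(t in `]-oo, x]) f t)%R.
exists F.
  move=> x; have H : derivable F x 1 /\ (F^`())%classic x = f x.
    apply: (@continuous_FTC1 R f -oo%O x (x + 1)) => //.
    - by rewrite ltrDl.
    - by rewrite ltNyr.
    - exact: cf.
  have [d1 d2] := H; split; first exact: d1.
  by rewrite -d2 derive1E.
move=> x xa; rewrite /F (eq_Rint _ _ (fun=> 0)).
  by rewrite Rintegral_cst// mul0r.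
by move=> t /=; rewrite in_itv/= => tx; apply: fa; exact: le_trans xa.
Qed.

(* [E] is a smooth approximation of [max 0] at scale [eps], [e] its second
   derivative, an approximate identity. *)
Lemma exists_smooth_ramp (eps : R) : 0 < eps ->
  exists E s e : R -> R,
  [/\ (forall k, nderivable k E),
      (forall x, is_derive x 1 E (s x)), (forall x, is_derive x 1 s (e x)) &
      [/\ continuous e, (forall x, 0 <= e x),
      (forall x, eps <= `|x| -> e x = 0),
      (forall x, x <= - eps -> E x = 0 /\ s x = 0) &
      (forall x, eps <= x -> s x = 1)]].
Proof.
move=> eps0.
have [||P dP P0] := @exists_primitive bump (-1); first exact: continuous_bump.
  move=> x x1; apply: bump_eq0; rewrite ler_normr; apply/orP; right; lra.
have P1 x : 1 <= x -> P x = P 1.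
  rewrite le_eqVlt => /predU1P[<-//|x1].
  have [c /andP[c1 _]] := @MVT_pt R P bump 1 x x1.
  by rewrite bump_eq0 ?mul0r ?ler_normr ?(ltW c1)// => /eqP; rewrite subr_eq0 => /eqP.
have c0 : 0 < P 1.
  have [|c /andP[c1 c2]] := @MVT_pt R P bump (-1) 1; first lra.
  rewrite (P0 (-1) (lexx _)) subr0 => ->; apply: mulr_gt0; last lra.
  by apply: bump_gt0; rewrite ltr_norml c1.
(* Division by the mass [P 1] of the bump and rescaling by [eps] give a smooth step from 0 to 1
   across []-eps, eps[], with derivative [e]. The [+ 0] keeps the affine form. *)
pose s x := (P 1)^-1 * P (eps^-1 * x + 0).
pose e x := (P 1)^-1 * (eps^-1 * bump (eps^-1 * x + 0)).
have ds x : is_derive x 1 s (e x).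
  apply: dZ; have d := dD (dZ eps^-1 (did x)) (dcst 0 x).
  by apply: (deq _ (dcomp (dP _) d)); rewrite mulr1 !addr0 mulrC.
have s0 x : x <= - eps -> s x = 0.
  move=> xe; by rewrite /s (P0 (_ + 0)) ?mulr0// addr0 ler_pdivrMl// mulrN1.
have [E dE E0] := @exists_primitive s (- eps) (fun x => dcontinuous (ds x)) s0.
have ke k : nderivable k e.
  by apply: nderivableZ; apply: nderivableZ; apply: nderivable_affine; exact: nderivable_bump.
exists E, s, e; split => //.
- case=> [//|[|k]]; first by exists s.
  by exists s => //; exists e.
- split.
  + by move=> x; have [e' ee' _] := ke 1; exact: dcontinuous (ee' x).
  + move=> x; apply: mulr_ge0; first by rewrite invr_ge0 ltW.
    by apply: mulr_ge0; [rewrite invr_ge0 ltW|exact: bump_ge0].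
  + move=> x xe; rewrite /e bump_eq0 ?mulr0// addr0 normrM gtr0_norm ?invr_gt0//.
    by rewrite mulrC ler_pdivlMr// mul1r.
  + by move=> x xe; rewrite E0// s0.
  + move=> x xe; by rewrite /s (P1 (_ + 0)) ?mulVf// ?gt_eqF// addr0 mulrC ler_pdivlMr// mul1r.
Qed.

End SmoothBump.

(** * Pointwise second differences from a weak second derivative *)

Section WeakSecondDerivative.
Context {R : realType}.
Notation mu := (@lebesgue_measure R).
Notation Itg D f := (mu.-integrable D (EFin \o f)).

Lemma normr_Rint_le_ae (D : set R) (f g : R -> R) : measurable D -> Itg D f ->
  Itg D g -> (forall x, D x -> 0 <= g x) ->
  {ae mu, forall x, D x -> `|f x| <= g x} ->
  `|\int[mu]_(x in D) f x| <= \int[mu]_(x in D) g x.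
Proof.
move=> mD fi gi g0 fg.
apply: (le_trans (@le_normr_Rintegral _ (measurableTypeR R) R mu D f mD fi)).
have nfi := Itg_norm _ _ fi.
rewrite /Rintegral fine_le//; [exact: integrable_fin_num|exact: integrable_fin_num|].
apply: (@ae_ge0_le_integral _ (measurableTypeR R) R mu D mD) => //.
- exact: measurable_int nfi.
- exact: measurable_int gi.
Qed.

Lemma locally_integrable_itv (f : R -> R) (a b : R) :
  locally_integrable [set: R] f -> Itg `]a, b[ f.
Proof.
move=> [mf _ fK]; apply: (Itg_sub _ `[a, b]) => //; first exact: subset_itv_oo_cc.
apply/integrableP; split; first exact/measurable_EFinP/measurable_funTS.
by apply: fK => //; exact: segment_compact.
Qed.

Lemma Itg_compact_support_mul (f e : R -> R) (a b : R) : locally_integrable [set: R] f ->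
  continuous e -> (forall x, ~~ (a < x < b) -> e x = 0) ->
  Itg setT (fun x => f x * e x) /\
  \int[mu]_x (f x * e x) = \int[mu]_(x in `]a, b[) (f x * e x).
Proof.
move=> lf ce e0.
have E : ((fun x => f x * e x) \_ `]a, b[) = (fun x => f x * e x).
  apply/funext => x; rewrite patchE; case: ifPn => //.
  by rewrite notin_setE/= in_itv/= => /negP /e0 ->; rewrite mulr0.
have [M M0 eM] : exists2 M : R, 0 < M & forall x, `]a, b[%classic x -> `|e x| <= M.
  have /compact_bounded [M [_ HM]] := @continuous_compact _ _ e `[a, b]
    (continuous_subspaceT ce) (@segment_compact R a b).
  exists (`|M| + 1); first by rewrite ltr_wpDl.
  move=> x /subset_itv_oo_cc xab; apply: HM; last by exists x.
  by rewrite (le_lt_trans (ler_norm M))// ltrDl.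
have i1 : Itg `]a, b[ (fun x => f x * e x).
  apply: (Itg_mulr_bounded _ _ _ M) => //; first exact: locally_integrable_itv.
  by apply: measurable_funTS; exact: continuous_measurable_fun.
split; last by rewrite [RHS]Rintegral_mkcond E.
by have /(Itg_mkcond _ _ (measurable_itv _)) := i1; rewrite E.
Qed.

(** [Q] is a representative of [f] continuous at [p]: within the support of the kernel it stays
    within [d] of [Q p], and the kernel has mass one because its primitive [s] climbs from 0 to 1.
    The kernel is quantified after [eps0] so that several points can share one kernel. *)
Lemma approximate_identity (f Q : R -> R) (p d : R) :
  locally_integrable [set: R] f -> {ae mu, forall x, Q x = f x} ->
  {for p, continuous Q} -> 0 < d ->
  exists2 eps0 : R, 0 < eps0 & forall (eps : R) (s e : R -> R), 0 < eps <= eps0 ->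
    (forall x : R, is_derive x 1 s (e x)) -> continuous e -> (forall x, 0 <= e x) ->
    (forall x, eps <= `|x| -> e x = 0) ->
    (forall x, x <= - eps -> s x = 0) -> (forall x, eps <= x -> s x = 1) ->
    Itg setT (fun z => f z * e (z - p)) /\
    `|\int[mu]_z (f z * e (z - p)) - Q p| <= d.
Proof.
move=> lf fQ cQ d0.
have /cvgrPdist_le /(_ _ d0) [r /= r0 rQ] := cQ.
exists r => // eps s e /andP[eps0 epsr] ds ce e0 es s0 s1.
have ce' : continuous (fun z => e (z - p)).
  move=> z; apply: continuous_comp; last exact: ce.
  by apply: cvgB; [exact: cvg_id|exact: cvg_cst].
have esup x : ~~ (p - eps < x < p + eps) -> e (x - p) = 0.
  move=> H; apply: es; rewrite leNgt; apply: contra H; rewrite ltr_norml; lra.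
have [i1 ->] := Itg_compact_support_mul f _ (p - eps) (p + eps) lf ce' esup.
split => //.
have mD : measurable `]p - eps, p + eps[%classic by exact: measurable_itv.
have cs x : {for x, continuous (fun z => s (z - p))}.
  apply: continuous_comp; last exact: dcontinuous (ds _).
  by apply: cvgB; [exact: cvg_id|exact: cvg_cst].
have [e1 e2] : Itg `]p - eps, p + eps[ (fun z => e (z - p)) /\
    \int[mu]_(z in `]p - eps, p + eps[) e (z - p) = 1 - 0.
  apply: (@FTC_oo R _ _ 0 1 _ (fun z => s (z - p))).
  - lra.
  - by move=> *; exact: e0.
  - by move=> x _; exact: ce'.
  - move=> x _; apply: (deq _ (dcomp (ds _) (dB (did x) (dcst p x)))).
    by rewrite subr0 mulr1.
  - have /cvg_at_right_filter := cs (p - eps).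
    by rewrite (_ : s (p - eps - p) = 0)// s0//; lra.
  - have /cvg_at_left_filter := cs (p + eps).
    by rewrite (_ : s (p + eps - p) = 1)// s1//; lra.
rewrite subr0 in e2.
have i2 := Itg_sub _ _ _ measurableT mD (subsetT _) i1.
have -> : Q p = \int[mu]_(z in `]p - eps, p + eps[) (Q p * e (z - p)).
  by rewrite RintegralZl// e2 mulr1.
have i3 := ItgZl _ _ (Q p) mD e1.
rewrite -RintegralB//.
have -> : d = \int[mu]_(z in `]p - eps, p + eps[) (d * e (z - p)).
  by rewrite RintegralZl// e2 mulr1.
apply: normr_Rint_le_ae => //.
- exact: ItgB.
- exact: ItgZl.
- by move=> x _; rewrite mulr_ge0// ltW.
apply: (@filterS _ _ (ae_filter_ringOfSetsType mu) _ _ _ fQ) => x Qx; rewrite /= in_itv/= => xp.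
rewrite -mulrBl normrM (ger0_norm (e0 _)) ler_wpM2r// distrC -Qx.
by apply: rQ; rewrite /= /ball/= ltr_norml; lra.
Qed.

(** To the left of the window all four ramps vanish. To the right all are affine of slope one, and
    the combination annihilates affine functions. The radius [2 * x'] leaves room for the smoothing
    scale [eps <= x' / 2]. *)
Lemma ramp_second_difference_support (E : R -> R) (eps x x' y z : R) :
  (forall t, t <= - eps -> E t = 0) ->
  (forall a b, eps <= a -> a <= b -> E b - E a = b - a) ->
  0 <= x -> x <= x' -> eps <= x' / 2 -> 0 < x' ->
  ~~ (y - 2 * x' < z < y + 2 * x') ->
  E (z - (y + x')) + E (z - (y - x')) +
    (-1) * (E (z - (y + x)) + E (z - (y - x))) = 0.
Proof.
move=> E0 Elin x0 xx' ex x'0; rewrite negb_and -!leNgt => /orP[zl|zr].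
  have e1 : z - (y + x') <= - eps by lra.
  have e2 : z - (y - x') <= - eps by lra.
  have e3 : z - (y + x) <= - eps by lra.
  have e4 : z - (y - x) <= - eps by lra.
  by rewrite !E0//; ring.
have e1 : eps <= z - (y + x') by lra.
have e2 : z - (y + x') <= z - (y - x') by lra.
have e3 : z - (y + x') <= z - (y + x) by lra.
have e4 : z - (y + x') <= z - (y - x) by lra.
move: (Elin _ _ e1 e2) (Elin _ _ e1 e3) (Elin _ _ e1 e4); clear; lra.
Qed.

(** The combination is a difference of two increments of [E], each over a length [x' - x]. As [E] is
    nondecreasing and 1-Lipschitz, both lie in [[0, x' - x]]. *)
Lemma ramp_second_difference_bound (E : R -> R) (x x' y z : R) :
  (forall a b, a <= b -> 0 <= E b - E a <= b - a) -> 0 <= x -> x <= x' ->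
  `|E (z - (y + x')) + E (z - (y - x')) +
    (-1) * (E (z - (y + x)) + E (z - (y - x)))| <= x' - x.
Proof.
move=> Einc x0 xx'.
have e1 : z - (y + x') <= z - (y + x) by lra.
have e2 : z - (y - x) <= z - (y - x') by lra.
move: (Einc _ _ e1) (Einc _ _ e2); rewrite ler_norml; clear; lra.
Qed.

(* Testing the weak derivative against a smoothed second difference of the ramp
   max 0, which is at most x' - x and supported near y. *)
Lemma weak_derivative2_increment (f f2 Q : R -> R) (x x' y : R) :
  is_weak_derivative 2 f f2 -> Itg setT f2 -> {ae mu, forall x, Q x = f x} ->
  0 <= x -> x <= x' -> 0 < x' ->
  {for y + x', continuous Q} -> {for y - x', continuous Q} ->
  {for y + x, continuous Q} -> {for y - x, continuous Q} ->
  `|Q (y + x') + Q (y - x') - Q (y + x) - Q (y - x)| <=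
  (x' - x) * \int[mu]_(z in `](y - 2 * x'), (y + 2 * x')[) `|f2 z|.
Proof.
move=> [lf lf2 wd] f2i fQ x0 xx' x'0 c1 c2 c3 c4.
(* The error [d] is shared equally by the four nodes, where point values of [Q] are approximated by
   smoothed averages of [f]. *)
apply/ler_addgt0Pr => d d0.
have d4 : 0 < d / 4 by lra.
have [e1 e1p H1] := approximate_identity f Q _ _ lf fQ c1 d4.
have [e2 e2p H2] := approximate_identity f Q _ _ lf fQ c2 d4.
have [e3 e3p H3] := approximate_identity f Q _ _ lf fQ c3 d4.
have [e4 e4p H4] := approximate_identity f Q _ _ lf fQ c4 d4.
have [eps [eps0 le1 le2 le3 [le4 le5]]] : exists eps : R,
    [/\ 0 < eps, eps <= e1, eps <= e2, eps <= e3 & eps <= e4 /\ eps <= x' / 2].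
  exists (Num.min (Num.min e1 e2) (Num.min (Num.min e3 e4) (x' / 2))).
  by rewrite !lt_min !ge_min !lexx e1p e2p e3p e4p !orbT; split => //=; lra.
have [E [s [e [nE dE ds [ce e0 es s0 s1]]]]] := exists_smooth_ramp eps eps0.
have s0' z : z <= - eps -> s z = 0 by move=> /s0 [].
have E0 z : z <= - eps -> E z = 0 by move=> /s0 [].
have {}H1 := H1 eps s e ltac:(rewrite eps0 le1//) ds ce e0 es s0' s1.
have {}H2 := H2 eps s e ltac:(rewrite eps0 le2//) ds ce e0 es s0' s1.
have {}H3 := H3 eps s e ltac:(rewrite eps0 le3//) ds ce e0 es s0' s1.
have {}H4 := H4 eps s e ltac:(rewrite eps0 le4//) ds ce e0 es s0' s1.
move: H1 H2 H3 H4 => [i1 h1] [i2 h2] [i3 h3] [i4 h4].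
have smon a b : a <= b -> s a <= s b.
  rewrite le_eqVlt => /predU1P[->//|ab].
  have [c _ cE] := @MVT_pt R s e a b ab.
  by rewrite -subr_ge0 cE mulr_ge0// subr_ge0 ltW.
have s01 z : 0 <= s z <= 1.
  apply/andP; split.
    by rewrite -(s0' (Num.min z (- eps))) ?ge_min ?lexx ?orbT//; apply: smon; rewrite ge_min lexx.
  by rewrite -(s1 (Num.max z eps)) ?le_max ?lexx ?orbT//; apply: smon; rewrite le_max lexx.
have Einc a b : a <= b -> 0 <= E b - E a <= b - a.
  rewrite le_eqVlt => /predU1P[->|ab]; first by rewrite !subrr lexx.
  have [c _ ->] := @MVT_pt R E s a b ab.
  have /andP[sc0 sc1] := s01 c.
  by rewrite mulr_ge0 ?subr_ge0 ?(ltW ab)//= ler_piMl// subr_ge0 ltW.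
have Elin a b : eps <= a -> a <= b -> E b - E a = b - a.
  move=> ea; rewrite le_eqVlt => /predU1P[->|ab]; first by rewrite !subrr.
  have [c /andP[ac _] ->] := @MVT_pt R E s a b ab.
  by rewrite s1 ?mul1r// (le_trans ea)// ltW.
pose phi z := E (1 * z + (- (y + x'))) + E (1 * z + (- (y - x'))) +
  (-1) * (E (1 * z + (- (y + x))) + E (1 * z + (- (y - x)))).
have nphi k : nderivable k phi.
  apply: nderivableD; first by apply: nderivableD; exact: nderivable_affine.
  by apply: nderivableZ; apply: nderivableD; exact: nderivable_affine.
have phi0 z : ~~ (y - 2 * x' < z < y + 2 * x') -> phi z = 0.
  by rewrite /phi !mul1r; exact: (ramp_second_difference_support E eps).
have phib z : `|phi z| <= x' - x.
  by rewrite /phi !mul1r; exact: (ramp_second_difference_bound E).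
have tphi : test_function phi.
  split; first by move=> k z; exact: nderivable_derivable.
  apply: (@subclosed_compact _ _ `[(y - 2 * x'), (y + 2 * x')]).
  - exact: closed_closure.
  - exact: segment_compact.
  - have /closure_id -> : closed `[(y - 2 * x'), (y + 2 * x')]%classic by exact: itv_closed.
    apply: closure_subset => z /= /eqP zn; apply: contrapT => H; apply: zn.
    apply: phi0; apply/negP => H'; apply: H.
    by case/andP: H' => ? ?; rewrite in_itv/= !ltW.
have phi2 : (phi^`(2))%classic = (fun z => e (z - (y + x')) + e (z - (y - x')) -
    e (z - (y + x)) - e (z - (y - x))).
  have da (g g' : R -> R) (c z : R) : (forall t : R, is_derive t 1 g (g' t)) ->
      is_derive z 1 (fun t => g (1 * t + c)) (g' (1 * z + c)).
    move=> gg; apply: (deq _ (dcomp (gg _) (dD (dZ 1 (did z)) (dcst c z)))).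
    by rewrite mulr1 addr0 mulr1.
  have p1 : (phi^`())%classic = (fun z => s (1 * z + (- (y + x'))) + s (1 * z + (- (y - x'))) +
      (-1) * (s (1 * z + (- (y + x))) + s (1 * z + (- (y - x))))).
    apply/funext => z; rewrite derive1E.
    have D := dD (dD (da E s (- (y + x')) z dE) (da E s (- (y - x')) z dE))
      (dZ (-1) (dD (da E s (- (y + x)) z dE) (da E s (- (y - x)) z dE))).
    exact: (derive_val (is_derive := D)).
  rewrite derive1nS derive1n1 p1; apply/funext => z; rewrite derive1E.
  have D := dD (dD (da s e (- (y + x')) z ds) (da s e (- (y - x')) z ds))
      (dZ (-1) (dD (da s e (- (y + x)) z ds) (da s e (- (y - x)) z ds))).
  rewrite (derive_val (is_derive := D)) !mul1r; ring.
have cphi : continuous phi.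
  by move=> z; have [p' pp' _] := nphi 1; exact: dcontinuous (pp' z).
have [j1 j2] := Itg_compact_support_mul f2 phi (y - 2 * x') (y + 2 * x') lf2 cphi phi0.
have W := wd phi tphi.
rewrite sqrrN expr1n mul1r j2 phi2 in W.
have key : `|\int[mu]_(z in `](y - 2 * x'), (y + 2 * x')[) (f2 z * phi z)| <=
    (x' - x) * \int[mu]_(z in `](y - 2 * x'), (y + 2 * x')[) `|f2 z|.
  have k1 : Itg `](y - 2 * x'), (y + 2 * x')[ (fun z => `|f2 z|).
    by apply: Itg_norm; exact: Itg_sub f2i.
  rewrite -RintegralZl//; apply: normr_Rint_le => //.
  - exact: Itg_sub j1.
  - exact: ItgZl.
  - by move=> z _; rewrite normrM mulrC ler_wpM2r.
have W2 : \int[mu]_z (f z * (e (z - (y + x')) + e (z - (y - x')) -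
    e (z - (y + x)) - e (z - (y - x)))) =
  \int[mu]_z (f z * e (z - (y + x'))) + \int[mu]_z (f z * e (z - (y - x'))) -
  \int[mu]_z (f z * e (z - (y + x))) - \int[mu]_z (f z * e (z - (y - x))).
  have a1 := ItgD _ _ _ measurableT i1 i2.
  have a2 := ItgB _ _ _ measurableT a1 i3.
  rewrite -RintegralD// -RintegralB// -RintegralB//.
  by apply: eq_Rint => z _; ring.
rewrite W2 in W; rewrite -W in key.
move: key h1 h2 h3 h4; set A1 := Rintegral _ _ _; set A2 := Rintegral _ _ _.
set A3 := Rintegral _ _ _; set A4 := Rintegral _ _ _; set B := _ * _.
rewrite !ler_norml; clear; lra.
Qed.

End WeakSecondDerivative.

(** * Integrated increments of second differences of the remainder *)

Section RemainderIncrement.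
Context {R : realType}.
Notation mu := (@lebesgue_measure R).
Notation mR := (measurableTypeR R).
Notation Itg D f := (mu.-integrable D (EFin \o f)).

(* Tonelli: integrating over all translates of a window multiplies the total
   mass by the length of the window. *)
Lemma integral_window (g : R -> R) (r : R) : 0 < r -> Itg setT g ->
  (forall z, 0 <= g z) ->
  Itg setT (fun y => \int[mu]_(z in `](y - r), (y + r)[) g z) /\
  \int[mu]_y (\int[mu]_(z in `](y - r), (y + r)[) g z) =
    2 * r * \int[mu]_z g z.
Proof.
move=> r0 gi g0.
have zr (z : R) : z - r < z + r by lra.
pose A := [set p : mR * mR | (p.1 - r < p.2) && (p.2 < p.1 + r)].
have mA : measurable A.
  have m1 : measurable_fun setT (fun p : mR * mR => p.1 - r < p.2).
    by apply: measurable_fun_ltr => //; exact: measurable_funB.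
  have m2 : measurable_fun setT (fun p : mR * mR => p.2 < p.1 + r).
    by apply: measurable_fun_ltr => //; exact: measurable_funD.
  have := measurable_and m1 m2.
  have mt : measurable [set true] by [].
  move=> /(_ measurableT [set true] mt).
  by rewrite setTI; congr (measurable _); apply/seteqP; split => p.
pose h (p : mR * mR) : \bar R := (g p.2 * \1_A p)%:E.
have mg : measurable_fun [set: mR] (g : mR -> R) by exact: Itg_measurable gi.
have mh : measurable_fun setT h.
  apply/measurable_EFinP; apply: measurable_funM.
    exact: (measurableT_comp mg measurable_snd).
  exact: measurable_indic.
have h0 p : (0 <= h p)%E by rewrite lee_fin mulr_ge0.
have F := @fubini_tonelli _ _ mR mR R mu mu h mh h0.
have inner1 (y : R) : (\int[mu]_z h (y, z) = (\int[mu]_(z in `](y - r), (y + r)[) g z)%:E)%E.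
  have gy : Itg `](y - r), (y + r)[ g.
    by apply: (Itg_sub _ setT _ measurableT (measurable_itv _) (@subsetT _ _) gi).
  rewrite /Rintegral fineK; last exact: integrable_fin_num.
  rewrite [RHS]integral_mkcond; apply: eq_integral => z _.
  rewrite /h patchE; case: ifPn => zy.
    have Ayz : A (y, z) by move: zy; rewrite inE /= in_itv.
    by rewrite indicE (mem_set Ayz) mulr1.
  have Ayz : ~ A (y, z) by move: zy; rewrite notin_setE /= in_itv.
  by rewrite indicE (memNset Ayz) mulr0.
have inner2 (z : R) : (\int[mu]_y h (y, z) = (2 * r * g z)%:E)%E.
  transitivity (\int[mu]_(y in `](z - r)%R, (z + r)%R[) (cst (g z)%:E y))%E.
    rewrite [RHS]integral_mkcond; apply: eq_integral => y _.
    rewrite /h patchE; case: ifPn => zy.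
      have Ayz : A (y, z) by move: zy; rewrite inE /= in_itv/= /A/=; clear; lra.
      by rewrite indicE (mem_set Ayz) mulr1.
    have Ayz : ~ A (y, z).
      move: zy; rewrite notin_setE /= in_itv/= /A/=; apply: contra_not; clear; lra.
    by rewrite indicE (memNset Ayz) mulr0.
  rewrite integral_cst; last exact: measurable_itv.
  have ml : (mu `](z - r)%R, (z + r)%R[ = (2 * r)%:E)%E.
    by rewrite lebesgue_measure_itv/= lte_fin zr -EFinB; congr EFin; ring.
  by rewrite [X in (_ * X)%E](_ : _ = (2 * r)%:E)// -EFinM mulrC.
have I2 : (\int[mu]_z \int[mu]_y h (y, z) = (2 * r * \int[mu]_z g z)%:E)%E.
  under eq_integral do rewrite inner2.
  have := integrable_fin_num measurableT (ItgZl _ _ (2 * r) measurableT gi).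
  by rewrite -(@RintegralZl _ mR R mu setT g (2 * r) measurableT gi) /Rintegral => /fineK.
have G0 y : 0 <= \int[mu]_(z in `](y - r), (y + r)[) g z by exact: Rintegral_ge0.
have I1 : (\int[mu]_y (\int[mu]_(z in `](y - r), (y + r)[) g z)%:E =
    (2 * r * \int[mu]_z g z)%:E)%E.
  by rewrite -I2 -F; apply: eq_integral => y _; rewrite inner1.
split; last by rewrite [LHS]/Rintegral I1.
apply/integrableP; split.
  have := @measurable_fun_fubini_tonelli_F _ _ mR mR R mu h mh h0.
  by apply: eq_measurable_fun => y _; rewrite /fubini_F /= inner1.
under eq_integral do rewrite /= ger0_norm ?G0//.
by rewrite I1 ltry.
Qed.

Lemma Itg_le_ae (D : set R) (f g : R -> R) : measurable D -> measurable_fun D f ->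
  Itg D g -> (forall x, D x -> 0 <= g x) ->
  {ae mu, forall x, D x -> `|f x| <= g x} -> Itg D f.
Proof.
move=> mD mf gi g0 fg; apply/integrableP; split; first exact/measurable_EFinP.
have /integrableP[mg] := gi; apply: le_lt_trans.
apply: (@ae_ge0_le_integral _ (measurableTypeR R) R mu D mD) => //.
- exact/measurable_EFinP/measurableT_comp.
- by apply/measurable_EFinP/measurableT_comp => //; exact: Itg_measurable gi.
- apply: (@filterS _ _ (ae_filter_ringOfSetsType mu) _ _ _ fg) => x H Dx.
  by rewrite lee_fin (le_trans (H Dx))// ler_norm.
Qed.

Lemma ae_neq (p : R) : {ae mu, forall x, x != p}.
Proof.
exists [set p]; split; [exact: measurable_set1|exact: lebesgue_measure_set1|].
by move=> x /= /negP; rewrite negbK => /eqP.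
Qed.

(** The values [Q y] cancel in the increment, leaving four nodes. Integrating the pointwise bound
    over [y], with windows of radius [2 * x'], gives [4 * x' * (x' - x)] times the mass of [f2], and
    [x' <= x' + x]. Increments are estimated, and not only single differences, because derivatives
    in [x] are needed later. *)
Lemma weak_derivative2_increment_L1 (f f2 Q : R -> R) (x x' : R) :
  is_weak_derivative 2 f f2 -> Itg setT f2 -> {ae mu, forall z, Q z = f z} ->
  measurable_fun setT Q -> (forall z, z != 0 -> {for z, continuous Q}) ->
  0 <= x -> x <= x' ->
  let r y := central_diff2 Q x' y - central_diff2 Q x y in
  Itg setT r /\
  \int[mu]_y `|r y| <= 4 * \int[mu]_z `|f2 z| * (x' ^+ 2 - x ^+ 2).
Proof.
move=> wd f2i fQ mQ cQ x0; rewrite le_eqVlt => /predU1P[<-|xx'] r.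
  have rE : r = cst 0 by apply/funext => y; rewrite /r subrr.
  rewrite rE; split; first exact: integrable0.
  by under eq_Rint do rewrite normr0; rewrite Rintegral_cst// mul0r subrr mulr0.
have x'0 : 0 < x' by exact: le_lt_trans xx'.
have nf2 := Itg_norm _ _ f2i.
have [] := integral_window (fun z => `|f2 z|) (2 * x') _ nf2 _ => //.
  by rewrite mulr_gt0.
set W := (fun y => _) => Wi WE.
have mr : measurable_fun setT r.
  have ms (c : R) : measurable_fun [set: R] (fun y : R => Q (y + c)).
    by apply: (measurableT_comp mQ); exact: measurable_funD.
  by apply: measurable_funB; apply: measurable_funB; (try apply: measurable_funD);
    (try exact: ms); exact: measurable_funM.
have rW : {ae mu, forall y, setT y -> `|r y| <= (x' - x) * W y}.
  (* These four values of [y] put a node at 0, the one point where [Q] may fail to be continuous. *)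
  have A1 := ae_neq x'; have A2 := ae_neq (- x'); have A3 := ae_neq x.
  have A4 := ae_neq (- x).
  have A12 := @filterI _ _ (ae_filter_ringOfSetsType mu) _ _ A1 A2.
  have A34 := @filterI _ _ (ae_filter_ringOfSetsType mu) _ _ A3 A4.
  apply: (@filterS2 _ _ (ae_filter_ringOfSetsType mu) _ _ _ _ A12 A34).
  move=> y [y1 y2] [y3 y4] _.
  have c1 : {for y + x', continuous Q} by apply: cQ; apply: contra y2; rewrite addr_eq0.
  have c2 : {for y - x', continuous Q} by apply: cQ; rewrite subr_eq0.
  have c3 : {for y + x, continuous Q} by apply: cQ; apply: contra y4; rewrite addr_eq0.
  have c4 : {for y - x, continuous Q} by apply: cQ; rewrite subr_eq0.
  have := weak_derivative2_increment f f2 Q x x' y wd f2i fQ x0 (ltW xx') x'0 c1 c2 c3 c4.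
  suff -> : r y = Q (y + x') + Q (y - x') - Q (y + x) - Q (y - x) by [].
  by rewrite /r /central_diff2; ring.
have W0 y : 0 <= W y by exact: Rintegral_ge0.
have xW0 y : 0 <= (x' - x) * W y by rewrite mulr_ge0// subr_ge0 ltW.
have ri : Itg setT r.
  by apply: (Itg_le_ae _ _ (fun y => (x' - x) * W y)) => //; exact: ItgZl.
split=> //.
have E : \int[mu]_y `|r y| = `|\int[mu]_y `|r y| |.
  by rewrite ger0_norm//; exact: Rintegral_ge0.
have xWi : Itg setT (fun y => (x' - x) * W y) by exact: ItgZl.
have := normr_Rint_le_ae setT (fun y => `|r y|) _ measurableT (Itg_norm _ _ ri) xWi
  (fun y _ => xW0 y).
rewrite -E => H.
apply: le_trans (H _) _.
  by apply: (@filterS _ _ (ae_filter_ringOfSetsType mu) _ _ _ rW) => y; rewrite normr_id.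
rewrite RintegralZl// WE; set N := Rintegral _ _ _.
have N0 : 0 <= N by exact: Rintegral_ge0.
have -> : 4 * N * (x' ^+ 2 - x ^+ 2) = (x' - x) * (4 * x' * N) + 4 * N * (x' - x) * x by ring.
have -> : (x' - x) * (2 * (2 * x') * N) = (x' - x) * (4 * x' * N) by ring.
by rewrite lerDl !mulr_ge0// subr_ge0 ltW.
Qed.

End RemainderIncrement.

(** * Convex kernels *)

Section ConvexKernel.
Context {R : realType}.
Notation mu := (@lebesgue_measure R).
Notation mR := (measurableTypeR R).
Notation Itg D f := (mu.-integrable D (EFin \o f)).
Context (K : R -> R).
Hypothesis K_L1 : Itg setT K.
Hypothesis K_even : forall x, K (- x) = K x.
Hypothesis K_pos : forall x, x != 0 -> 0 < K x.
Hypothesis K_convex : convex_function (`]0, +oo[ : set R) K.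

(** The chord inequality is cleared of denominators, so that several instances can be combined
    linearly. *)
Lemma convex_three_points (a b c : R) : 0 < a -> a < b -> b < c ->
  (c - a) * K b <= (c - b) * K a + (b - a) * K c.
Proof.
move=> a0 ab bc; have ca : 0 < c - a by lra.
have t01 : 0 <= (c - b) / (c - a) <= 1.
  rewrite divr_ge0 ?subr_ge0 ?(ltW bc) ?(ltW (lt_trans ab bc))//=.
  by rewrite ler_pdivrMr//; lra.
have := K_convex (Itv01 (andP t01).1 (andP t01).2).
move=> /(_ a c); rewrite !inE /= !in_itv/= !andbT => /(_ a0 ltac:(lra)).
rewrite !convRE /= /unstable.onem /=.
rewrite [X in K X](_ : _ = (c - b) / (c - a) * a + (1 - (c - b) / (c - a)) * c)//.
have -> : (c - b) / (c - a) * a + (1 - (c - b) / (c - a)) * c = b by field; lra.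
move=> H.
have := ler_wpM2l (ltW ca) H; congr (_ <= _); field; lra.
Qed.

(** If [K] increased somewhere, convexity would keep it above [K b > 0] on all of []b, +oo[],
    against integrability. *)
Lemma convex_kernel_nonincreasing (a b : R) : 0 < a -> a <= b -> K b <= K a.
Proof.
move=> a0; rewrite le_eqVlt => /predU1P[->//|ab]; rewrite leNgt; apply/negP => Kab.
have Kb0 : 0 < K b by apply: K_pos; lra.
have H y : b < y -> K b <= K y.
  move=> yb; have := convex_three_points a b y a0 ab yb.
  have p1 : 0 < b - a by lra. have p2 : 0 < y - b by lra.
  have := ltr_pM2l p2 (K a) (K b); rewrite Kab => p3 p4.
  rewrite -(ler_pM2l p1); move: p3 p4.
  have -> : (y - a) * K b = (y - b) * K b + (b - a) * K b by ring.
  by move=> p3; lra.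
pose N := \int[mu]_y `|K y|.
have N0 : 0 <= N by exact: Rintegral_ge0.
(* On []b, c[] the lower bound [K b] has integral [N + 1], more than the total mass [N]. *)
pose c := b + (N + 1) / K b.
have bc : b < c by rewrite ltrDl divr_gt0// ltr_wpDl.
have i1 : Itg `]b, c[ (fun=> K b) by exact: Itg_cst.
have i2 : Itg `]b, c[ K by exact: Itg_sub K_L1.
have l1 : \int[mu]_(y in `]b, c[) K b <= \int[mu]_(y in `]b, c[) K y.
  by apply: le_Rint => // y; rewrite /= in_itv/= => /andP[+ _]; exact: H.
have l2 : \int[mu]_(y in `]b, c[) K y <= N.
  apply: (@le_trans _ _ (\int[mu]_(y in `]b, c[) `|K y|)).
    by apply: le_Rint => //; [exact: Itg_norm|move=> y _; exact: ler_norm].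
  by apply: Rint_sub_le => //; exact: Itg_norm.
have := le_trans l1 l2; rewrite (Rint_cst _ _ _ (ltW bc)) /c addrAC subrr add0r mulrC divfK.
  by rewrite leNgt ltrDl ltr01.
by rewrite gt_eqF.
Qed.

(** Slopes of a convex function increase, so the slopes beyond [x / 2] are controlled by chords
    starting at [x / 4], whose drop is at most [K (x / 4)] by positivity. This yields continuity off
    0. *)
Lemma convex_kernel_lipschitz (x y : R) : 0 < x -> x / 2 < y ->
  `|K y - K x| <= 4 * K (x / 4) / x * `|y - x|.
Proof.
move=> x0 xy; set C := K (x / 4).
have C0 : 0 < C by apply: K_pos; lra.
suff [L1 L2] : x * `|K y - K x| <= 4 * C * `|y - x| /\ True.
  by rewrite mulrAC ler_pdivlMr// mulrC.
split=> //; have [yx|yx|->] := ltgtP y x; last by rewrite !subrr normr0 !mulr0.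
- have m1 := convex_kernel_nonincreasing y x ltac:(lra) (ltW yx).
  have m2 : 0 < K y by apply: K_pos; lra.
  rewrite ger0_norm ?subr_ge0// (ltr0_norm (_ : y - x < 0)) ?subr_lt0// opprB.
  have := convex_three_points (x / 4) y x ltac:(lra) ltac:(lra) yx; rewrite -/C => c3.
  have : x / 4 * (K y - K x) <= (y - x / 4) * (K y - K x).
    by rewrite ler_wpM2r ?subr_ge0//; lra.
  have : 0 <= (x - y) * K y by rewrite mulr_ge0 ?ltW// subr_gt0.
  by move: c3; clear; nra.
- have m1 := convex_kernel_nonincreasing x y x0 (ltW yx).
  have m2 : 0 < K x by apply: K_pos; lra.
  rewrite distrC ger0_norm ?subr_ge0// (gtr0_norm (_ : 0 < y - x)) ?subr_gt0//.
  have := convex_three_points (x / 4) x y ltac:(lra) ltac:(lra) yx; rewrite -/C => c3.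
  have : 0 <= (y - x) * K x by rewrite mulr_ge0 ?ltW// subr_gt0.
  have : 0 <= x * (K x - K y) by rewrite mulr_ge0 ?subr_ge0// ltW.
  by move: c3; clear; nra.
Qed.

Lemma convex_kernel_continuous (x : R) : x != 0 -> {for x, continuous K}.
Proof.
have pos z : 0 < z -> {for z, continuous K}.
  move=> z0; have C0 : 0 < 4 * K (z / 4) / z.
    by rewrite divr_gt0// mulr_gt0// K_pos//; lra.
  apply/cvgrPdist_le => e e0; near=> y.
  rewrite distrC (le_trans (convex_kernel_lipschitz z y z0 _))//.
    by near: y; apply: lt_nbhsr; lra.
  rewrite mulrC -ler_pdivlMr// distrC; near: y.
  by apply/nbhs_ballP; exists (e / (4 * K (z / 4) / z)); [rewrite /= divr_gt0|move=> t /ltW].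
move=> x0; have [xn|xp|E] := ltgtP x 0; last by rewrite E eqxx in x0.
- have -> : K = K \o -%R by apply/funext => y /=; rewrite K_even.
  by apply: continuous_comp; [exact: oppr_continuous|apply: pos; rewrite oppr_gt0].
- exact: pos.
Unshelve. all: by end_near. Qed.

Lemma central_diff2_ge0 (x y : R) : 0 < x -> x < y -> 0 <= central_diff2 K x y.
Proof.
move=> x0 xy; have := convex_three_points (y - x) y (y + x) ltac:(lra) ltac:(lra) ltac:(lra).
rewrite /central_diff2.
have -> : (y + x - (y - x)) * K y = x * (2 * K y) by ring.
have -> : (y + x - y) * K (y - x) + (y - (y - x)) * K (y + x) = x * (K (y + x) + K (y - x)) by ring.
by rewrite ler_pM2l// subr_ge0.
Qed.

(** By evenness the nodes are [x - y] and [x + y], symmetric about [x]: spreading them raises their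
    sum by convexity, while [- 2 * K y] grows because [K] is nonincreasing. *)
Lemma central_diff2_nondecreasing (x y1 y2 : R) : 0 < y1 -> y1 <= y2 -> y2 < x ->
  central_diff2 K x y1 <= central_diff2 K x y2.
Proof.
move=> y10; rewrite le_eqVlt => /predU1P[->//|y12] y2x.
have Kl y : K (y - x) = K (x - y) by rewrite -K_even opprB.
rewrite /central_diff2 !Kl.
have c1 := convex_three_points (x - y2) (x - y1) (y2 + x) ltac:(lra) ltac:(lra) ltac:(lra).
have c2 := convex_three_points (x - y2) (y1 + x) (y2 + x) ltac:(lra) ltac:(lra) ltac:(lra).
have c3 := convex_kernel_nonincreasing y1 y2 y10 (ltW y12).
have y20 : 0 < 2 * y2 by lra.
suff : 2 * y2 * (K (y1 + x) + K (x - y1)) <= 2 * y2 * (K (y2 + x) + K (x - y2)).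
  by rewrite ler_pM2l//; lra.
move: c1 c2; clear; nra.
Qed.

Lemma Itg_central_diff2T (x : R) : Itg setT (central_diff2 K x).
Proof.
apply: ItgB => //; last exact: ItgZl.
by apply: ItgD => //; exact: Itg_shiftT.
Qed.

Lemma Itg_central_diff2 (x : R) (D : set R) : measurable D -> Itg D (central_diff2 K x).
Proof. by move=> mD; exact: Itg_sub (Itg_central_diff2T x). Qed.

(** Translation invariance makes the integral over the line vanish, and evenness splits it into two
    equal halves. Consequently a constant can be subtracted from [u] in the convolution. *)
Lemma Rint_central_diff2_eq0 (x : R) : \int[mu]_(y in `]0, +oo[) central_diff2 K x y = 0.
Proof.
have sT c : \int[mu]_y K (y + c) = \int[mu]_y K y.
  have mphi : measurable_fun [set: mR] ((fun t => t + c) : mR -> mR) by exact: measurable_funD.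
  have := Rint_measure_preserving _ mphi (lebesgue_measure_shift c) setT K measurableT K_L1.
  by rewrite preimage_setT.
have full : \int[mu]_y central_diff2 K x y = 0.
  rewrite RintegralB//; last 2 first.
  - by apply: ItgD => //; exact: Itg_shiftT.
  - exact: ItgZl.
  rewrite RintegralD//; [|exact: Itg_shiftT..].
  by rewrite sT (sT (- x)) RintegralZl//; ring.
have mphi : measurable_fun [set: mR] ((fun t => 0 - t) : mR -> mR) by exact: measurable_funB.
have half := Rint_measure_preserving _ mphi (lebesgue_measure_reflect 0) `]0, +oo[
  (central_diff2 K x) (measurable_itv _) (Itg_central_diff2 x _ (measurable_itv _)).
have pre : (fun t => 0 - t) @^-1` `]0, +oo[%classic = `]-oo, (0 : R)[%classic.
  by apply/seteqP; split => y /=; rewrite !in_itv/= !andbT sub0r oppr_gt0.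
have ev y : central_diff2 K x (0 - y) = central_diff2 K x y.
  rewrite /central_diff2 sub0r K_even -(K_even (- y + x)) -(K_even (- y - x)).
  by rewrite !opprD !opprK; ring.
rewrite pre (eq_Rint `]-oo, 0[ _ (central_diff2 K x)) in half; last by move=> y _; exact: ev.
move: full; rewrite -(Rint_but _ _ 0 measurableT (Itg_central_diff2T x)).
have -> : [set: R] `\ 0 = `]-oo, 0[%classic `|` `]0, +oo[%classic.
  apply/seteqP; split => y /=; rewrite !in_itv/= andbT.
    by case=> _ /eqP; case: ltgtP => //; [left|right].
  by case=> y0; split => //; apply/eqP; rewrite ?(lt_eqF y0)// (gt_eqF y0).
rewrite (@Rintegral_setU _ mR R mu)//.
- by rewrite -half => /eqP; rewrite -mulr2n mulrn_eq0 => /eqP.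
- by apply: Itg_central_diff2; exact: measurableU.
- apply/disj_setPS => y [/=]; rewrite !in_itv/= andbT => y1 y2.
  by move: (lt_trans y1 y2); rewrite ltxx.
Qed.

(* Chebyshev's sum inequality on (0, x), where the kernel increases from
   negative to positive values and has nonpositive mean. *)
Lemma convolution_lower_bound (x B : R) (u : R -> R) : 0 < x ->
  measurable_fun (`]0, +oo[%classic : set R) u ->
  (forall y, 0 < y -> 0 <= u y <= B) ->
  (forall y z, 0 < y -> y <= z -> z <= x -> u y <= u z) ->
  \int[mu]_(y in `]x, +oo[) (central_diff2 K x y * (u y - u x)) <=
  \int[mu]_(y in `]0, +oo[) (central_diff2 K x y * u y).
Proof.
move=> x0 mu_ uB und.
pose k := central_diff2 K x.
have ki D : measurable D -> Itg D k by exact: Itg_central_diff2.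
have mP : measurable (`]0, +oo[%classic : set R) by exact: measurable_itv.
have kui : Itg `]0, +oo[ (fun y => k y * u y).
  apply: (Itg_mulr_bounded _ _ _ B) => //; first exact: ki.
  by move=> y; rewrite /= in_itv/= andbT => /uB /andP[? ?]; rewrite ger0_norm.
have kci : Itg `]0, +oo[ (fun y => k y * u x) by apply: ItgZr => //; exact: ki.
have E1 : \int[mu]_(y in `]0, +oo[) (k y * u y) =
    \int[mu]_(y in `]0, +oo[) (k y * (u y - u x)).
  have Z : \int[mu]_(y in `]0, +oo[) (k y * u x) = 0.
    by rewrite RintegralZr//; [rewrite Rint_central_diff2_eq0 mul0r|exact: ki].
  have := @RintegralB _ mR R mu _ _ _ mP kui kci; rewrite Z subr0 => <-.
  by apply: eq_Rint => y _; rewrite mulrBr.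
have kdi : Itg `]0, +oo[ (fun y => k y * (u y - u x)).
  have := ItgB _ _ _ mP kui kci.
  by apply: Itg_eq => // y _; rewrite mulrBr.
rewrite E1 (Rint_split_oy 0 x _ (ltW x0) kdi) lerDr.
have sub : (`]0, x[%classic : set R) `<=` `]0, +oo[%classic.
  by move=> y /=; rewrite !in_itv/= andbT => /andP[].
have kx0 : \int[mu]_(y in `]0, x[) k y <= 0.
  have := Rint_central_diff2_eq0 x; rewrite (Rint_split_oy 0 x _ (ltW x0) (ki _ mP)).
  move/eqP; rewrite addr_eq0 => /eqP ->; rewrite oppr_le0.
  apply: Rintegral_ge0 => y; rewrite /= in_itv/= andbT; exact: central_diff2_ge0.
(* The number [c] separates two regimes: [u x - u y] is at least [c] where the kernel is nonpositive
   and at most [c] where it is positive. It is taken as the infimum over the first region. *)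
suff [c c0 H] : exists2 c, 0 <= c & forall y, 0 < y < x -> k y * (u x - u y) <= k y * c.
  have i1 : Itg `]0, x[ (fun y => k y * (u y - u x)) by exact: Itg_sub kdi.
  have i2 : Itg `]0, x[ (fun y => k y * (- c)) by apply: ItgZr => //; exact: ki.
  apply: (@le_trans _ _ (\int[mu]_(y in `]0, x[) (k y * (- c)))).
    rewrite RintegralZr//; last exact: ki.
    by rewrite mulrN oppr_ge0 mulr_le0_ge0.
  apply: le_Rint => // y; rewrite /= in_itv/= => /H.
  by rewrite -[u y - _]opprB !mulrN lerN2.
pose N := [set y | 0 < y < x /\ k y <= 0].
have [N0|/set0P[z Nz]] := eqVneq N set0.
  exists (u x); first by case/andP: (uB x x0).
  move=> y /andP[y0 yx]; have ky : 0 <= k y.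
    rewrite leNgt; apply/negP => ky; have : N y by rewrite /N/= y0 yx ltW.
    by rewrite N0.
  by apply: ler_wpM2l => //; rewrite gerBl; case/andP: (uB y y0).
pose G := [set u x - u y | y in N].
have G0 : lbound G 0.
  by move=> _ [y [/andP[y0 yx] _] <-]; rewrite subr_ge0; apply: und => //; exact: ltW.
have hG : has_inf G by split; [exists (u x - u z); exists z|exists 0].
exists (inf G); first by apply: lb_le_inf => //; case: hG.
move=> y /andP[y0 yx]; have [ky|ky] := leP (k y) 0.
  rewrite ler_wnM2l//; apply: ge_inf; first by exists 0.
  by exists y => //; rewrite /N/= y0 yx.
rewrite ler_pM2l//; apply: lb_le_inf; first by exists (u x - u z); exists z.
move=> _ [w [/andP[w0 wx] kw] <-]; rewrite lerD2l lerN2.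
have [wy|yw] := leP w y; first by apply: und => //; exact: ltW.
have := central_diff2_nondecreasing x y w y0 (ltW yw) wx.
by move=> /(lt_le_trans ky)/lt_le_trans/(_ kw); rewrite ltxx.
Qed.
End ConvexKernel.

(** * The two singular kernels *)

Section LogKernel.
Context {R : realType}.
Notation sqrt := (@Num.sqrt R).
Notation L := (@log_part R).

Lemma log_partE (z : R) : L z = - ln `|z|.
Proof.
rewrite /log_part; have [->|z0] := eqVneq z 0.
  by rewrite normr0 invr0 mulr0 ln0// oppr0.
by rewrite div1r lnV// posrE normr_gt0.
Qed.

Lemma measurable_log_part : measurable_fun [set: R] L.
Proof.
rewrite (_ : L = (fun z => - ln `|z|)); last by apply/funext => z; exact: log_partE.
by apply: measurableT_comp => //; apply: (measurableT_comp (@measurable_ln R)).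
Qed.

Lemma log_part_continuous (z : R) : z != 0 -> {for z, continuous L}.
Proof.
move=> z0; rewrite (_ : L = (fun z => - ln `|z|)); last by apply/funext => t; exact: log_partE.
apply: cvgN; apply: continuous_comp; first exact: norm_continuous.
by apply: continuous_ln; rewrite normr_gt0.
Qed.

(** The derivative of [t - 1/t - 2 ln t] is the square of [1 - 1/t]. *)
Lemma ln_le_sub_inv (r : R) : 1 <= r -> 2 * ln r <= r - r^-1.
Proof.
rewrite le_eqVlt => /predU1P[<-|r1]; first by rewrite ln1 mulr0 invr1 subrr.
pose f (t : R) := t - t^-1 - 2 * ln t.
pose df (t : R) := 1 - (- 1 / t ^+ 2) - 2 * t^-1.
have [c|c /andP[c1 cr]] := @MVT_pt R f df 1 r r1.
  move=> /andP[c1 _]; have c0 : 0 < c by lra.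
  by apply: (dB (dB (did c) (dV _ (did c))) (dZ 2 (is_derive1_ln c0))); rewrite gt_eqF.
rewrite /f ln1 invr1 subrr mulr0 subrr subr0 => E.
rewrite -subr_ge0 E mulr_ge0//; last lra.
have c0 : c != 0 by rewrite gt_eqF//; lra.
rewrite /df (_ : _ - _ = (1 - c^-1) ^+ 2) ?sqr_ge0//.
by field.
Qed.

Lemma ln_sqrt2 (z : R) : 0 < z -> 2 * ln (sqrt z) = ln z.
Proof.
move=> z0; have sz : 0 < sqrt z by rewrite sqrtr_gt0.
by rewrite -[in RHS](sqrt_sqr z (ltW z0)) lnM ?posrE// mulr_natl mulr2n.
Qed.

Lemma ln_le_sqrt (t : R) : 0 < t -> ln t <= sqrt t.
Proof.
move=> t0; have [t1|t1] := leP t 1.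
  by apply: le_trans (ln_le0 t1) _; rewrite sqrtr_ge0.
have s1 : 1 <= sqrt t by rewrite -sqrtr1 ler_wsqrtr// ltW.
have s0 : 0 < sqrt t by exact: lt_le_trans s1.
have := ln_le_sub_inv _ s1; rewrite ln_sqrt2// => /le_trans; apply.
by rewrite gerBl invr_ge0 ltW.
Qed.

(** The logarithmic mean dominates the geometric mean: [ln_le_sub_inv] at the square root of the
    quotient. *)
Lemma ln_diff_le_sqrt (s t : R) : 0 < s -> 0 < t ->
  `|ln s - ln t| <= `|s - t| / sqrt (s * t).
Proof.
have main (a b : R) : 0 < a -> a <= b -> `|ln b - ln a| <= `|b - a| / sqrt (b * a).
  move=> a0 ab; have b0 : 0 < b by exact: lt_le_trans ab.
  rewrite !ger0_norm ?subr_ge0 ?ler_ln ?posrE//.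
  have [sa sb] : 0 < sqrt a /\ 0 < sqrt b by rewrite !sqrtr_gt0.
  have r1 : 1 <= sqrt b / sqrt a by rewrite ler_pdivlMr// mul1r ler_wsqrtr.
  have := ln_le_sub_inv _ r1; rewrite ln_div ?posrE// mulrBr.
  rewrite !ln_sqrt2// => /le_trans; apply; rewrite le_eqVlt; apply/orP; left; apply/eqP.
  rewrite sqrtrM ?ltW//.
  have -> : b - a = sqrt b * sqrt b - sqrt a * sqrt a by rewrite !sqrt_sqr// ltW.
  by field; rewrite !gt_eqF.
move=> s0 t0; have [st|ts] := leP s t.
  by rewrite distrC (distrC s t) [s * t]mulrC; exact: main.
by apply: main => //; exact: ltW.
Qed.

Lemma log_part_increment (m a b : R) : 0 < m -> m <= `|a| -> m <= `|b| ->
  `|L a - L b| <= `| `|a| - `|b| | / m.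
Proof.
have main (s t : R) : 0 < m -> m <= s -> s <= t -> `|ln t - ln s| <= `|t - s| / m.
  move=> m0 ms st; have s0 : 0 < s by exact: lt_le_trans ms.
  have t0 : 0 < t by exact: lt_le_trans st.
  rewrite !ger0_norm ?subr_ge0 ?ler_ln ?posrE// -ln_div ?posrE//.
  have -> : t / s = 1 + (t - s) / s by field; rewrite gt_eqF.
  apply: le_trans (le_ln1Dx _) _.
    by apply: (@lt_le_trans _ _ 0); [lra|rewrite divr_ge0 ?subr_ge0// ltW].
  by rewrite ler_wpM2l ?subr_ge0// lef_pV2 ?posrE.
move=> m0 ma mb; rewrite !log_partE opprK addrC.
have [ab|ba] := leP `|a| `|b|.
  by rewrite [X in _ <= X / _]distrC; exact: main.
by rewrite distrC; apply: main => //; exact: ltW.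
Qed.

(** The factor [|z|] is supplied by a Lipschitz bound on the integrand. It cancels the singularity
    at 0 and leaves an integrable one at [h], with only one power of [h] in front. *)
Lemma log_part_local (rho h z : R) : 0 < h -> z != 0 -> z != h -> `|z| <= rho ->
  `|L (z - h) - L z| * `|z| <= h * sqrt rho / sqrt `|z - h|.
Proof.
move=> h0 z0 zh zr; have zp : 0 < `|z| by rewrite normr_gt0.
have zhp : 0 < `|z - h| by rewrite normr_gt0 subr_eq0.
rewrite !log_partE opprK addrC distrC.
have := ln_diff_le_sqrt _ _ zhp zp; rewrite sqrtrM ?normr_ge0// => H.
have [sa sb] : 0 < sqrt `|z - h| /\ 0 < sqrt `|z| by rewrite !sqrtr_gt0.
have d : `| `|z - h| - `|z| | <= h.
  by apply: le_trans (ler_dist_dist _ _) _; rewrite addrAC subrr add0r normrN gtr0_norm.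
apply: (@le_trans _ _ (h / (sqrt `|z - h| * sqrt `|z|) * `|z|)).
  by rewrite ler_wpM2r// (le_trans H)// ler_wpM2r// invr_ge0 mulr_ge0 ?sqrtr_ge0.
have -> : h / (sqrt `|z - h| * sqrt `|z|) * `|z| = h * sqrt `|z| / sqrt `|z - h|.
  by rewrite -{2}(sqrt_sqr `|z| (normr_ge0 _)); field; rewrite !gt_eqF.
by rewrite ler_wpM2r ?invr_ge0 ?sqrtr_ge0// ler_wpM2l ?(ltW h0)// ler_wsqrtr.
Qed.

Lemma central_diff2_log (x y : R) : 0 < x -> 0 < y -> y != x ->
  central_diff2 L x y = ln (y ^+ 2 / ((y + x) * `|y - x|)).
Proof.
move=> x0 y0 yx; have p1 : 0 < y + x by rewrite addr_gt0.
have p2 : 0 < `|y - x| by rewrite normr_gt0 subr_eq0.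
rewrite /central_diff2 !log_partE (gtr0_norm p1) (gtr0_norm y0).
rewrite ln_div ?posrE ?exprn_gt0 ?mulr_gt0// lnM ?posrE// lnXn// -mulr_natl; ring.
Qed.

(** Here [y^2 / (y + x) <= 2 x], so the difference is at most [ln (2 x / |y - x|)]. The bound
    [ln t <= sqrt t] then puts it in the form shared with the other kernel. *)
Lemma central_diff2_log_near (x y : R) : 0 < x -> 0 < y -> y <= 2 * x -> y != x ->
  central_diff2 L x y <= sqrt (2 * x) / sqrt `|y - x|.
Proof.
move=> x0 y0 y2 yx; rewrite central_diff2_log//.
have p1 : 0 < y + x by rewrite addr_gt0.
have p2 : 0 < `|y - x| by rewrite normr_gt0 subr_eq0.
have x2 : 0 < 2 * x by rewrite mulr_gt0.
apply: (@le_trans _ _ (ln (2 * x / `|y - x|))).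
  rewrite ler_ln ?posrE ?divr_gt0 ?exprn_gt0 ?mulr_gt0//.
  rewrite invfM mulrA ler_wpM2r ?invr_ge0// ler_pdivrMr//; nra.
apply: le_trans (ln_le_sqrt _ (divr_gt0 x2 p2)) _.
by rewrite (sqrtrM _ (ltW x2)) sqrtrV.
Qed.

(** The increment is the logarithm of [(y^2 - x^2) / (y^2 - x'^2)]. Apply [ln (1 + s) <= s] to this
    quotient for the upper bound and to its inverse for the lower one. *)
Lemma central_diff2_log_far (x x' y : R) : 0 <= x -> x <= x' -> x' < y ->
  (x' ^+ 2 - x ^+ 2) / y ^+ 2 <= central_diff2 L x' y - central_diff2 L x y <=
  (x' ^+ 2 - x ^+ 2) / (y ^+ 2 - x' ^+ 2).
Proof.
move=> x0 xx' x'y.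
have y0 : 0 < y by lra.
have E (t : R) : 0 <= t -> t < y -> central_diff2 L t y = ln (y ^+ 2) - ln (y ^+ 2 - t ^+ 2).
  move=> t0 ty; have -> : y ^+ 2 - t ^+ 2 = (y + t) * (y - t) by ring.
  have [p1 p2] : 0 < y + t /\ 0 < y - t by lra.
  rewrite /central_diff2 !log_partE !gtr0_norm// lnXn// lnM ?posrE// -mulr_natl; ring.
rewrite !E//; last lra; last lra.
have q' : 0 < y ^+ 2 - x' ^+ 2 by rewrite subr_sqr mulr_gt0; lra.
have q : 0 < y ^+ 2 - x ^+ 2 by rewrite subr_sqr mulr_gt0; lra.
have D0 : 0 <= x' ^+ 2 - x ^+ 2 by rewrite subr_sqr mulr_ge0; lra.
have -> : ln (y ^+ 2) - ln (y ^+ 2 - x' ^+ 2) - (ln (y ^+ 2) - ln (y ^+ 2 - x ^+ 2)) =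
  ln (y ^+ 2 - x ^+ 2) - ln (y ^+ 2 - x' ^+ 2) by ring.
apply/andP; split.
  have -> : ln (y ^+ 2 - x ^+ 2) - ln (y ^+ 2 - x' ^+ 2) =
    - (ln ((y ^+ 2 - x' ^+ 2) / (y ^+ 2 - x ^+ 2))) by rewrite ln_div ?posrE// opprB.
  rewrite lerNr.
  have -> : (y ^+ 2 - x' ^+ 2) / (y ^+ 2 - x ^+ 2) =
      1 + - ((x' ^+ 2 - x ^+ 2) / (y ^+ 2 - x ^+ 2)) by field; rewrite gt_eqF.
  apply: le_trans (le_ln1Dx _) _.
    by rewrite ltrN2 ltr_pdivrMr//; lra.
  rewrite lerN2 ler_wpM2l// lef_pV2 ?posrE ?exprn_gt0// gerBl sqr_ge0//.
rewrite -ln_div ?posrE//.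
have -> : (y ^+ 2 - x ^+ 2) / (y ^+ 2 - x' ^+ 2) =
      1 + (x' ^+ 2 - x ^+ 2) / (y ^+ 2 - x' ^+ 2) by field; rewrite gt_eqF.
apply: le_ln1Dx; apply: (@lt_le_trans _ _ 0); first lra.
by rewrite divr_ge0// ltW.
Qed.

Lemma log_part_Itg (r : R) : 0 < r ->
  (@lebesgue_measure R).-integrable `](- r), r[ (EFin \o L).
Proof.
move=> r0; have [i1 _] := @invsqrt_dist_Itg R 0 (- r) r ltac:(lra).
have i2 : (@lebesgue_measure R).-integrable `](- r), r[ (EFin \o (fun=> sqrt r)).
  exact: Itg_cst.
apply: Itg_le (ItgD _ _ _ _ i1 i2) => //.
  by apply: measurable_funTS; exact: measurable_log_part.
move=> z; rewrite /= in_itv/= => /andP[zl zr]; rewrite subr0 log_partE normrN.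
have [->|z0] := eqVneq z 0; first by rewrite normr0 ln0// normr0 sqrtr0 invr0 add0r sqrtr_ge0.
have zp : 0 < `|z| by rewrite normr_gt0.
have sz : sqrt `|z| <= sqrt r by apply: ler_wsqrtr; rewrite ler_norml; lra.
rewrite ler_norml; apply/andP; split.
  rewrite lerNl -lnV ?posrE//; apply: le_trans (ln_le_sqrt _ _) _; first by rewrite invr_gt0.
  by rewrite sqrtrV// lerDl sqrtr_ge0.
by apply: le_trans (ln_le_sqrt _ zp) _; rewrite -[leLHS]add0r lerD// invr_ge0 sqrtr_ge0.
Qed.

End LogKernel.

(** * The inverse square root kernel *)

Section SqrtKernel.
Context {R : realType}.
Notation sqrt := (@Num.sqrt R).
Notation H := (@sqrt_part R).

Lemma sqrt_partE (z : R) : H z = (sqrt `|z|)^-1.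
Proof. by rewrite /sqrt_part div1r powRN powR12_sqrt. Qed.

Lemma measurable_sqrt_part : measurable_fun [set: R] H.
Proof.
rewrite (_ : H = (fun z => (sqrt `|z|)^-1)); last by apply/funext => z; exact: sqrt_partE.
apply: (measurableT_comp measurable_invr); exact: (measurableT_comp measurable_sqrt).
Qed.

Lemma sqrt_part_continuous (z : R) : z != 0 -> {for z, continuous H}.
Proof.
move=> z0; rewrite (_ : H = (fun z => (sqrt `|z|)^-1)); last by apply/funext => t; exact: sqrt_partE.
apply: cvgV; first by rewrite gt_eqF// sqrtr_gt0 normr_gt0.
by apply: continuous_comp; [exact: norm_continuous|exact: sqrt_continuous].
Qed.

Lemma invsqrt_diff (s t : R) : 0 < s -> 0 < t ->
  `|(sqrt s)^-1 - (sqrt t)^-1| = `|s - t| / (sqrt s * sqrt t * (sqrt s + sqrt t)).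
Proof.
move=> s0 t0; have [a0 b0] : 0 < sqrt s /\ 0 < sqrt t by rewrite !sqrtr_gt0.
have -> : (sqrt s)^-1 - (sqrt t)^-1 = (t - s) / (sqrt s * sqrt t * (sqrt s + sqrt t)).
  rewrite -{2}(sqrt_sqr s (ltW s0)) -{2}(sqrt_sqr t (ltW t0)); field.
  by rewrite !gt_eqF// addr_gt0.
rewrite normrM distrC normfV (gtr0_norm (_ : 0 < _ * _))// !mulr_gt0// addr_gt0//.
Qed.

Lemma sqrt_part_increment (m a b : R) : 0 < m -> m <= `|a| -> m <= `|b| ->
  `|H a - H b| <= `| `|a| - `|b| | / (m * sqrt m).
Proof.
move=> m0 ma mb; have a0 := lt_le_trans m0 ma; have b0 := lt_le_trans m0 mb.
rewrite !sqrt_partE invsqrt_diff// ler_wpM2l//.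
have sm : 0 < sqrt m by rewrite sqrtr_gt0.
have sa : sqrt m <= sqrt `|a| by rewrite ler_sqrt.
have sb : sqrt m <= sqrt `|b| by rewrite ler_sqrt.
have sa0 := lt_le_trans sm sa; have sb0 := lt_le_trans sm sb.
rewrite lef_pV2 ?posrE ?mulr_gt0 ?addr_gt0//.
rewrite -{1}(sqrt_sqr m (ltW m0)); apply: ler_pM; rewrite ?mulr_ge0 ?sqrtr_ge0//.
  by apply: ler_pM; rewrite ?sqrtr_ge0.
by apply: le_trans sa _; rewrite lerDl ltW.
Qed.

Lemma sqrt_part_local (h z : R) : 0 < h -> z != 0 -> z != h ->
  `|H (z - h) - H z| * `|z| <= h / sqrt `|z - h|.
Proof.
move=> h0 z0 zh; have zp : 0 < `|z| by rewrite normr_gt0.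
have zhp : 0 < `|z - h| by rewrite normr_gt0 subr_eq0.
rewrite !sqrt_partE invsqrt_diff//.
have [sa sb] : 0 < sqrt `|z - h| /\ 0 < sqrt `|z| by rewrite !sqrtr_gt0.
have d : `| `|z - h| - `|z| | <= h.
  by apply: le_trans (ler_dist_dist _ _) _; rewrite addrAC subrr add0r normrN gtr0_norm.
apply: (@le_trans _ _ (h / (sqrt `|z - h| * sqrt `|z| * (sqrt `|z|)) * `|z|)).
  rewrite ler_wpM2r//; apply: ler_pM => //.
  rewrite lef_pV2 ?posrE ?mulr_gt0 ?addr_gt0// ler_wpM2l ?mulr_ge0 ?sqrtr_ge0//.
  by rewrite lerDr sqrtr_ge0.
by rewrite -{3}(sqrt_sqr `|z| (normr_ge0 _)) le_eqVlt; apply/orP; left; apply/eqP;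
  field; rewrite !gt_eqF.
Qed.

(** The inequality of means bounds the right side below by [2 / w], where [w] is the fourth root of
    [c^2 - t^2]. With [s = sqrt c] the claim becomes a polynomial inequality in [s] and [w], in
    which the factor [s - w >= 0] splits off. *)
Lemma sqrt_second_difference (c t : R) : 0 <= t -> t < c ->
  2 / sqrt c + t ^+ 2 / (2 * (c ^+ 2 * sqrt c)) <= (sqrt (c + t))^-1 + (sqrt (c - t))^-1.
Proof.
move=> t0 tc; have c0 : 0 < c by lra.
have [p0 q0] : 0 < c + t /\ 0 < c - t by lra.
set p := sqrt (c + t); set q := sqrt (c - t); set s := sqrt c.
have [pp qp] : 0 < p /\ 0 < q by rewrite !sqrtr_gt0.
have sp : 0 < s by rewrite sqrtr_gt0.
have p2 : p * p = c + t by rewrite sqrt_sqr// ltW.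
have q2 : q * q = c - t by rewrite sqrt_sqr// ltW.
have s2 : s * s = c by rewrite sqrt_sqr// ltW.
have P0 : 0 < p * q by rewrite mulr_gt0.
pose w := sqrt (p * q); have wp : 0 < w by rewrite sqrtr_gt0.
have w2 : w * w = p * q by rewrite sqrt_sqr// ltW.
have ws : w <= s.
  apply: ler_wsqrtr; rewrite -(ler_pXn2r (n := 2)) ?nnegrE ?(ltW P0) ?(ltW c0)//.
  by rewrite exprMn !expr2 p2 q2; nra.
have pqw : 2 / w <= p^-1 + q^-1.
  have -> : p^-1 + q^-1 = (p + q) / (p * q) by field; rewrite !gt_eqF.
  rewrite -w2 ler_pdivlMr ?mulr_gt0// mulrA divfK ?gt_eqF//.
  rewrite -(ler_pXn2r (n := 2)) ?nnegrE ?mulr_ge0 ?addr_ge0 ?sqrtr_ge0//.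
  rewrite exprMn [w ^+ 2]expr2 w2.
  have -> : 2 ^+ 2 * (p * q) = (p + q) ^+ 2 - (p - q) ^+ 2 by ring.
  by rewrite gerBl sqr_ge0.
apply: le_trans pqw.
have -> : 2 / s + t ^+ 2 / (2 * (c ^+ 2 * s)) = (4 * c ^+ 2 + t ^+ 2) / (2 * c ^+ 2 * s).
  by field; rewrite !gt_eqF.
rewrite ler_pdivrMr ?mulr_gt0// ?exprn_gt0// mulrAC ler_pdivlMr//.
have c2 : c ^+ 2 = s ^+ 4 by rewrite -s2; ring.
have w4 : w ^+ 4 = c ^+ 2 - t ^+ 2.
  by rewrite (_ : w ^+ 4 = (w * w) * (w * w)); [rewrite w2; transitivity ((p * p) * (q * q)); [ring|rewrite p2 q2; ring]|ring].
have -> : t ^+ 2 = s ^+ 4 - w ^+ 4 by rewrite w4 -c2; ring.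
rewrite c2.
have : 0 <= (s - w) * (4 * s ^+ 4 - w * (s + w) * (s ^+ 2 + w ^+ 2)).
  rewrite mulr_ge0 ?subr_ge0//.
  have : w * (s + w) * (s ^+ 2 + w ^+ 2) <= s * (s + s) * (s ^+ 2 + s ^+ 2).
    have w0 := ltW wp; have s0 := ltW sp.
    have h2 : w ^+ 2 <= s ^+ 2 by rewrite ler_pXn2r// nnegrE.
    apply: ler_pM; rewrite ?mulr_ge0 ?addr_ge0 ?sqr_ge0//; last by rewrite lerD2l.
    by apply: ler_pM; rewrite ?addr_ge0// lerD2l.
  by have -> : s * (s + s) * (s ^+ 2 + s ^+ 2) = 4 * s ^+ 4 by ring.
have -> : (s - w) * (4 * s ^+ 4 - w * (s + w) * (s ^+ 2 + w ^+ 2)) =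
   2 * (2 * s ^+ 4 * s) - (4 * s ^+ 4 + (s ^+ 4 - w ^+ 4)) * w by ring.
by rewrite subr_ge0.
Qed.

Lemma central_diff2_sqrtE (x y : R) : 0 < y ->
  central_diff2 H x y = (sqrt `|y + x|)^-1 + (sqrt `|y - x|)^-1 - 2 / sqrt y.
Proof. by move=> y0; rewrite /central_diff2 !sqrt_partE (gtr0_norm y0). Qed.

(** For [y < x] the nodes become [x - y] and [x + y], symmetric about [x], and convexity compares
    them with twice the value at [x]. *)
Lemma central_diff2_sqrt_inner (x y : R) : 0 < y -> y < x ->
  2 / sqrt x - 2 / sqrt y <= central_diff2 H x y.
Proof.
move=> y0 yx; rewrite central_diff2_sqrtE// lerD2r (distrC y) (addrC y).
have := sqrt_second_difference x y (ltW y0) yx; rewrite !gtr0_norm ?subr_gt0 ?addr_gt0//; last lra.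
have x0 : 0 <= x by lra.
by apply: le_trans; rewrite lerDl divr_ge0 ?sqr_ge0// !mulr_ge0 ?sqr_ge0 ?sqrtr_ge0.
Qed.

Lemma central_diff2_sqrt_outer (x y : R) : 0 <= x -> x < y ->
  x ^+ 2 / (2 * (y ^+ 2 * sqrt y)) <= central_diff2 H x y.
Proof.
move=> x0 xy; have y0 : 0 < y by lra.
rewrite central_diff2_sqrtE// lerBrDl.
by have := sqrt_second_difference y x x0 xy; rewrite !gtr0_norm ?subr_gt0//; lra.
Qed.

Lemma central_diff2_sqrt_near (x y : R) : 0 < x -> 0 < y ->
  central_diff2 H x y <= (sqrt `|y - x|)^-1.
Proof.
move=> x0 y0; rewrite central_diff2_sqrtE// gtr0_norm; last by rewrite addr_gt0.
have sy : 0 < sqrt y by rewrite sqrtr_gt0.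
rewrite addrAC gerDr subr_le0; apply: (@le_trans _ _ (sqrt y)^-1); last first.
  by rewrite ler_peMl ?invr_ge0 ?ltW//; lra.
by rewrite lef_pV2 ?posrE ?sqrtr_gt0 ?addr_gt0//; apply: ler_wsqrtr; lra.
Qed.

(** With [P = sqrt (y^2 - x^2)] and [t] the sum of the two square roots, the sum of inverse roots is
    [t / P] and [t^2 = 2 y + 2 P]. Both decrease in [x] while the quotient increases, and the
    numerator can be frozen at [t] for the upper bound. *)
Lemma central_diff2_sqrt_far (x x' y : R) : 0 <= x -> x <= x' -> 4 * x' <= 3 * y -> 0 < y ->
  0 <= central_diff2 H x' y - central_diff2 H x y <=
    4 * (x' ^+ 2 - x ^+ 2) / (y ^+ 2 * sqrt y).
Proof.
move=> x0 xx' xy y0; rewrite !central_diff2_sqrtE// !gtr0_norm; try lra.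
have [p0 q0 p0' q0'] : [/\ 0 < y + x, 0 < y - x, 0 < y + x' & 0 < y - x'] by split; lra.
set p := sqrt (y + x); set q := sqrt (y - x).
set p' := sqrt (y + x'); set q' := sqrt (y - x'); set a := sqrt y.
have [pp qp pp' qp' ap] : [/\ 0 < p, 0 < q, 0 < p', 0 < q' & 0 < a].
  by split; rewrite sqrtr_gt0.
have p2 : p * p = y + x by rewrite sqrt_sqr// ltW.
have q2 : q * q = y - x by rewrite sqrt_sqr// ltW.
have p2' : p' * p' = y + x' by rewrite sqrt_sqr// ltW.
have q2' : q' * q' = y - x' by rewrite sqrt_sqr// ltW.
have a2 : a * a = y by rewrite sqrt_sqr// ltW.
pose P : R := p * q; pose P' : R := p' * q'; pose t : R := p + q; pose t' : R := p' + q'.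
have [Pp Pp' tp tp'] : [/\ 0 < P, 0 < P', 0 < t & 0 < t'] by rewrite /P /P' !mulr_gt0// !addr_gt0.
have PP : P ^+ 2 = y ^+ 2 - x ^+ 2.
  by transitivity ((p * p) * (q * q)); [rewrite /P; ring|rewrite p2 q2; ring].
have PP' : P' ^+ 2 = y ^+ 2 - x' ^+ 2.
  by transitivity ((p' * p') * (q' * q')); [rewrite /P'; ring|rewrite p2' q2'; ring].
have tt : t ^+ 2 = 2 * y + 2 * P.
  by transitivity (p * p + q * q + 2 * P); [rewrite /t /P; ring|rewrite p2 q2; ring].
have tt' : t' ^+ 2 = 2 * y + 2 * P'.
  by transitivity (p' * p' + q' * q' + 2 * P'); [rewrite /t' /P'; ring|rewrite p2' q2'; ring].
have D0 : x ^+ 2 <= x' ^+ 2 by rewrite ler_pXn2r ?nnegrE//; lra.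
have -> : p'^-1 + q'^-1 - 2 / a - (p^-1 + q^-1 - 2 / a) = t' / P' - t / P.
  by rewrite /t /t' /P /P'; field; rewrite !gt_eqF.
have P'P : P' <= P by rewrite -(ler_pXn2r (n := 2)) ?nnegrE ?(ltW Pp) ?(ltW Pp')// PP PP'; move: D0; clear; lra.
have t't : t' <= t.
  rewrite -(ler_pXn2r (n := 2)) ?nnegrE ?(ltW tp) ?(ltW tp')// tt tt'.
  by move: P'P; clear; lra.
clearbody P P' t t'; clear p2 q2 p2' q2' pp qp pp' qp' p0 q0 p0' q0'.
apply/andP; split.
  rewrite subr_ge0 ler_pdivrMr// mulrAC ler_pdivlMr//.
  rewrite -(ler_pXn2r (n := 2)) ?nnegrE ?mulr_ge0 ?(ltW tp) ?(ltW tp') ?(ltW Pp) ?(ltW Pp')//.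
  rewrite !exprMn tt tt' -subr_ge0.
  have -> : (2 * y + 2 * P') * P ^+ 2 - (2 * y + 2 * P) * P' ^+ 2 =
     (P - P') * (2 * y * (P + P') + 2 * P * P') by ring.
  by rewrite mulr_ge0 ?subr_ge0// addr_ge0// !mulr_ge0 ?addr_ge0// ltW.
(* From [4 x' <= 3 y] the square of [P'] is at least [7/16 y^2], above the square of [13/20 y]. The
   final constant is then [(20/13)^3 = 8000/2197 < 4]. *)
have P'y : 13 / 20 * y <= P'.
  rewrite -(ler_pXn2r (n := 2)) ?nnegrE ?mulr_ge0 ?(ltW Pp')//; last lra.
  have h : x' <= 3 / 4 * y by move: xy; clear; lra.
  have h0 : 0 <= x' by exact: le_trans xx'.
  have : x' ^+ 2 <= (3 / 4 * y) ^+ 2 by rewrite ler_pXn2r ?nnegrE// (le_trans h0 h).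
  have -> : (3 / 4 * y) ^+ 2 = 9 / 16 * y ^+ 2 by field.
  have -> : (13 / 20 * y) ^+ 2 = 169 / 400 * y ^+ 2 by field.
  by rewrite PP'; move: (sqr_ge0 y); clear; lra.
have ta : t <= 2 * a.
  rewrite -(ler_pXn2r (n := 2)) ?nnegrE ?mulr_ge0 ?(ltW ap) ?(ltW tp)//.
  have Py : P <= y by rewrite -(ler_pXn2r (n := 2)) ?nnegrE ?(ltW Pp) ?(ltW y0)// PP gerBl sqr_ge0.
  by rewrite tt exprMn [a ^+ 2]expr2 a2; move: Py; clear; lra.
apply: (@le_trans _ _ (t / P' - t / P)); first by rewrite lerD2r ler_wpM2r ?invr_ge0 ?(ltW Pp').
have -> : t / P' - t / P = t * (P ^+ 2 - P' ^+ 2) / (P' * P * (P + P')).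
  by field; rewrite !gt_eqF ?addr_gt0.
have -> : P ^+ 2 - P' ^+ 2 = x' ^+ 2 - x ^+ 2 by rewrite PP PP'; ring.
set D := x' ^+ 2 - x ^+ 2; have Dn : 0 <= D by rewrite subr_ge0.
have yn := ltW y0; have Py : 13 / 20 * y <= P by exact: le_trans P'P.
have l3 : 13 / 20 * y * (13 / 20 * y) * (13 / 20 * y + 13 / 20 * y) <= P' * P * (P + P').
  by apply: ler_pM; rewrite ?mulr_ge0 ?addr_ge0 ?mulr_ge0//; [apply: ler_pM; rewrite ?mulr_ge0|apply: lerD].
apply: (@le_trans _ _ (2 * a * D / (13 / 20 * y * (13 / 20 * y) * (13 / 20 * y + 13 / 20 * y)))).
  apply: ler_pM; rewrite ?(mulr_ge0 (ltW tp) Dn) ?invr_ge0 ?mulr_ge0 ?addr_ge0 ?(ltW Pp) ?(ltW Pp')//.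
    exact: ler_wpM2r.
  by rewrite lef_pV2 ?posrE ?mulr_gt0 ?addr_gt0 ?mulr_gt0.
have -> : 2 * a * D / (13 / 20 * y * (13 / 20 * y) * (13 / 20 * y + 13 / 20 * y)) = 8000 / 2197 * (D / (y ^+ 2 * a)).
  by rewrite -a2; field; rewrite !gt_eqF ?addr_gt0 ?mulr_gt0.
have -> : 4 * D / (y ^+ 2 * a) = 4 * (D / (y ^+ 2 * a)) by rewrite mulrA.
apply: ler_wpM2r; last by clear; lra.
by rewrite divr_ge0// mulr_ge0 ?sqr_ge0// ltW.
Qed.

Lemma sqrt_part_Itg (r : R) : 0 < r ->
  (@lebesgue_measure R).-integrable `](- r), r[ (EFin \o H).
Proof.
move=> r0; have [i1 _] := @invsqrt_dist_Itg R 0 (- r) r ltac:(lra).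
by apply: Itg_eq i1 => // z _; rewrite subr0 sqrt_partE.
Qed.

End SqrtKernel.

(** * The square root profile *)

Section SqrtProfile.
Context {R : realType}.
Notation mu := (@lebesgue_measure R).
Notation Itg D f := (mu.-integrable D (EFin \o f)).
Notation sqrt := (@Num.sqrt R).
Notation H := (@sqrt_part R).

Lemma dsqrtc {g : R -> R} {x b : R} : 0 < g x -> is_derive x 1 g b ->
  is_derive x 1 (fun t => sqrt (g t)) (b / (2 * sqrt (g x))).
Proof. by move=> gx gb; apply: (deq _ (@dcomp _ sqrt g _ _ _ (dsqrt gx) gb)); rewrite mulrC. Qed.

Lemma dlnc {g : R -> R} {x b : R} : is_derive x 1 g b -> 0 < g x ->
  is_derive x 1 (fun t => ln (g t)) (b / g x).
Proof. by move=> gb gx; refine (deq _ (@dcomp _ (@ln R) g _ _ _ (is_derive1_ln gx) gb) _); rewrite mulrC. Qed.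

Lemma datanc {g : R -> R} {x b : R} : is_derive x 1 g b ->
  is_derive x 1 (fun t => atan (g t)) (b / (1 + g x ^+ 2)).
Proof. by move=> gb; apply: (deq _ (@dcomp _ atan g _ _ _ (is_derive1_atan _) gb)); rewrite mulrC. Qed.

Lemma dsqrt_shift (x c : R) : 0 < x + c ->
  is_derive x 1 (fun y => sqrt (y + c)) (2 * sqrt (x + c))^-1.
Proof.
by move=> xc; apply: (deq _ (@dsqrtc (fun y => y + c) x _ xc (dD (did x) (dcst c x))));
  rewrite addr0 div1r.
Qed.

Lemma dsqrt_reflect (x c : R) : 0 < c - x ->
  is_derive x 1 (fun y => sqrt (c - y)) (- (2 * sqrt (c - x))^-1).
Proof.
by move=> xc; apply: (deq _ (@dsqrtc (fun y => c - y) x _ xc (dB (dcst c x) (did x))));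
  rewrite sub0r mulNr div1r.
Qed.

Lemma cid (x : R) : {for x, continuous (fun t : R => t)}.
Proof. exact: cvg_id. Qed.

Lemma ccst (c x : R) : {for x, continuous (fun _ : R => c)}.
Proof. exact: cvg_cst. Qed.

Lemma csqrt {f : R -> R} {x : R} : {for x, continuous f} ->
  {for x, continuous (fun y => sqrt (f y))}.
Proof. by move=> fc; apply: (@continuous_comp _ _ _ f sqrt) fc _; exact: sqrt_continuous. Qed.

Lemma cD {f g : R -> R} {x : R} : {for x, continuous f} -> {for x, continuous g} ->
  {for x, continuous (fun y => f y + g y)}.
Proof. exact: cvgD. Qed.

Lemma cB {f g : R -> R} {x : R} : {for x, continuous f} -> {for x, continuous g} ->
  {for x, continuous (fun y => f y - g y)}.
Proof. exact: cvgB. Qed.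

Lemma cM {f g : R -> R} {x : R} : {for x, continuous f} -> {for x, continuous g} ->
  {for x, continuous (fun y => f y * g y)}.
Proof. exact: cvgM. Qed.

Lemma cV {f : R -> R} {x : R} : f x != 0 -> {for x, continuous f} ->
  {for x, continuous (fun y => (f y)^-1)}.
Proof. exact: cvgV. Qed.

Lemma cln {f : R -> R} {x : R} : 0 < f x -> {for x, continuous f} ->
  {for x, continuous (fun y => ln (f y))}.
Proof. by move=> fx fc; apply: (@continuous_comp _ _ _ f (@ln R)) fc _; exact: continuous_ln. Qed.

Lemma catan {f : R -> R} {x : R} : {for x, continuous f} ->
  {for x, continuous (fun y => atan (f y))}.
Proof. by move=> fc; apply: (@continuous_comp _ _ _ f (@atan R)) fc _; exact: continuous_atan. Qed.

(** First of three pieces of the profile integral. Its [sqrt 2] and logarithm cancel against those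
    of the piece over []x, +oo[], so that only the arctangent of the middle piece survives, as
    [pi / 2]. *)
Lemma sqrt_profile_left (x : R) : 0 < x ->
  Itg `]0, x[ (fun y => sqrt y / sqrt (y + x)) /\
  \int[mu]_(y in `]0, x[) (sqrt y / sqrt (y + x)) = x * (sqrt 2 - ln (1 + sqrt 2)).
Proof.
move=> x0; pose F y := sqrt y * sqrt (y + x) - x * ln (sqrt y + sqrt (y + x)).
have Fc (y : R) : 0 <= y -> {for y, continuous F}.
  move=> y0; have c2 := csqrt (cD (cid y) (ccst x y)).
  apply: cB (cM (csqrt (cid y)) c2) (cM (ccst x y) (cln _ (cD (csqrt (cid y)) c2))).
  by rewrite ltr_wpDl ?sqrtr_ge0// sqrtr_gt0; lra.
have [] := @FTC_oo R 0 x (F 0) (F x) (fun y => sqrt y / sqrt (y + x)) F x0.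
- by move=> y _; rewrite divr_ge0 ?sqrtr_ge0.
- move=> y /andP[y0 _]; apply: cM (csqrt (cid y)) (cV _ (csqrt (cD (cid y) (ccst x y)))).
  by rewrite gt_eqF// sqrtr_gt0; lra.
- rewrite /F => y /andP[y0 _]; have yx : 0 < y + x by lra.
  have [a0 b0] : 0 < sqrt y /\ 0 < sqrt (y + x) by rewrite !sqrtr_gt0.
  have ab : 0 < sqrt y + sqrt (y + x) by rewrite addr_gt0.
  apply: (deq _ (dB (dM (dsqrt y0) (dsqrt_shift _ _ yx))
    (dZ x (dlnc (dD (dsqrt y0) (dsqrt_shift _ _ yx)) ab)))).
  have xE : x = sqrt (y + x) * sqrt (y + x) - sqrt y * sqrt y by rewrite !sqrt_sqr ?ltW//; ring.
  rewrite {3}xE; field; rewrite !gt_eqF//.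
- by apply: cvg_at_right_filter; exact: Fc.
- by apply: cvg_at_left_filter; apply: Fc; exact: ltW.
move=> ? ->; split=> //; rewrite /F add0r sqrtr0 mul0r add0r.
have -> : x + x = 2 * x by ring.
have sx : 0 < sqrt x by rewrite sqrtr_gt0.
have s2 : 0 < 1 + sqrt 2 by rewrite ltr_pwDl ?sqrtr_ge0.
rewrite sqrtrM// (_ : sqrt x + sqrt 2 * sqrt x = sqrt x * (1 + sqrt 2)); last by ring.
rewrite lnM ?posrE// add0r.
have -> : sqrt x * (sqrt 2 * sqrt x) = sqrt 2 * x by rewrite mulrCA sqrt_sqr// ltW.
ring.
Qed.

Lemma sqrt_profile_middle (x : R) : 0 < x ->
  Itg `]0, x[ (fun y => sqrt y / sqrt (x - y)) /\
  \int[mu]_(y in `]0, x[) (sqrt y / sqrt (x - y)) = x * (pi / 2).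
Proof.
move=> x0; have sx : 0 < sqrt x by rewrite sqrtr_gt0.
(* 2 atan (a / (X + b)) is the arcsine of a / X when a^2 + b^2 = X^2, but
   unlike arcsine it is differentiable in a form continuous up to a = X. *)
pose F y := x * (2 * atan (sqrt y / (sqrt x + sqrt (x - y)))) - sqrt y * sqrt (x - y).
have dn y : 0 < sqrt x + sqrt (x - y) by rewrite ltr_wpDr ?sqrtr_ge0.
have Fc (y : R) : {for y, continuous F}.
  have c2 := csqrt (cB (ccst x y) (cid y)).
  apply: cB (cM (ccst x y) (cM (ccst 2 y) (catan (cM (csqrt (cid y)) (cV _ (cD (ccst (sqrt x) y) c2))))))
    (cM (csqrt (cid y)) c2).
  by rewrite gt_eqF.
have [] := @FTC_oo R 0 x (F 0) (F x) (fun y => sqrt y / sqrt (x - y)) F x0.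
- by move=> y _; rewrite divr_ge0 ?sqrtr_ge0.
- move=> y /andP[y0 yx]; apply: cM (csqrt (cid y)) (cV _ (csqrt (cB (ccst x y) (cid y)))).
  by rewrite gt_eqF// sqrtr_gt0; lra.
- rewrite /F => y /andP[y0 yx']; have yx : 0 < x - y by lra.
  have [a0 b0] : 0 < sqrt y /\ 0 < sqrt (x - y) by rewrite !sqrtr_gt0.
  have dnz : sqrt x + sqrt (x - y) != 0 by rewrite gt_eqF.
  apply: (deq _ (dB (dZ x (dZ 2 (datanc (dM (dsqrt y0)
     (@dV _ (fun y => sqrt x + sqrt (x - y)) _ _ dnz (dD (dcst (sqrt x) y) (dsqrt_reflect _ _ yx)))))))
     (dM (dsqrt y0) (dsqrt_reflect _ _ yx)))).
  have := sqrt_sqr x (ltW x0); have := sqrt_sqr y (ltW y0); have := sqrt_sqr (x - y) (ltW yx).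
  move: sx a0 b0; set X := sqrt x; set a := sqrt y; set b := sqrt (x - y) => X0 a0 b0 b2 a2 X2.
  have E : a * a = X * X - b * b by rewrite a2 X2 b2; ring.
  have p1 : 0 < (X + b) ^+ 2 by rewrite exprn_gt0// addr_gt0.
  have p2 : 1 + (a / (X + b)) ^+ 2 = 2 * X / (X + b).
    rewrite expr_div_n expr2 [a * a]E; field; rewrite gt_eqF// addr_gt0//.
  have Xb : 0 < X + b by rewrite addr_gt0.
  rewrite p2 -X2; transitivity ((b * (X + b) + a * a) / (2 * a * b) * X / (X + b) - (b * b - a * a) / (2 * a * b)).
    by field; rewrite !gt_eqF//.
  by rewrite [a * a]E; rewrite -[RHS](_ : a * a / (a * b) = _); [rewrite [a * a]E|]; field; rewrite !gt_eqF.
- by apply: cvg_at_right_filter; exact: Fc.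
- by apply: cvg_at_left_filter; exact: Fc.
move=> ? ->; split=> //; rewrite /F !subrr sqrtr0 mulr0 !mul0r atan0 addr0 divff ?gt_eqF// atan1 subr0 subr0.
by field.
Qed.

Lemma sqrt_profile_right (x : R) : 0 < x ->
  Itg `]x, +oo[ (fun y => central_diff2 H x y * sqrt y) /\
  \int[mu]_(y in `]x, +oo[) (central_diff2 H x y * sqrt y) =
    - (x * (sqrt 2 - 2 - ln (1 + sqrt 2))).
Proof.
move=> x0; have sx : 0 < sqrt x by rewrite sqrtr_gt0.
pose F y := sqrt y * sqrt (y + x) + sqrt y * sqrt (y - x) - 2 * y
  - x * ln (sqrt y + sqrt (y + x)) + x * ln (sqrt y + sqrt (y - x)).
pose f y := sqrt y / sqrt (y + x) + sqrt y / sqrt (y - x) - 2.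
have fE y : x < y -> f y = central_diff2 H x y * sqrt y.
  move=> xy; have y0 : 0 < sqrt y by rewrite sqrtr_gt0; lra.
  rewrite central_diff2_sqrtE ?(lt_trans x0 xy)// !gtr0_norm ?subr_gt0//; last lra.
  by rewrite /f mulrBl divfK ?gt_eqF// mulrDl ![sqrt y / _]mulrC.
have c1 (y : R) := csqrt (cid y).
have c2 (y : R) := csqrt (cD (cid y) (ccst x y)).
have c3 (y : R) := csqrt (cB (cid y) (ccst x y)).
have Fc (y : R) : 0 < y -> {for y, continuous F}.
  move=> y0; apply: cD (cB (cB (cD (cM (c1 y) (c2 y)) (cM (c1 y) (c3 y))) (cM (ccst 2 y) (cid y)))
    (cM (ccst x y) (cln _ (cD (c1 y) (c2 y))))) (cM (ccst x y) (cln _ (cD (c1 y) (c3 y))));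
  by rewrite ltr_wpDr ?sqrtr_ge0// sqrtr_gt0.
have Fy : F y @[y --> +oo] --> (0 : R).
  (* Single terms of [F] are unbounded at infinity. The three algebraic ones combine to a multiple
     of [p - q], and the logarithms differ by at most [(p - q) / (a + q)], where [p - q <= 2 x / a].
     Everything is thus of order [x^2 / y]. *)
  have bnd y : x < y -> `|F y| <= 4 * x ^+ 2 / y.
    move=> xy; have [y0 p0 q0] : [/\ 0 < y, 0 < y + x & 0 < y - x] by split; lra.
    rewrite /F; have := sqrt_sqr y (ltW y0).
    have := sqrt_sqr (y + x) (ltW p0); have := sqrt_sqr (y - x) (ltW q0).
    have ap : sqrt y <= sqrt (y + x) by apply: ler_wsqrtr; lra.
    have qa : sqrt (y - x) <= sqrt y by apply: ler_wsqrtr; lra.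
    have : 0 < sqrt (y - x) by rewrite sqrtr_gt0.
    have : 0 < sqrt y by rewrite sqrtr_gt0.
    move: ap qa; set a := sqrt y; set p := sqrt (y + x); set q := sqrt (y - x).
    clearbody a p q => ap qa a0 qp q2 p2 a2; have pp : 0 < p by exact: lt_le_trans ap.
    have [ap0 aq0 pq0] : [/\ 0 < a + p, 0 < a + q & 0 < p + q] by rewrite !addr_gt0.
    have pq : p - q = 2 * x / (p + q).
      by rewrite (_ : 2 * x = p * p - q * q); [field; rewrite gt_eqF|rewrite p2 q2; ring].
    have pql : 0 <= p - q <= 2 * x / a.
      rewrite subr_ge0 (le_trans qa ap)/= pq ler_wpM2l//; first by rewrite mulr_ge0// ltW.
      by rewrite lef_pV2 ?posrE//; apply: le_trans ap _; rewrite lerDl ltW.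
    have E1 : a * p + a * q - 2 * y = - (x * a * (p - q) / ((a + p) * (a + q))).
      have -> : a * p + a * q - 2 * y = a * (p * p - a * a) / (a + p) + a * (q * q - a * a) / (a + q).
        by rewrite -a2; field; rewrite !gt_eqF.
      by rewrite p2 q2 a2; field; rewrite !gt_eqF.
    have l1 : 0 <= ln (a + p) - ln (a + q) <= (p - q) / (a + q).
      rewrite subr_ge0 ler_ln ?posrE// lerD2l (le_trans qa ap)/= -ln_div ?posrE//.
      have -> : (a + p) / (a + q) = 1 + (p - q) / (a + q) by field; rewrite gt_eqF.
      apply: le_ln1Dx; apply: (@lt_le_trans _ _ 0); first lra.
      by rewrite divr_ge0 ?(ltW aq0)//; case/andP: pql.
    have i1 : (p - q) / (a + q) <= 2 * x / y.
      rewrite -a2 invfM mulrA; apply: ler_pM; rewrite ?invr_ge0 ?(ltW aq0)//; [by case/andP: pql..|].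
      by rewrite lef_pV2 ?posrE// lerDl ltW.
    have i2 : 0 <= a * (p - q) / ((a + p) * (a + q)) <= (p - q) / (a + q).
      have pq1 : 0 <= p - q by case/andP: pql.
      rewrite divr_ge0 ?mulr_ge0 ?(ltW a0) ?(ltW ap0) ?(ltW aq0)//=.
      have -> : a * (p - q) / ((a + p) * (a + q)) = (p - q) / (a + q) * (a / (a + p)).
        by field; rewrite !gt_eqF.
      by rewrite ler_piMr ?divr_ge0 ?(ltW aq0)// ler_pdivrMr// mul1r lerDl ltW.
    have xn := ltW x0.
    rewrite (_ : _ + _ = - (x * (a * (p - q) / ((a + p) * (a + q)))) - x * (ln (a + p) - ln (a + q))); last first.
      by rewrite E1; field; rewrite !gt_eqF.
    have := ler_wpM2l xn (andP i2).1; have := ler_wpM2l xn (andP i2).2.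
    have := ler_wpM2l xn (andP l1).1; have := ler_wpM2l xn (andP l1).2.
    have := ler_wpM2l xn i1.
    have -> : 4 * x ^+ 2 / y = x * (2 * x / y) + x * (2 * x / y) by field; rewrite gt_eqF.
    by rewrite ler_norml; clear; lra.
  apply/cvgrPdist_le => e e0; near=> y.
  rewrite sub0r normrN; apply: le_trans (bnd y _) _; first by near: y; apply: nbhs_pinfty_gt; rewrite num_real.
  have y0 : 0 < y by near: y; apply: nbhs_pinfty_gt; rewrite num_real.
  rewrite ler_pdivrMr// [e * y]mulrC -ler_pdivrMr//; near: y; apply: nbhs_pinfty_ge; rewrite num_real.
have [] := @FTC_oy R x (F x) 0 f F.
- move=> y xy; rewrite fE// mulr_ge0 ?sqrtr_ge0//.
  apply: le_trans (central_diff2_sqrt_outer x y (ltW x0) xy).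
  have yn : 0 <= y by lra.
  by rewrite divr_ge0 ?sqr_ge0// !mulr_ge0 ?sqr_ge0 ?sqrtr_ge0.
- move=> y xy; apply: cB (cD (cM (c1 y) (cV _ (c2 y))) (cM (c1 y) (cV _ (c3 y)))) (ccst 2 y);
  by rewrite gt_eqF// sqrtr_gt0; lra.
- rewrite /F /f => y xy; have [y0 p0 q0] : [/\ 0 < y, 0 < y + x & 0 < y - x] by split; lra.
  have [a0 pp qp] : [/\ 0 < sqrt y, 0 < sqrt (y + x) & 0 < sqrt (y - x)] by rewrite !sqrtr_gt0.
  have ab : 0 < sqrt y + sqrt (y + x) by rewrite addr_gt0.
  have ab' : 0 < sqrt y + sqrt (y - x) by rewrite addr_gt0.
  have d1 := dsqrt y0; have d2 := dsqrt_shift y x p0.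
  have d3 : is_derive y 1 (fun y => sqrt (y - x)) (2 * sqrt (y - x))^-1.
    exact: dsqrt_shift y (- x) q0.
  apply: (deq _ (dD (dB (dB (dD (dM d1 d2) (dM d1 d3)) (dZ 2 (did y))) (dZ x (dlnc (dD d1 d2) ab)))
     (dZ x (dlnc (dD d1 d3) ab')))).
  have := sqrt_sqr y (ltW y0); have := sqrt_sqr (y + x) (ltW p0); have := sqrt_sqr (y - x) (ltW q0).
  move: a0 pp qp ab ab'; set a := sqrt y; set p := sqrt (y + x); set q := sqrt (y - x).
  move=> a0 pp qp ab ab' q2 p2 a2.
  have E1 : (2 * a)^-1 * p + a * (2 * p)^-1 - x * (((2 * a)^-1 + (2 * p)^-1) / (a + p)) = a / p.
    have -> : x = p * p - a * a by rewrite p2 a2; ring.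
    by field; rewrite !gt_eqF.
  have E2 : (2 * a)^-1 * q + a * (2 * q)^-1 + x * (((2 * a)^-1 + (2 * q)^-1) / (a + q)) = a / q.
    have -> : x = a * a - q * q by rewrite q2 a2; ring.
    by field; rewrite !gt_eqF.
  by rewrite -E1 -E2; ring.
- by apply: cvg_at_right_filter; exact: Fc.
- exact: Fy.
move=> fi fI; split.
  by apply: Itg_eq fi => // y; rewrite /= in_itv/= andbT; exact: fE.
rewrite -(eq_Rint _ f); last by move=> y; rewrite /= in_itv/= andbT; exact: fE.
rewrite fI /F sub0r subrr sqrtr0 mulr0 addr0.
have -> : x + x = 2 * x by ring.
have s2 : 0 < 1 + sqrt 2 by rewrite ltr_pwDl ?sqrtr_ge0.
rewrite sqrtrM// (_ : sqrt x + sqrt 2 * sqrt x = sqrt x * (1 + sqrt 2)); last by ring.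
rewrite lnM ?posrE// addr0.
have -> : sqrt x * (sqrt 2 * sqrt x) = sqrt 2 * x by rewrite mulrCA sqrt_sqr// ltW.
ring.
Unshelve. all: by end_near. Qed.

Lemma sqrt_profile (x : R) : 0 < x ->
  Itg `]0, +oo[ (fun y => central_diff2 H x y * sqrt y) /\
  \int[mu]_(y in `]0, +oo[) (central_diff2 H x y * sqrt y) = pi / 2 * x.
Proof.
move=> x0; have [i1 v1] := sqrt_profile_left x x0.
have [i2 v2] := sqrt_profile_middle x x0; have [i3 v3] := sqrt_profile_right x x0.
have ic : Itg `]0, x[ (fun=> (2 : R)) by exact: Itg_cst.
have E y : y \in `]0, x[ ->
    sqrt y / sqrt (y + x) + sqrt y / sqrt (x - y) - 2 = central_diff2 H x y * sqrt y.
  rewrite in_itv/= => /andP[y0 yx]; have sy : 0 < sqrt y by rewrite sqrtr_gt0.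
  rewrite central_diff2_sqrtE// (distrC y) !gtr0_norm ?subr_gt0//; last lra.
  by rewrite mulrBl divfK ?gt_eqF// mulrDl ![sqrt y / _]mulrC.
have i12 := ItgD _ _ _ (measurable_itv _) i1 i2.
have i123 := ItgB _ _ _ (measurable_itv _) i12 ic.
have i0 : Itg `]0, x[ (fun y => central_diff2 H x y * sqrt y).
  by apply: Itg_eq i123 => // y; exact: E.
have ia : Itg `]0, +oo[ (fun y => central_diff2 H x y * sqrt y).
  apply: Itg_split i0 i3; apply: measurable_funTS; apply: measurable_funM.
    apply: measurable_funB.
      by apply: measurable_funD; apply: measurableT_comp measurable_sqrt_part _;
        [exact: measurable_funD|exact: measurable_funB].
    by apply: measurable_funM => //; exact: measurable_sqrt_part.
  exact: measurable_sqrt.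
split=> //; rewrite (Rint_split_oy 0 x) ?ltW// v3.
rewrite -(eq_Rint _ (fun y => sqrt y / sqrt (y + x) + sqrt y / sqrt (x - y) - 2)); last exact: E.
by rewrite RintegralB// RintegralD// v1 v2 Rint_cst ?ltW//; ring.
Qed.

Lemma sin_le_id (t : R) : 0 <= t -> sin t <= t.
Proof.
rewrite le_eqVlt => /predU1P[<-|t0]; first by rewrite sin0.
have [c _ E] := @MVT_pt R (fun t => t - sin t) (fun t => 1 - cos t) 0 t t0
  (fun c _ => dB (did c) (is_derive_sin c)).
rewrite -subr_ge0; move: E; rewrite sin0 !subr0 => ->.
by rewrite mulr_ge0 ?(ltW t0)// subr_ge0 cos_le1.
Qed.

(** From [sin (1/3) <= 1/3], two duplications give [cos (2/3) >= 7/9] and [cos (4/3) > 0]. If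
    [pi <= 8/3], then [4/3 - pi/2] would lie in the range where the sine is nonnegative, although
    its sine is [- cos (4/3)]. *)
Lemma pi_gt_8_3 : 8 / 3 < pi :> R.
Proof.
have c43 : 0 < cos (4 / 3 : R).
  have s3 : 0 <= sin (1 / 3 : R) <= 1 / 3.
    rewrite sin_le_id// sin_ge0_pi//; have := @pi_ge2 R; lra.
  have c23 : 7 / 9 <= cos (2 / 3 : R).
    rewrite (_ : 2 / 3 = (1 / 3) *+ 2); last by rewrite mulr2n; field.
    have := cos2Dsin2 (1 / 3 : R); rewrite cos_mulr2n mulr2n.
    have : sin (1 / 3 : R) ^+ 2 <= (1 / 3) ^+ 2.
      by case/andP: s3 => s0 s1; rewrite ler_pXn2r ?nnegrE.
    have -> : (1 / 3) ^+ 2 = 1 / 9 :> R by field.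
    by clear; lra.
  rewrite (_ : 4 / 3 = (2 / 3) *+ 2); last by rewrite mulr2n; field.
  rewrite cos_mulr2n mulr2n.
  have : (7 / 9) ^+ 2 <= cos (2 / 3 : R) ^+ 2.
    by rewrite ler_pXn2r ?nnegrE//; lra.
  have -> : (7 / 9) ^+ 2 = 49 / 81 :> R by field.
  by clear; lra.
rewrite ltNge; apply/negP => pi83.
have : 0 <= sin (4 / 3 - pi / 2 : R).
  by apply: sin_ge0_pi; have := @pi_ge2 R; lra.
by rewrite sinBpihalf oppr_ge0 leNgt c43.
Qed.

End SqrtProfile.

(* [lra] is slow in large contexts and rejects goals whose section variables
   have been cleared: only what depends on reals local to the proof may go. *)
Ltac is_parameter v := fail.

Ltac is_local_real v := lazymatch type of v with
  | forall _, _ => fail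
  | realType => fail
  | ?T => lazymatch type of T with Prop => fail | _ => tryif is_parameter v then fail else idtac end
  end.

Ltac clear_irrelevant :=
  repeat match goal with v : _ |- _ => is_local_real v; clear dependent v end.

Ltac clear_quantified :=
  repeat match goal with v : _ |- _ => is_local_real v;
    match goal with H : forall _, _ |- _ =>
      let P := type of H in lazymatch P with context [v] => clear H end end end.

Ltac linarith := first [clear_irrelevant; lra | clear_quantified; lra | lra].

(** * Elementary limits and inequalities *)

Lemma le0_of_small (R : realFieldType) (a L e0 : R) : 0 < e0 ->
  (forall eps, 0 < eps -> eps <= e0 -> a <= L * eps) -> a <= 0.
Proof.
move=> e00 H; rewrite leNgt; apply/negP => a0.
have L0 : 0 < `|L| + 1 by have := normr_ge0 L; linarith.
have q0 : 0 < a / (2 * (`|L| + 1)) by rewrite divr_gt0// mulr_gt0.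
pose p := Num.min e0 (a / (2 * (`|L| + 1))).
have p0 : 0 < p by rewrite lt_min e00.
have pe : p <= e0 by rewrite ge_min lexx.
have : p <= a / (2 * (`|L| + 1)) by rewrite ge_min lexx orbT.
rewrite ler_pdivlMr ?mulr_gt0// => h; have := H p p0 pe.
by have := ler_wpM2r (ltW p0) (ler_norm L); linarith.
Qed.

(* The two inequalities are the ones satisfied by the lower and upper limits
   [m], [M] of [u x / sqrt x]; with [r = m / M] they combine to
   [(c - 4/3) * (1 - r) <= 0]. *)
Lemma sqrt_fixed_point (R : realFieldType) (c m M : R) : 4 / 3 < c -> 0 < m -> m <= M ->
  M ^+ 2 <= M * c + 2 / 3 * (M - m) ->
  (let r := m / M in m * c - (M - m) * (2 * r ^+ 2 - 4 / 3 * r ^+ 3) - 2 * m * (1 - r) ^+ 2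
     + m * (2 * (1 - r ^+ 2) - 4 / 3 * (1 - r ^+ 3)) <= m ^+ 2) ->
  m = c /\ M = c.
Proof.
move=> c43 m0 mM I1 /=; have M0 : 0 < M by exact: lt_le_trans mM.
pose r := m / M; rewrite -/r => I2.
have mE : m = r * M by rewrite /r divfK// gt_eqF.
have r0 : 0 < r by rewrite divr_gt0.
have r1 : r <= 1 by rewrite ler_pdivrMr// mul1r.
(* Division by [m], with [M / m = 1 / r], makes the cubic terms of the second inequality cancel. The
   quadratic ones cancel against [r] times the bound [A2]. *)
have A1 : c - 4 / 3 + 2 * r - 2 / 3 * r ^+ 2 <= r * M.
  rewrite -(ler_pM2l m0); apply: le_trans (_ : m ^+ 2 <= _); last by rewrite -mE.
  by apply: le_trans I2; rewrite mE; linarith.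
have A2 : M <= c + 2 / 3 * (1 - r).
  by rewrite -(ler_pM2l M0); move: I1; rewrite mE; linarith.
have A3 := ler_wpM2l (ltW r0) A2.
have A4 : (c - 4 / 3) * (1 - r) <= 0 by linarith.
have rE : r = 1.
  by apply/eqP; rewrite eq_le r1 -subr_le0 -(pmulr_rle0 _ (_ : 0 < c - 4 / 3)) ?subr_gt0.
move: mE A1 A2; rewrite rE => -> ? ?.
by have -> : M = c by [apply/eqP; rewrite eq_le; apply/andP; split; linarith]; rewrite mul1r.
Qed.

(** The upper limit is the infimum of the eventual upper bounds. Its two characteristic properties
    are stated with explicit slack, ready for arguments that evaluate an inequality at nearly
    extremal points. *)
Lemma sup_near0 (R : realType) (g : R -> R) (a b d0 : R) : 0 < d0 ->
  (forall x, 0 < x -> x < d0 -> a <= g x <= b) ->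
  exists2 M : R, a <= M <= b & forall eps : R, 0 < eps ->
    (exists2 d : R, 0 < d & forall x, 0 < x -> x < d -> g x <= M + eps) /\
    (forall d : R, 0 < d -> exists2 x : R, 0 < x < d & M - eps <= g x).
Proof.
move=> d00 Hg.
pose Q := [set P : R | exists2 d : R, 0 < d & forall x, 0 < x -> x < d -> g x <= P].
have Qb : Q b by exists d0 => // x x0 xd; case/andP: (Hg x x0 xd).
have Ql : lbound Q a.
  move=> P [d dp HP]; pose x := Num.min d d0 / 2.
  have m0 : 0 < Num.min d d0 by rewrite lt_min dp.
  have x0 : 0 < x by rewrite divr_gt0.
  have xm : x < Num.min d d0 by rewrite /x; linarith.
  move: xm; rewrite lt_min => /andP[xd xd0].
  by have /andP[h _] := Hg x x0 xd0; apply: le_trans h (HP x x0 xd).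
have hQ : has_inf Q by split; [exists b|exists a].
exists (inf Q).
  by rewrite (lb_le_inf (ex_intro _ b Qb) Ql) (ge_inf (ex_intro _ a Ql) Qb).
move=> eps ep; split.
  have [P [d dp HP] Pe] := inf_adherent ep hQ.
  by exists d => // x x0 xd; apply: le_trans (HP x x0 xd) (ltW Pe).
move=> d dp; apply: contrapT => H.
have : Q (inf Q - eps).
  exists d => // x x0 xd; rewrite leNgt; apply/negP => h; apply: H; exists x; rewrite ?x0//; exact: ltW.
by move=> /(ge_inf (ex_intro _ a Ql)); linarith.
Qed.


Lemma four_sqrt2_le (R : realType) : 4 * Num.sqrt 2 <= 6 :> R.
Proof.
have : Num.sqrt 2 <= 3 / 2 :> R.
  by rewrite -[leRHS]ger0_norm// -sqrtr_sqr ler_wsqrtr// expr2; linarith.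
linarith.
Qed.

(** As the derivative exists, its right difference quotients determine it. The error [h * E1] per
    unit of [h] disappears in the limit, so it may carry large constants. *)
Lemma is_derive_right_le (R : realType) (A : R -> R) (x dA G E0 E1 delta : R) :
  0 < delta -> is_derive x 1 A dA -> 0 <= E1 ->
  (forall h, 0 < h -> h < delta -> `|A (x + h) - A x - h * G| <= h * (E0 + h * E1)) ->
  `|dA - G| <= E0.
Proof.
move=> d0 [dx dE] E10 H; rewrite leNgt; apply/negP => lt0.
pose eta := `|dA - G| - E0; have eta0 : 0 < eta by rewrite subr_gt0.
have : (fun h => h^-1 *: ((A \o shift x) (h *: 1) - A x)) @ (0 : R)^' --> dA.
  by rewrite -dE; exact: dx.
move=> /cvgrPdist_lt /(_ (eta / 2)); rewrite divr_gt0// => /(_ isT).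
rewrite near_withinE => Hn.
have {}Hn : \forall h \near (0 : R)^'+, `|dA - h^-1 * (A (x + h) - A x)| < eta / 2.
  rewrite near_withinE; move: Hn; apply: filterS => h Hh h0.
  have := Hh (lt0r_neq0 h0); rewrite /GRing.scale/= mulr1.
  by rewrite [h + x]addrC.
near (0 : R)^'+ => h.
have h0 : 0 < h by near: h; exact: nbhs_right_gt.
have hd : h < delta by near: h; exact: nbhs_right_lt.
have hE : h * E1 < eta / 2.
  have E1p : 0 < E1 + 1 by linarith.
  apply: le_lt_trans (_ : h * (E1 + 1) < _); first by rewrite ler_wpM2l ?(ltW h0)// lerDl.
  rewrite -ltr_pdivlMr//; near: h; apply: nbhs_right_lt.
  by apply: divr_gt0; [exact: divr_gt0|rewrite ltr_wpDl].
have H2 : `|dA - h^-1 * (A (x + h) - A x)| < eta / 2 by near: h.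
have H1 := H h h0 hd.
have H3 : `|h^-1 * (A (x + h) - A x) - G| <= E0 + h * E1.
  rewrite -(ler_pM2l h0) -{1}(gtr0_norm h0) -normrM mulrBr mulrA divff ?gt_eqF// mul1r.
  exact: H1.
have := ler_distD (h^-1 * (A (x + h) - A x)) dA G.
rewrite /eta in hE H2; linarith.
Unshelve. all: by end_near. Qed.

Lemma derivative_bound_lipschitz (R : realType) (f df : R -> R) (a rho V : R) :
  (forall z, `|z - a| < rho -> is_derive z 1 f (df z)) ->
  (forall z, `|z - a| < rho -> `|df z| <= V) ->
  forall y : R, `|y - a| < rho -> `|f y - f a| <= V * `|y - a|.
Proof.
move=> fd fV y ya.
have main (b c : R) : b < c -> `|b - a| < rho -> `|c - a| < rho -> `|f c - f b| <= V * `|c - b|.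
  move=> bc ba ca; have [|z /andP[bz zc] ->] := @MVT_pt R f df b c bc.
    move=> z /andP[bz zc]; apply: fd; move: ba ca; rewrite !ltr_norml => /andP[? _] /andP[_ ?]; linarith.
  rewrite normrM ler_wpM2r//; apply: fV.
  move: ba ca; rewrite !ltr_norml => /andP[? _] /andP[_ ?]; linarith.
have rho0 : `|a - a| < rho by rewrite subrr normr0 (le_lt_trans _ ya).
have [lt|gt|->] := ltgtP y a; last by rewrite !subrr normr0 mulr0.
- by rewrite distrC (distrC y); exact: main.
- exact: main.
Qed.

(** For [0 < r <= 1/8], [(1 - 4r)^2 (1 + r) < 1 - r] and [(1 + 4r)^2 (1 - r) > 1 + r], so a larger
    deviation of [v] contradicts one of the comparisons of squares. *)
Lemma normr_sub_le_of_sqr (R : realFieldType) (r s v : R) : 0 < r -> r <= 1 / 8 -> 0 < s -> 0 <= v ->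
  (1 - r) * v ^+ 2 <= (1 + r) * s ^+ 2 -> (1 - r) * s ^+ 2 <= (1 + r) * v ^+ 2 ->
  `|v - s| <= 4 * r * s.
Proof.
move=> r0 r8 s0 v0 q1 q2; have s2 : 0 < s ^+ 2 by rewrite exprn_gt0.
rewrite ler_norml; apply/andP; split; rewrite leNgt; apply/negP => lt.
- have hv : v <= (1 - 4 * r) * s by linarith.
  have hp : 0 <= (1 - 4 * r) * s by rewrite mulr_ge0 ?(ltW s0)//; linarith.
  have : v ^+ 2 <= ((1 - 4 * r) * s) ^+ 2 by rewrite ler_pXn2r ?nnegrE.
  rewrite exprMn => /(ler_wpM2l (_ : 0 <= 1 + r)) => /(_ ltac:(linarith)) /(le_trans q2).
  rewrite [X in _ <= X -> _]mulrA (ler_pM2r s2); nra.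
- have hv : (1 + 4 * r) * s <= v by linarith.
  have hp : 0 <= (1 + 4 * r) * s by rewrite mulr_ge0 ?(ltW s0)//; linarith.
  have : ((1 + 4 * r) * s) ^+ 2 <= v ^+ 2 by rewrite ler_pXn2r ?nnegrE.
  rewrite exprMn => /(ler_wpM2l (_ : 0 <= 1 - r)) => /(_ ltac:(linarith)) /le_trans /(_ q1).
  rewrite [X in X <= _ -> _]mulrA (ler_pM2r s2); nra.
Qed.

(** Division of asymptotics: with [a], [v], [d] in the roles of [A'], [u], [u'], the relations
    [a ~ 2 v d], [a ~ 2 s T] and [v ~ s] give [d ~ T]. *)
Lemma normr_factor_sub_le (R : realFieldType) (r s T v d a : R) : 0 < r -> r <= 1 / 8 ->
  0 < s -> 0 < T -> 0 <= d -> `|v - s| <= r * s ->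
  `|a - 2 * (v * d)| <= r * (v * d) -> `|a - 2 * (s * T)| <= r * (s * T) ->
  `|d - T| <= 4 * r * T.
Proof.
move=> r0 r8 s0 T0 d0; rewrite !ler_norml => /andP[v1 v2] /andP[a1 a2] /andP[b1 b2].
have p0 : 0 < s * T by rewrite mulr_gt0.
have w1 : (1 - r) * (s * d) <= v * d by rewrite mulrA ler_wpM2r//; linarith.
have w2 : v * d <= (1 + r) * (s * d) by rewrite mulrA ler_wpM2r//; linarith.
have q1 : (2 - r) * (v * d) <= (2 + r) * (s * T) by linarith.
have q2 : (2 - r) * (s * T) <= (2 + r) * (v * d) by linarith.
have w3 := ler_wpM2l (_ : 0 <= 2 - r) w1; have w4 := ler_wpM2l (_ : 0 <= 2 + r) w2.
have {}w3 := le_trans (w3 ltac:(linarith)) q1; have {}w4 := le_trans q2 (w4 ltac:(linarith)).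
rewrite [leLHS]mulrA in w3; rewrite [leRHS]mulrA in w4.
apply/andP; split; rewrite leNgt; apply/negP => lt.
- have h : s * d <= (1 - 4 * r) * (s * T).
    by rewrite mulrCA ler_wpM2l ?(ltW s0)//; linarith.
  have := ler_wpM2l (_ : 0 <= (2 + r) * (1 + r)) h => /(_ ltac:(by rewrite mulr_ge0; linarith)) /(le_trans w4).
  by rewrite [X in _ <= X -> _]mulrA ler_pM2r//; nra.
- have h : (1 + 4 * r) * (s * T) <= s * d.
    by rewrite mulrCA ler_wpM2l ?(ltW s0)//; linarith.
  have := ler_wpM2l (_ : 0 <= (2 - r) * (1 - r)) h => /(_ ltac:(by rewrite mulr_ge0; linarith)) /le_trans /(_ w3).
  by rewrite [X in X <= _ -> _]mulrA ler_pM2r//; nra.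
Qed.

(** * Second differences of singular convolutions *)

Section SingularConvolution.
Context {R : realType}.
Notation mu := (@lebesgue_measure R).
Notation mR := (measurableTypeR R).
Notation Itg D f := (mu.-integrable D (EFin \o f)).
Notation sqrt := (@Num.sqrt R).
(** The gauge [sg a] stands for the size of [a * S' a]: it is 1 for the logarithm and [1 / sqrt a]
    for the inverse square root. [CR] will be four times the mass of the weak second derivative of
    the remainder. *)
Context (K S sg : R -> R) (CR : R).
Ltac is_parameter v ::= constr_eq v CR.
Notation dK := (central_diff2 K).
Notation dS := (central_diff2 S).
Hypothesis K_L1 : Itg setT K.
Hypothesis K_even : forall x : R, K (- x) = K x.
Hypothesis K_pos : forall x : R, x != 0 -> 0 < K x.
Hypothesis K_convex : convex_function (`]0, +oo[ : set R) K.
Hypothesis CR0 : 0 <= CR.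
Hypothesis rem_increment : forall x x' : R, 0 <= x -> x <= x' ->
  let d y := (dK x' y - dS x' y) - (dK x y - dS x y) in
  Itg setT d /\ \int[mu]_y `|d y| <= CR * (x' ^+ 2 - x ^+ 2).
Hypothesis sg_gt0 : forall a : R, 0 < a -> 0 < sg a.
Hypothesis sg_nonincreasing : forall a b : R, 0 < a -> a <= b -> sg b <= sg a.
(** Says that [sqrt a * sg a] is nondecreasing, hence that [a * sg a] gains at least a factor
    [sqrt (a / b)] when [b] shrinks to [a]. This smallness lets a narrow window absorb the local
    term. *)
Hypothesis sg_scale : forall a b : R, 0 < a -> a <= b -> a * sg a <= sqrt (a / b) * (b * sg b).
Hypothesis S_Itg : forall r : R, 0 < r -> Itg `](- r), r[ S.
Hypothesis S_increment : forall m a b : R, 0 < m -> m <= `|a| -> m <= `|b| ->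
  `|S a - S b| <= `| `|a| - `|b| | * (sg m / m).
Hypothesis S_local : forall rho h z : R, 0 < h -> z != 0 -> z != h -> `|z| <= rho ->
  `|S (z - h) - S z| * `|z| <= h * (sg rho * sqrt rho) / sqrt `|z - h|.
Hypothesis S_near : forall x y : R, 0 < x -> 0 < y -> y < 2 * x -> y != x ->
  dS x y <= 2 * (sg x * sqrt x) / sqrt `|y - x|.
Hypothesis S_far : forall x x' y : R, 0 <= x -> x <= x' -> 4 * x' <= 3 * y -> 0 < y ->
  0 <= dS x' y - dS x y <= 4 * (x' ^+ 2 - x ^+ 2) * (sg y / y ^+ 2).

Lemma central_diff2_0 (f : R -> R) (y : R) : central_diff2 f 0 y = 0.
Proof. by rewrite /central_diff2 addr0 subr0; ring. Qed.

Lemma sg_mul_nondecreasing (a b : R) : 0 < a -> a <= b -> a * sg a <= b * sg b.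
Proof.
move=> a0 ab; have b0 : 0 < b by exact: lt_le_trans ab.
apply: le_trans (sg_scale _ _ a0 ab) _; rewrite ler_piMl ?mulr_ge0 ?(ltW b0) ?(ltW (sg_gt0 _ b0))//.
by rewrite -sqrtr1 ler_wsqrtr// ler_pdivrMr// mul1r.
Qed.

Lemma rem_at_Itg (x : R) : 0 <= x -> Itg setT (fun y => dK x y - dS x y).
Proof.
move=> x0; have [+ _] := rem_increment 0 x (lexx 0) x0.
by apply: Itg_eq => // y _; rewrite !central_diff2_0; ring.
Qed.

(** [S] need not be integrable at infinity, as the logarithm shows. Its second difference is, being
    that of [K] minus an integrable remainder. *)
Lemma Itg_dS (x : R) (D : set R) : 0 <= x -> measurable D -> Itg D (dS x).
Proof.
move=> x0 mD; apply: (Itg_sub D setT) => //.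
have := ItgB _ _ _ measurableT (Itg_central_diff2T K K_L1 x) (rem_at_Itg x x0).
by apply: Itg_eq => // y _; ring.
Qed.

Lemma rem_increment_le (x x' W : R) (D : set R) (w : R -> R) : 0 <= x -> x <= x' ->
  measurable D -> measurable_fun D w -> (forall y, D y -> `|w y| <= W) -> 0 <= W ->
  let d y := (dK x' y - dS x' y) - (dK x y - dS x y) in
  Itg D (fun y => d y * w y) /\
  `|\int[mu]_(y in D) (d y * w y)| <= W * (CR * (x' ^+ 2 - x ^+ 2)).
Proof.
move=> x0 xx' mD mw wW W0 d; have [di dI] := rem_increment x x' x0 xx'.
have diD : Itg D d by exact: (Itg_sub D setT).
have dwi : Itg D (fun y => d y * w y) by exact: Itg_mulr_bounded wW.
split=> //; apply: le_trans (normr_Rint_le D _ (fun y => W * `|d y|) mD dwi _ _) _.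
- by apply: ItgZl => //; exact: Itg_norm.
- by move=> y Dy; rewrite normrM mulrC ler_wpM2r ?wW.
rewrite RintegralZl//; last exact: Itg_norm.
apply: ler_wpM2l => //; apply: le_trans dI.
by apply: Rint_sub_le => //; exact: Itg_norm.
Qed.

(** The increment estimate starting from step 0, where second differences vanish. *)
Lemma rem_le (x W : R) (D : set R) (w : R -> R) : 0 <= x ->
  measurable D -> measurable_fun D w -> (forall y, D y -> `|w y| <= W) -> 0 <= W ->
  `|\int[mu]_(y in D) (dK x y * w y) - \int[mu]_(y in D) (dS x y * w y)| <= W * (CR * x ^+ 2).
Proof.
move=> x0 mD mw wW W0.
have := rem_increment_le 0 x W D w (lexx 0) x0 mD mw wW W0.
rewrite expr0n/= subr0 => -[_]; rewrite -(@RintegralB _ mR R mu)//.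
- congr (`|_| <= _); apply: eq_Rint => y _; rewrite !central_diff2_0; ring.
- by apply: Itg_mulr_bounded wW => //; exact: Itg_central_diff2.
- by apply: Itg_mulr_bounded wW => //; exact: Itg_dS.
Qed.

Lemma rem_le_cst (x : R) (D : set R) : 0 <= x -> measurable D ->
  `|\int[mu]_(y in D) dK x y - \int[mu]_(y in D) dS x y| <= CR * x ^+ 2.
Proof.
move=> x0 mD; rewrite -[leRHS]mul1r.
have h y : D y -> `|1 : R| <= 1 by rewrite normr1.
apply: le_trans (rem_le x 1 D (fun=> 1) x0 mD ltac:(by []) h ler01).
by under eq_Rint do rewrite -[dK x _]mulr1; under [X in _ - X]eq_Rint do rewrite -[dS x _]mulr1.
Qed.

Lemma convolution_increment (x x' B : R) (u : R -> R) : 0 <= x -> x <= x' ->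
  measurable_fun (`]0, +oo[%classic : set R) u -> (forall y : R, 0 < y -> 0 <= u y <= B) -> 0 <= B ->
  `|\int[mu]_(y in `]0, +oo[) (dK x' y * u y) - \int[mu]_(y in `]0, +oo[) (dK x y * u y) -
    \int[mu]_(y in `]0, +oo[) ((dS x' y - dS x y) * u y)| <= B * (CR * (x' ^+ 2 - x ^+ 2)).
Proof.
move=> x0 xx' mu_ uB B0; have x'0 := le_trans x0 xx'.
have mP : measurable (`]0, +oo[%classic : set R) by exact: measurable_itv.
have wB y : `]0, +oo[%classic y -> `|u y| <= B.
  by rewrite /= in_itv/= andbT => /uB /andP[? ?]; rewrite ger0_norm.
have ik z : Itg `]0, +oo[ (fun y => dK z y * u y).
  by apply: Itg_mulr_bounded wB => //; exact: Itg_central_diff2.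
have is_ : Itg `]0, +oo[ (fun y => (dS x' y - dS x y) * u y).
  by apply: Itg_mulr_bounded wB => //; apply: ItgB => //; exact: Itg_dS.
have [_] := rem_increment_le x x' B _ u x0 xx' mP mu_ wB B0.
rewrite -!(@RintegralB _ mR R mu)//; last exact: ItgB.
by congr (`|_| <= _); apply: eq_Rint => y _; ring.
Qed.

Lemma sg_div_sqr_le (a y : R) : 0 < a -> a <= y -> sg y / y ^+ 2 <= sg a * (y ^+ 2)^-1.
Proof.
move=> a0 ay; rewrite ler_wpM2r ?invr_ge0 ?sqr_ge0//; exact: sg_nonincreasing.
Qed.

Lemma tail_le (x x' a W : R) (w : R -> R) : 0 <= x -> x <= x' -> 0 < a -> 4 * x' <= 3 * a ->
  measurable_fun (`]a, +oo[%classic : set R) w -> (forall y, a < y -> `|w y| <= W) ->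
  `|\int[mu]_(y in `]a, +oo[) ((dS x' y - dS x y) * w y)| <=
    4 * (x' ^+ 2 - x ^+ 2) * (sg a / a) * W.
Proof.
move=> x0 xx' a0 xa mw wW; have x'0 := le_trans x0 xx'.
have [i2 v2] := invsqr_itvy a a0.
have mP : measurable (`]a, +oo[%classic : set R) by exact: measurable_itv.
have wW' y : `]a, +oo[%classic y -> `|w y| <= W by rewrite /= in_itv/= andbT; exact: wW.
have W0 : 0 <= W by apply: le_trans (wW (a + 1) _); rewrite ?ltrDl.
pose c := 4 * (x' ^+ 2 - x ^+ 2) * sg a * W.
have -> : 4 * (x' ^+ 2 - x ^+ 2) * (sg a / a) * W = c * a^-1 by rewrite /c; ring.
rewrite -v2 -RintegralZl//; apply: normr_Rint_le => //.
- by apply: Itg_mulr_bounded wW' => //; apply: ItgB => //; exact: Itg_dS.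
- exact: ItgZl.
move=> y; rewrite /= in_itv/= andbT => ay; rewrite normrM.
have /andP[s0 s1] := S_far x x' y x0 xx' ltac:(linarith) ltac:(linarith).
rewrite ger0_norm//.
have -> : c / y ^+ 2 = 4 * (x' ^+ 2 - x ^+ 2) * (sg a * (y ^+ 2)^-1) * W by rewrite /c; ring.
apply: ler_pM => //; last exact: wW.
apply: le_trans s1 _; rewrite ler_wpM2l ?sg_div_sqr_le ?(ltW ay)//.
by rewrite mulr_ge0// subr_ge0 ler_pXn2r// nnegrE.
Qed.

(* Bounding [u y - u x] from below by a constant before integrating keeps the
   remainder proportional to that constant. *)
Lemma convolution_lower_bound_block (x a b e B : R) (u : R -> R) :
  0 < x -> x < a -> a <= b -> b <= e ->
  measurable_fun (`]0, +oo[%classic : set R) u ->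
  (forall y : R, 0 < y -> 0 <= u y <= B) ->
  (forall y z : R, 0 < y -> y <= z -> z <= e -> u y <= u z) ->
  (u a - u x) * (\int[mu]_(y in `]a, b[) dS x y - CR * x ^+ 2)
    - u x * \int[mu]_(y in `]e, +oo[) dK x y <=
  \int[mu]_(y in `]0, +oo[) (dK x y * u y).
Proof.
move=> x0 xa ab be mu_ uB und.
have xe : x <= e by apply: le_trans be; apply: le_trans ab; exact: ltW.
have e0 : 0 < e by exact: lt_le_trans xe.
apply: le_trans (convolution_lower_bound K K_L1 K_even K_pos K_convex x B u x0 mu_ uB _); last first.
  by move=> y z y0 yz zx; apply: und => //; exact: le_trans xe.
have mP c : 0 <= c -> measurable_fun (`]c, +oo[%classic : set R) (fun y => u y - u x).
  move=> c0; apply: measurable_funB => //; apply: measurable_funS mu_ => //.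
  by apply: subset_itvr; rewrite bnd_simp.
have wB (D : set R) : D `<=` `]0, +oo[%classic -> forall y, D y -> `|u y - u x| <= B.
  move=> D0 y /D0; rewrite /= in_itv/= andbT => /uB /andP[? ?].
  by have /andP[? ?] := uB x x0; rewrite ler_norml; linarith.
have ki c : 0 <= c -> Itg `]c, +oo[ (fun y => dK x y * (u y - u x)).
  move=> c0; apply: (Itg_mulr_bounded _ _ _ B) => //; first exact: Itg_central_diff2.
    exact: mP.
  by apply: wB; apply: subset_itvr; rewrite bnd_simp.
rewrite (Rint_split_oy x e) ?(ltW x0)// ?ki ?(ltW x0)//.
have i1 : Itg `]x, e[ (fun y => dK x y * (u y - u x)).
  by apply: Itg_sub (ki x (ltW x0)) => //; apply: subset_itvl; rewrite bnd_simp.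
have k0 y : x < y -> 0 <= dK x y by exact: central_diff2_ge0.
(* Between [x] and [e] the integrand is nonnegative, so all but the block []a, b[] is discarded.
   Beyond [e], where monotonicity is lost, only [u y - u x >= - u x] is used. *)
apply: lerD.
  apply: (@le_trans _ _ (\int[mu]_(y in `]a, b[) (dK x y * (u y - u x)))); last first.
    apply: Rint_sub_le => //; first by apply: subset_itvW; rewrite ?(ltW xa).
    move=> y; rewrite /= in_itv/= => /andP[xy ye]; rewrite mulr_ge0 ?k0// subr_ge0.
    by apply: und => //; exact: ltW.
  have i2 : Itg `]a, b[ (fun y => dK x y * (u y - u x)).
    by apply: Itg_sub i1 => //; apply: subset_itvW; rewrite ?(ltW xa).
  have ikab : Itg `]a, b[ (dK x) by exact: Itg_central_diff2.
  apply: (@le_trans _ _ (\int[mu]_(y in `]a, b[) (dK x y * (u a - u x)))); last first.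
    apply: le_Rint => //; first exact: ItgZr.
    move=> y; rewrite /= in_itv/= => /andP[ay yb]; rewrite ler_wpM2l ?k0 ?(lt_trans xa ay)//.
    by rewrite lerD2r und ?(lt_trans x0 xa) ?(ltW ay) ?(le_trans (ltW yb)).
  rewrite RintegralZr// [leRHS]mulrC; apply: ler_wpM2l.
    by rewrite subr_ge0 und ?(ltW xa)// (le_trans ab be).
  have := rem_le_cst x `]a, b[ (ltW x0) ltac:(by []).
  by rewrite ler_norml => /andP[+ _]; rewrite lerBrDr addrC.
rewrite mulrC -mulrN -RintegralZr//; last exact: Itg_central_diff2.
apply: le_Rint => //; [|exact: ki (ltW e0)|].
  by apply: ItgZr => //; exact: Itg_central_diff2.
move=> y; rewrite /= in_itv/= andbT => ey; rewrite ler_wpM2l ?k0 ?(le_lt_trans xe)//.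
by rewrite lerDr; case/andP: (uB y (lt_trans e0 ey)).
Qed.

Lemma tail_dK_le (x e : R) : 0 < x -> 0 < e -> 4 * x <= 3 * e ->
  \int[mu]_(y in `]e, +oo[) dK x y <= (4 * (sg e / e) + CR) * x ^+ 2.
Proof.
move=> x0 e0 xe.
have := rem_le_cst x `]e, +oo[ (ltW x0) ltac:(by []).
rewrite ler_norml => /andP[_ r1].
have h y : e < y -> `|1 : R| <= 1 by rewrite normr1.
have := tail_le 0 x e 1 (fun=> 1) (lexx 0) (ltW x0) e0 xe ltac:(by []) h.
under eq_Rint do rewrite central_diff2_0 subr0 mulr1.
rewrite ler_norml expr0n/= subr0 mulr1 => /andP[_ r2].
by rewrite mulrDl mulrAC -lerBlDl; apply: le_trans r1; rewrite lerB.
Qed.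

(** The integral of [1 / sqrt |y - x|] over []0, 2 x[] is at most [4 sqrt (2 x)], and
    [8 sqrt 2 <= 12]. *)
Lemma near_le (x W : R) (w : R -> R) : 0 < x -> measurable_fun (`]0, (2 * x)[%classic : set R) w ->
  (forall y : R, 0 < y -> y < 2 * x -> 0 <= w y <= W) -> 0 <= W ->
  \int[mu]_(y in `]0, (2 * x)[) (dS x y * w y) <= 12 * (x * sg x) * W.
Proof.
move=> x0 mw wW W0; have [i1 v1] := @invsqrt_dist_Itg R x 0 (2 * x) ltac:(linarith).
have s0 : 0 < sg x by exact: sg_gt0.
have wW' y : `]0, (2 * x)[%classic y -> `|w y| <= W.
  by rewrite /= in_itv/= => /andP[y0 y2]; have /andP[? ?] := wW y y0 y2; rewrite ger0_norm.
pose c := 2 * (sg x * sqrt x) * W.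
have c0 : 0 <= c by rewrite mulr_ge0 ?mulr_ge0 ?sqrtr_ge0 ?(ltW s0).
apply: (@le_trans _ _ (c * \int[mu]_(y in `]0, (2 * x)[) (sqrt `|y - x|)^-1)).
  rewrite -RintegralZl//; apply: (le_Rint_but _ _ _ x) => //.
  - by apply: Itg_mulr_bounded wW' => //; exact: Itg_dS (ltW x0) _.
  - exact: ItgZl.
  move=> y; rewrite /= in_itv/= => /andP[y0 y2] yx; have /andP[w0 w1] := wW y y0 y2.
  apply: (@le_trans _ _ (2 * (sg x * sqrt x) / sqrt `|y - x| * w y)).
    by rewrite ler_wpM2r// S_near.
  rewrite /c [leRHS]mulrAC; apply: ler_wpM2l => //.
  by rewrite !mulr_ge0 ?invr_ge0 ?sqrtr_ge0 ?ltW.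
apply: le_trans (ler_wpM2l c0 v1) _; rewrite subr0 /c sqrtrM//.
have -> : 2 * (sg x * sqrt x) * W * (4 * (sqrt 2 * sqrt x)) = 8 * sqrt 2 * (sg x * (sqrt x * sqrt x)) * W.
  by ring.
rewrite sqrt_sqr ?(ltW x0)// ler_wpM2r// [sg x * x]mulrC ler_wpM2r//; first by rewrite mulr_ge0 ?ltW.
by have := @four_sqrt2_le R; linarith.
Qed.

Lemma S_shift_Itg (a b c : R) : Itg `]a, b[ (fun y => S (y + c)).
Proof.
pose r := 1 + `|a + c| + `|b + c|.
have r0 : 0 < r by rewrite /r -addrA ltr_wpDr// addr_ge0.
have := Itg_shift c _ _ _ (S_Itg r r0); apply: Itg_sub => //.
apply: subset_itvW; rewrite /r.
  by have := ler_norm (- (a + c)); rewrite normrN; have := normr_ge0 (b + c); linarith.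
by have := ler_norm (b + c); have := normr_ge0 (a + c); linarith.
Qed.

(** After translation the common part of the two integrals cancels, leaving two end windows of
    length [h] whose points pair up with moduli differing by at most [2 h]. The mean of the
    increment is therefore quadratic in [h]. *)
Lemma increment_mean_le (x rho h : R) : 0 < h -> 2 * h <= rho ->
  `|\int[mu]_(y in `](x - rho), (x + rho)[) (S (y - x - h) - S (y - x))| <=
    4 * h ^+ 2 * (sg (rho / 2) / rho).
Proof.
move=> h0 hr; have r0 : 0 < rho by linarith.
have S1 a b : Itg `]a, b[ S.
  by have := S_shift_Itg a b 0; apply: Itg_eq => // y _; rewrite addr0.
have e1 : \int[mu]_(y in `](x - rho), (x + rho)[) S (y - x - h) =
    \int[mu]_(z in `](- rho - h), (rho - h)[) S z.
  rewrite (Rint_shift (- (x + h)) (- rho - h) (rho - h))//.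
  have -> : - rho - h - - (x + h) = x - rho by ring.
  have -> : rho - h - - (x + h) = x + rho by ring.
  by apply: eq_Rint => y _; congr S; ring.
have e2 : \int[mu]_(y in `](x - rho), (x + rho)[) S (y - x) = \int[mu]_(z in `](- rho), rho[) S z.
  rewrite (Rint_shift (- x) (- rho) rho)// opprK [- rho + x]addrC.
  by have -> : rho + x = x + rho by ring.
have i1 : Itg `](x - rho), (x + rho)[ (fun y => S (y - x - h)).
  have := S_shift_Itg (x - rho) (x + rho) (- (x + h)); apply: Itg_eq => // y _.
  by congr S; ring.
rewrite RintegralB//; last exact: S_shift_Itg.
rewrite e1 e2 (Rint_split_oo (- rho - h) (- rho))//; last linarith.
rewrite (Rint_split_oo (- rho) (rho - h) rho)//; last linarith.
have key (a b c : R) : a + b - (b + c) = a - c by ring.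
rewrite key.
rewrite (Rint_shift (2 * rho) (rho - h) rho)//.
have -> : rho - h - 2 * rho = - rho - h by ring.
have -> : rho - 2 * rho = - rho by ring.
have i2 : Itg `](- rho - h), (- rho)[ (fun t => S (t + 2 * rho)) by exact: S_shift_Itg.
rewrite -RintegralB//.
have -> : 4 * h ^+ 2 * (sg (rho / 2) / rho) = (2 * h * (sg (rho / 2) / (rho / 2))) * (- rho - (- rho - h)).
  by field; rewrite gt_eqF.
rewrite -Rint_cst; last linarith.
apply: normr_Rint_le => //; [exact: ItgB|exact: Itg_cst|].
move=> t; rewrite /= in_itv/= => /andP[t1 t2].
have n1 : `|t| = - t by rewrite ltr0_norm//; linarith.
have n2 : `|t + 2 * rho| = t + 2 * rho by rewrite gtr0_norm//; linarith.
apply: le_trans (S_increment (rho / 2) t (t + 2 * rho) _ _ _) _; rewrite ?n1 ?n2; try linarith.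
apply: ler_wpM2r; first by rewrite divr_ge0 ?ltW ?sg_gt0//; linarith.
by rewrite ler_norml; linarith.
Qed.

(** The term [2 * S y] cancels in the increment. The part in [y + x] is regular; so is the part in
    [y - x] at distance at least [rho] from [x]. Inside that window [w y - w x] compensates the
    singularity through [S_local], and the constant [w x] meets only the small mean of
    [increment_mean_le]. *)
Lemma near_increment (x rho h V W : R) (w : R -> R) : 0 < h -> 2 * h <= rho -> rho <= x ->
  measurable_fun (`]0, (2 * x)[%classic : set R) w ->
  (forall y : R, 0 < y -> y < 2 * x -> `|w y| <= W) -> 0 <= V ->
  (forall y : R, `|y - x| < rho -> `|w y - w x| <= V * `|y - x|) ->
  `|\int[mu]_(y in `]0, (2 * x)[) ((dS (x + h) y - dS x y) * w y)| <=
    h * (8 * (x * W) * (sg (rho / 2) / rho) + 6 * V * (rho * sg rho)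
         + 4 * h * W * (sg (rho / 2) / rho)).
Proof.
move=> h0 hr rx mw wW V0 wV; have r0 : 0 < rho by linarith. have x0 : 0 < x by linarith.
have W0 : 0 <= W by apply: (le_trans (normr_ge0 _) (wW x x0 _)); linarith.
have mD : measurable (`]0, (2 * x)[%classic : set R) by exact: measurable_itv.
have wW' y : `]0, (2 * x)[%classic y -> `|w y| <= W by rewrite /= in_itv/= => /andP[]; exact: wW.
set A := sg (rho / 2) / rho.
have A0 : 0 <= A by rewrite divr_ge0 ?ltW ?sg_gt0//; linarith.
pose g1 y := S (y + x + h) - S (y + x); pose g2 y := S (y - x - h) - S (y - x).
have ig1 a b : Itg `]a, b[ g1.
  apply: ItgB => //; last exact: S_shift_Itg.
  by have := S_shift_Itg a b (x + h); apply: Itg_eq => // y _; rewrite addrA.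
have ig2 a b : Itg `]a, b[ g2.
  apply: ItgB => //; last exact: S_shift_Itg.
  by have := S_shift_Itg a b (- x - h); apply: Itg_eq => // y _; rewrite addrA.
have i1 : Itg `]0, (2 * x)[ (fun y => g1 y * w y) by exact: Itg_mulr_bounded wW'.
have i2 : Itg `]0, (2 * x)[ (fun y => g2 y * w y) by exact: Itg_mulr_bounded wW'.
have E : \int[mu]_(y in `]0, (2 * x)[) ((dS (x + h) y - dS x y) * w y) =
    \int[mu]_(y in `]0, (2 * x)[) (g1 y * w y) + \int[mu]_(y in `]0, (2 * x)[) (g2 y * w y).
  rewrite -RintegralD//; apply: eq_Rint => y _; rewrite /g1 /g2 /central_diff2.
  by rewrite opprD !addrA; ring.
have B1 : `|\int[mu]_(y in `]0, (2 * x)[) (g1 y * w y)| <= h * (4 * (x * W) * A).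
  have -> : h * (4 * (x * W) * A) = h * (2 * A) * W * (2 * x - 0) by ring.
  rewrite -Rint_cst; last linarith.
  apply: normr_Rint_le => //; first exact: Itg_cst.
  move=> y; rewrite /= in_itv/= => /andP[y0 y2]; rewrite normrM ler_pM ?wW//.
  apply: le_trans (S_increment (rho / 2) _ _ _ _ _) _; rewrite ?(gtr0_norm (_ : 0 < y + x)) ?(gtr0_norm (_ : 0 < y + x + h)); try linarith.
  rewrite addrAC subrr add0r gtr0_norm// (_ : sg (rho / 2) / (rho / 2) = 2 * A)//.
  by rewrite /A; field; rewrite gt_eqF.
have i2s a b : 0 <= a -> b <= 2 * x -> Itg `]a, b[ (fun y => g2 y * w y).
  by move=> a0 b2; apply: Itg_sub i2 => //; apply: subset_itvW.
have Bo a b : 0 <= a -> b <= 2 * x -> a <= b -> (forall y, a < y < b -> rho <= `|y - x|) ->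
    `|\int[mu]_(y in `]a, b[) (g2 y * w y)| <= h * (2 * W * A) * (b - a).
  move=> a0 b2 ab far; rewrite -Rint_cst//.
  apply: normr_Rint_le => //; [exact: i2s|exact: Itg_cst|].
  move=> y; rewrite /= in_itv/= => yab; have yr := far y yab; case/andP: yab => ya yb.
  have -> : h * (2 * W * A) = h * (2 * A) * W by ring.
  rewrite normrM ler_pM ?wW//; try linarith.
  have yh : rho / 2 <= `|y - x - h|.
    by move: yr; rewrite !ler_normr => /orP[] yr; apply/orP; [left|right]; linarith.
  apply: le_trans (S_increment (rho / 2) _ _ _ yh _) _; try linarith.
  rewrite (_ : sg (rho / 2) / (rho / 2) = 2 * A); last by rewrite /A; field; rewrite gt_eqF.
  apply: ler_wpM2r; first by rewrite mulr_ge0.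
  by apply: le_trans (ler_dist_dist _ _) _; rewrite addrAC subrr add0r normrN gtr0_norm.
have Bm : `|\int[mu]_(y in `](x - rho), (x + rho)[) (g2 y * w y)| <=
    h * (6 * V * (rho * sg rho)) + h * (4 * h * W * A).
  have -> : \int[mu]_(y in `](x - rho), (x + rho)[) (g2 y * w y) =
    \int[mu]_(y in `](x - rho), (x + rho)[) (g2 y * (w y - w x)) +
    (\int[mu]_(y in `](x - rho), (x + rho)[) g2 y) * w x.
    have im : Itg `](x - rho), (x + rho)[ (fun y => g2 y * w y) by apply: i2s; linarith.
    have ic : Itg `](x - rho), (x + rho)[ (fun y => g2 y * w x) by exact: ItgZr.
    rewrite -RintegralZr// -RintegralD//; first by apply: eq_Rint => y _; ring.
    by have := ItgB _ _ _ (measurable_itv _) im ic; apply: Itg_eq => // y _; ring.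
  apply: le_trans (ler_normD _ _) _; apply: lerD; last first.
    rewrite normrM (_ : h * (4 * h * W * A) = 4 * h ^+ 2 * A * W); last by ring.
    by apply: ler_pM => //; [exact: increment_mean_le|apply: wW; linarith].
  have [j1 v1] := @invsqrt_dist_Itg R (x + h) (x - rho) (x + rho) ltac:(linarith).
  pose c := V * (h * (sg rho * sqrt rho)).
  have c0 : 0 <= c by rewrite !mulr_ge0 ?sqrtr_ge0 ?(ltW h0) ?(ltW (sg_gt0 _ r0)).
  apply: (@le_trans _ _ (c * (4 * sqrt (2 * rho)))); last first.
    rewrite sqrtrM// (_ : c * (4 * (sqrt 2 * sqrt rho)) = h * (4 * sqrt 2 * V * ((sqrt rho * sqrt rho) * sg rho))); last first.
      by rewrite /c; ring.
    rewrite sqrt_sqr ?(ltW r0)// ler_wpM2l ?(ltW h0)// ler_wpM2r//.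
      by rewrite mulr_ge0 ?(ltW r0) ?(ltW (sg_gt0 _ r0)).
    by rewrite ler_wpM2r// four_sqrt2_le.
  have v1' : \int[mu]_(y in `](x - rho), (x + rho)[) (sqrt `|y - (x + h)|)^-1 <= 4 * sqrt (2 * rho).
    by apply: le_trans v1 _; rewrite (_ : x + rho - (x - rho) = 2 * rho)//; ring.
  apply: le_trans (ler_wpM2l c0 v1').
  have wm : measurable_fun (`](x - rho), (x + rho)[%classic : set R) (fun y => w y - w x).
    by apply: measurable_funB => //; apply: measurable_funS mw => //; apply: subset_itvW; linarith.
  rewrite -RintegralZl//; apply: (normr_Rint_le_but _ _ _ (x + h)) => //; [|exact: ItgZl|].
    apply: (Itg_mulr_bounded _ _ _ (V * rho)) => // y; rewrite /= in_itv/= => /andP[y1 y2].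
    have yr : `|y - x| < rho by rewrite ltr_norml; linarith.
    by apply: le_trans (wV y yr) _; rewrite ler_wpM2l// ltW.
  move=> y; rewrite /= in_itv/= => /andP[y1 y2] yh; rewrite normrM.
  have yr : `|y - x| < rho by rewrite ltr_norml; linarith.
  have [->|yx] := eqVneq y x; first by rewrite subrr normr0 mulr0 mulr_ge0 ?invr_ge0 ?sqrtr_ge0.
  apply: le_trans (ler_wpM2l (normr_ge0 _) (wV y yr)) _.
  have z0 : y - x != 0 by rewrite subr_eq0.
  have zh : y - x != h by apply: contra yh => /eqP <-; rewrite addrC subrK.
  have := S_local rho h (y - x) h0 z0 zh (ltW yr).
  rewrite -/(g2 y) (_ : y - x - h = y - (x + h)); last by ring.
  move=> /(ler_wpM2l V0); rewrite mulrCA; congr (_ <= _); rewrite /c; ring.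
rewrite E; apply: le_trans (ler_normD _ _) _.
rewrite (Rint_split_oo 0 (x - rho) (2 * x) (fun y => g2 y * w y))//; last linarith.
rewrite (Rint_split_oo (x - rho) (x + rho) (2 * x) (fun y => g2 y * w y)); [|linarith|by apply: i2s; linarith].
have Bl : `|\int[mu]_(y in `]0, (x - rho)[) (g2 y * w y)| <= h * (2 * W * A) * (x - rho - 0).
  by apply: Bo => //; [linarith|linarith|move=> y /andP[y0 y1]; rewrite ler_normr; apply/orP; right; linarith].
have Br : `|\int[mu]_(y in `](x + rho), (2 * x)[) (g2 y * w y)| <= h * (2 * W * A) * (2 * x - (x + rho)).
  by apply: Bo => //; [linarith|linarith|move=> y /andP[y0 y1]; rewrite ler_normr; apply/orP; left; linarith].
have WA : 0 <= h * (2 * W * A) * rho by apply: mulr_ge0; [apply: mulr_ge0; [exact: ltW|apply: mulr_ge0 => //; exact: mulr_ge0]|exact: ltW].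
apply: le_trans (lerD B1 (le_trans (ler_normD _ _)
  (lerD Bl (le_trans (ler_normD _ _) (lerD Bm Br))))) _.
rewrite -subr_ge0.
rewrite (_ : _ - _ = 2 * (h * (2 * W * A) * rho)); last by ring.
by rewrite mulr_ge0.
Qed.

Lemma far_le (x x' a b : R) (w : R -> R) : 0 <= x -> x <= x' -> 0 < a -> 4 * x' <= 3 * a ->
  Itg `]a, b[ (fun y => sg y / y ^+ 2 * `|w y|) ->
  Itg `]a, b[ (fun y => (dS x' y - dS x y) * w y) ->
  `|\int[mu]_(y in `]a, b[) ((dS x' y - dS x y) * w y)| <=
    4 * (x' ^+ 2 - x ^+ 2) * \int[mu]_(y in `]a, b[) (sg y / y ^+ 2 * `|w y|).
Proof.
move=> x0 xx' a0 xa i1 i2; rewrite -RintegralZl//.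
apply: normr_Rint_le => //; first exact: ItgZl.
move=> y; rewrite /= in_itv/= => /andP[ay yb]; rewrite normrM mulrA ler_wpM2r//.
have /andP[s0 s1] := S_far x x' y x0 xx' ltac:(linarith) ltac:(linarith).
by rewrite ger0_norm.
Qed.

Lemma sg_weight_Itg (a b W : R) (w : R -> R) : 0 < a ->
  measurable_fun (`]a, b[%classic : set R) sg -> measurable_fun (`]a, b[%classic : set R) w ->
  (forall y, a < y -> y < b -> `|w y| <= W) ->
  Itg `]a, b[ (fun y => sg y / y ^+ 2 * `|w y|).
Proof.
move=> a0 msg mw wW; have [ab|ba] := ltP a b; last first.
  by rewrite set_itv_ge ?bnd_simp -?leNgt//; exact: integrable_set0.
have W0 : 0 <= W by apply: le_trans (normr_ge0 _) (wW ((a + b) / 2) _ _); linarith.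
apply: (Itg_bounded _ _ _ (sg a * (a ^+ 2)^-1 * W)).
  apply: measurable_funM; last exact: measurableT_comp.
  apply: measurable_funM => //; apply: measurable_funTS.
  apply: (measurableT_comp measurable_invr); exact: measurable_funX.
move=> y /andP[ay yb]; have y0 : 0 < y by linarith.
have s0 := sg_gt0 y y0; have y2 : 0 <= (y ^+ 2)^-1 by rewrite invr_ge0 sqr_ge0.
rewrite ger0_norm; last by rewrite mulr_ge0// mulr_ge0// ltW.
apply: ler_pM; rewrite ?wW ?(mulr_ge0 (ltW s0) y2)//.
apply: ler_pM; rewrite ?(ltW s0) ?sg_nonincreasing ?(ltW ay)//.
by rewrite lef_pV2 ?posrE ?exprn_gt0// ler_pXn2r ?nnegrE ?(ltW ay) ?(ltW a0) ?(ltW y0).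
Qed.

(** * Estimates for an increasing solution and its derivative *)

Section Solution.
Context (u du dA : R -> R) (B e : R).
Ltac is_parameter v ::= first [constr_eq v CR | constr_eq v B | constr_eq v e].
Notation A x := (\int[mu]_(y in `]0, +oo[) (dK x y * u y)).
Hypothesis e0 : 0 < e.
Hypothesis u_meas : measurable_fun (`]0, +oo[%classic : set R) u.
Hypothesis sg_meas : measurable_fun [set: R] sg.
Hypothesis u_bnd : forall y : R, 0 < y -> 0 <= u y <= B.
Hypothesis u_inc : forall y z : R, 0 < y -> y < z -> z < e -> u y < u z.
Hypothesis u_der : forall y : R, 0 < y -> y < e -> is_derive y 1 u (du y).
(** Supplied by the equation, which writes [A] in terms of [n] and [u], and not by differentiating
    the singular integral. *)
Hypothesis A_der : forall y : R, 0 < y -> y < e -> is_derive y 1 (fun x => A x) (dA y).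

Lemma u_nondecreasing (y z : R) : 0 < y -> y <= z -> z < e -> u y <= u z.
Proof. by move=> y0; rewrite le_eqVlt => /predU1P[->//|yz ze]; rewrite ltW// u_inc. Qed.

Lemma u_gt0 (y : R) : 0 < y -> y < e -> 0 < u y.
Proof.
move=> y0 ye; have y20 : 0 < y / 2 by linarith.
have /andP[u0 _] := u_bnd _ y20; apply: le_lt_trans u0 (u_inc _ _ y20 _ ye); linarith.
Qed.

Lemma B_ge0 : 0 <= B.
Proof. by have /andP[u0 uB] := u_bnd 1 ltr01; exact: le_trans uB. Qed.

Lemma du_ge0 (y : R) : 0 < y -> y < e -> 0 <= du y.
Proof.
move=> y0 ye; have [dx dE] := u_der y y0 ye; rewrite -dE -derive1E.
apply: (@incr_derive1_ge0_itv _ _ false true 0 e).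
- by move=> z /[!inE]; rewrite /= in_itv/= => /andP[z0 ze]; have [] := u_der z z0 ze.
- by move=> a b; rewrite !in_itv/= => /andP[a0 ae] /andP[b0 be] ab; exact: u_inc.
- by rewrite in_itv/= y0.
Qed.

(** Up to a factor of order [x], this bounds what [A'] receives from the points beyond [2 x]: those
    below [e], those beyond [e], and the remainder of the kernel. *)
Definition far_mass (x : R) : R :=
  \int[mu]_(y in `](2 * x), e[) (sg y / y ^+ 2 * u y) + B * (sg e / e) + B * CR.

Lemma far_mass_ge0 (x : R) : 0 < x -> 0 <= far_mass x.
Proof.
move=> x0; rewrite /far_mass; have B0 := B_ge0.
apply: addr_ge0; [apply: addr_ge0|exact: mulr_ge0]; last first.
  by rewrite mulr_ge0// divr_ge0 ?ltW ?sg_gt0.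
apply: Rintegral_ge0 => y; rewrite /= in_itv/= => /andP[ya yb].
have y0 : 0 < y by linarith.
by rewrite mulr_ge0 ?divr_ge0 ?sqr_ge0 ?(ltW (sg_gt0 _ y0))//; case/andP: (u_bnd y y0).
Qed.

Lemma u_measurable_oo (c d : R) : 0 <= c -> measurable_fun (`]c, d[%classic : set R) u.
Proof.
move=> c0; apply: measurable_funS u_meas => // y; rewrite /= !in_itv/= andbT => /andP[cy _].
exact: le_lt_trans cy.
Qed.

Lemma u_measurable_oy (c : R) : 0 <= c -> measurable_fun (`]c, +oo[%classic : set R) u.
Proof.
move=> c0; apply: measurable_funS u_meas => // y; rewrite /= !in_itv/= !andbT.
exact: le_lt_trans.
Qed.

Lemma normr_u_le (y : R) : 0 < y -> `|u y| <= B.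
Proof. by move=> /u_bnd /andP[? ?]; rewrite ger0_norm. Qed.

Lemma dS_increment_u_Itg (x h : R) : 0 < x -> 0 < h ->
  Itg `]0, +oo[ (fun y => (dS (x + h) y - dS x y) * u y).
Proof.
move=> x0 h0; apply: (Itg_mulr_bounded _ _ _ B) => //.
  by apply: ItgB => //; apply: Itg_dS => //; linarith.
by move=> y; rewrite /= in_itv/= andbT; exact: normr_u_le.
Qed.

(** Near [x] the function [w] replaces [u]: it is [u] itself for crude bounds and for the logarithm,
    and [u] minus its conjectured profile for the square root. [G] is the derivative of everything
    that the near integral of [w] does not see, up to the error [E]. *)
Lemma convolution_derivative_approx (x rho V W G E E' delta : R) (w : R -> R) :
  0 < x -> x < e -> 0 < rho -> rho <= x -> 0 <= V -> 0 < delta -> 0 <= E' ->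
  measurable_fun (`]0, (2 * x)[%classic : set R) w ->
  (forall y : R, 0 < y -> y < 2 * x -> `|w y| <= W) ->
  (forall y : R, `|y - x| < rho -> `|w y - w x| <= V * `|y - x|) ->
  (forall h, 0 < h -> h < delta ->
    `|\int[mu]_(y in `]0, +oo[) ((dS (x + h) y - dS x y) * u y)
      - \int[mu]_(y in `]0, (2 * x)[) ((dS (x + h) y - dS x y) * w y) - h * G| <= h * (E + h * E')) ->
  `|dA x - G| <= 8 * (x * W) * (sg (rho / 2) / rho) + 6 * V * (rho * sg rho) + 2 * x * (B * CR) + E.
Proof.
move=> x0 xe r0 rx V0 d0 E'0 mw wW wV H; have B0 := B_ge0.
have W0 : 0 <= W by apply: (le_trans (normr_ge0 _) (wW x x0 _)); linarith.
pose M := sg (rho / 2) / rho.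
have M0 : 0 <= M by rewrite divr_ge0 ?ltW ?sg_gt0//; linarith.
have BC : 0 <= B * CR by exact: mulr_ge0.
apply: (is_derive_right_le _ (fun x => A x) x (dA x) G _ (4 * W * M + B * CR + E') (Num.min delta (rho / 2))).
- by rewrite lt_min d0 divr_gt0.
- exact: A_der.
- by rewrite !addr_ge0// mulr_ge0// mulr_ge0.
move=> h h0; rewrite lt_min => /andP[hd hr]; have hx : x <= x + h by linarith.
have := convolution_increment x (x + h) B u (ltW x0) hx u_meas u_bnd B0.
rewrite (_ : (x + h) ^+ 2 - x ^+ 2 = h * (2 * x + h)); last by ring.
set a1 := A (x + h); set a2 := A x; set i1 := \int[mu]_(y in `]0, +oo[) _ => C1.
have N1 := near_increment x rho h V W w h0 ltac:(linarith) rx mw wW V0 wV.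
have := H h h0 hd; rewrite -/i1; set n1 := \int[mu]_(y in _) _ in N1 * => I1.
rewrite (_ : a1 - a2 - h * G = (a1 - a2 - i1) + (n1 + (i1 - n1 - h * G))); last by ring.
apply: le_trans (ler_normD _ _) _; apply: le_trans (lerD C1 (le_trans (ler_normD _ _) (lerD N1 I1))) _.
rewrite le_eqVlt; apply/orP; left; apply/eqP; rewrite -/M; ring.
Qed.

(** Taken with [w = u] and [G = 0], so that all contributions from beyond [2 x] are counted as
    error. *)
Lemma convolution_derivative_le (x rho V : R) : 0 < x -> 2 * x < e -> 0 < rho -> rho <= x ->
  0 <= V -> (forall y : R, `|y - x| < rho -> `|u y - u x| <= V * `|y - x|) ->
  dA x <= 8 * (x * u (2 * x)) * (sg (rho / 2) / rho) + 6 * V * (rho * sg rho) + 8 * x * far_mass x.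
Proof.
move=> x0 xe r0 rx V0 uV; have B0 := B_ge0.
have x2 : 0 < 2 * x by linarith.
pose I := \int[mu]_(y in `](2 * x), e[) (sg y / y ^+ 2 * u y).
have i1 : Itg `](2 * x), e[ (fun y => sg y / y ^+ 2 * `|u y|).
  apply: (sg_weight_Itg _ _ B) => //; [exact: measurable_funTS|apply: u_measurable_oo; linarith|].
  by move=> y ya _; apply: normr_u_le; linarith.
have Ie : \int[mu]_(y in `](2 * x), e[) (sg y / y ^+ 2 * `|u y|) = I.
  apply: eq_Rint => y; rewrite /= in_itv/= => /andP[ya yb].
  by rewrite ger0_norm//; case/andP: (u_bnd y ltac:(linarith)).
pose J := I + B * (sg e / e).
have J0 : 0 <= J.
  have s1 : 0 <= B * (sg e / e) by rewrite mulr_ge0// divr_ge0 ?(ltW (sg_gt0 _ e0)) ?(ltW e0).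
  rewrite addr_ge0//.
  rewrite -Ie; apply: Rintegral_ge0 => y; rewrite /= in_itv/= => /andP[ya yb].
  by rewrite mulr_ge0// divr_ge0 ?sqr_ge0// ltW// sg_gt0//; linarith.
have BC : 0 <= 6 * x * (B * CR) by rewrite mulr_ge0 ?mulr_ge0// ltW.
suff : `|dA x - 0| <= 8 * (x * u (2 * x)) * (sg (rho / 2) / rho) + 6 * V * (rho * sg rho)
    + 2 * x * (B * CR) + 8 * x * J.
  rewrite subr0 => /(le_trans (ler_norm _)) /le_trans; apply; rewrite -subr_ge0.
  by rewrite [leRHS](_ : _ = 6 * x * (B * CR))// /far_mass -/I /J; ring.
apply: (convolution_derivative_approx x rho V (u (2 * x)) 0 (8 * x * J) (4 * J) (x / 2) u) => //.
- linarith.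
- linarith.
- exact: mulr_ge0.
- exact: u_measurable_oo.
- move=> y y0 y2; have /andP[? _] := u_bnd y y0; rewrite ger0_norm//.
  by rewrite u_nondecreasing// ltW.
move=> h h0 hr; have ik := dS_increment_u_Itg x h x0 h0.
have aux (n f : R) : n + f - n = f by ring.
rewrite mulr0 subr0 (Rint_split_oy 0 (2 * x) _ (ltW x2) ik) aux.
rewrite (Rint_split_oy (2 * x) e _ (ltW xe)); last first.
  by apply: Itg_sub ik => //; apply: subset_itvr; rewrite bnd_simp ltW.
have F1 : `|\int[mu]_(y in `](2 * x), e[) ((dS (x + h) y - dS x y) * u y)| <=
    4 * ((x + h) ^+ 2 - x ^+ 2) * I.
  rewrite -Ie; apply: far_le => //; [linarith|linarith|linarith|].
  apply: Itg_sub ik => //; move=> y; rewrite /= !in_itv/= andbT => /andP[ya _]; linarith.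
have T1 : `|\int[mu]_(y in `]e, +oo[) ((dS (x + h) y - dS x y) * u y)| <=
    4 * ((x + h) ^+ 2 - x ^+ 2) * (sg e / e) * B.
  apply: tail_le => //; [linarith|linarith|linarith|by apply: u_measurable_oy; linarith|].
  by move=> y ey; apply: normr_u_le; linarith.
apply: le_trans (ler_normD _ _) _; apply: le_trans (lerD F1 T1) _.
rewrite le_eqVlt; apply/orP; left; apply/eqP; rewrite /J; ring.
Qed.

(* The weight vanishing at both ends of [x/2, 3x/2] makes the maximum interior,
   so that the derivative is controlled near the maximiser by its value there
   and the local term of the estimate can be absorbed. *)
Lemma du_le (C e1 : R) : 0 < C -> 0 < e1 -> 2 * e1 <= e ->
  (forall y : R, 0 < y -> y < e -> {for y, continuous du}) ->
  (forall y : R, 0 < y -> y < e1 -> u (2 * y) <= C * u y) ->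
  (forall y : R, 0 < y -> y < e1 -> y * sg y <= C * u y) ->
  (forall y : R, 0 < y -> y < e1 -> y ^+ 2 * far_mass y <= C * u y ^+ 2) ->
  (forall y : R, 0 < y -> y < e1 -> u y * du y <= dA y) ->
  exists2 C' : R, 0 <= C' & forall x : R, 0 < x -> 2 * x < e1 -> du x <= C' * (u x / x).
Proof.
move=> C0 e10 e1e duc H1 H2 H3 H4.
(* The local term will be at most [6 * (4 du) * (q C u)], and this choice makes it at most half of
   [u du]. *)
pose q := (48 * (C + 1))^-1.
have q0 : 0 < q by rewrite invr_gt0; linarith.
have qC : 24 * q * C <= 1 / 2.
  by rewrite /q mulrAC ler_pdivrMr; linarith.
have q1 : q <= 1 / 48 by rewrite /q ler_pdivlMr// mulrC ler_pdivrMr; linarith.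
have q2 : q ^+ 2 <= 1 / 2 by rewrite expr2; nra.
have Cn := ltW C0; have qn := ltW q0; clearbody q.
have [C2 C20 C2E] : exists2 C2 : R, 0 <= C2 & C2 = 16 * (2 * C ^+ 2 / q ^+ 4 + C).
  by eexists; last by []; rewrite mulr_ge0// addr_ge0// divr_ge0 ?exprn_ge0// mulr_ge0 ?sqr_ge0.
exists (8 * C2 * C) => [|x x0 xe1]; first by rewrite !mulr_ge0.
have xe : 2 * x < e by linarith.
pose d y := x / 2 - `|y - x|; pose psi y := du y * d y ^+ 2.
have cpsi : {within `[x / 2, 3 * x / 2], continuous psi}.
  apply: continuous_in_subspaceT => y /[!inE]; rewrite /= in_itv/= => /andP[y1 y2].
  apply: cvgM; first by apply: duc; linarith.
  rewrite /d; apply: (@continuous_comp _ _ _ (fun y => x / 2 - `|y - x|) (fun t => t ^+ 2)).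
    apply: cvgB; first exact: cvg_cst.
    by apply: cvg_norm; apply: cvgB; [exact: cvg_id|exact: cvg_cst].
  exact: exprn_continuous.
have [ys] := EVT_max (ltac:(linarith) : x / 2 <= 3 * x / 2) cpsi.
rewrite in_itv/= => /andP[ys1 ys2] psimax.
have ux : 0 < u x by apply: u_gt0; linarith.
have psix : du x * (x ^+ 2 / 4) <= psi ys.
  have -> : du x * (x ^+ 2 / 4) = psi x by rewrite /psi /d subrr normr0; field.
  by apply: psimax; rewrite in_itv/=; linarith.
suff : psi ys <= 2 * C2 * C * (x * u x).
  move=> /(le_trans psix) hh; rewrite -(ler_pM2r (_ : 0 < x ^+ 2 / 4)); last by rewrite divr_gt0 ?exprn_gt0.
  apply: le_trans hh _; rewrite le_eqVlt; apply/orP; left; apply/eqP.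
  by field; rewrite gt_eqF.
have ys0 : 0 < ys by linarith.
have ys2x : ys <= 2 * x by linarith.
have xe1' : x < e1 by linarith.
have s20 : 0 < x / 2 by linarith.
have yse : ys < e by linarith.
have us : 0 < u ys by exact: u_gt0.
have xu : 0 <= 2 * C2 * C * (x * u x) by rewrite !mulr_ge0 ?(ltW x0) ?(ltW ux).
have dn : 0 <= d ys by rewrite /d subr_ge0 ler_norml; linarith.
have [d0|d0] := leP (d ys) 0.
  by rewrite /psi (le_anti (_ : d ys <= 0 <= d ys)) ?d0// expr0n mulr0.
have dus := du_ge0 ys ys0 yse.
have dlt : d ys <= x / 2 by rewrite /d gerBl.
pose rho := q ^+ 2 * d ys.
have rho0 : 0 < rho by rewrite mulr_gt0// exprn_gt0.
have rhod : rho <= d ys / 2.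
  have := ler_wpM2r (ltW d0) q2; rewrite -/rho; linarith.
(* Within [rho <= d ys / 2] the weight [d] loses at most half its value, so maximality of [psi]
   bounds [du] there by four times its value at [ys]. *)
have lip y : `|y - ys| < rho -> `|u y - u ys| <= 4 * du ys * `|y - ys|.
  apply: (derivative_bound_lipschitz _ u du).
    move=> z; rewrite ltr_norml => /andP[z1 z2]; apply: u_der; linarith.
  move=> z zr; have dz : d ys / 2 <= d z.
    have := ler_distD ys z x; rewrite /d; move: zr rhod; rewrite /d; linarith.
  have z0 : 0 < z /\ z < e by move: zr; rewrite ltr_norml => /andP[z1 z2]; split; linarith.
  rewrite ger0_norm; last by apply: du_ge0; case: z0.
  have dz0 : 0 < d z by linarith.
  have zI : z \in `[x / 2, 3 * x / 2]%R.
    by rewrite in_itv/=; move: dz0; rewrite /d subr_gt0 ltr_norml; linarith.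
  have := psimax z zI; rewrite /psi => pz.
  rewrite -(ler_pM2r (_ : 0 < d z ^+ 2)) ?exprn_gt0//; apply: le_trans pz _.
  rewrite [4 * _]mulrC -mulrA ler_wpM2l//.
  rewrite (_ : d ys ^+ 2 = 4 * (d ys / 2) ^+ 2); last by field.
  by rewrite ler_wpM2l// ler_pXn2r// nnegrE ltW// divr_gt0.
have ysx : rho <= ys by linarith.
have := convolution_derivative_le ys rho (4 * du ys) ys0 ltac:(linarith) rho0 ysx ltac:(linarith) lip.
have b1 := H1 ys ys0 ltac:(linarith). have b2 := H2 ys ys0 ltac:(linarith). have b3 := H3 ys ys0 ltac:(linarith).
have b4 := H4 ys ys0 ltac:(linarith).
have s1 : rho * sg rho <= q * (C * u ys).
  apply: le_trans (sg_scale _ _ rho0 ysx) _.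
  apply: ler_pM => //; rewrite ?sqrtr_ge0 ?mulr_ge0 ?(ltW ys0) ?(ltW (sg_gt0 _ ys0))//.
  rewrite -[leRHS]ger0_norm ?(ltW q0)// -sqrtr_sqr ler_wsqrtr// ler_pdivrMr//.
  by rewrite ler_wpM2l ?sqr_ge0//; linarith.
have s2 : rho * sg (rho / 2) <= 2 * (C * u ys).
  have r2 : 0 < rho / 2 by rewrite divr_gt0.
  have r2y : rho / 2 <= ys by apply: le_trans ysx; rewrite ler_pdivrMr// ler_peMr ?(ltW rho0)// ler1n.
  rewrite (_ : rho * sg (rho / 2) = 2 * (rho / 2 * sg (rho / 2))); last by rewrite mulrA (mulrC 2) divfK.
  by rewrite ler_wpM2l// (le_trans (sg_mul_nondecreasing _ _ r2 r2y)).
set J := far_mass ys in b3 *; have J0 : 0 <= J by exact: far_mass_ge0.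
move=> main.
have M0 : 0 <= sg (rho / 2) / rho by rewrite divr_ge0 ?ltW ?sg_gt0//; linarith.
have ysn := ltW ys0; have usn := ltW us.
(* Half of the left side has been absorbed; the remaining half is doubled. *)
have st1 : u ys * du ys <= 16 * ys * (C * u ys * (sg (rho / 2) / rho) + J).
  have t1 := ler_wpM2r M0 (ler_wpM2l ysn b1).
  have t2 := ler_wpM2l dus s1.
  have t3 := ler_wpM2l (mulr_ge0 dus usn) qC.
  move: main b4 t1 t2 t3; rewrite -/J; set M := sg _ / _; linarith.
(* The squared weight in [psi] exactly pays for the two powers of [rho] lost in
   [sg (rho / 2) / rho], since [d ys = rho / q^2]. *)
have Md : sg (rho / 2) / rho * d ys ^+ 2 <= 2 * (C * u ys) / q ^+ 4.
  have dE : d ys = rho / q ^+ 2 by rewrite /rho; field; rewrite gt_eqF.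
  rewrite (_ : sg (rho / 2) / rho * d ys ^+ 2 = rho * sg (rho / 2) / q ^+ 4); last first.
    by rewrite dE; move: rho0; clearbody rho => rho0; field; rewrite !gt_eqF.
  by rewrite ler_wpM2r// invr_ge0 exprn_ge0.
have Jd : J * d ys ^+ 2 <= C * u ys ^+ 2.
  apply: le_trans b3; rewrite mulrC ler_wpM2r// ler_pXn2r ?nnegrE//; linarith.
have st2 : u ys * psi ys <= u ys * (C2 * ys * u ys).
  have t1 := ler_wpM2r (sqr_ge0 (d ys)) st1.
  have t2 := ler_wpM2l (mulr_ge0 ysn (mulr_ge0 Cn usn)) Md.
  have t3 := ler_wpM2l ysn Jd.
  rewrite /psi C2E.
  have -> : u ys * (16 * (2 * C ^+ 2 / q ^+ 4 + C) * ys * u ys) =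
    16 * (ys * (C * u ys) * (2 * (C * u ys) / q ^+ 4)) + 16 * (ys * (C * u ys ^+ 2)) by ring.
  rewrite mulrA; apply: le_trans t1 _.
  rewrite (_ : _ * d ys ^+ 2 = 16 * (ys * (C * u ys) * (sg (rho / 2) / rho * d ys ^+ 2)) +
     16 * (ys * (J * d ys ^+ 2))); last by ring.
  by apply: lerD; rewrite ler_wpM2l.
have : psi ys <= C2 * ys * u ys by rewrite -(ler_pM2l us).
move=> /le_trans; apply.
have uss : u ys <= C * u x.
  by apply: le_trans (H1 x x0 xe1'); exact: u_nondecreasing.
rewrite (_ : 2 * C2 * C * (x * u x) = C2 * (2 * x) * (C * u x)); last by ring.
apply: ler_pM; rewrite ?mulr_ge0 ?(ltW ys0) ?(ltW us)//.
by rewrite ler_wpM2l//; linarith.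
Qed.


Hypothesis A_u : forall eps : R, 0 < eps -> exists2 d : R, 0 < d &
  forall x : R, 0 < x -> x < d -> `|A x - u x ^+ 2| <= eps * u x ^+ 2.
Hypothesis dA_u : forall eps : R, 0 < eps -> exists2 d : R, 0 < d &
  forall x : R, 0 < x -> x < d -> `|dA x - 2 * (u x * du x)| <= eps * (u x * du x).
Hypothesis du_c : forall y : R, 0 < y -> y < e -> {for y, continuous du}.

Lemma sg_div_ge0 (a : R) : 0 < a -> 0 <= sg a / a.
Proof. by move=> a0; rewrite divr_ge0 ?(ltW (sg_gt0 _ a0)) ?(ltW a0). Qed.

Lemma A_le_2sqr : exists2 d : R, 0 < d & forall x : R, 0 < x -> x < d ->
  A x <= 2 * u x ^+ 2 /\ u x ^+ 2 <= 2 * A x.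
Proof.
have [d d0 H] := A_u (1 / 2) ltac:(linarith); exists d => // x x0 xd.
have := H x x0 xd; have := sqr_ge0 (u x); rewrite ler_norml => ? /andP[? ?]; split; linarith.
Qed.

(** * The logarithmic case *)

Section LogCase.
Definition phi x := \int[mu]_(y in `]x, e[) (u y / y ^+ 2).
Notation t x := (sqrt (phi x)).
Hypothesis sg1 : forall a : R, sg a = 1.
Hypothesis S_log : forall x x' y : R, 0 <= x -> x <= x' -> x' < y ->
  (x' ^+ 2 - x ^+ 2) / y ^+ 2 <= dS x' y - dS x y <= (x' ^+ 2 - x ^+ 2) / (y ^+ 2 - x' ^+ 2).

Lemma phi_Itg (a b : R) : 0 < a -> Itg `]a, b[ (fun y => u y / y ^+ 2).
Proof.
move=> a0; have uB y : a < y -> y < b -> `|u y| <= B.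
  by move=> ay _; apply: normr_u_le; exact: lt_trans ay.
have := sg_weight_Itg a b B u a0 (measurable_funTS sg_meas) (u_measurable_oo a b (ltW a0)) uB.
apply: Itg_eq => // y.
rewrite /= in_itv/= => /andP[ay _]; have /andP[? _] := u_bnd y ltac:(linarith).
by rewrite sg1 ger0_norm// mul1r mulrC.
Qed.

Lemma invsqr_itv_oo (a b : R) : 0 < a -> a <= b ->
  Itg `]a, b[ (fun y => (y ^+ 2)^-1) /\ \int[mu]_(y in `]a, b[) (y ^+ 2)^-1 = a^-1 - b^-1.
Proof.
move=> a0 ab; have [i1 v1] := invsqr_itvy a a0; have [i2 v2] := invsqr_itvy b (lt_le_trans a0 ab).
split; first by apply: Itg_sub i1 => //; apply: subset_itvl.
by rewrite -v1 -v2 (Rint_split_oy a b _ ab i1) addrK.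
Qed.

Lemma phi_split (x z : R) : 0 < x -> x <= z -> z <= e ->
  phi x = \int[mu]_(y in `]x, z[) (u y / y ^+ 2) + phi z.
Proof. by move=> x0 xz ze; rewrite /phi (Rint_split_oo x z e) ?xz//; exact: phi_Itg. Qed.

Lemma u_div_sqr_ge0 (y : R) : 0 < y -> 0 <= u y / y ^+ 2.
Proof. by move=> /u_bnd /andP[? _]; rewrite divr_ge0 ?sqr_ge0. Qed.

Lemma phi_nonincreasing (x z : R) : 0 < x -> x <= z -> z <= e -> phi z <= phi x.
Proof.
move=> x0 xz ze; rewrite (phi_split x z)// lerDr.
by apply: Rintegral_ge0 => y; rewrite /= in_itv/= => /andP[xy _]; apply: u_div_sqr_ge0; linarith.
Qed.

Lemma phi_ge_block (x z : R) : 0 < x -> x <= z -> z <= e ->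
  u x * (x^-1 - z^-1) <= \int[mu]_(y in `]x, z[) (u y / y ^+ 2).
Proof.
move=> x0 xz ze; have [i v] := invsqr_itv_oo x z x0 xz.
rewrite -v -RintegralZl//; apply: le_Rint => //; [exact: ItgZl|exact: phi_Itg|].
move=> y; rewrite /= in_itv/= => /andP[xy yz]; rewrite ler_wpM2r ?invr_ge0 ?sqr_ge0//.
by apply: u_nondecreasing; [|exact: ltW|exact: lt_le_trans ze].
Qed.

Lemma phi_le_block (x z : R) : 0 < x -> x <= z -> z < e ->
  \int[mu]_(y in `]x, z[) (u y / y ^+ 2) <= u z * (x^-1 - z^-1).
Proof.
move=> x0 xz ze; have [i v] := invsqr_itv_oo x z x0 xz.
rewrite -v -RintegralZl//; apply: le_Rint => //; [exact: phi_Itg|exact: ItgZl|].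
move=> y; rewrite /= in_itv/= => /andP[xy yz]; rewrite ler_wpM2r ?invr_ge0 ?sqr_ge0//.
by apply: u_nondecreasing => //; [exact: lt_trans xy|exact: ltW].
Qed.

Lemma u_le_phi (x : R) : 0 < x -> 2 * x <= e -> u x <= 2 * x * phi x.
Proof.
move=> x0 xe; have h := phi_ge_block x e x0 ltac:(linarith) (lexx e).
have u0 : 0 <= u x by case/andP: (u_bnd x x0).
have ei : e^-1 <= (2 * x)^-1 by rewrite lef_pV2 ?posrE//; linarith.
have -> : u x = 2 * x * (u x * (x^-1 - (2 * x)^-1)) by field; rewrite gt_eqF.
rewrite ler_wpM2l//; first by rewrite mulr_ge0// ltW.
by apply: le_trans h; rewrite ler_wpM2l// lerB.
Qed.

Lemma phi_gt0 (x : R) : 0 < x -> 2 * x <= e -> 0 < phi x.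
Proof.
move=> x0 xe; have u0 : 0 < u x by apply: u_gt0; linarith.
have := lt_le_trans u0 (u_le_phi x x0 xe); rewrite pmulr_rgt0//; linarith.
Qed.

Lemma dS_log_bounds (x y : R) : 0 <= x -> x < y ->
  x ^+ 2 / y ^+ 2 <= dS x y <= x ^+ 2 / (y ^+ 2 - x ^+ 2).
Proof.
move=> x0 xy; have := S_log 0 x y (lexx 0) x0 xy.
by rewrite central_diff2_0 !subr0 expr0n/= !subr0.
Qed.

(** Beyond [x] the kernel is at least [x^2 / y^2] up to the remainder. Against [u y - u x] this
    gives [x^2 phi x], minus [u x] times an integral of [x^2 / y^2] that is at most [x]. *)
Lemma convolution_log_lower : exists2 C : R, 0 <= C & forall x : R, 0 < x -> 4 * x <= 3 * e ->
  x ^+ 2 * phi x - x * u x - C * x ^+ 2 <= A x.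
Proof.
have B0 := B_ge0.
exists (B * CR + B * (4 * (sg e / e) + CR)).
  have s0 := sg_div_ge0 e e0.
  by apply: addr_ge0; [exact: mulr_ge0|apply: mulr_ge0 => //; apply: addr_ge0 => //; exact: mulr_ge0].
move=> x x0 xe; have xe' : x < e by linarith.
have /andP[u0 uB] := u_bnd x x0.
have mw (D : set R) : D `<=` `]x, +oo[%classic -> measurable_fun D (fun y => u y - u x).
  move=> Dx; apply: measurable_funB => //; apply: measurable_funS u_meas => //.
  by move=> y /Dx; rewrite /= !in_itv/= !andbT; linarith.
have wB (D : set R) : D `<=` `]x, +oo[%classic -> forall y, D y -> `|u y - u x| <= B.
  move=> Dx y /Dx; rewrite /= in_itv/= andbT => xy.
  by have /andP[? ?] := u_bnd y ltac:(linarith); rewrite ler_norml; linarith.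
have xoo : (`]x, e[%classic : set R) `<=` `]x, +oo[%classic by apply: subset_itvl.
have eoo : (`]e, +oo[%classic : set R) `<=` `]x, +oo[%classic by apply: subset_itvr; rewrite bnd_simp ltW.
have ki (D : set R) : measurable D -> D `<=` `]x, +oo[%classic -> Itg D (fun y => dK x y * (u y - u x)).
  by move=> mD Dx; apply: (Itg_mulr_bounded _ _ _ B) => //; [exact: Itg_central_diff2|exact: mw|exact: wB].
have kiS (D : set R) : measurable D -> D `<=` `]x, +oo[%classic -> Itg D (fun y => dS x y * (u y - u x)).
  by move=> mD Dx; apply: (Itg_mulr_bounded _ _ _ B) => //; [exact: Itg_dS (ltW x0) _|exact: mw|exact: wB].
have LB := convolution_lower_bound K K_L1 K_even K_pos K_convex x B u x0 u_meas u_bnd.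
apply: le_trans (LB _); last by move=> y z y0 yz zx; apply: u_nondecreasing => //; linarith.
rewrite (Rint_split_oy x e _ (ltW xe')); last exact: ki.
have r1 := rem_le x B `]x, e[ (fun y => u y - u x) (ltW x0) ltac:(by []) (mw _ xoo) (wB _ xoo) B0.
have s1 : x ^+ 2 * phi x - x * u x <= \int[mu]_(y in `]x, e[) (dS x y * (u y - u x)).
  have [i v] := invsqr_itv_oo x e x0 (ltW xe').
  have i1 := ItgZl _ _ (x ^+ 2) (measurable_itv _) (phi_Itg x e x0).
  have i2 := ItgZl _ _ (x ^+ 2 * u x) (measurable_itv _) i.
  apply: (@le_trans _ _ (\int[mu]_(y in `]x, e[) (x ^+ 2 * (u y / y ^+ 2) - x ^+ 2 * u x * (y ^+ 2)^-1))); last first.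
    apply: le_Rint => //; [exact: ItgB|exact: kiS|].
    move=> y; rewrite /= in_itv/= => /andP[xy ye].
    have /andP[k1 _] := dS_log_bounds x y (ltW x0) xy.
    have -> : x ^+ 2 * (u y / y ^+ 2) - x ^+ 2 * u x * (y ^+ 2)^-1 = x ^+ 2 / y ^+ 2 * (u y - u x) by ring.
    by rewrite ler_wpM2r// subr_ge0 u_nondecreasing// ltW.
  rewrite RintegralB// !RintegralZl//; last exact: phi_Itg.
  rewrite -/(phi x) v lerD2l lerN2 (_ : x ^+ 2 * u x * (x^-1 - e^-1) = x * u x - x ^+ 2 * u x / e); last first.
    by field; rewrite !gt_eqF.
  by rewrite gerBl divr_ge0 ?(ltW e0)// mulr_ge0 ?sqr_ge0.
have s2 : - (u x * \int[mu]_(y in `]e, +oo[) dK x y) <= \int[mu]_(y in `]e, +oo[) (dK x y * (u y - u x)).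
  rewrite mulrC -mulrN -RintegralZr//; last exact: Itg_central_diff2.
  apply: le_Rint => //; [|exact: ki|].
    by apply: ItgZr => //; exact: Itg_central_diff2.
  move=> y; rewrite /= in_itv/= andbT => ey; rewrite ler_wpM2l//.
    by apply: central_diff2_ge0 => //; exact: lt_trans ey.
  by rewrite lerDr; case/andP: (u_bnd y (lt_trans e0 ey)).
have s3 : u x * \int[mu]_(y in `]e, +oo[) dK x y <= B * ((4 * (sg e / e) + CR) * x ^+ 2).
  apply: ler_pM => //; last exact: tail_dK_le.
  apply: Rintegral_ge0 => y; rewrite /= in_itv/= andbT => ey.
  by apply: central_diff2_ge0 => //; exact: lt_trans ey.
move: r1; rewrite ler_norml => /andP[r1 _].
rewrite mulrDl opprD addrA; apply: lerD; last first.
  by apply: le_trans s2; rewrite lerN2 -mulrA.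
by move: s1 r1; rewrite -mulrA; linarith.
Qed.

(** A fixed block away from 0 gives [A x] a contribution of order [x^2]. Together with [A <= 2 u^2]
    this forces [u] to be at least linear, unless [u x] already exceeds the threshold [kap]. *)
Lemma u_linear_lower : exists2 c : R, 0 < c &
  exists2 d : R, 0 < d & forall x : R, 0 < x -> x < d -> c * x <= u x.
Proof.
pose b := e / 2; have b0 : 0 < b by rewrite divr_gt0.
have [d1 d10 HA] := A_le_2sqr.
pose C := 4 * (sg b / b) + CR.
have C0 : 0 <= C by rewrite addr_ge0// mulr_ge0// sg_div_ge0.
have CRp : 0 < CR + 1 by rewrite ltr_wpDl.
(* The block []y1, 2 y1[] has kernel mass at least [x^2 / (2 y1) >= 2 (CR + 1) x^2], which outweighs
   the remainder [CR x^2]. *)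
pose y1 := Num.min (b / 4) (4 * (CR + 1))^-1.
have y10 : 0 < y1 by rewrite lt_min divr_gt0//= invr_gt0 mulr_gt0.
have y1b : y1 <= b / 4 by rewrite ge_min lexx.
have y1C : y1 <= (4 * (CR + 1))^-1 by rewrite ge_min lexx orbT.
have e0' := e0; have CR0' := CR0.
have be : b < e by rewrite /b; linarith.
have uy1 : 0 < u y1 by apply: u_gt0; linarith.
pose kap := u y1 / (2 * (1 + C)).
have kap0 : 0 < kap by rewrite divr_gt0// mulr_gt0//; linarith.
have c0 : 0 < sqrt (u y1) / 2 by rewrite divr_gt0// sqrtr_gt0.
exists (Num.min kap (sqrt (u y1) / 2)); first by rewrite lt_min kap0.
exists (Num.min (Num.min d1 1) y1); first by rewrite lt_min y10 andbT lt_min d10 ltr01.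
move=> x x0; rewrite lt_min => /andP[]; rewrite lt_min => /andP[xd1 x1] xy1.
have u0 : 0 <= u x by case/andP: (u_bnd x x0).
have [ku|uk] := leP kap (u x).
  apply: le_trans ku; apply: (@le_trans _ _ (kap * x)); first by rewrite ler_wpM2r ?(ltW x0)// ge_min lexx.
  by rewrite ler_piMr ?(ltW kap0)// ltW.
apply: (@le_trans _ _ (sqrt (u y1) / 2 * x)); first by rewrite ler_wpM2r ?(ltW x0)// ge_min lexx orbT.
have [HA1 _] := HA x x0 xd1.
have und y z : 0 < y -> y <= z -> z <= b -> u y <= u z.
  by move=> y0 yz zb; apply: u_nondecreasing => //; exact: le_lt_trans be.
have LB := convolution_lower_bound_block x y1 (2 * y1) b B u x0 xy1 ltac:(linarith) ltac:(linarith) u_meas u_bnd und.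
have [i v] := invsqr_itv_oo y1 (2 * y1) y10 ltac:(linarith).
have k1 : x ^+ 2 * (2 * (CR + 1)) <= \int[mu]_(y in `]y1, (2 * y1)[) dS x y.
  apply: (@le_trans _ _ (x ^+ 2 * (y1^-1 - (2 * y1)^-1))).
    rewrite ler_wpM2l ?sqr_ge0// (_ : y1^-1 - (2 * y1)^-1 = y1^-1 / 2); last by field; rewrite gt_eqF.
    have := y1C; rewrite -lef_pV2 ?posrE ?invr_gt0 ?mulr_gt0// invrK => h.
    by rewrite ler_pdivlMr//; linarith.
  rewrite -v -RintegralZl//; apply: le_Rint => //; [exact: ItgZl|exact: Itg_dS (ltW x0) _|].
  move=> y; rewrite /= in_itv/= => /andP[y1y _].
  by have /andP[] := dS_log_bounds x y (ltW x0) (lt_trans xy1 y1y).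
have tl := tail_dK_le x b x0 b0 ltac:(linarith); rewrite -/C in tl.
have du0 : 0 <= u y1 - u x by rewrite subr_ge0 und ?(ltW xy1)//; linarith.
have m1 := ler_wpM2l u0 tl.
have k2 : x ^+ 2 <= \int[mu]_(y in `]y1, (2 * y1)[) dS x y - CR * x ^+ 2.
  by have := mulr_ge0 CR0 (sqr_ge0 x); have := sqr_ge0 x; linarith.
have m2 := ler_wpM2l du0 k2.
have m3 : u x * (2 * (1 + C)) <= u y1 by rewrite -ler_pdivlMr ?ltW// mulr_gt0//; linarith.
have m4 := ler_wpM2r (sqr_ge0 x) m3.
have : x ^+ 2 * u y1 <= 4 * u x ^+ 2.
  by move: LB HA1 m1 m2 m4; set a := A x; set i1 := \int[mu]_(y in `]b, +oo[) _; linarith.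
move=> m5; rewrite -(ler_pXn2r (n := 2)) ?nnegrE ?mulr_ge0 ?(ltW c0) ?(ltW x0)//.
rewrite !exprMn [sqrt _ ^+ 2]expr2 sqrt_sqr ?(ltW uy1)//.
rewrite (_ : 2^-1 ^+ 2 = 4^-1); last by field.
linarith.
Qed.

(** By the linear lower bound every dyadic block adds at least [c / 2], as for the harmonic
    series. *)
Lemma phi_unbounded (M : R) : exists2 d : R, 0 < d & forall x : R, 0 < x -> x < d -> M <= phi x.
Proof.
have e0' := e0.
have [c c0 [d d0 Hu]] := u_linear_lower.
pose d1 := Num.min (d / 2) (e / 2).
have d10 : 0 < d1 by rewrite lt_min !divr_gt0.
have d1d : d1 <= d / 2 by rewrite ge_min lexx.
have d1e : d1 <= e / 2 by rewrite ge_min lexx orbT.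
have pw k : 0 < d1 / 2 ^+ k <= d1.
  by rewrite divr_gt0 ?exprn_gt0//= ler_pdivrMr ?exprn_gt0// ler_peMr ?(ltW d10)// exprn_ege1// ler1n.
have H k : k%:R * (c / 2) <= phi (d1 / 2 ^+ k).
  elim: k => [|k IH].
    by rewrite mul0r ltW// phi_gt0 ?expr0 ?divr1//; linarith.
  have /andP[x0 xd] := pw k.+1; set x := d1 / 2 ^+ k.+1 in x0 xd *.
  have E : d1 / 2 ^+ k = 2 * x by rewrite /x exprS; field; rewrite expf_neq0.
  have /andP[_ xd'] := pw k; rewrite E in IH xd'.
  rewrite (phi_split x (2 * x)); try linarith.
  have := phi_ge_block x (2 * x) x0 ltac:(linarith) ltac:(linarith).
  rewrite (_ : x^-1 - (2 * x)^-1 = (2 * x)^-1); last by field; rewrite gt_eqF.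
  have cu : c / 2 <= u x * (2 * x)^-1.
    by rewrite ler_pdivlMr ?mulr_gt0//; have := Hu x x0 ltac:(linarith); linarith.
  by move=> h; rewrite -natr1 mulrDl mul1r [leLHS]addrC; apply: lerD => //; exact: le_trans h.
have [k Hk] : exists k : nat, M <= k%:R * (c / 2).
  exists (Num.bound `|M / (c / 2)|).
  rewrite -ler_pdivrMr ?divr_gt0//; apply: le_trans (ler_norm _) _.
  by rewrite ltW// archi_boundP.
have /andP[p0 pd] := pw k.
exists (d1 / 2 ^+ k) => // x x0 xd; apply: le_trans Hk _; apply: le_trans (H k) _.
by apply: phi_nonincreasing; [|exact: ltW|linarith].
Qed.

(** Beyond [2 x] the kernel exceeds [x^2 / y^2] by [x^4 / (y^2 (y^2 - x^2))]. Against [u y <= D y]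
    this excess integrates to order [x^2 D]; below [2 x] the kernel is bounded crudely by
    [near_le]. *)
Lemma convolution_log_upper : exists2 C : R, 0 <= C & forall x D : R, 0 < x -> 4 * x <= e -> 0 <= D ->
  (forall y : R, 2 * x < y -> y < e -> u y <= D * y) ->
  A x <= x ^+ 2 * phi x + 12 * (x * u (2 * x)) + x ^+ 2 * D + C * x ^+ 2.
Proof.
have B0 := B_ge0; have s0 := sg_div_ge0 e e0.
exists (B * CR + 4 * (sg e / e) * B); first exact: addr_ge0 (mulr_ge0 B0 CR0) (mulr_ge0 (mulr_ge0 _ s0) B0).
move=> x D x0 xe D0 uD; have x2 : 0 < 2 * x by linarith. have xe' : 2 * x < e by linarith.
have mP : measurable (`]0, +oo[%classic : set R) by exact: measurable_itv.
have wB y : `]0, +oo[%classic y -> `|u y| <= B by rewrite /= in_itv/= andbT; exact: normr_u_le.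
have ik : Itg `]0, +oo[ (fun y => dS x y * u y).
  by apply: (Itg_mulr_bounded _ _ _ B) => //; exact: Itg_dS (ltW x0) _.
have r1 := rem_le x B _ u (ltW x0) mP u_meas wB B0.
rewrite [X in `|_ - X|](Rint_split_oy 0 (2 * x) _ (ltW x2) ik) in r1.
rewrite (Rint_split_oy (2 * x) e _ (ltW xe')) in r1; last first.
  by apply: Itg_sub ik => //; apply: subset_itvr; rewrite bnd_simp ltW.
have n1 : \int[mu]_(y in `]0, (2 * x)[) (dS x y * u y) <= 12 * (x * sg x) * u (2 * x).
  apply: near_le => //; [exact: u_measurable_oo| |by case/andP: (u_bnd _ x2)].
  move=> y y0 y2; have /andP[-> _] := u_bnd y y0.
  by rewrite u_nondecreasing// ltW.
have t1 : `|\int[mu]_(y in `]e, +oo[) ((dS x y - dS 0 y) * u y)| <= 4 * (x ^+ 2 - 0 ^+ 2) * (sg e / e) * B.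
  apply: tail_le => //; [exact: ltW|linarith|by apply: u_measurable_oy; exact: ltW|].
  by move=> y ey; apply: normr_u_le; exact: lt_trans ey.
move: t1; under eq_Rint do rewrite central_diff2_0 subr0.
rewrite expr0n subr0 => t1.
have f1 : \int[mu]_(y in `](2 * x), e[) (dS x y * u y) <= x ^+ 2 * phi (2 * x) + x ^+ 2 * D.
  have [i v] := invsqr_itvy (2 * x) x2.
  have sub : (`](2 * x), e[%classic : set R) `<=` `](2 * x), +oo[%classic by apply: subset_itvl.
  have i' : Itg `](2 * x), e[ (fun y => (y ^+ 2)^-1) by apply: Itg_sub i.
  have i1 := ItgZl _ _ (x ^+ 2) (measurable_itv _) (phi_Itg (2 * x) e x2).
  have i2 := ItgZl _ _ (2 * x ^+ 3 * D) (measurable_itv _) i'.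
  apply: (@le_trans _ _ (\int[mu]_(y in `](2 * x), e[) (x ^+ 2 * (u y / y ^+ 2) + 2 * x ^+ 3 * D * (y ^+ 2)^-1))).
    apply: le_Rint => //; [|exact: ItgD|].
      by apply: Itg_sub ik => //; move=> y; rewrite /= !in_itv/= andbT => /andP[? _]; linarith.
    move=> y; rewrite /= in_itv/= => /andP[xy ye]; have y0 : 0 < y by linarith.
    have /andP[_ k1] := dS_log_bounds x y (ltW x0) ltac:(linarith).
    have u0 : 0 <= u y by case/andP: (u_bnd y y0).
    apply: le_trans (ler_wpM2r u0 k1) _.
    have yx : 0 < y ^+ 2 - x ^+ 2 by rewrite subr_sqr mulr_gt0; linarith.
    have -> : x ^+ 2 / (y ^+ 2 - x ^+ 2) * u y =
      x ^+ 2 * (u y / y ^+ 2) + x ^+ 4 * (u y / (y ^+ 2 - x ^+ 2)) * (y ^+ 2)^-1.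
      by field; rewrite !gt_eqF.
    rewrite lerD2l ler_wpM2r ?invr_ge0 ?sqr_ge0//.
    rewrite (_ : 2 * x ^+ 3 * D = x ^+ 4 * (2 * D / x)); last by field; rewrite gt_eqF.
    rewrite ler_wpM2l ?exprn_ge0 ?(ltW x0)// ler_pdivrMr// mulrAC ler_pdivlMr//.
    have h1 := uD y xy ye.
    apply: le_trans (ler_wpM2r (ltW x0) h1) _; rewrite [2 * D]mulrC -!mulrA ler_wpM2l//.
    by rewrite mulrC; nra.
  rewrite RintegralD// !RintegralZl//; last exact: phi_Itg.
  rewrite -/(phi (2 * x)) lerD2l; have : \int[mu]_(y in `](2 * x), e[) (y ^+ 2)^-1 <= (2 * x)^-1.
    by rewrite -v; apply: Rint_sub_le => // y _; rewrite invr_ge0 sqr_ge0.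
  move=> /(ler_wpM2l (_ : 0 <= 2 * x ^+ 3 * D)) => /(_ ltac:(by rewrite !mulr_ge0 ?exprn_ge0 ?(ltW x0))).
  move=> /le_trans; apply; rewrite le_eqVlt; apply/orP; left; apply/eqP.
  by field; rewrite gt_eqF.
have p2 : phi (2 * x) <= phi x by apply: phi_nonincreasing => //; linarith.
have p3 := ler_wpM2l (sqr_ge0 x) p2.
move: r1 t1; rewrite !ler_norml => /andP[_ r1] /andP[_ t1].
rewrite sg1 mulr1 in n1.
move: r1 t1 n1 f1 p3; set a := A x; set i1 := \int[mu]_(y in `]0, (2 * x)[) _.
set i2 := \int[mu]_(y in `](2 * x), e[) (dS _ _ * _); set i3 := \int[mu]_(y in `]e, +oo[) _.
by linarith.
Qed.

Lemma t_gt0 (x : R) : 0 < x -> 2 * x <= e -> 0 < t x.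
Proof. by move=> x0 xe; rewrite sqrtr_gt0 phi_gt0. Qed.

Lemma t_sqr (x : R) : 0 < x -> 2 * x <= e -> t x ^+ 2 = phi x.
Proof. by move=> x0 xe; rewrite expr2 sqrt_sqr// ltW// phi_gt0. Qed.

Lemma t_nonincreasing (x z : R) : 0 < x -> x <= z -> z <= e -> t z <= t x.
Proof. by move=> x0 xz ze; apply: ler_wsqrtr; exact: phi_nonincreasing. Qed.

Lemma t_unbounded (M : R) : exists2 d : R, 0 < d & forall x : R, 0 < x -> x < d -> M <= t x.
Proof.
have [d d0 H] := phi_unbounded (M ^+ 2); exists d => // x x0 xd.
apply: le_trans (ler_norm _) _; rewrite -sqrtr_sqr; apply: ler_wsqrtr; exact: H.
Qed.

(** Converts a bound at [y] by [psi y], valid for small [y], into one by the larger [psi x], uniform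
    in [y >= x] up to [e]. It is applied with [phi] and then with its square root. *)
Lemma u_linear_growth (d M c : R) (psi : R -> R) : 0 < d -> d <= e / 2 -> 0 <= M -> 0 < c ->
  (forall y : R, 0 < y -> y < d -> u y <= M * y * psi y) ->
  (forall x z : R, 0 < x -> x <= z -> z <= e / 2 -> psi z <= psi x) ->
  c <= psi (e / 2) ->
  exists2 C : R, 0 <= C &
    forall x y : R, 0 < x -> 2 * x <= e -> x <= y -> y < e -> u y <= C * psi x * y.
Proof.
move=> d0 de M0 c0 Hu mono hc; have B0 := B_ge0; have e0' := e0.
have dc : 0 <= B / (d * c) by rewrite divr_ge0// mulr_ge0// ltW.
exists (M + B / (d * c)); first exact: addr_ge0.
move=> x y x0 xe xy ye; have y0 : 0 < y by exact: lt_le_trans xy.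
have px : c <= psi x by apply: le_trans hc _; apply: mono => //; linarith.
have px0 : 0 <= psi x by apply: le_trans px; exact: ltW.
have e1 : 0 <= M * psi x * y by rewrite !mulr_ge0// ltW.
have e2 : 0 <= B / (d * c) * psi x * y by apply: mulr_ge0; [exact: mulr_ge0|exact: ltW].
rewrite mulrDl mulrDl; have [yd|dy] := ltP y d.
  apply: le_trans (Hu y y0 yd) _; apply: le_trans (_ : M * psi x * y <= _); last by rewrite lerDl.
  rewrite mulrAC ler_wpM2r ?(ltW y0)// ler_wpM2l// mono//; linarith.
apply: le_trans (_ : B / (d * c) * psi x * y <= _); last by rewrite lerDr.
have /andP[_ uB] := u_bnd y y0; apply: le_trans uB _.
rewrite -mulrA mulrAC ler_pdivlMr ?mulr_gt0// ler_wpM2l// mulrC.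
by apply: ler_pM => //; exact: ltW.
Qed.

(** A bootstrap: monotonicity first gives [u y <= 2 y phi y]. Inserted in the upper bound for [A],
    this makes [A y], hence [u y ^+ 2], of order [y^2 phi y], so the factor [phi] improves to its
    square root. *)
Lemma u_le_t : exists2 C : R, 0 <= C &
  forall x y : R, 0 < x -> 2 * x <= e -> x <= y -> y < e -> u y <= C * t x * y.
Proof.
have e0' := e0; have B0 := B_ge0; have e2 : 0 < e / 2 by rewrite divr_gt0.
have pe : 0 < phi (e / 2) by apply: phi_gt0 => //; linarith.
have [C1 C10 H1] : exists2 C : R, 0 <= C &
    forall x y : R, 0 < x -> 2 * x <= e -> x <= y -> y < e -> u y <= C * phi x * y.
  apply: (u_linear_growth (e / 2) 2 (phi (e / 2)) (fun x => phi x)) => //.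
    by move=> y y0 ye; apply: u_le_phi => //; linarith.
  by move=> x z x0 xz ze; apply: phi_nonincreasing => //; linarith.
have [C C0 HU] := convolution_log_upper.
have [d d0 HA] := A_le_2sqr.
pose M := 2 * (1 + 24 * C1 + C1 + C / phi (e / 2)).
have q0 : 0 <= C / phi (e / 2) by rewrite divr_ge0// ltW.
have M0 : 0 <= M.
  by rewrite /M; move: q0 C10; set q := C / _; clearbody q; linarith.
pose d' := Num.min d (e / 4).
have d'0 : 0 < d' by rewrite lt_min d0 divr_gt0.
have d'd : d' <= d by rewrite ge_min lexx.
have d'e : d' <= e / 4 by rewrite ge_min lexx orbT.
clearbody d'.
apply: (u_linear_growth d' (sqrt M) (t (e / 2)) (fun x => t x)) => //.
- linarith.
- by rewrite sqrtr_gt0.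
- move=> y y0 yd.
  have u0 : 0 <= u y by case/andP: (u_bnd y y0).
  have py : phi (e / 2) <= phi y by apply: phi_nonincreasing; linarith.
  have p0 : 0 < phi y by exact: lt_le_trans py.
  have := HU y (C1 * phi y) y0 ltac:(linarith) ltac:(by rewrite mulr_ge0// ltW).
  have [_ h2] := HA y y0 ltac:(linarith).
  have hD z : 2 * y < z -> z < e -> u z <= C1 * phi y * z.
    by move=> zy ze; apply: H1 => //; linarith.
  move=> /(_ hD) h1.
  have h3 := H1 y (2 * y) y0 ltac:(linarith) ltac:(linarith) ltac:(linarith).
  have h4 : C * y ^+ 2 <= C / phi (e / 2) * (y ^+ 2 * phi y).
    rewrite mulrAC ler_pdivlMr// -mulrA ler_wpM2l// ler_wpM2l ?sqr_ge0//.
  have h5 := ler_wpM2l (ltW y0) h3.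
  have uM : u y ^+ 2 <= M * (y ^+ 2 * phi y).
    rewrite /M; move: h1 h2 h4 h5; set a := A y; set p := phi y; set q := C / _; linarith.
  rewrite -[leLHS]ger0_norm// -sqrtr_sqr.
  have -> : sqrt M * y * t y = sqrt (M * (y ^+ 2 * phi y)).
    by rewrite (sqrtrM _ M0) (sqrtrM _ (sqr_ge0 y)) sqrtr_sqr gtr0_norm// mulrA.
  exact: ler_wsqrtr.
- by move=> x z x0 xz ze; apply: t_nonincreasing => //; linarith.
Qed.

(** All error terms are of order [x^2 t x] by [u_le_t]. Those of order [x^2] are absorbed as well,
    because [t] is bounded below near 0. *)
Lemma A_phi : exists2 C : R, 0 <= C & exists2 d : R, 0 < d &
  forall x : R, 0 < x -> x < d -> `|A x - x ^+ 2 * phi x| <= C * (x ^+ 2 * t x).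
Proof.
have e0' := e0; have [C1 C10 H1] := u_le_t.
have [C2 C20 H2] := convolution_log_upper; have [C3 C30 H3] := convolution_log_lower.
have te : 0 < t (e / 2) by apply: t_gt0; linarith.
exists (25 * C1 + (C2 + C3) / t (e / 2)).
  apply: addr_ge0; first exact: mulr_ge0.
  by apply: divr_ge0; [exact: addr_ge0|exact: ltW].
exists (e / 4); first by rewrite divr_gt0.
move=> x x0 xe; have x4 : 4 * x <= e by linarith.
have x2 : 2 * x <= e by linarith.
have xx2 : x <= 2 * x by linarith.
have x3 : 4 * x <= 3 * e by linarith.
have tx : t (e / 2) <= t x by apply: t_nonincreasing => //; linarith.
have tx0 : 0 < t x by exact: lt_le_trans tx.
have h1 := H1 x x x0 x2 (lexx x) ltac:(linarith).
have h2 := H1 x (2 * x) x0 x2 xx2 ltac:(linarith).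
have h3 := H2 x (C1 * t x) x0 x4 ltac:(by rewrite mulr_ge0// ltW).
have hD z : 2 * x < z -> z < e -> u z <= C1 * t x * z.
  by move=> zy ze; apply: H1 => //; exact: le_trans xx2 (ltW zy).
have {}h3 := h3 hD.
have h4 := H3 x x0 x3.
have h5 := ler_wpM2l (ltW x0) h1; have h6 := ler_wpM2l (ltW x0) h2.
have h7 : (C2 + C3) * x ^+ 2 <= (C2 + C3) / t (e / 2) * (x ^+ 2 * t x).
  rewrite mulrAC ler_pdivlMr// -mulrA ler_wpM2l ?addr_ge0// ler_wpM2l ?sqr_ge0//.
have p1 : 0 <= C2 * x ^+ 2 by rewrite mulr_ge0 ?sqr_ge0.
have p2 : 0 <= C3 * x ^+ 2 by rewrite mulr_ge0 ?sqr_ge0.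
have p3 : 0 <= C1 * (x ^+ 2 * t x) by rewrite !mulr_ge0 ?sqr_ge0// ltW.
rewrite ler_norml; move: h3 h4 h5 h6 h7 p1 p2 p3.
set a := A x; set p := phi x; set q := _ / t (e / 2); set s := t x; clearbody q s; linarith.
Qed.

Lemma u_equiv (eps : R) : 0 < eps -> exists2 d : R, 0 < d &
  forall x : R, 0 < x -> x < d -> `|u x - x * t x| <= eps * (x * t x).
Proof.
wlog e1 : eps / eps <= 1 / 2.
  move=> H e0'; have [|e1] := leP eps (1 / 2); first by move=> /H; exact.
  have [d d0 Hd] := H (1 / 2) (lexx _) ltac:(linarith); exists d => // x x0 xd.
  have [u0 _] := andP (u_bnd x x0); apply: le_trans (Hd x x0 xd) _.
  by rewrite ler_wpM2r ?(ltW e1)// mulr_ge0 ?sqrtr_ge0// ltW.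
move=> ep; have e0' := e0.
(* The passage from squares to values in [normr_sub_le_of_sqr] costs a factor four. *)
pose et := eps / 4; have et0 : 0 < et by rewrite divr_gt0.
have [C C0 [d1 d10 H1]] := A_phi.
have [d2 d20 H2] := A_u et et0.
have [d3 d30 H3] := t_unbounded (C / et).
exists (Num.min (Num.min d1 d2) (Num.min d3 (e / 2))).
  by rewrite !lt_min d10 d20 d30 divr_gt0.
move=> x x0; rewrite !lt_min => /andP[/andP[xd1 xd2] /andP[xd3 xe]].
have xe2 : 2 * x <= e by linarith.
have tx0 := t_gt0 x x0 xe2; have tE := t_sqr x x0 xe2.
have h1 := H1 x x0 xd1; have h2 := H2 x x0 xd2; have h3 := H3 x x0 xd3.
have u0 : 0 <= u x by case/andP: (u_bnd x x0).
have h4 : C * (x ^+ 2 * t x) <= et * (x * t x) ^+ 2.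
  rewrite ler_pdivrMr// in h3.
  rewrite (_ : et * (x * t x) ^+ 2 = t x * et * (x ^+ 2 * t x)); last by ring.
  by rewrite ler_wpM2r// mulr_ge0 ?sqr_ge0// ltW.
have s0 : 0 < x * t x by rewrite mulr_gt0.
have pE : x ^+ 2 * phi x = (x * t x) ^+ 2 by rewrite exprMn tE.
move: h1 h2 h4; rewrite pE.
set s := x * t x in s0 *; set v := u x in u0 *; set a := A x.
move=> h1 h2 h4; have {}h1 := le_trans h1 h4; move: h1.
move: h2; rewrite !ler_norml; clearbody s v a => /andP[h2 h2'] /andP[h3' h3''].
have q1 : (1 - et) * v ^+ 2 <= (1 + et) * s ^+ 2 by linarith.
have q2 : (1 - et) * s ^+ 2 <= (1 + et) * v ^+ 2 by linarith.
have etE : eps = 4 * et by rewrite /et; field.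
have et8 : et <= 1 / 8 by rewrite /et; linarith.
rewrite etE -ler_norml; exact: normr_sub_le_of_sqr.
Qed.

(** The variable end of [phi] is the lower one. Near [x], [phi] is therefore rewritten as [phi a]
    minus an integral from a fixed [a = x / 2] to the variable. *)
Lemma phi_derive (x : R) : 0 < x -> x < e -> is_derive x 1 (fun x => phi x) (- (u x / x ^+ 2)).
Proof.
move=> x0 xe; pose a := x / 2; have a0 : 0 < a by rewrite divr_gt0.
have ax : a < x by rewrite /a; linarith.
pose f (y : R) := u y / y ^+ 2; pose F z := \int[mu]_(y in `]a, z]) f y.
have fi c : a < c -> Itg `]a, c] f.
  move=> ac; have := phi_Itg a (c + 1) a0; apply: Itg_sub => //.
  by apply: subset_itvl; rewrite bnd_simp ltrDl.
have fc : {for x, continuous f}.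
  apply: cM (dcontinuous (u_der x x0 xe)) (cV _ _); first by rewrite expf_neq0 ?gt_eqF.
  exact: exprn_continuous.
have xw : x < (x + e) / 2 by linarith.
have ab : (BRight a < BRight x)%O by rewrite bnd_simp.
have [dF FE] := @continuous_FTC1 R f (BRight a) x _ xw (fi _ (lt_trans ax xw)) ab fc.
have FD : is_derive x 1 F (f x) by rewrite -FE derive1E; exact: DeriveDef.
apply: (@near_eq_is_derive _ _ _ (fun z => phi a - F z)); last first.
  by apply: (deq _ (dB (dcst (phi a) x) FD)); rewrite sub0r.
near=> z; have az : a < z by near: z; exact: lt_nbhsr.
have ze : z < e by near: z; exact: lt_nbhsl.
rewrite (phi_split a z a0 (ltW az) (ltW ze)) /F -Rintegral_itv_bndo_bndc; last exact: phi_Itg.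
by rewrite addrAC subrr add0r.
Unshelve. all: by end_near. Qed.

Lemma t_derive (x : R) : 0 < x -> 2 * x <= e ->
  is_derive x 1 (fun x => t x) (- (u x / (2 * (x ^+ 2 * t x)))).
Proof.
move=> x0 xe; have xe' : x < e by linarith.
apply: (deq _ (dsqrtc (phi_gt0 x x0 xe) (phi_derive x x0 xe'))).
by rewrite mulNr invfM [in RHS]mulrCA invfM !mulrA; congr (- _); rewrite !invfM; ring.
Qed.

(** The derivative of [t] is close to that of [- ln x / 2], so adding or subtracting
    [eps / 2 * ln x] makes the difference monotone on []0, z0]]. Its value at [z0] is a constant,
    eventually smaller than [eps / 2 * - ln x]. *)
Lemma t_equiv (eps : R) : 0 < eps -> exists2 d : R, 0 < d &
  forall x : R, 0 < x -> x < d -> `|t x + ln x / 2| <= eps * - ln x.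
Proof.
move=> ep; have e0' := e0; have [d1 d10 H] := u_equiv eps ep.
pose z0 := Num.min (d1 / 2) (e / 4).
have z00 : 0 < z0 by rewrite lt_min !divr_gt0.
have z0d : z0 < d1 by rewrite gt_min; apply/orP; left; linarith.
have z0e : z0 <= e / 4 by rewrite ge_min lexx orbT.
clearbody z0.
(* The sign [s] is 1 or -1, and treats the upper and lower bounds together. *)
pose f (s x : R) := t x + ln x / 2 + s * (eps / 2 * ln x).
pose df (s x : R) := - (u x / (2 * (x ^+ 2 * t x))) + x^-1 / 2 + s * (eps / 2 * x^-1).
have fd s x : 0 < x -> x <= z0 -> is_derive x 1 (f s) (df s x).
  move=> x0 xz; have lnd := is_derive1_ln x0.
  have d1' := t_derive x x0 ltac:(linarith).
  apply: (deq _ (dD (dD d1' (dM lnd (dcst 2^-1 x))) (dZ s (dZ (eps / 2) lnd)))).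
  by rewrite /df mulr0 addr0.
have dfE s x : 0 < x -> x <= z0 ->
    df s x = (2 * (x * (x * t x)))^-1 * (s * (eps * (x * t x)) - (u x - x * t x)).
  move=> x0 xz; have tx : 0 < t x by apply: t_gt0 => //; linarith.
  by rewrite /df; move: tx; set T := t x; clearbody T => tx; field; rewrite !gt_eqF.
have dfp x : 0 < x -> x <= z0 -> 0 <= df 1 x /\ df (-1) x <= 0.
  move=> x0 xz; have tx : 0 < t x by apply: t_gt0 => //; linarith.
  have xt : 0 < (2 * (x * (x * t x)))^-1 by rewrite invr_gt0 !mulr_gt0.
  have := H x x0 ltac:(linarith); rewrite ler_norml => /andP[h1 h2].
  by rewrite !dfE// pmulr_rge0// pmulr_rle0//; split; linarith.
have key x : 0 < x -> x < z0 -> f 1 x <= f 1 z0 /\ f (-1) z0 <= f (-1) x.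
  move=> x0 xz; split.
    rewrite -subr_ge0; have [|c /andP[c1 c2] ->] := @MVT_pt R (f 1) (df 1) x z0 xz.
      by move=> c /andP[c1 c2]; apply: fd => //; exact: lt_le_trans c1.
    by rewrite mulr_ge0 ?subr_ge0 ?(ltW xz)//; case: (dfp c (lt_trans x0 c1) (ltW c2)).
  rewrite -subr_le0; have [|c /andP[c1 c2] ->] := @MVT_pt R (f (-1)) (df (-1)) x z0 xz.
    by move=> c /andP[c1 c2]; apply: fd => //; exact: lt_le_trans c1.
  by rewrite mulr_le0_ge0 ?subr_ge0 ?(ltW xz)//; case: (dfp c (lt_trans x0 c1) (ltW c2)).
pose M := `|f 1 z0| + `|f (-1) z0|.
exists (Num.min z0 (expR (- (2 * M / eps)))); first by rewrite lt_min z00 expR_gt0.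
move=> x x0; rewrite lt_min => /andP[xz xM]; have [k1 k2] := key x x0 xz.
have lx : ln x <= - (2 * M / eps).
  by rewrite -[leRHS]expRK ler_ln ?posrE ?expR_gt0// ltW.
have lM : M <= eps / 2 * - ln x.
  by move: lx; rewrite lerNr ler_pdivrMr//; linarith.
have M1 : f 1 z0 <= M by rewrite /M; apply: le_trans (ler_norm _) _; rewrite lerDl.
have M2 : - M <= f (-1) z0.
  by rewrite lerNl /M; apply: le_trans (ler_norm _) _; rewrite normrN lerDr.
move: k1 k2 M1 M2; rewrite {1}/f; rewrite [X in _ -> _ <= X -> _]/f.
move: (f 1 z0) (f (-1) z0) lM => a b; clearbody M; move: (t x) => T lM k1 k2 M1 M2.
rewrite ler_norml; linarith.
Qed.

Lemma u_double_le : exists2 C : R, 0 < C & exists2 d : R, 0 < d & d <= e / 4 /\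
  forall x : R, 0 < x -> x < d -> [/\ x * t x <= C * u x, u (2 * x) <= C * u x & u x <= C * (x * t x)].
Proof.
have e0' := e0; have [C1 C10 H1] := u_le_t; have [d1 d10 H2] := u_equiv (1 / 2) ltac:(linarith).
exists (2 + 4 * C1); first linarith.
exists (Num.min d1 (e / 4)); first by rewrite lt_min d10 divr_gt0.
split; first by rewrite ge_min lexx orbT.
move=> x x0; rewrite lt_min => /andP[xd xe].
have x2 : 2 * x <= e by linarith.
have tx := t_gt0 x x0 x2.
have := H2 x x0 xd; rewrite ler_norml => /andP[h1 h2].
have h3 := H1 x (2 * x) x0 x2 ltac:(linarith) ltac:(linarith).
have s0 : 0 < x * t x by rewrite mulr_gt0.
have h4 : x * t x <= 2 * u x by linarith.
have u0 : 0 <= u x by case/andP: (u_bnd x x0).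
have h5 := ler_wpM2l C10 h4; have h6 := mulr_ge0 C10 u0; have h7 := mulr_ge0 C10 (ltW s0).
by move: h1 h2 h3 h4 h5 h6 h7 s0; move: (t x) => T *; split; linarith.
Qed.

(** Every hypothesis of [du_le] reduces to the comparability of [u x] with [x * t x]. Here
    [far_mass] is [phi] at [2 x] plus a constant, and [phi], bounded below near 0, absorbs the
    constant. *)
Lemma du_log_le : exists2 C : R, 0 <= C & exists2 d : R, 0 < d &
  forall x : R, 0 < x -> x < d -> du x <= C * t x.
Proof.
have e0' := e0; have B0 := B_ge0; have s0 := sg_div_ge0 e e0; have CR0' := CR0.
have [C1 C10 [d1 d10 [d1e H1]]] := u_double_le.
have [c c0 [d2 d20 H2]] := u_linear_lower.
have [d3 d30 H3] := dA_u 1 ltr01.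
have pe : 0 < phi (e / 2) by apply: phi_gt0; linarith.
pose D := B * (sg e / e) + B * CR.
have D0 : 0 <= D := addr_ge0 (mulr_ge0 B0 s0) (mulr_ge0 B0 CR0).
have q0 : 0 <= D / phi (e / 2) by rewrite divr_ge0// ltW.
pose C := C1 + c^-1 + C1 ^+ 2 * (1 + D / phi (e / 2)).
have C12 : 0 <= C1 ^+ 2 * (1 + D / phi (e / 2)) by rewrite mulr_ge0 ?sqr_ge0// addr_ge0.
have ci : 0 < c^-1 by rewrite invr_gt0.
have C0 : 0 < C by rewrite /C; move: C12; set q := C1 ^+ 2 * _; linarith.
pose e1 := Num.min d1 (Num.min d2 d3).
have e10 : 0 < e1 by rewrite !lt_min d10 d20.
have e1d1 : e1 <= d1 by rewrite ge_min lexx.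
have e1d2 : e1 <= d2 by rewrite !ge_min lexx orbT.
have e1d3 : e1 <= d3 by rewrite !ge_min lexx !orbT.
have le (a b : R) : 0 <= b -> a <= C -> a * b <= C * b by move=> ? ?; exact: ler_wpM2r.
have CC1 : C1 <= C by rewrite /C; move: C12 ci; set q := C1 ^+ 2 * _; linarith.
have Cc : c^-1 <= C by rewrite /C; move: C12 C10; set q := C1 ^+ 2 * _; linarith.
have CC2 : C1 ^+ 2 * (1 + D / phi (e / 2)) <= C.
  by rewrite /C; move: ci C10; set q := C1 ^+ 2 * _; linarith.
clearbody C e1.
have [| | | |C' C'0 H] := du_le C e1 C0 e10 ltac:(linarith) du_c.
- move=> y y0 ye; have u0 : 0 <= u y by case/andP: (u_bnd y y0).
  by have [_ h _] := H1 y y0 ltac:(linarith); apply: le_trans h _; exact: le.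
- move=> y y0 ye; rewrite sg1 mulr1; have u0 : 0 <= u y by case/andP: (u_bnd y y0).
  by apply: le_trans (le _ _ u0 Cc); rewrite mulrC ler_pdivlMr// mulrC H2//; linarith.
- move=> y y0 ye; have y2 : 2 * y <= e by linarith.
  have u0 : 0 <= u y by case/andP: (u_bnd y y0).
  have [h _ _] := H1 y y0 ltac:(linarith).
  have tE := t_sqr y y0 y2; have ty := t_gt0 y y0 y2.
  have fm : far_mass y = phi (2 * y) + D.
    rewrite /far_mass -addrA; congr (_ + _); apply: eq_Rint => z _.
    by rewrite sg1 div1r mulrC.
  have p1 : phi (2 * y) <= phi y by apply: phi_nonincreasing => //; linarith.
  have p2 : phi (e / 2) <= phi y by apply: phi_nonincreasing => //; linarith.
  have f1 : far_mass y <= (1 + D / phi (e / 2)) * phi y.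
    rewrite fm [leRHS]mulrDl mul1r; apply: lerD => //.
    by rewrite mulrAC ler_pdivlMr// ler_wpM2l.
  have f2 : y ^+ 2 * phi y <= C1 ^+ 2 * u y ^+ 2.
    rewrite -tE -!exprMn ler_pXn2r// nnegrE ?mulr_ge0 ?(ltW y0) ?(ltW ty) ?(ltW C10)//.
  apply: le_trans (le _ _ (sqr_ge0 (u y)) CC2).
  apply: le_trans (ler_wpM2l (sqr_ge0 y) f1) _; rewrite mulrCA [leRHS]mulrAC mulrC.
  by apply: ler_wpM2r => //; rewrite addr_ge0.
- move=> y y0 ye; have := H3 y y0 ltac:(linarith); rewrite ler_norml => /andP[h _].
  by move: h; set p := u y * du y; linarith.
exists (C' * C1); first by rewrite mulr_ge0// ltW.
exists (e1 / 2); first by rewrite divr_gt0.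
move=> x x0 xe; apply: le_trans (H x x0 ltac:(linarith)) _; rewrite -mulrA ler_wpM2l//.
have [_ _ h] := H1 x x0 ltac:(linarith).
by rewrite ler_pdivrMr// mulrAC -mulrA.
Qed.

(** Beyond [2 x] the increment of the kernel is [h (2 x + h) / y^2] to leading order, which produces
    [2 x phi (2 x)]. The window is [x / 2], wide enough since a bound on [du] is now available. *)
Lemma dA_far_approx (x T V : R) : 0 < x -> x < e / 8 -> 0 <= T -> 0 <= V ->
  (forall y : R, x <= y -> y < e -> u y <= T * y) ->
  (forall y : R, `|y - x| < x / 2 -> `|du y| <= V) ->
  `|dA x - 2 * x * phi (2 * x)| <= 8 * (x * (T * (2 * x))) * (sg (x / 2 / 2) / (x / 2)) +
    6 * V * (x / 2 * sg (x / 2)) + 2 * x * (B * CR) + (3 * x * T + 8 * x * (B * (sg e / e))).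
Proof.
move=> x0 xe8 T0 V0 uD duV.
have [x2 x4 x2' xx2 xe] : [/\ 0 < 2 * x, 4 * x <= e, 2 * x <= e, x <= 2 * x & x < e] by split; linarith.
have x2e : 2 * x < e by linarith.
have h0 : 0 < x / 2 by rewrite divr_gt0.
have hx : x / 2 <= x by linarith.
have B0 := B_ge0; have s0 := sg_div_ge0 e e0.
have lip y : `|y - x| < x / 2 -> `|u y - u x| <= V * `|y - x|.
  apply: (derivative_bound_lipschitz _ u du) => // z.
  by rewrite ltr_norml => /andP[z1 z2]; apply: u_der; linarith.
have p7 : 0 <= phi (2 * x).
  by apply: Rintegral_ge0 => y; rewrite /= in_itv/= => /andP[xy _]; apply: u_div_sqr_ge0; exact: lt_trans xy.
pose G := 2 * x * phi (2 * x).
apply: (convolution_derivative_approx x (x / 2) V (T * (2 * x)) G _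
  (phi (2 * x) + 3 / 2 * T + 4 * (B * (sg e / e))) (x / 2) u) => //.
- by apply: addr_ge0; [apply: addr_ge0 => //; exact: mulr_ge0|apply: mulr_ge0 => //; exact: mulr_ge0].
- exact: u_measurable_oo.
- move=> y y0 y2; have /andP[? _] := u_bnd y y0; rewrite ger0_norm//.
  by apply: le_trans (uD _ xx2 x2e); apply: u_nondecreasing => //; exact: ltW.
move=> h hp hh; have ik := dS_increment_u_Itg x h x0 hp.
have aux (n f : R) : n + f - n = f by ring.
rewrite (Rint_split_oy 0 (2 * x) _ (ltW x2) ik) aux.
have sub : (`](2 * x), e[%classic : set R) `<=` `]0, +oo[%classic.
  by move=> y; rewrite /= !in_itv/= andbT => /andP[ya _]; exact: lt_trans ya.
rewrite (Rint_split_oy (2 * x) e _ (ltW x2e)); last first.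
  by apply: Itg_sub ik => //; apply: subset_itvr; rewrite bnd_simp ltW.
have ik2 := Itg_sub _ _ _ (measurable_itv _) (measurable_itv _) sub ik.
have T1 : `|\int[mu]_(y in `]e, +oo[) ((dS (x + h) y - dS x y) * u y)| <=
    4 * ((x + h) ^+ 2 - x ^+ 2) * (sg e / e) * B.
  apply: tail_le => //; [exact: ltW|linarith|linarith|by apply: u_measurable_oy; exact: ltW|].
  by move=> y ey; apply: normr_u_le; exact: lt_trans ey.
have DE : (x + h) ^+ 2 - x ^+ 2 = h * (2 * x + h) by ring.
have Dp : 0 <= h * (2 * x + h) by rewrite mulr_ge0 ?addr_ge0 ?ltW.
have xh : x <= x + h by linarith.
have xh2 : x + h <= 3 / 2 * x by linarith.
have ip := phi_Itg (2 * x) e x2.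
have L1 : h * (2 * x + h) * phi (2 * x) <= \int[mu]_(y in `](2 * x), e[) ((dS (x + h) y - dS x y) * u y).
  rewrite /phi -RintegralZl//; apply: le_Rint => //; first exact: ItgZl.
  move=> y; rewrite /= in_itv/= => /andP[ya yb]; have y0 : 0 < y by exact: lt_trans ya.
  have /andP[k1 _] := S_log x (x + h) y (ltW x0) xh ltac:(linarith); rewrite DE in k1.
  by rewrite mulrA mulrAC ler_wpM2r//; case/andP: (u_bnd y y0).
have L2 : \int[mu]_(y in `](2 * x), e[) ((dS (x + h) y - dS x y) * u y) <=
    h * (2 * x + h) * phi (2 * x) + h * (2 * x + h) * (3 / 2 * T).
  have [i v] := invsqr_itv_oo (2 * x) e x2 x2'.
  have j1 := ItgZl _ _ (h * (2 * x + h)) (measurable_itv _) ip.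
  have j2 := ItgZl _ _ (h * (2 * x + h) * (3 * x * T)) (measurable_itv _) i.
  apply: (@le_trans _ _ (\int[mu]_(y in `](2 * x), e[) (h * (2 * x + h) * (u y / y ^+ 2) + 
      h * (2 * x + h) * (3 * x * T) * (y ^+ 2)^-1))).
    apply: le_Rint => //; first exact: ItgD.
    move=> y; rewrite /= in_itv/= => /andP[ya yb]; have y0 : 0 < y by exact: lt_trans ya.
    have u0 : 0 <= u y by case/andP: (u_bnd y y0).
    have /andP[_ k2] := S_log x (x + h) y (ltW x0) xh ltac:(linarith); rewrite DE in k2.
    apply: le_trans (ler_wpM2r u0 k2) _.
    (* From [x + h <= 3/2 x] and [2 x < y], [x + h] is at most [3/4 y]. *)
    have yq : 7 / 16 * y ^+ 2 <= y ^+ 2 - (x + h) ^+ 2.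
      have : (x + h) ^+ 2 <= (3 / 4 * y) ^+ 2 by rewrite ler_pXn2r ?nnegrE//; linarith.
      rewrite (_ : (3 / 4 * y) ^+ 2 = 9 / 16 * y ^+ 2); last by field.
      by have := sqr_ge0 y; linarith.
    have y2p : 0 < y ^+ 2 by rewrite exprn_gt0.
    have qp : 0 < y ^+ 2 - (x + h) ^+ 2 by apply: lt_le_trans yq; rewrite mulr_gt0.
    rewrite (_ : h * (2 * x + h) / (y ^+ 2 - (x + h) ^+ 2) * u y = h * (2 * x + h) * (u y / y ^+ 2) +
      h * (2 * x + h) * ((x + h) ^+ 2 * u y / (y ^+ 2 - (x + h) ^+ 2)) * (y ^+ 2)^-1); last first.
      by field; rewrite !gt_eqF.
    rewrite lerD2l ler_wpM2r ?invr_ge0 ?(ltW y2p)// ler_wpM2l// ler_pdivrMr//.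
    apply: (@le_trans _ _ (3 * x * T * (7 / 16 * y ^+ 2))); last first.
      by rewrite ler_wpM2l// !mulr_ge0// ltW.
    have uy := uD y (le_trans xx2 (ltW ya)) yb.
    have x9 : (x + h) ^+ 2 <= 9 / 4 * x ^+ 2.
      rewrite (_ : 9 / 4 * x ^+ 2 = (3 / 2 * x) ^+ 2); last by field.
      by rewrite ler_pXn2r ?nnegrE//; linarith.
    apply: le_trans (ler_pM (sqr_ge0 _) u0 x9 uy) _; rewrite -/T.
    rewrite (_ : 9 / 4 * x ^+ 2 * (T * y) = x * T * y * (9 / 4 * x)); last by ring.
    rewrite (_ : 3 * x * T * (7 / 16 * y ^+ 2) = x * T * y * (21 / 16 * y)); last by ring.
    by rewrite ler_wpM2l ?mulr_ge0 ?(ltW x0) ?(ltW y0)//; linarith.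
  rewrite RintegralD// !RintegralZl// v -/(phi (2 * x)) lerD2l -!mulrA ler_wpM2l ?(ltW hp)// ler_wpM2l ?addr_ge0 ?(ltW x2) ?(ltW hp)//.
  rewrite (_ : 2^-1 * T = x * (T * (2 * x)^-1)); last by field; rewrite gt_eqF.
  by rewrite !ler_wpM2l ?(ltW x0)// gerBl invr_ge0 ltW.
move: T1; rewrite DE !ler_norml; set i3 := \int[mu]_(y in `]e, +oo[) _ => /andP[T1 T2].
move: L1 L2; set i2 := \int[mu]_(y in _) ((_ - _) * _) => L1 L2.
have hh2 : 0 <= h * h by rewrite mulr_ge0 ?ltW.
have z1 := mulr_ge0 hh2 p7; have z2 := mulr_ge0 hh2 T0; have z3 := mulr_ge0 (mulr_ge0 (ltW hp) (ltW x0)) T0.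
move: T1 T2 L1 L2 z1 z2 z3; rewrite /G; set P := phi (2 * x); set s := sg e / e; clearbody i2 i3 P s.
clear lip uD duV; move=> *; apply/andP; split; linarith.
Qed.

(** Passing from [phi (2 x)] to [phi x] costs one dyadic block, of order [t x], and the bound on
    [du] over the window around [x] is taken at its left end. *)
Lemma dA_phi : exists2 C : R, 0 <= C & exists2 d : R, 0 < d &
  forall x : R, 0 < x -> x < d -> `|dA x - 2 * x * phi x| <= C * (x * t x).
Proof.
have e0' := e0; have B0 := B_ge0; have s0 := sg_div_ge0 e e0.
have [C1 C10 H1] := u_le_t.
have [C2 C20 [d2 d20 H2]] := du_log_le.
have [K0 K00 HK] : exists2 K0 : R, 0 < K0 & forall x : R, 0 < x -> x <= e / 2 -> K0 <= t x.
  exists (t (e / 2)); first by apply: t_gt0; linarith.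
  by move=> x x0 xe; apply: t_nonincreasing => //; linarith.
pose D := B * (sg e / e) + B * CR.
have D0 : 0 <= D := addr_ge0 (mulr_ge0 B0 s0) (mulr_ge0 B0 CR0).
have q0 : 0 <= D / K0 by rewrite divr_ge0// ltW.
have r0 : 0 <= C1 / K0 by rewrite divr_ge0// ltW.
exists (37 * C1 + 3 * C2 * (1 + C1 / K0) + 8 * (D / K0)).
  by apply: addr_ge0; [apply: addr_ge0; apply: mulr_ge0|apply: mulr_ge0] => //;
    [exact: mulr_ge0|exact: addr_ge0].
exists (Num.min (d2 / 2) (e / 8)); first by rewrite lt_min !divr_gt0.
move=> x x0; rewrite lt_min => /andP[xd xe8].
have [x2 x4 x2' xx2 xe] : [/\ 0 < 2 * x, 4 * x <= e, 2 * x <= e, x <= 2 * x & x < e] by split; linarith.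
have x2e : 2 * x < e by linarith.
have xe2 : x <= e / 2 by linarith.
have h0 : 0 < x / 2 by rewrite divr_gt0.
have hx : x / 2 <= x by linarith.
have tx := t_gt0 x x0 x2'; have tE := t_sqr x x0 x2'.
have tt := HK x x0 xe2.
have uD y : x <= y -> y < e -> u y <= C1 * t x * y by exact: H1.
have duV y : `|y - x| < x / 2 -> `|du y| <= C2 * t (x / 2).
  rewrite ltr_norml => /andP[y1 y2]; have y0 : 0 < y by linarith.
  rewrite ger0_norm; last by apply: du_ge0 => //; linarith.
  apply: le_trans (H2 y y0 _) _; first linarith.
  by rewrite ler_wpM2l//; apply: t_nonincreasing => //; linarith.
have pE := phi_split x (2 * x) x0 xx2 x2'.
have p2 := phi_le_block x (2 * x) x0 xx2 x2e.
have p4 := phi_le_block (x / 2) x h0 hx xe; have p5 := phi_split (x / 2) x h0 hx (ltW xe).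
have p6 : 0 <= \int[mu]_(y in `]x, (2 * x)[) (u y / y ^+ 2).
  by apply: Rintegral_ge0 => y; rewrite /= in_itv/= => /andP[xy _]; apply: u_div_sqr_ge0; exact: lt_trans xy.
pose T := C1 * t x; have T0 : 0 <= T by rewrite mulr_ge0// ltW.
pose G := 2 * x * phi (2 * x).
have main := dA_far_approx x T (C2 * t (x / 2)) x0 xe8 T0 (mulr_ge0 C20 (sqrtr_ge0 _)) uD duV.
rewrite -/G in main.
have D1 : D <= D / K0 * t x by rewrite mulrAC ler_pdivlMr// ler_wpM2l.
(* Halving the argument adds to [phi] a block of size at most [C1 * t x], so [t] grows by at most a
   constant factor. *)
have th : t (x / 2) <= (1 + C1 / K0) * t x.
  have g1 : 1 <= 1 + C1 / K0 by rewrite lerDl.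
  apply: (@le_trans _ _ (sqrt (((1 + C1 / K0) * t x) ^+ 2))); last first.
    by rewrite sqrtr_sqr ger0_norm// mulr_ge0 ?(ltW tx)// addr_ge0.
  apply: ler_wsqrtr; rewrite p5 exprMn.
  have ux : u x * ((x / 2)^-1 - x^-1) <= C1 * t x.
    rewrite (_ : (x / 2)^-1 - x^-1 = x^-1); last by field; rewrite gt_eqF.
    by rewrite ler_pdivrMr// uD.
  apply: (@le_trans _ _ (C1 * t x + t x ^+ 2)); first by rewrite tE lerD2r (le_trans p4).
  have c1 : C1 * t x <= C1 / K0 * t x ^+ 2.
    by rewrite expr2 !mulrA ler_wpM2r ?(ltW tx)// mulrAC ler_pdivlMr// ler_wpM2l.
  apply: (@le_trans _ _ ((1 + C1 / K0) * t x ^+ 2)).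
    by rewrite mulrDl mul1r addrC lerD2l.
  by rewrite ler_wpM2r ?sqr_ge0// expr2 ler_peMl// (le_trans _ g1).
have g2 : 2 * x * \int[mu]_(y in `]x, (2 * x)[) (u y / y ^+ 2) <= 2 * x * T.
  rewrite ler_wpM2l ?(ltW x2)//; apply: le_trans p2 _.
  rewrite (_ : x^-1 - (2 * x)^-1 = (2 * x)^-1); last by field; rewrite gt_eqF.
  by rewrite ler_pdivrMr// uD.
have g3 : `|G - 2 * x * phi x| <= 2 * x * T.
  by rewrite /G pE mulrDr opprD addrCA subrr addr0 normrN ger0_norm// mulr_ge0// ltW.
rewrite -(subrK G (dA x)) -addrA; apply: le_trans (ler_normD _ _) _.
apply: le_trans (lerD main g3) _; rewrite !sg1 !mulr1.
rewrite (_ : 8 * (x * (T * (2 * x))) * (1 / (x / 2)) = 32 * (x * T)); last by field; rewrite gt_eqF.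
have v1 := ler_wpM2l (ltW x0) (ler_wpM2l C20 th); have v2 := ler_wpM2l (ltW x0) D1.
have v3 : 0 <= x * (B * CR) by rewrite !mulr_ge0// ltW.
move: v1 v2 v3; rewrite /D sg1 /T; set ei := 1 / e; set q1 := (B * ei + _) / K0; set q2 := C1 / K0.
move: (t (x / 2)) (t x) => Th Tx; clearbody ei q1 q2.
clear main g2 g3 th D1 uD duV pE p2 p4 p5 p6 HK H1 H2; linarith.
Qed.

Lemma du_equiv (eps : R) : 0 < eps -> exists2 d : R, 0 < d &
  forall x : R, 0 < x -> x < d -> `|du x - t x| <= eps * t x.
Proof.
move=> ep; have e0' := e0.
pose r := Num.min (eps / 4) (1 / 8).
have r0 : 0 < r by rewrite lt_min !divr_gt0.
have r8 : r <= 1 / 8 by rewrite ge_min lexx orbT.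
have r4 : 4 * r <= eps by rewrite mulrC -ler_pdivlMr// ge_min lexx.
clearbody r.
have [d1 d10 H1] := u_equiv r r0; have [d2 d20 H2] := dA_u r r0.
have [C C0 [d3 d30 H3]] := dA_phi; have [d4 d40 H4] := t_unbounded (C / r).
exists (Num.min (Num.min d1 d2) (Num.min (Num.min d3 d4) (e / 2))).
  by rewrite !lt_min d10 d20 d30 d40 divr_gt0.
move=> x x0; rewrite !lt_min => /andP[/andP[xd1 xd2] /andP[/andP[xd3 xd4] xe]].
have x2 : 2 * x <= e by linarith.
have tx := t_gt0 x x0 x2; have tE := t_sqr x x0 x2.
have h4 : C <= r * t x by have := H4 x x0 xd4; rewrite ler_pdivrMr// mulrC.
apply: (@le_trans _ _ (4 * r * t x)); last by rewrite ler_wpM2r ?(ltW tx).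
apply: (normr_factor_sub_le _ r (x * t x) (t x) (u x) (du x) (dA x)) => //.
- by rewrite mulr_gt0.
- by apply: du_ge0 => //; linarith.
- exact: H1.
- exact: H2.
have := H3 x x0 xd3; rewrite -{1}tE (_ : 2 * x * t x ^+ 2 = 2 * (x * t x * t x)); last by ring.
move=> /le_trans; apply.
rewrite (_ : r * (x * t x * t x) = r * t x * (x * t x)); last by ring.
by rewrite ler_wpM2r// mulr_ge0// ltW.
Qed.

Lemma log_asymptotics (eps : R) : 0 < eps -> exists2 d : R, 0 < d & forall x : R, 0 < x -> x < d ->
  `|u x + x * ln x / 2| <= eps * (x * - ln x) /\ `|du x + ln x / 2| <= eps * - ln x.
Proof.
move=> ep; have e0' := e0.
pose r := Num.min (eps / 2) (1 / 2).
have r0 : 0 < r by rewrite lt_min !divr_gt0.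
have r8 : r <= 1 / 2 by rewrite ge_min lexx orbT.
have r4 : 2 * r <= eps by rewrite mulrC -ler_pdivlMr// ge_min lexx.
clearbody r.
have [d1 d10 H1] := u_equiv r r0; have [d2 d20 H2] := du_equiv r r0.
have [d3 d30 H3] := t_equiv r r0.
exists (Num.min (Num.min d1 d2) (Num.min d3 1)); first by rewrite !lt_min d10 d20 d30 ltr01.
move=> x x0; rewrite !lt_min => /andP[/andP[xd1 xd2] /andP[xd3 x1]].
have l0 : 0 <= - ln x by rewrite oppr_ge0 ln_le0// ltW.
have h1 := H1 x x0 xd1; have h2 := H2 x x0 xd2; have h3 := H3 x x0 xd3.
have t1 : t x <= - ln x by move: h3; rewrite ler_norml => /andP[_]; nra.
have k1 := ler_wpM2l (ltW r0) t1.
have k2 : 2 * r * - ln x <= eps * - ln x by exact: ler_wpM2r.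
move: h1 h2 h3 t1 k1 k2; move: (t x) => T h1 h2 h3 t1 k1 k2.
split; last by move: h2 h3; rewrite !ler_norml => /andP[a1 a2] /andP[b1 b2]; apply/andP; split; linarith.
rewrite (_ : u x + x * ln x / 2 = (u x - x * T) + x * (T + ln x / 2)); last by ring.
apply: le_trans (ler_normD _ _) _; rewrite [`|x * _|]normrM (gtr0_norm x0).
have h4 := ler_wpM2l (ltW x0) h3; have k3 := ler_wpM2l (ltW x0) k1; have k4 := ler_wpM2l (ltW x0) k2.
linarith.
Qed.

End LogCase.

(** * The square root case *)

Section SqrtCase.
(** The profile constant, [pi / 2] in the application. The gap above [4 / 3] feeds
    [sqrt_fixed_point]. *)
Context (c : R).
Ltac is_parameter v ::= first [constr_eq v CR | constr_eq v B | constr_eq v e | constr_eq v c].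
Hypothesis c43 : 4 / 3 < c.
Hypothesis sgE : forall a : R, sg a = (sqrt a)^-1.
Hypothesis S_inner : forall x y : R, 0 < y -> y < x -> 2 / sqrt x - 2 / sqrt y <= dS x y.
Hypothesis S_outer : forall x y : R, 0 <= x -> x < y -> x ^+ 2 / (2 * (y ^+ 2 * sqrt y)) <= dS x y.
Hypothesis profile : forall x : R, 0 < x -> Itg `]0, +oo[ (fun y => dS x y * sqrt y) /\
  \int[mu]_(y in `]0, +oo[) (dS x y * sqrt y) = c * x.

Lemma mul_sg (x : R) : 0 < x -> x * sg x = sqrt x.
Proof.
move=> x0; rewrite sgE -{1}(sqrt_sqr x (ltW x0)) -mulrA divff ?mulr1//.
by rewrite gt_eqF// sqrtr_gt0.
Qed.

Lemma dS_sqrt_ge0 (x y : R) : 0 <= x -> x < y -> 0 <= dS x y.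
Proof.
move=> x0 xy; apply: le_trans (S_outer x y x0 xy).
by rewrite divr_ge0 ?sqr_ge0// mulr_ge0// mulr_ge0 ?sqr_ge0 ?sqrtr_ge0.
Qed.

Lemma dS_u_Itg (x : R) : 0 < x -> Itg `]0, +oo[ (fun y => dS x y * u y).
Proof.
move=> x0; apply: (Itg_mulr_bounded _ _ _ B) => //; first exact: Itg_dS (ltW x0) _.
by move=> y; rewrite /= in_itv/= andbT; exact: normr_u_le.
Qed.

Lemma convolution_truncate (x b : R) : 0 < x -> 4 * x <= 3 * b ->
  `|A x - \int[mu]_(y in `]0, b[) (dS x y * u y)| <= (B * CR + 4 * (sg b / b) * B) * x ^+ 2.
Proof.
move=> x0 xb; have b0 : 0 < b by linarith.
have r1 := rem_le x B `]0, +oo[ u (ltW x0) ltac:(by []) u_meas _ B_ge0.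
have {}r1 := r1 ltac:(by move=> y; rewrite /= in_itv/= andbT; exact: normr_u_le).
have t1 : `|\int[mu]_(y in `]b, +oo[) ((dS x y - dS 0 y) * u y)| <= 4 * (x ^+ 2 - 0 ^+ 2) * (sg b / b) * B.
  apply: tail_le => //; [exact: ltW|by apply: u_measurable_oy; exact: ltW|].
  by move=> y ey; apply: normr_u_le; exact: lt_trans ey.
move: t1; under eq_Rint do rewrite central_diff2_0 subr0.
rewrite expr0n subr0 => t1.
rewrite [X in `|_ - X|](Rint_split_oy 0 b _ (ltW b0) (dS_u_Itg x x0)) in r1.
move: r1 t1; set i1 := \int[mu]_(y in `]0, b[) _; set i2 := \int[mu]_(y in `]b, +oo[) _; set a := A x.
rewrite !ler_norml => /andP[? ?] /andP[? ?]; apply/andP; split; linarith.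
Qed.

Lemma sqrt_ratio_continuous (x b : R) : 0 < x -> b < e ->
  {within `[x, b], continuous (fun y => u y / sqrt y)}.
Proof.
move=> x0 be; apply: continuous_in_subspaceT => y; rewrite inE/= in_itv/= => /andP[xy yb].
have y0 : 0 < y by exact: lt_le_trans xy.
suff : {for (y : R), continuous (fun z : R => u z / sqrt z)} by [].
apply: cM; first by apply: dcontinuous (u_der y y0 _); exact: le_lt_trans be.
by apply: cV; [rewrite gt_eqF// sqrtr_gt0|apply: csqrt; exact: cid].
Qed.

(** On this block [y^2 sqrt y <= 32 x^2 sqrt x], so the kernel is at least [1 / (64 sqrt x)] over a
    length [2 x]. *)
Lemma dS_sqrt_block (x : R) : 0 < x -> sqrt x / 32 <= \int[mu]_(y in `](2 * x), (4 * x)[) dS x y.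
Proof.
move=> x0; have sx : 0 < sqrt x by rewrite sqrtr_gt0.
have x24 : 2 * x <= 4 * x by linarith.
have -> : sqrt x / 32 = \int[mu]_(y in `](2 * x), (4 * x)[) (sqrt x / (64 * x)).
  by rewrite Rint_cst//; field; rewrite gt_eqF.
apply: le_Rint => //; [exact: Itg_cst|exact: Itg_dS (ltW x0) _|].
move=> y; rewrite /= in_itv/= => /andP[y1 y2]; have y0 : 0 < y by linarith.
apply: le_trans (S_outer x y (ltW x0) ltac:(linarith)).
have sy : 0 < sqrt y by rewrite sqrtr_gt0.
have s2 : sqrt y <= 2 * sqrt x.
  rewrite (_ : 2 * sqrt x = sqrt (4 * x)); first by apply: ler_wsqrtr; exact: ltW.
  by rewrite sqrtrM// (_ : 4 = 2 ^+ 2) ?sqrtr_sqr ?ger0_norm//; field.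
have yy : y ^+ 2 <= 16 * x ^+ 2.
  by rewrite (_ : 16 * x ^+ 2 = (4 * x) ^+ 2) ?ler_pXn2r ?nnegrE ?(ltW y0)//; [linarith|linarith|ring].
rewrite ler_pdivlMr; last by rewrite mulr_gt0// mulr_gt0// exprn_gt0.
have p := ler_pM (sqr_ge0 y) (ltW sy) yy s2.
have q : 0 <= sqrt x / (64 * x) by rewrite divr_ge0 ?(ltW sx)// mulr_ge0// ltW.
apply: le_trans (ler_wpM2l q (ler_wpM2l (ler0n _ 2) p)) _.
rewrite le_eqVlt; apply/orP; left; apply/eqP.
transitivity (x * (sqrt x * sqrt x)); first by field; rewrite gt_eqF.
by rewrite (sqrt_sqr x (ltW x0)) expr2.
Qed.

(** Evaluate at a minimiser [z] of [u / sqrt] on [[x, b]]. If [z] is not small the bound is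
    immediate. Otherwise minimality makes [u (2 z) - u z] a fixed fraction of [u z], so [A z] is at
    least of order [sqrt z * u z], and [A <= 2 u^2] concludes. *)
Lemma u_sqrt_lower : exists2 c0 : R, 0 < c0 &
  exists2 d : R, 0 < d & forall x : R, 0 < x -> x < d -> c0 * sqrt x <= u x.
Proof.
pose b := e / 2; have b0 : 0 < b by rewrite divr_gt0.
have [d1 d10 HA] := A_le_2sqr.
pose C := 4 * (sg b / b) + CR + CR.
have C0 : 0 <= C by rewrite !addr_ge0// mulr_ge0// sg_div_ge0.
have C1 : 0 < C + 1 by rewrite ltr_wpDl.
(* The block yields [2/5 * 1/32 = 4 k] times [sqrt z * u z], and the errors will be kept below [k]
   times that. *)
have [k k0 kE] : exists2 k : R, 0 < k & k = 1 / 16 / 20 by exists (1 / 16 / 20) => //; linarith.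
have e0' := e0; have CR0' := CR0.
have be : b < e by rewrite /b; linarith.
pose d0 := Num.min (Num.min d1 1) (Num.min (b / 4) (k / (C + 1))).
have d00 : 0 < d0 by rewrite !lt_min d10 ltr01 !divr_gt0.
have d0b : d0 <= b / 4 by rewrite !ge_min lexx ?orbT.
have d0e : d0 < e by linarith.
have ud : 0 < u d0 by apply: u_gt0.
have sb : 0 < sqrt b by rewrite sqrtr_gt0.
have q0 : 0 < u d0 / sqrt b by rewrite divr_gt0.
pose c0 := Num.min (u d0 / sqrt b) (k / 2).
exists c0; first by rewrite lt_min q0 divr_gt0.
exists d0 => // x x0 xd; have xb : x <= b by linarith.
have [z] := EVT_min xb (sqrt_ratio_continuous x b x0 be).
rewrite in_itv/= => /andP[xz zb] zm.
have {zm} zmin y : x <= y -> y <= b -> u z / sqrt z <= u y / sqrt y.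
  by move=> xy yb; apply: zm; rewrite in_itv/= xy.
have sx : 0 < sqrt x by rewrite sqrtr_gt0.
have z0 : 0 < z by exact: lt_le_trans xz.
have sz : 0 < sqrt z by rewrite sqrtr_gt0.
rewrite -ler_pdivlMr//; apply: le_trans (zmin x (lexx x) xb).
have [dz|] := leP d0 z.
  apply: (@le_trans _ _ (u d0 / sqrt b)); first by rewrite ge_min lexx.
  apply: ler_pM; [exact: ltW|by rewrite invr_ge0 ltW| |].
    by apply: u_nondecreasing => //; exact: le_lt_trans be.
  by rewrite lef_pV2 ?posrE// ler_wsqrtr.
rewrite !lt_min => /andP[/andP[zd1 z1] /andP[zb4 zC]].
apply: (@le_trans _ _ (k / 2)); first by rewrite ge_min lexx orbT.
have uz : 0 < u z by apply: u_gt0 => //; exact: le_lt_trans be.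
(* Minimality gives [u (2 z) >= sqrt 2 * u z], and [sqrt 2 >= 7/5]. *)
have u2 : 2 / 5 * u z <= u (2 * z) - u z.
  have := zmin (2 * z) ltac:(linarith) ltac:(linarith); rewrite sqrtrM//.
  have s2 : 0 < sqrt 2 :> R by rewrite sqrtr_gt0.
  have s75 : 7 / 5 <= sqrt 2 :> R.
    by rewrite -(ler_pXn2r (n := 2)) ?nnegrE ?sqrtr_ge0 ?divr_ge0// [leRHS]expr2 sqrt_sqr//; linarith.
  rewrite ler_pdivlMr ?mulr_gt0// mulrCA mulfVK ?gt_eqF// => h.
  by have := ler_wpM2r (ltW uz) s75; linarith.
have [HA1 _] := HA z z0 zd1.
have und y t : 0 < y -> y <= t -> t <= b -> u y <= u t.
  by move=> y0 yz ztb; apply: u_nondecreasing => //; exact: le_lt_trans be.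
have LB := convolution_lower_bound_block z (2 * z) (4 * z) b B u z0 ltac:(linarith) ltac:(linarith) ltac:(linarith) u_meas u_bnd und.
have tl := tail_dK_le z b z0 b0 ltac:(linarith).
have kl := dS_sqrt_block z z0.
have zz : C * z ^+ 2 <= k * sqrt z.
  have zs : z <= sqrt z.
    by rewrite -{1}(sqrt_sqr z (ltW z0)) ler_piMl ?sqrtr_ge0// -sqrtr1 ler_wsqrtr// ltW.
  have zc : C * z <= k.
    by move: zC (ltW z0); rewrite ltr_pdivlMr//; linarith.
  have := ler_pM (mulr_ge0 C0 (ltW z0)) (ltW z0) zc zs; rewrite expr2 mulrA; linarith.
have CRz : 0 <= CR * z ^+ 2 by rewrite mulr_ge0 ?sqr_ge0.
have tl0 : 0 <= 4 * (sg b / b) * z ^+ 2 by rewrite mulr_ge0 ?sqr_ge0// mulr_ge0// sg_div_ge0.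
have k2 : sqrt z / 32 - CR * z ^+ 2 <= \int[mu]_(y in `](2 * z), (4 * z)[) dS z y - CR * z ^+ 2.
  by rewrite lerD2r.
have k3 : 0 <= sqrt z / 32 - CR * z ^+ 2.
  by move: zz; rewrite /C !mulrDl kE; have := ltW sz; linarith.
have m0 : 0 <= 2 / 5 * u z by rewrite mulr_ge0// ltW.
have m1 := ler_pM m0 k3 u2 k2.
have m2 := ler_wpM2l (ltW uz) tl.
have m3 : u z * (k * sqrt z) <= u z * (2 * u z).
  have := ler_wpM2l (ltW uz) zz; rewrite /C kE.
  have := mulr_ge0 (ltW uz) CRz.
  move: (mulr_ge0 (ltW uz) (mulr_ge0 (sg_div_ge0 b b0) (sqr_ge0 z))) (mulr_gt0 uz sz) LB HA1 m1 m2.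
  move: (A z) (\int[mu]_(y in `]b, +oo[) dK z y) (sg b / b) (\int[mu]_(y in `](2 * z), (4 * z)[) dS z y) (u (2 * z)).
  move: (u z) (sqrt z).
  by move=> *; linarith.
rewrite ler_pM2l// in m3.
by rewrite ler_pdivlMr//; linarith.
Qed.

(** The weight [sg y / y^2] times [sqrt y] is exactly [y^-2], so growth like [sqrt y] is admissible
    up to infinity. Hence the generic upper bound of the interval. *)
Lemma far_sqrt_le (x x' a D : R) (b : itv_bound R) (w : R -> R) : 0 <= x -> x <= x' -> 0 < a ->
  4 * x' <= 3 * a -> 0 <= D ->
  Itg [set` Interval (BRight a) b] (fun y => (dS x' y - dS x y) * w y) ->
  (forall y : R, y \in Interval (BRight a) b -> `|w y| <= D * sqrt y) ->
  `|\int[mu]_(y in [set` Interval (BRight a) b]) ((dS x' y - dS x y) * w y)| <=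
    4 * (x' ^+ 2 - x ^+ 2) * (D / a).
Proof.
move=> x0 xx' a0 xa D0 ik wD.
have sub : [set` Interval (BRight a) b] `<=` `]a, +oo[%classic.
  by apply: subset_itvl; case: (b) => [[] ?|[]].
have [i v] := invsqr_itvy a a0.
have i' := Itg_sub _ _ _ (measurable_itv _) (measurable_itv _) sub i.
have c0 : 0 <= 4 * (x' ^+ 2 - x ^+ 2) * D.
  by rewrite mulr_ge0// mulr_ge0// subr_ge0 ler_pXn2r ?nnegrE ?(le_trans x0 xx').
apply: (@le_trans _ _ (\int[mu]_(y in [set` Interval (BRight a) b]) (4 * (x' ^+ 2 - x ^+ 2) * D * (y ^+ 2)^-1))).
  apply: normr_Rint_le => //; first exact: ItgZl.
  move=> y yI; have := sub y yI; rewrite /= in_itv/= andbT => ay.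
  have y0 : 0 < y by exact: lt_trans ay.
  have /andP[k0 k1] := S_far x x' y x0 xx' ltac:(linarith) y0.
  rewrite normrM ger0_norm//; apply: le_trans (ler_pM k0 (normr_ge0 _) k1 (wD y yI)) _.
  rewrite sgE le_eqVlt; apply/orP; left; apply/eqP.
  by field; rewrite !gt_eqF// sqrtr_gt0.
rewrite RintegralZl// mulrA ler_wpM2l// -v; apply: Rint_sub_le => // y _.
by rewrite invr_ge0 sqr_ge0.
Qed.

Lemma convolution_sqrt_rough_upper (b : R) : 0 < b -> b < e -> exists2 C : R, 0 <= C &
  forall x D : R, 0 < x -> 4 * x <= b -> 0 <= D ->
  (forall y : R, 2 * x < y -> y < b -> u y <= D * sqrt y) ->
  A x <= 12 * (sqrt x * u (2 * x)) + 2 * x * D + C * x ^+ 2.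
Proof.
move=> b0 be; have B0 := B_ge0.
exists (B * CR + 4 * (sg b / b) * B).
  exact: addr_ge0 (mulr_ge0 B0 CR0) (mulr_ge0 (mulr_ge0 (ler0n _ 4) (sg_div_ge0 b b0)) B0).
move=> x D x0 xb D0 uD; have x2 : 0 < 2 * x by linarith.
have x2b : 2 * x < b by linarith.
have xb3 : 4 * x <= 3 * b by linarith.
have := convolution_truncate x b x0 xb3; rewrite ler_norml => /andP[_ T].
have ik := dS_u_Itg x x0.
have sub : (`]0, b[%classic : set R) `<=` `]0, +oo[%classic by apply: subset_itvl.
have ikb := Itg_sub _ _ _ (measurable_itv _) (measurable_itv _) sub ik.
rewrite (Rint_split_oo 0 (2 * x) b _ _ ikb) in T; last by rewrite (ltW x2) (ltW x2b).
have n1 : \int[mu]_(y in `]0, (2 * x)[) (dS x y * u y) <= 12 * (x * sg x) * u (2 * x).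
  apply: near_le => //; [exact: u_measurable_oo| |by case/andP: (u_bnd _ x2)].
  move=> y y0 y2; have /andP[-> _] := u_bnd y y0.
  by rewrite u_nondecreasing// ?(ltW y2)//; linarith.
rewrite (mul_sg x x0) in n1.
have f1 : `|\int[mu]_(y in `](2 * x), b[) ((dS x y - dS 0 y) * u y)| <= 4 * (x ^+ 2 - 0 ^+ 2) * (D / (2 * x)).
  apply: far_sqrt_le => //; [exact: ltW|linarith| |].
    apply: (Itg_eq _ (fun y => dS x y * u y)) => //.
      by move=> y _; rewrite central_diff2_0 subr0.
    apply: Itg_sub ikb => //; apply: subset_itvr; rewrite bnd_simp; exact: ltW.
  move=> y; rewrite in_itv/= => /andP[y1 y2].
  by rewrite ger0_norm ?uD//; case/andP: (u_bnd y (lt_trans x2 y1)).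
move: f1; under eq_Rint do rewrite central_diff2_0 subr0.
rewrite expr0n subr0 (_ : 4 * x ^+ 2 * (D / (2 * x)) = 2 * x * D); last by field; rewrite gt_eqF.
rewrite ler_norml => /andP[_ f1].
move: T n1 f1; set i1 := \int[mu]_(y in `]0, (2 * x)[) _; set i2 := \int[mu]_(y in `](2 * x), b[) _.
by set a := A x; linarith.
Qed.

(** Evaluate at a maximiser [z] of [u / sqrt] on [[x, b]]: with [D] the maximum, [A z] is at most
    linear in [D] while [u z ^+ 2 = z D^2]. *)
Lemma u_sqrt_upper : exists2 C : R, 0 < C &
  exists2 d : R, 0 < d & forall x : R, 0 < x -> x < d -> u x <= C * sqrt x.
Proof.
have B0 := B_ge0.
pose b := e / 2; have b0 : 0 < b by rewrite divr_gt0.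
have [d1 d10 HA] := A_le_2sqr.
have e0' := e0; have be : b < e by rewrite /b; linarith.
have [C C0 HC] := convolution_sqrt_rough_upper b b0 be.
pose d0 := Num.min (Num.min d1 1) (b / 8).
have d00 : 0 < d0 by rewrite !lt_min d10 ltr01 divr_gt0.
have d0b : d0 <= b / 8 by rewrite !ge_min lexx ?orbT.
have sd : 0 < sqrt d0 by rewrite sqrtr_gt0.
have E0 : 0 <= B / sqrt d0 by rewrite divr_ge0// ltW.
(* When [z < d0] the maximum satisfies [D^2 <= 40 D + 2 C], impossible for [D > 41 + 2 C]. The first
   term covers [z >= d0]. *)
pose C' := B / sqrt d0 + 41 + 2 * C.
have C'0 : 0 < C' by rewrite /C'; move: E0; set q := B / _; linarith.
exists C' => //; exists d0 => // x x0 xd; have xb : x <= b by linarith.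
have [z] := EVT_max xb (sqrt_ratio_continuous x b x0 be).
rewrite in_itv/= => /andP[xz zb] zm.
have {zm} zmax y : x <= y -> y <= b -> u y / sqrt y <= u z / sqrt z.
  by move=> xy yb; apply: zm; rewrite in_itv/= xy.
have sx : 0 < sqrt x by rewrite sqrtr_gt0.
have z0 : 0 < z by exact: lt_le_trans xz.
have sz : 0 < sqrt z by rewrite sqrtr_gt0.
rewrite -ler_pdivrMr//; apply: le_trans (zmax x (lexx x) xb) _.
have [u0 uB] := andP (u_bnd z z0).
have [dz|] := leP d0 z.
  apply: (@le_trans _ _ (B / sqrt d0)); last by rewrite /C'; move: E0 C0; set q := B / _; linarith.
  by apply: ler_pM; rewrite ?invr_ge0 ?sqrtr_ge0 ?lef_pV2 ?posrE ?ler_wsqrtr.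
rewrite !lt_min => /andP[/andP[zd1 z1] zb4].
pose D := u z / sqrt z; have D0 : 0 <= D by rewrite divr_ge0// ltW.
have uD y : x <= y -> y <= b -> u y <= D * sqrt y.
  move=> xy yb; rewrite -ler_pdivrMr; first exact: zmax.
  by rewrite sqrtr_gt0; exact: lt_le_trans xy.
have h := HC z D z0 ltac:(linarith) D0 _.
have {}h := h ltac:(by move=> y y1 y2; apply: uD; [linarith|exact: ltW]).
have [_ HA2] := HA z z0 zd1.
have u2 : sqrt z * u (2 * z) <= 3 / 2 * (z * D).
  have s32 : sqrt 2 <= 3 / 2 :> R.
    by rewrite -(ler_pXn2r (n := 2)) ?nnegrE ?sqrtr_ge0 ?divr_ge0// [leLHS]expr2 sqrt_sqr//; linarith.
  have := uD (2 * z) ltac:(linarith) ltac:(linarith); rewrite sqrtrM// => /(ler_wpM2l (ltW sz)) => /le_trans; apply.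
  rewrite (_ : sqrt z * (D * (sqrt 2 * sqrt z)) = sqrt 2 * (sqrt z * sqrt z * D)); last by ring.
  by rewrite sqrt_sqr ?(ltW z0)// ler_wpM2r// mulr_ge0// ltW.
have uz : u z ^+ 2 = z * D ^+ 2.
  rewrite (_ : u z = D * sqrt z); last by rewrite /D divfK// gt_eqF.
  by rewrite exprMn [sqrt z ^+ 2]expr2 sqrt_sqr ?(ltW z0)// mulrC.
have : z * D ^+ 2 <= z * (40 * D + 2 * C).
  have zz : C * (z * z) <= C * z by rewrite ler_wpM2l// ler_piMl ?(ltW z0)// ltW.
  by move: h HA2; rewrite uz; move: u2; move: (A z) (sqrt z * u (2 * z)) => *; linarith.
rewrite ler_pM2l// -/D => q; rewrite /C'; move: E0 q; move: (B / _) => E E0.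
have [|D1] := leP D (41 + 2 * C); first by linarith.
have D41 : 41 <= D by linarith.
have D10 : 0 < D by linarith.
have := ler_wpM2l C0 D41; have := D1; rewrite -(ltr_pM2l D10) => m1 m2.
by linarith.
Qed.

Lemma affine_sqrt_integral0 (b al be ga : R) : 0 < b ->
  Itg `]0, b[ (fun y => al / sqrt y + be + ga * sqrt y) /\
  \int[mu]_(y in `]0, b[) (al / sqrt y + be + ga * sqrt y) =
    2 * al * sqrt b + be * b + 2 / 3 * ga * (b * sqrt b).
Proof.
move=> b0; have [i1 v1] := invsqrt_itv0 b b0; have [i2 v2] := sqrt_itv0 b b0.
have j1 := ItgZl _ _ al (measurable_itv _) i1.
have j2 := ItgZl _ _ ga (measurable_itv _) i2.
have j3 := Itg_cst 0 b be.
have j4 := ItgD _ _ _ (measurable_itv _) j1 j3.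
split; first exact: ItgD.
rewrite RintegralD// RintegralD// !RintegralZl// v1 v2 Rint_cst ?(ltW b0)//.
by field.
Qed.

Lemma affine_sqrt_integral (a b al be ga : R) : 0 <= a -> a <= b -> 0 < b ->
  Itg `]a, b[ (fun y => al / sqrt y + be + ga * sqrt y) /\
  \int[mu]_(y in `]a, b[) (al / sqrt y + be + ga * sqrt y) =
    2 * al * (sqrt b - sqrt a) + be * (b - a) + 2 / 3 * ga * (b * sqrt b - a * sqrt a).
Proof.
move=> a0 ab b0.
have [ib vb] := affine_sqrt_integral0 b al be ga b0.
have sub : (`]a, b[%classic : set R) `<=` `]0, b[%classic by apply: subset_itvr; rewrite bnd_simp.
split; first exact: Itg_sub ib.
move: a0; rewrite le_eqVlt => /predU1P[<-|a0].
  by rewrite vb sqrtr0; field.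
have [ia va] := affine_sqrt_integral0 a al be ga a0.
have := Rint_split_oo 0 a b _ _ ib; rewrite (ltW a0) ab => /(_ isT).
by rewrite vb va; move: (\int[mu]_(x in `]a, b[) _) => I E; linarith.
Qed.

Lemma dS_sqrt_Itg (x : R) (D : set R) : 0 < x -> measurable D -> D `<=` `]0, +oo[%classic ->
  Itg D (fun y => dS x y * sqrt y).
Proof. by move=> x0 mD sub; have [i _] := profile x x0; apply: Itg_sub i. Qed.

Lemma profile_truncate (x b : R) : 0 < x -> 4 * x <= 3 * b ->
  c * x - 4 * x ^+ 2 / b <= \int[mu]_(y in `]0, b[) (dS x y * sqrt y) <= c * x.
Proof.
move=> x0 xb; have b0 : 0 < b by linarith.
have [i v] := profile x x0.
have ib : Itg `]b, +oo[ (fun y => dS x y * sqrt y).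
  by apply: Itg_sub i => //; apply: subset_itvr; rewrite bnd_simp ltW.
have : `|\int[mu]_(y in `]b, +oo[) ((dS x y - dS 0 y) * sqrt y)| <= 4 * (x ^+ 2 - 0 ^+ 2) * (1 / b).
  apply: far_sqrt_le => //; [exact: ltW| |].
    by apply: Itg_eq ib => // y _; rewrite central_diff2_0 subr0.
  by move=> y _; rewrite mul1r ger0_norm// sqrtr_ge0.
under eq_Rint do rewrite central_diff2_0 subr0.
rewrite expr0n subr0 ler_norml => /andP[_ T].
have T0 : 0 <= \int[mu]_(y in `]b, +oo[) (dS x y * sqrt y).
  apply: Rintegral_ge0 => y; rewrite /= in_itv/= andbT => yb.
  by rewrite mulr_ge0 ?sqrtr_ge0// dS_sqrt_ge0 ?(ltW x0)//; linarith.
have := Rint_split_oy 0 b _ (ltW b0) i; rewrite v.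
move: T T0; move: (\int[mu]_(y in `]b, +oo[) _) (\int[mu]_(y in `]0, b[) _) => p q T T0 E.
by apply/andP; split; linarith.
Qed.

(** On []0, x[] set [k0 = 2 / sqrt y - 2 / sqrt x], so that [dS + k0 >= 0]. Using [u <= P sqrt y]
    against [dS + k0] and [u >= p sqrt y] against [k0] leaves an excess [(P - p) k0 sqrt y], whose
    integral is [2/3 (P - p) x]. *)
Lemma convolution_sqrt_upper (b p P : R) : 0 < b -> 0 <= P ->
  (forall y : R, 0 < y -> y < b -> p * sqrt y <= u y <= P * sqrt y) ->
  exists2 C : R, 0 <= C & forall x : R, 0 < x -> 4 * x <= b ->
    A x <= x * (P * c + 2 / 3 * (P - p)) + C * x ^+ 2.
Proof.
move=> b0 P0 uB; exists (B * CR + 4 * (sg b / b) * B).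
  exact: addr_ge0 (mulr_ge0 B_ge0 CR0) (mulr_ge0 (mulr_ge0 (ler0n _ 4) (sg_div_ge0 b b0)) B_ge0).
move=> x x0 xb; have xb3 : 4 * x <= 3 * b by linarith. have xltb : x < b by linarith.
have sx : 0 < sqrt x by rewrite sqrtr_gt0.
have := convolution_truncate x b x0 xb3; rewrite ler_norml => /andP[_ T].
have /andP[_ Pr] := profile_truncate x b x0 xb3.
have sub : (`]0, b[%classic : set R) `<=` `]0, +oo[%classic by apply: subset_itvl.
have sub1 : (`]0, x[%classic : set R) `<=` `]0, +oo[%classic by apply: subset_itvl.
have sub2 : (`]x, b[%classic : set R) `<=` `]0, +oo[%classic.
  by move=> y; rewrite /= !in_itv/= andbT => /andP[? _]; exact: lt_trans x0 _.
have ik := dS_u_Itg x x0.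
have I1 := Itg_sub _ _ _ (measurable_itv _) (measurable_itv _) sub1 ik.
have I2 := Itg_sub _ _ _ (measurable_itv _) (measurable_itv _) sub2 ik.
have J1 := dS_sqrt_Itg x _ x0 (measurable_itv _) sub1.
have J2 := dS_sqrt_Itg x _ x0 (measurable_itv _) sub2.
rewrite (Rint_split_oo 0 x b) in T; rewrite ?(ltW x0) ?(ltW xltb)//; last exact: Itg_sub ik.
rewrite (Rint_split_oo 0 x b) in Pr; rewrite ?(ltW x0) ?(ltW xltb)//; last exact: dS_sqrt_Itg.
have [L vL] := affine_sqrt_integral 0 x 0 (2 * (P - p)) (- (2 * (P - p)) / sqrt x) (lexx 0) (ltW x0) x0.
have h1 : \int[mu]_(y in `]0, x[) (dS x y * u y) <=
    P * \int[mu]_(y in `]0, x[) (dS x y * sqrt y) + 2 / 3 * (P - p) * x.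
  have <- : 2 * 0 * (sqrt x - sqrt 0) + 2 * (P - p) * (x - 0) +
      2 / 3 * (- (2 * (P - p)) / sqrt x) * (x * sqrt x - 0 * sqrt 0) = 2 / 3 * (P - p) * x.
    by field; rewrite gt_eqF.
  rewrite -vL -RintegralZl// -RintegralD//; last exact: ItgZl.
  apply: le_Rint => //; first by apply: ItgD => //; exact: ItgZl.
  move=> y; rewrite /= in_itv/= => /andP[y0 yx]; have sy : 0 < sqrt y by rewrite sqrtr_gt0.
  have /andP[u1 u2] := uB y y0 ltac:(linarith).
  have k := S_inner x y y0 yx.
  have k0 : 0 <= 2 / sqrt y - 2 / sqrt x.
    by rewrite subr_ge0 ler_wpM2l// lef_pV2 ?posrE// ler_wsqrtr// ltW.
  have k1 : 0 <= dS x y + (2 / sqrt y - 2 / sqrt x) by linarith.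
  have m1 := ler_wpM2l k1 u2; have m2 := ler_wpM2l k0 u1.
  have E : (2 / sqrt y - 2 / sqrt x) * sqrt y = 2 - 2 / sqrt x * sqrt y.
    by field; rewrite !gt_eqF.
  have -> : 0 / sqrt y + 2 * (P - p) + - (2 * (P - p)) / sqrt x * sqrt y =
      (P - p) * ((2 / sqrt y - 2 / sqrt x) * sqrt y) by rewrite E; ring.
  by move: m1 m2; move: (2 / sqrt y - 2 / sqrt x) (dS x y) (sqrt y) => *; linarith.
have h2 : \int[mu]_(y in `]x, b[) (dS x y * u y) <= P * \int[mu]_(y in `]x, b[) (dS x y * sqrt y).
  rewrite -RintegralZl//; apply: le_Rint => //; first exact: ItgZl.
  move=> y; rewrite /= in_itv/= => /andP[xy yb]; rewrite mulrCA ler_wpM2l//.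
    by apply: dS_sqrt_ge0 => //; exact: ltW.
  by case/andP: (uB y (lt_trans x0 xy) yb).
have := ler_wpM2l P0 Pr; move: T h1 h2.
move: (A x) (\int[mu]_(y in `]0, x[) (dS x y * u y)) (\int[mu]_(y in `]x, b[) (dS x y * u y)).
move: (\int[mu]_(y in `]0, x[) (dS x y * sqrt y)) (\int[mu]_(y in `]x, b[) (dS x y * sqrt y)).
by move: ((B * CR + 4 * (sg b / b) * B) * x ^+ 2) => *; linarith.
Qed.

(** The same splitting with the bounds exchanged, except that the negative part [k0] meets
    [u <= P sqrt y] only on []0, r^2 x[]. On the rest of []0, x[] monotonicity gives
    [u y <= u x <= q sqrt x]. *)
Lemma convolution_sqrt_lower (b p P r : R) : 0 < b -> b <= e -> 0 <= p -> 0 < r -> r <= 1 ->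
  (forall y : R, 0 < y -> y < b -> p * sqrt y <= u y <= P * sqrt y) ->
  exists2 C : R, 0 <= C & forall x q : R, 0 < x -> 4 * x <= b -> u x <= q * sqrt x ->
    x * (p * c - (P - p) * (2 * r ^+ 2 - 4 / 3 * r ^+ 3) - 2 * q * (1 - r) ^+ 2
         + p * (2 * (1 - r ^+ 2) - 4 / 3 * (1 - r ^+ 3))) - C * x ^+ 2 <= A x.
Proof.
move=> b0 be p0 r0 r1 uB; exists (B * CR + 4 * (sg b / b) * B + p * (4 / b)).
  apply: addr_ge0; last by rewrite mulr_ge0// divr_ge0// ltW.
  exact: addr_ge0 (mulr_ge0 B_ge0 CR0) (mulr_ge0 (mulr_ge0 (ler0n _ 4) (sg_div_ge0 b b0)) B_ge0).
move=> x q x0 xb uq; have xb3 : 4 * x <= 3 * b by linarith. have xltb : x < b by linarith.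
have sx : 0 < sqrt x by rewrite sqrtr_gt0.
(* With [r = m / M], this is where [M sqrt y] overtakes [m sqrt x]. *)
pose t := r ^+ 2 * x.
have t0 : 0 < t by rewrite mulr_gt0// exprn_gt0.
have tx : t <= x by rewrite ger_pMl// expr_le1// ltW.
have st : sqrt t = r * sqrt x.
  by rewrite sqrtrM ?sqr_ge0// sqrtr_sqr gtr0_norm.
have := convolution_truncate x b x0 xb3; rewrite ler_norml => /andP[T _].
have /andP[Pr _] := profile_truncate x b x0 xb3.
have sub y1 y2 : 0 <= y1 -> (`]y1, y2[%classic : set R) `<=` `]0, +oo[%classic.
  by move=> y10 y; rewrite /= !in_itv/= andbT => /andP[? _]; exact: le_lt_trans y10 _.
have ik y1 y2 (y10 : 0 <= y1) := Itg_sub _ _ _ (measurable_itv _) (measurable_itv _) (sub y1 y2 y10) (dS_u_Itg x x0).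
have jk y1 y2 (y10 : 0 <= y1) := dS_sqrt_Itg x _ x0 (measurable_itv _) (sub y1 y2 y10).
rewrite (Rint_split_oo 0 x b) in T; [|by rewrite (ltW x0) (ltW xltb)|exact: ik].
rewrite (Rint_split_oo 0 x b) in Pr; [|by rewrite (ltW x0) (ltW xltb)|exact: jk].
rewrite (Rint_split_oo 0 t x) in T; [|by rewrite (ltW t0) tx|exact: ik].
rewrite (Rint_split_oo 0 t x) in Pr; [|by rewrite (ltW t0) tx|exact: jk].
have k y : 0 < y -> y < x -> 0 <= 2 / sqrt y - 2 / sqrt x /\ 0 <= dS x y + (2 / sqrt y - 2 / sqrt x).
  move=> y0 yx; have := S_inner x y y0 yx; split; last linarith.
  by rewrite subr_ge0 ler_wpM2l// lef_pV2 ?posrE ?sqrtr_gt0// ler_wsqrtr// ltW.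
have h1 : p * \int[mu]_(y in `]0, t[) (dS x y * sqrt y) - (P - p) * (2 * r ^+ 2 - 4 / 3 * r ^+ 3) * x <=
    \int[mu]_(y in `]0, t[) (dS x y * u y).
  have [L vL] := affine_sqrt_integral 0 t 0 (2 * (P - p)) (- (2 * (P - p)) / sqrt x) (lexx 0) (ltW t0) t0.
  have -> : (P - p) * (2 * r ^+ 2 - 4 / 3 * r ^+ 3) * x = 2 * 0 * (sqrt t - sqrt 0) + 2 * (P - p) * (t - 0) +
      2 / 3 * (- (2 * (P - p)) / sqrt x) * (t * sqrt t - 0 * sqrt 0).
    by rewrite st /t; field; rewrite gt_eqF.
  have J := ItgZl _ _ p (measurable_itv _) (jk 0 t (lexx 0)).
  rewrite -vL -RintegralZl//; last exact: jk.
  rewrite -RintegralB//; apply: le_Rint => //; [exact: ItgB|exact: ik|].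
  move=> y; rewrite /= in_itv/= => /andP[y0 yx]; have sy : 0 < sqrt y by rewrite sqrtr_gt0.
  have /andP[u1 u2] := uB y y0 ltac:(linarith).
  have [k0 k1] := k y y0 ltac:(linarith).
  have m1 := ler_wpM2l k1 u1; have m2 := ler_wpM2l k0 u2.
  have E : (2 / sqrt y - 2 / sqrt x) * sqrt y = 2 - 2 / sqrt x * sqrt y.
    by field; rewrite !gt_eqF.
  have -> : 0 / sqrt y + 2 * (P - p) + - (2 * (P - p)) / sqrt x * sqrt y =
      (P - p) * ((2 / sqrt y - 2 / sqrt x) * sqrt y) by rewrite E; ring.
  by move: m1 m2; move: (2 / sqrt y - 2 / sqrt x) (dS x y) (sqrt y) => *; linarith.
have h2 : p * \int[mu]_(y in `]t, x[) (dS x y * sqrt y) - (2 * q * (1 - r) ^+ 2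
         - p * (2 * (1 - r ^+ 2) - 4 / 3 * (1 - r ^+ 3))) * x <=
    \int[mu]_(y in `]t, x[) (dS x y * u y).
  have [L vL] := affine_sqrt_integral t x (2 * q * sqrt x) (- 2 * q - 2 * p) (2 * p / sqrt x) (ltW t0) tx x0.
  have -> : (2 * q * (1 - r) ^+ 2 - p * (2 * (1 - r ^+ 2) - 4 / 3 * (1 - r ^+ 3))) * x =
     2 * (2 * q * sqrt x) * (sqrt x - sqrt t) + (- 2 * q - 2 * p) * (x - t) +
      2 / 3 * (2 * p / sqrt x) * (x * sqrt x - t * sqrt t).
    rewrite st /t; transitivity (4 * q * (sqrt x * sqrt x) * (1 - r) + (- 2 * q - 2 * p) * (x - r ^+ 2 * x) +
      2 / 3 * (2 * p) * (x - r ^+ 3 * x)); last by field; rewrite gt_eqF.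
    by rewrite (sqrt_sqr x (ltW x0)); field.
  have J := ItgZl _ _ p (measurable_itv _) (jk t x (ltW t0)).
  rewrite -vL -RintegralZl//; last exact/jk/ltW.
  rewrite -RintegralB//; apply: le_Rint => //; [exact: ItgB|exact/ik/ltW|].
  move=> y; rewrite /= in_itv/= => /andP[ty yx]; have y0 : 0 < y by exact: lt_trans ty.
  have sy : 0 < sqrt y by rewrite sqrtr_gt0.
  have /andP[u1 _] := uB y y0 ltac:(linarith).
  have u2 : u y <= q * sqrt x by apply: le_trans uq; apply: u_nondecreasing => //; [exact: ltW|linarith].
  have [k0 k1] := k y y0 yx.
  have m1 := ler_wpM2l k1 u1; have m2 := ler_wpM2l k0 u2.
  have -> : 2 * q * sqrt x / sqrt y + (- 2 * q - 2 * p) + 2 * p / sqrt x * sqrt y =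
      (2 / sqrt y - 2 / sqrt x) * (q * sqrt x - p * sqrt y).
    by field; rewrite !gt_eqF.
  by move: m1 m2; move: (2 / sqrt y - 2 / sqrt x) (dS x y) (sqrt y) => *; linarith.
have h3 : p * \int[mu]_(y in `]x, b[) (dS x y * sqrt y) <= \int[mu]_(y in `]x, b[) (dS x y * u y).
  rewrite -RintegralZl//; last exact/jk/ltW.
  apply: le_Rint => //; [exact/ItgZl/jk/ltW|exact/ik/ltW|].
  move=> y; rewrite /= in_itv/= => /andP[xy yb]; rewrite mulrCA ler_wpM2l//.
    by apply: dS_sqrt_ge0 => //; exact: ltW.
  by case/andP: (uB y (lt_trans x0 xy) yb).
have := ler_wpM2l p0 Pr; move: T h1 h2 h3.
rewrite (_ : (B * CR + 4 * (sg b / b) * B + p * (4 / b)) * x ^+ 2 =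
  (B * CR + 4 * (sg b / b) * B) * x ^+ 2 + p * (4 * x ^+ 2 / b)); last by ring.
move: (4 * x ^+ 2 / b) ((B * CR + 4 * (sg b / b) * B) * x ^+ 2).
move: (A x) (\int[mu]_(y in `]0, t[) (dS x y * u y)) (\int[mu]_(y in `]t, x[) (dS x y * u y)).
move: (\int[mu]_(y in `]x, b[) (dS x y * u y)).
move: (\int[mu]_(y in `]0, t[) (dS x y * sqrt y)) (\int[mu]_(y in `]t, x[) (dS x y * sqrt y)).
move: (\int[mu]_(y in `]x, b[) (dS x y * sqrt y)).
by move=> *; linarith.
Qed.

(** The lower limit is obtained as minus the upper limit of [- g]. Each inequality of
    [sqrt_fixed_point] is first proved up to a multiple of a slack [t], which [le0_of_small]
    removes. *)
Lemma u_sqrt_equiv (eps : R) : 0 < eps -> exists2 d : R, 0 < d &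
  forall x : R, 0 < x -> x < d -> `|u x - c * sqrt x| <= eps * sqrt x.
Proof.
have e0' := e0; have c0 : 0 < c by have := c43; linarith.
have [a a0 [d1 d10 H1]] := u_sqrt_lower; have [b b0 [d2 d20 H2]] := u_sqrt_upper.
pose g x := u x / sqrt x.
have gE x : 0 < x -> u x = g x * sqrt x by move=> x0; rewrite /g divfK// gt_eqF// sqrtr_gt0.
have d120 : 0 < Num.min d1 d2 by rewrite lt_min d10.
have gab x : 0 < x -> x < Num.min d1 d2 -> a <= g x <= b.
  move=> x0; rewrite lt_min => /andP[xd1 xd2]; have sx : 0 < sqrt x by rewrite sqrtr_gt0.
  by rewrite ler_pdivlMr// ler_pdivrMr// H1 ?H2.
have [M /andP[aM Mb] HM] := sup_near0 _ g a b _ d120 gab.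
have [] := sup_near0 _ (fun x => - g x) (- b) (- a) _ d120.
  by move=> x x0 xd; rewrite !lerN2 andbC gab.
move=> m' /andP[bm ma] Hm'; pose m := - m'; have m0 : 0 < m by rewrite /m; linarith.
have near_g t : 0 < t -> exists2 d : R, 0 < d & forall x : R, 0 < x -> x < d -> m - t <= g x <= M + t.
  move=> t0; have [[d3 d30 H3] _] := HM t t0; have [[d4 d40 H4] _] := Hm' t t0.
  exists (Num.min d3 d4); first by rewrite lt_min d30.
  move=> x x0; rewrite lt_min => /andP[xd3 xd4].
  by have := H3 x x0 xd3; have := H4 x x0 xd4; rewrite /m; linarith.
have mM : m <= M.
  rewrite -subr_le0; apply: (le0_of_small _ _ 2 1 ltr01) => t t0 _.
  have [d dp H] := near_g t t0; have := H (d / 2) ltac:(by rewrite divr_gt0) ltac:(linarith).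
  by linarith.
have M0 : 0 < M by exact: lt_le_trans mM.
have setup t : 0 < t -> t <= m -> exists2 d : R, 0 < d & exists2 k : R, (0 < k /\ k < e) &
    (forall y : R, 0 < y -> y < k -> (m - t) * sqrt y <= u y <= (M + t) * sqrt y) /\
    (4 * d <= k /\ forall x : R, 0 < x -> x < d -> `|A x - u x ^+ 2| <= t * u x ^+ 2).
  move=> t0 tm; have [d3 d30 H3] := near_g t t0; have [d4 d40 H4] := A_u t t0.
  pose k := Num.min d3 (e / 2); have k0 : 0 < k by rewrite lt_min d30 divr_gt0.
  have kd : k <= d3 by rewrite ge_min lexx.
  have ke : k <= e / 2 by rewrite ge_min lexx orbT.
  exists (Num.min d4 (k / 4)); first by rewrite lt_min d40 divr_gt0.
  exists k; first by split => //; linarith.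
  split.
    move=> y y0 yk; rewrite (gE y y0); have sy : 0 < sqrt y by rewrite sqrtr_gt0.
    by have /andP[? ?] := H3 y y0 ltac:(linarith); rewrite !ler_wpM2r// ltW.
  split; first by have : Num.min d4 (k / 4) <= k / 4 by [rewrite ge_min lexx orbT]; linarith.
  by move=> x x0; rewrite lt_min => /andP[xd4 _]; exact: H4.
pose t1 := Num.min m 1; have t10 : 0 < t1 by rewrite lt_min m0 ltr01.
have small C t : 0 <= C -> 0 < t -> 0 < t / (C + 1) /\ forall x : R, 0 < x -> x < t / (C + 1) -> C * x ^+ 2 <= x * t.
  move=> C0 t0; have C1 : 0 < C + 1 by linarith.
  split; first by rewrite divr_gt0.
  move=> x x0; rewrite ltr_pdivlMr// => h; rewrite expr2 mulrCA ler_pM2l//.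
  by move: h; rewrite mulrDr mulr1 [x * C]mulrC; linarith.
have I1 : M ^+ 2 <= M * c + 2 / 3 * (M - m).
  rewrite -subr_le0; apply: (le0_of_small _ _ (2 * M + M ^+ 2 + c + 4 / 3 + 1) t1 t10) => t t0.
  rewrite le_min => /andP[tm tl1].
  have [d dp [k [k0 ke] [ub [dk HA]]]] := setup t t0 tm.
  have [C C0 HC] := convolution_sqrt_upper k (m - t) (M + t) k0 (ltac:(linarith) : 0 <= M + t) ub.
  have [s0 Hs] := small C t C0 t0.
  (* A point where the ratio nearly attains [M], close enough to 0 for the quadratic error to be
     below [x * t]. *)
  have [_ /(_ (Num.min d (t / (C + 1))))] := HM t t0; rewrite lt_min dp s0 => /(_ isT) [x].
  rewrite lt_min => /andP[x0 /andP[xd xs]] gx.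
  have hA := HC x x0 ltac:(linarith); have hs := Hs x x0 xs.
  have := HA x x0 xd; rewrite ler_norml (gE x x0) exprMn [sqrt x ^+ 2]expr2 (sqrt_sqr x (ltW x0)) => /andP[hl _].
  have g2 : (M - t) ^+ 2 <= g x ^+ 2 by rewrite ler_pXn2r ?nnegrE//; linarith.
  have key : x * ((1 - t) * g x ^+ 2) <= x * ((M + t) * c + 2 / 3 * (M + t - (m - t)) + t).
    by move: hl hA hs; move: (A x) (C * x ^+ 2) (g x ^+ 2) => *; linarith.
  rewrite ler_pM2l// in key.
  have := ler_wpM2l (ltac:(linarith) : 0 <= 1 - t) g2.
  have q1 : 0 <= t ^+ 2 * (1 - t) by rewrite mulr_ge0 ?sqr_ge0//; linarith.
  have q2 : 0 <= t ^+ 2 * M by rewrite mulr_ge0 ?sqr_ge0// ltW.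
  by move=> q3; move: key q1 q2 q3; move: (g x) => *; linarith.
have I2 : let r := m / M in m * c - (M - m) * (2 * r ^+ 2 - 4 / 3 * r ^+ 3) - 2 * m * (1 - r) ^+ 2
     + m * (2 * (1 - r ^+ 2) - 4 / 3 * (1 - r ^+ 3)) <= m ^+ 2.
  move=> r; have r0 : 0 < r by rewrite divr_gt0.
  have r1 : r <= 1 by rewrite ler_pdivrMr// mul1r.
  (* The polynomials in [r] are made opaque: the remaining arithmetic is linear in them, and the
     slack estimate keeps them as coefficients. *)
  have [al alE] : exists al, al = 2 * r ^+ 2 - 4 / 3 * r ^+ 3 by eexists.
  have [be beE] : exists be, be = (1 - r) ^+ 2 by eexists.
  have [ga gaE] : exists ga, ga = 2 * (1 - r ^+ 2) - 4 / 3 * (1 - r ^+ 3) by eexists.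
  rewrite -alE -beE -gaE.
  rewrite -subr_le0; apply: (le0_of_small _ _ (c + 2 * al + 2 * be + ga + 1 + m ^+ 2 + 4 * m + 2) t1 t10) => t t0.
  rewrite le_min => /andP[tm tl1].
  have [d dp [k [k0 ke] [ub [dk HA]]]] := setup t t0 tm.
  have [C C0 HC] := convolution_sqrt_lower k (m - t) (M + t) r k0 (ltW ke) (ltac:(linarith) : 0 <= m - t) r0 r1 ub.
  have [s0 Hs] := small C t C0 t0.
  have [_ /(_ (Num.min d (t / (C + 1))))] := Hm' t t0; rewrite lt_min dp s0 => /(_ isT) [x].
  rewrite lt_min => /andP[x0 /andP[xd xs]] gx.
  have {}gx : g x <= m + t by rewrite /m; linarith.
  have gx0 : 0 <= g x by rewrite /g divr_ge0 ?sqrtr_ge0//; case/andP: (u_bnd x x0).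
  have := HC x (m + t) x0 ltac:(linarith); rewrite (gE x x0) ler_wpM2r ?sqrtr_ge0// => /(_ isT).
  rewrite -alE -beE -gaE => hA; have hs := Hs x x0 xs.
  have := HA x x0 xd; rewrite ler_norml (gE x x0) exprMn [sqrt x ^+ 2]expr2 (sqrt_sqr x (ltW x0)) => /andP[_ hl].
  have g2 : g x ^+ 2 <= (m + t) ^+ 2 by rewrite ler_pXn2r ?nnegrE//; linarith.
  have key : x * ((m - t) * c - (M + t - (m - t)) * al - 2 * (m + t) * be + (m - t) * ga - t) <= x * ((1 + t) * g x ^+ 2).
    by move: hl hA hs; move: (A x) (C * x ^+ 2) (g x ^+ 2) => *; linarith.
  rewrite ler_pM2l// in key.
  have q3 := ler_wpM2l (ltac:(linarith) : 0 <= 1 + t) g2.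
  have q0 : 0 <= (1 - t) * (2 * m * t + t + t ^+ 2).
    by rewrite mulr_ge0 ?subr_ge0// !addr_ge0 ?sqr_ge0 ?(ltW t0)// !mulr_ge0 ?(ltW m0) ?(ltW t0).
  have q1 : 0 <= t * (1 - t) by rewrite mulr_ge0 ?(ltW t0)//; linarith.
  by move: key q0 q1 q3; move: (g x) => *; linarith.
have [mE ME] := sqrt_fixed_point _ c m M c43 m0 mM I1 I2.
move=> ep; have [d dp H] := near_g eps ep; exists d => // x x0 xd.
have := H x x0 xd; rewrite mE ME => /andP[h1 h2]; rewrite (gE x x0) -mulrBl normrM.
by rewrite (ger0_norm (sqrtr_ge0 x)) ler_wpM2r ?sqrtr_ge0// ler_norml; linarith.
Qed.

(** An instance of [du_le]: [u y] is comparable with [sqrt y], and so is [y * sg y], while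
    [far_mass y] is of order [1 / y]. All its hypotheses then compare like powers of [y]. *)
Lemma du_sqrt_le : exists2 C : R, 0 <= C &
  exists2 d : R, 0 < d & forall x : R, 0 < x -> x < d -> du x <= C / sqrt x.
Proof.
have e0' := e0; have B0 := B_ge0.
have [a a0 [d1 d10 H1]] := u_sqrt_lower; have [b b0 [d2 d20 H2]] := u_sqrt_upper.
have [d3 d30 H3] := dA_u 1 ltr01.
have s2 : 0 < sqrt d2 by rewrite sqrtr_gt0.
have q0 : 0 <= B / sqrt d2 by rewrite divr_ge0// ltW.
pose b' := b + B / sqrt d2; have b'0 : 0 <= b' by rewrite addr_ge0// ltW.
have ub' y : 0 < y -> u y <= b' * sqrt y.
  move=> y0; have sy := sqrtr_ge0 y; have [yd|dy] := ltP y d2.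
    by apply: le_trans (H2 y y0 yd) _; rewrite ler_wpM2r// lerDl.
  have [_ uB] := andP (u_bnd y y0); apply: (le_trans uB).
  apply: (@le_trans _ _ (B / sqrt d2 * sqrt y)); last by rewrite ler_wpM2r// lerDr ltW.
  by rewrite mulrAC ler_pdivlMr// ler_wpM2l// ler_wsqrtr.
pose D := B * (sg e / e) + B * CR.
have D0 : 0 <= D := addr_ge0 (mulr_ge0 B0 (sg_div_ge0 e e0)) (mulr_ge0 B0 CR0).
have fm x : 0 < x -> far_mass x <= b' / (2 * x) + D.
  move=> x0; have x2 : 0 < 2 * x by rewrite mulr_gt0.
  rewrite /far_mass -addrA lerD2r.
  have [i v] := invsqr_itvy (2 * x) x2.
  have sub : (`](2 * x), e[%classic : set R) `<=` `](2 * x), +oo[%classic by apply: subset_itvl.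
  have i' := Itg_sub _ _ _ (measurable_itv _) (measurable_itv _) sub i.
  apply: (@le_trans _ _ (\int[mu]_(y in `](2 * x), e[) (b' * (y ^+ 2)^-1))); last first.
    rewrite RintegralZl// ler_wpM2l// -v; apply: Rint_sub_le => // y _.
    by rewrite invr_ge0 sqr_ge0.
  have k y : 2 * x < y -> 0 <= sg y / y ^+ 2 * u y <= b' * (y ^+ 2)^-1.
    move=> xy; have y0 : 0 < y by exact: lt_trans xy.
    have sy : 0 < sqrt y by rewrite sqrtr_gt0.
    have [u0 _] := andP (u_bnd y y0).
    have t0 : 0 <= sg y / y ^+ 2 by rewrite divr_ge0 ?sqr_ge0 ?(ltW (sg_gt0 _ y0)).
    rewrite mulr_ge0//=; apply: le_trans (ler_wpM2l t0 (ub' y y0)) _.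
    by rewrite sgE le_eqVlt; apply/orP; left; apply/eqP; field; rewrite !gt_eqF.
  apply: le_Rint => //; last by move=> y; rewrite /= in_itv/= => /andP[/k/andP[]].
    apply: (Itg_eq _ (fun y => sg y / y ^+ 2 * `|u y|)) => //.
      move=> y; rewrite /= in_itv/= => /andP[xy _].
      by rewrite ger0_norm//; case/andP: (u_bnd y (lt_trans x2 xy)).
    have uB y : 2 * x < y -> y < e -> `|u y| <= B.
      by move=> xy _; apply: normr_u_le; exact: lt_trans xy.
    exact: sg_weight_Itg _ _ B u x2 (measurable_funTS sg_meas) (u_measurable_oo _ _ (ltW x2)) uB.
  exact: ItgZl.
pose C := 2 * (b / a) + a^-1 + (b' + D) / a ^+ 2.
have c1 : 0 < b / a by rewrite divr_gt0.
have c2 : 0 < a^-1 by rewrite invr_gt0.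
have c3 : 0 <= (b' + D) / a ^+ 2 by rewrite divr_ge0 ?sqr_ge0// addr_ge0.
have C0 : 0 < C by rewrite /C; move: c1 c2 c3; move: (b / a) (a^-1) ((b' + D) / a ^+ 2) => *; linarith.
have C1 : 2 * (b / a) <= C by rewrite /C; move: c2 c3; move: (a^-1) ((b' + D) / a ^+ 2) => *; linarith.
have C2 : a^-1 <= C by rewrite /C; move: c1 c3; move: (b / a) ((b' + D) / a ^+ 2) => *; linarith.
have C3 : (b' + D) / a ^+ 2 <= C by rewrite /C; move: c1 c2; move: (b / a) (a^-1) => *; linarith.
clearbody C.
pose e1 := Num.min (Num.min d1 (d2 / 2)) (Num.min d3 (Num.min 1 (e / 2))).
have e10 : 0 < e1 by rewrite !lt_min d10 d30 ltr01 !divr_gt0.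
have e1d1 : e1 <= d1 by rewrite !ge_min lexx.
have e1d2 : e1 <= d2 / 2 by rewrite !ge_min lexx !orbT.
have e1d3 : e1 <= d3 by rewrite !ge_min lexx !orbT.
have e11 : e1 <= 1 by rewrite !ge_min lexx !orbT.
have e1e : e1 <= e / 2 by rewrite !ge_min lexx !orbT.
clearbody e1.
have le (k v : R) : 0 <= v -> k <= C -> k * v <= C * v by move=> ? ?; exact: ler_wpM2r.
have [| | | |C' C'0 H] := du_le C e1 C0 e10 ltac:(linarith) du_c.
- move=> y y0 ye; have u0 : 0 <= u y by case/andP: (u_bnd y y0).
  apply: le_trans (le _ _ u0 C1); apply: le_trans (H2 (2 * y) ltac:(linarith) ltac:(linarith)) _.
  have s22 : sqrt 2 <= 2 :> R by have := four_sqrt2_le R; linarith.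
  have h := H1 y y0 ltac:(linarith); rewrite sqrtrM// -mulrA mulrCA.
  rewrite (_ : b / a * u y = b * (u y / a)); last by ring.
  apply: ler_pM => //; rewrite ?sqrtr_ge0 ?mulr_ge0 ?(ltW b0) ?sqrtr_ge0//.
  by rewrite ler_pM2l// ler_pdivlMr// mulrC.
- move=> y y0 ye; have u0 : 0 <= u y by case/andP: (u_bnd y y0).
  apply: le_trans (le _ _ u0 C2); rewrite (mul_sg y y0) mulrC ler_pdivlMr// mulrC.
  by apply: H1 => //; linarith.
- move=> y y0 ye; apply: le_trans (le _ _ (sqr_ge0 _) C3).
  have bD : 0 <= b' + D by rewrite addr_ge0.
  have h1 : y ^+ 2 * far_mass y <= (b' + D) * y.
    apply: le_trans (ler_wpM2l (sqr_ge0 y) (fm y y0)) _.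
    rewrite mulrDr (_ : y ^+ 2 * (b' / (2 * y)) = b' * y / 2); last by field; rewrite gt_eqF.
    have := mulr_ge0 b'0 (ltW y0); have y1 : y <= 1 by linarith.
    by have := ler_wpM2l (mulr_ge0 D0 (ltW y0)) y1; linarith.
  apply: (le_trans h1); rewrite -mulrA ler_wpM2l// mulrC ler_pdivlMr ?exprn_gt0//.
  rewrite -{1}(sqrt_sqr y (ltW y0)) -expr2 -exprMn mulrC.
  have [u0 _] := andP (u_bnd y y0).
  rewrite ler_pXn2r ?nnegrE ?mulr_ge0 ?sqrtr_ge0 ?(ltW a0)//.
  by apply: H1 => //; linarith.
- move=> y y0 ye; have := H3 y y0 ltac:(linarith); rewrite ler_norml mul1r => /andP[h _].
  by move: h; move: (u y * du y) => *; linarith.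
exists (C' * b); first by rewrite mulr_ge0// ltW.
exists (e1 / 2); first by rewrite divr_gt0.
move=> x x0 xe; apply: le_trans (H x x0 ltac:(linarith)) _; rewrite -mulrA ler_wpM2l//.
have sx : 0 < sqrt x by rewrite sqrtr_gt0.
rewrite ler_pdivrMr//; apply: le_trans (H2 x x0 ltac:(linarith)) _.
by rewrite [leRHS]mulrAC ler_pdivlMr// -mulrA (sqrt_sqr x (ltW x0)).
Qed.

Lemma profile_increment (x h : R) : 0 < x -> 0 < h ->
  Itg `]0, +oo[ (fun y => (dS (x + h) y - dS x y) * sqrt y) /\
  \int[mu]_(y in `]0, +oo[) ((dS (x + h) y - dS x y) * sqrt y) = c * h.
Proof.
move=> x0 h0; have [i v] := profile x x0; have [i' v'] := profile (x + h) (addr_gt0 x0 h0).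
have E y : (dS (x + h) y - dS x y) * sqrt y = dS (x + h) y * sqrt y - dS x y * sqrt y by ring.
split; first by apply: Itg_eq (ItgB _ _ _ (measurable_itv _) i' i).
by under eq_Rint do rewrite E; rewrite RintegralB// v v'; ring.
Qed.

(** The profile [c sqrt y] contributes exactly [c * (c * h)] to the increment, whence the limit
    [c^2]. What remains is [w = u - c sqrt]: small by [eta], but with a derivative merely bounded by
    [V / sqrt x], so the window [q^2 x] trades [eta / q^3] against [V q]. *)
Lemma dA_sqrt_approx (x b q eta D V : R) : 0 < x -> 4 * x <= b -> b <= e -> 0 < q -> q <= 1 / 2 ->
  0 <= eta -> 0 <= D -> 0 <= V ->
  (forall y : R, 0 < y -> y < b -> `|u y - c * sqrt y| <= eta * sqrt y) ->
  (forall y : R, b <= y -> `|u y - c * sqrt y| <= D * sqrt y) ->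
  (forall y : R, `|y - x| < x / 2 -> `|du y - c / (2 * sqrt y)| <= V / sqrt x) ->
  `|dA x - c ^+ 2| <= 16 * eta / q ^+ 3 + 6 * V * q + 2 * x * (B * CR) + (4 * eta + 8 * x * (D / b)).
Proof.
move=> x0 xb be q0 q12 eta0 D0 V0 near far duV.
have [x2 b0 x2b hx] : [/\ 0 < 2 * x, 0 < b, 2 * x < b & 0 < x / 2] by split; linarith.
have sx : 0 < sqrt x by rewrite sqrtr_gt0.
have q21 : q ^+ 2 <= 1 / 4.
  by rewrite (_ : 1 / 4 = (1 / 2) ^+ 2); [rewrite ler_pXn2r ?nnegrE ?(ltW q0)|field].
pose rho := q ^+ 2 * x; have rho0 : 0 < rho by rewrite mulr_gt0// exprn_gt0.
have rhox : rho <= x / 2 by have := ler_wpM2r (ltW x0) q21; rewrite -/rho; linarith.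
have srho : sqrt rho = q * sqrt x by rewrite sqrtrM ?sqr_ge0// sqrtr_sqr gtr0_norm.
have srho2 : sqrt (rho / 2) = q * sqrt x / sqrt 2.
  by rewrite sqrtrM ?(ltW rho0)// srho sqrtrV.
pose w y := u y - c * sqrt y.
have mw (D' : set R) : measurable D' -> D' `<=` `]0, +oo[%classic -> measurable_fun D' w.
  move=> mD sub; apply: measurable_funB; first by apply: measurable_funS u_meas.
  by apply: measurable_funM => //; apply: measurable_funTS; exact: measurable_sqrt.
have sub2 : (`]0, (2 * x)[%classic : set R) `<=` `]0, +oo[%classic by apply: subset_itvl.
have := convolution_derivative_approx x rho (V / sqrt x) (eta * sqrt (2 * x)) (c ^+ 2)
  (4 * eta + 8 * x * (D / b)) (2 * eta / x + 4 * (D / b)) (x / 2) w x0.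
rewrite (mul_sg rho rho0) srho (_ : 6 * (V / sqrt x) * (q * sqrt x) = 6 * V * q); last first.
  by field; rewrite gt_eqF.
rewrite sgE srho2 sqrtrM//.
rewrite (_ : 8 * (x * (eta * (sqrt 2 * sqrt x))) * ((q * sqrt x / sqrt 2)^-1 / rho) = 16 * eta / q ^+ 3); last first.
  have s2 : 0 < sqrt 2 :> R by rewrite sqrtr_gt0.
  rewrite /rho; transitivity (8 * (sqrt 2 * sqrt 2) * eta / q ^+ 3).
    by field; rewrite !gt_eqF// exprn_gt0.
  by rewrite (sqrt_sqr (2 : R))//; congr (_ / _); ring.
apply=> //.
- by linarith.
- by linarith.
- by rewrite divr_ge0// ltW.
- by apply: addr_ge0; [rewrite divr_ge0 ?mulr_ge0// ltW|rewrite mulr_ge0// divr_ge0// ltW].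
- exact: mw.
- move=> y y0 y2; apply: le_trans (near y y0 ltac:(linarith)) _.
  by rewrite -sqrtrM// ler_wpM2l// ler_wsqrtr// ltW.
- have hV z : `|z - x| < rho -> is_derive (z : R) 1 w (du z - c * (2 * sqrt z)^-1).
    rewrite ltr_norml => /andP[z1 z2]; have z0 : 0 < z by linarith.
    by apply: dB; [apply: u_der => //; linarith|apply: dZ; exact: dsqrt].
  apply: (derivative_bound_lipschitz _ w _ x rho (V / sqrt x) hV) => z zr.
  by apply: duV; exact: lt_le_trans rhox.
move=> h h0 hh; have [ip vp] := profile_increment x h x0 h0.
have iu := dS_increment_u_Itg x h x0 h0.
have E y : (dS (x + h) y - dS x y) * w y =
    (dS (x + h) y - dS x y) * u y - c * ((dS (x + h) y - dS x y) * sqrt y) by rewrite /w; ring.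
have iw : Itg `]0, +oo[ (fun y => (dS (x + h) y - dS x y) * w y).
  by apply: Itg_eq (ItgB _ _ _ (measurable_itv _) iu (ItgZl _ _ c (measurable_itv _) ip)).
have vw : \int[mu]_(y in `]0, +oo[) ((dS (x + h) y - dS x y) * w y) =
    \int[mu]_(y in `]0, +oo[) ((dS (x + h) y - dS x y) * u y) - c * (c * h).
  by under eq_Rint do rewrite E; rewrite RintegralB ?RintegralZl ?vp//; exact: ItgZl.
have i2 : Itg `](2 * x), +oo[ (fun y => (dS (x + h) y - dS x y) * w y).
  by apply: Itg_sub iw => //; apply: subset_itvr; rewrite bnd_simp ltW.
have f1 : `|\int[mu]_(y in `](2 * x), b[) ((dS (x + h) y - dS x y) * w y)| <=
    4 * ((x + h) ^+ 2 - x ^+ 2) * (eta / (2 * x)).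
  apply: far_sqrt_le => //; [exact: ltW|linarith|linarith| |].
    by apply: Itg_sub i2 => //; apply: subset_itvl.
  by move=> y; rewrite in_itv/= => /andP[y1 y2]; apply: near => //; exact: lt_trans y1.
have f2 : `|\int[mu]_(y in `]b, +oo[) ((dS (x + h) y - dS x y) * w y)| <=
    4 * ((x + h) ^+ 2 - x ^+ 2) * (D / b).
  apply: far_sqrt_le => //; [exact: ltW|linarith|linarith| |].
    by apply: Itg_sub i2 => //; apply: subset_itvr; rewrite bnd_simp ltW.
  by move=> y; rewrite in_itv/= andbT => y1; apply: far; exact: ltW.
have := Rint_split_oy 0 (2 * x) _ (ltW x2) iw; rewrite vw (Rint_split_oy (2 * x) b _ (ltW x2b) i2).
move=> K0; rewrite (_ : _ - _ - _ = \int[mu]_(y in `](2 * x), b[) ((dS (x + h) y - dS x y) * w y) +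
  \int[mu]_(y in `]b, +oo[) ((dS (x + h) y - dS x y) * w y)); last first.
  move: K0; move: (\int[mu]_(y in `]0, +oo[) _) (\int[mu]_(y in `]0, (2 * x)[) _).
  move: (\int[mu]_(y in `](2 * x), b[) _) (\int[mu]_(y in `]b, +oo[) _) => p1 p2 p3 p4 ?; linarith.
apply: le_trans (ler_normD _ _) _; apply: le_trans (lerD f1 f2) _.
rewrite le_eqVlt; apply/orP; left; apply/eqP.
by field; rewrite !gt_eqF.
Qed.

Lemma dA_sqrt_limit (eps : R) : 0 < eps -> exists2 d : R, 0 < d &
  forall x : R, 0 < x -> x < d -> `|dA x - c ^+ 2| <= eps.
Proof.
move=> ep; have e0' := e0; have B0 := B_ge0; have c0 : 0 < c by have := c43; linarith.
have [C C0 [d1 d10 H1]] := du_sqrt_le.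
pose V := 2 * C + c; have V0 : 0 < V by rewrite /V; linarith.
have VE : 2 * C + c <= V by [].
clearbody V.
have q00 : 0 < eps / (24 * V) by rewrite divr_gt0// mulr_gt0.
(* The window is fixed first, by the derivative term alone. *)
pose q := Num.min (1 / 2) (eps / (24 * V)).
have q0 : 0 < q by rewrite lt_min q00 andbT; linarith.
have q12 : q <= 1 / 2 by rewrite ge_min lexx.
have qV : 6 * V * q <= eps / 4.
  have : q <= eps / (24 * V) by rewrite ge_min lexx orbT.
  by rewrite ler_pdivlMr ?mulr_gt0//; linarith.
clearbody q.
have q3 : 0 < q ^+ 3 by rewrite exprn_gt0.
have q31 : q ^+ 3 <= 1 by rewrite exprn_ile1 ?(ltW q0)//; linarith.
(* Then [eta] is made small relative to [q^3]: [16 eta / q^3] is [eps / 5] and [4 eta] at most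
   [eps / 20]. *)
pose eta := eps * q ^+ 3 / 80; have eta0 : 0 < eta by rewrite divr_gt0// mulr_gt0.
have etaE : 16 * eta / q ^+ 3 + 4 * eta <= eps / 4.
  rewrite (_ : 16 * eta / q ^+ 3 = eps / 5); last by rewrite /eta; field; rewrite gt_eqF.
  by have := ler_wpM2l (ltW ep) q31; rewrite mulr1 /eta; linarith.
have [d2 d20 H2] := u_sqrt_equiv eta eta0.
pose b := Num.min d2 (e / 2); have b0 : 0 < b by rewrite lt_min d20 divr_gt0.
have bd2 : b <= d2 by rewrite ge_min lexx.
have be : b <= e / 2 by rewrite ge_min lexx orbT.
clearbody b.
have sb : 0 < sqrt b by rewrite sqrtr_gt0.
pose D := B / sqrt b + c.
have D0 : 0 <= D by rewrite addr_ge0 ?(ltW c0)// divr_ge0// ltW.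
have F0 : 0 <= 2 * (B * CR) + 8 * (D / b).
  by apply: addr_ge0; apply: mulr_ge0 => //; [exact: mulr_ge0|rewrite divr_ge0// ltW].
pose F := 2 * (B * CR) + 8 * (D / b) + 1.
have Fp : 0 < F by rewrite /F; move: F0; move: (2 * (B * CR) + 8 * (D / b)) => *; linarith.
exists (Num.min (Num.min (d1 / 2) (b / 4)) (eps / (4 * F))).
  by rewrite !lt_min !divr_gt0// mulr_gt0.
move=> x x0; rewrite !lt_min => /andP[/andP[xd1 xb] xF].
have sx : 0 < sqrt x by rewrite sqrtr_gt0.
have M : `|dA x - c ^+ 2| <= 16 * eta / q ^+ 3 + 6 * V * q + 2 * x * (B * CR) + (4 * eta + 8 * x * (D / b)).
  apply: (dA_sqrt_approx x b q eta D V) => //; try linarith.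
  - by move=> y y0 yb; apply: H2 => //; linarith.
  - move=> y yb; have y0 : 0 < y by exact: lt_le_trans yb.
    have [u0 uB] := andP (u_bnd y y0).
    have c1 : 0 <= c * sqrt y by rewrite mulr_ge0 ?sqrtr_ge0// ltW.
    have c2 : B <= B / sqrt b * sqrt y by rewrite mulrAC ler_pdivlMr// ler_wpM2l// ler_wsqrtr.
    by rewrite /D mulrDl ler_norml; apply/andP; split; linarith.
  - move=> y; rewrite ltr_norml => /andP[y1 y2]; have y0 : 0 < y by linarith.
    have sy : 0 < sqrt y by rewrite sqrtr_gt0.
    have s2 : (sqrt y)^-1 <= 2 / sqrt x.
      rewrite ler_pdivlMr// mulrC ler_pdivrMr//.
      rewrite (_ : 2 * sqrt y = sqrt (4 * y)); first by apply: ler_wsqrtr; linarith.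
      by rewrite sqrtrM// (_ : 4 = 2 ^+ 2) ?sqrtr_sqr ?ger0_norm//; ring.
    have h1 := H1 y y0 ltac:(linarith); have h0 := du_ge0 y y0 ltac:(linarith).
    have h2 := ler_wpM2l C0 s2; have h3 := ler_wpM2l (ltW c0) s2.
    have h4 : 0 <= c / (2 * sqrt y) by rewrite divr_ge0 ?(ltW c0)// mulr_ge0// ltW.
    have h5 : c / (2 * sqrt y) = c / sqrt y / 2 by field; rewrite gt_eqF.
    have ix : 0 < (sqrt x)^-1 by rewrite invr_gt0.
    have h6 := ler_wpM2r (ltW ix) VE.
    have h7 := mulr_ge0 C0 (ltW ix); have h8 := mulr_ge0 (ltW c0) (ltW ix).
    move: h0 h1 h2 h3 h4 h6 h7 h8; rewrite h5; move: (sqrt x)^-1 (sqrt y)^-1 (du y) => *.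
    by rewrite ler_norml; apply/andP; split; linarith.
apply: (le_trans M); move: xF; rewrite ltr_pdivlMr ?mulr_gt0// /F.
move: qV etaE; move: (16 * eta / q ^+ 3) (B * CR) (D / b) => *; linarith.
Qed.

Lemma sqrt_asymptotics (eps : R) : 0 < eps -> exists2 d : R, 0 < d & forall x : R, 0 < x -> x < d ->
  `|u x - c * sqrt x| <= eps * sqrt x /\ `|du x - c / 2 / sqrt x| <= eps / sqrt x.
Proof.
move=> ep; have e0' := e0; have c0 : 0 < c by have := c43; linarith.
pose r := Num.min (eps / (2 * c)) (1 / 8).
have r0 : 0 < r by rewrite lt_min !divr_gt0// mulr_gt0.
have r8 : r <= 1 / 8 by rewrite ge_min lexx orbT.
have rc : 2 * (r * c) <= eps.
  have : r <= eps / (2 * c) by rewrite ge_min lexx.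
  by rewrite ler_pdivlMr ?mulr_gt0//; linarith.
clearbody r.
have rcp : 0 < r * c by rewrite mulr_gt0.
have [d1 d10 H1] := u_sqrt_equiv (r * c) rcp; have [d2 d20 H2] := dA_u r r0.
have [d3 d30 H3] := dA_sqrt_limit (r * (c ^+ 2 / 2)) ltac:(by rewrite mulr_gt0// divr_gt0// exprn_gt0).
exists (Num.min (Num.min d1 d2) (Num.min d3 e)); first by rewrite !lt_min d10 d20 d30.
move=> x x0; rewrite !lt_min => /andP[/andP[xd1 xd2] /andP[xd3 xe]].
have sx : 0 < sqrt x by rewrite sqrtr_gt0.
have h1 := H1 x x0 xd1; split; first by apply: le_trans h1 _; rewrite ler_wpM2r ?(ltW sx)//; linarith.
have T0 : 0 < c / 2 / sqrt x by rewrite !divr_gt0.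
have E : c * sqrt x * (c / 2 / sqrt x) = c ^+ 2 / 2 by field; rewrite gt_eqF.
apply: (@le_trans _ _ (4 * r * (c / 2 / sqrt x))).
  apply: (normr_factor_sub_le _ r (c * sqrt x) _ (u x) (du x) (dA x)) => //.
  - by rewrite mulr_gt0.
  - exact: du_ge0.
  - by rewrite mulrA.
  - exact: H2.
  by rewrite E (_ : 2 * (c ^+ 2 / 2) = c ^+ 2); [exact: H3|field].
rewrite (_ : 4 * r * (c / 2 / sqrt x) = 2 * (r * c) / sqrt x); last by field; rewrite gt_eqF.
by rewrite ler_pM2r ?invr_gt0.
Qed.

End SqrtCase.
End Solution.
End SingularConvolution.

(** * Solutions of the equation *)

Section SolutionFacts.
Context {R : realType}.
Notation mu := (@lebesgue_measure R).
Notation Itg D f := (mu.-integrable D (EFin \o f)).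
Notation dK := (central_diff2 (R := R)).

(** The difference [K - S] equals the given remainder almost everywhere and is continuous off 0, by
    convexity of [K]. It is therefore the representative to which the pointwise estimates apply. *)
Lemma remainder_increment (K S f f2 : R -> R) : Itg setT K -> (forall x, K (- x) = K x) ->
  (forall x, x != 0 -> 0 < K x) ->
  convex_function (`]0, +oo[ : set R) K -> {ae mu, forall x, K x = S x + f x} ->
  is_weak_derivative 2 f f2 -> Itg setT f2 ->
  measurable_fun setT S -> (forall z, z != 0 -> {for z, continuous S}) ->
  forall x x' : R, 0 <= x -> x <= x' ->
  let d y := (dK K x' y - dK S x' y) - (dK K x y - dK S x y) in
  Itg setT d /\ \int[mu]_y `|d y| <= 4 * \int[mu]_z `|f2 z| * (x' ^+ 2 - x ^+ 2).
Proof.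
move=> K1 Ke Kp Kc Ks wf f21 mS Sc x x' x0 xx' d.
pose Q z := K z - S z.
have dE y : d y = central_diff2 Q x' y - central_diff2 Q x y.
  by rewrite /d /Q /central_diff2; ring.
have Qf : {ae mu, forall z, Q z = f z}.
  by apply: (@filterS _ _ (ae_filter_ringOfSetsType mu) _ _ _ Ks) => z; rewrite /Q => ->; rewrite addrC addKr.
have mQ : measurable_fun setT Q by apply: measurable_funB => //; exact: Itg_measurable K1.
have Qc z : z != 0 -> {for z, continuous Q}.
  by move=> z0; apply: cvgB; [exact: convex_kernel_continuous|exact: Sc].
have [i v] := weak_derivative2_increment_L1 f f2 Q x x' wf f21 Qf mQ Qc x0 xx'.
split; first by apply: Itg_eq i => // y _; rewrite dE.
by under eq_Rint do rewrite dE.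
Qed.

Lemma within_halfline_nbhs (x : R) (P : R -> Prop) :
  (\forall y \near within `[0, +oo[ x^', P y) ->
  exists2 r : R, 0 < r & forall y, 0 <= y -> y != x -> `|y - x| < r -> P y.
Proof.
move=> /nbhs_ballP[r /= r0 H]; exists r => // y y0 yx yr.
by apply: (H y) => //=; [rewrite /ball/= distrC|rewrite in_itv/= y0].
Qed.

Lemma within_continuous0 (f : R -> R) (eps : R) : {within `[0, +oo[, continuous f} -> 0 < eps ->
  exists2 d : R, 0 < d & forall x : R, 0 <= x -> x < d -> `|f x - f 0| < eps.
Proof.
move=> /subspace_continuousP /(_ 0) H ep.
have /H /cvgrPdist_lt /(_ eps ep) /nbhs_ballP[r /= r0 Hr] : `[0, +oo[%classic (0 : R) by rewrite /= in_itv/= lexx.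
exists r => // x x0 xr; rewrite distrC; apply: Hr => /=.
  by rewrite /ball/= sub0r normrN ger0_norm.
by rewrite in_itv/= x0.
Qed.

(** The linear bound on [n] comes from its difference quotient at 0 together with [n 0 = 0], and the
    bound on [dn] from continuity at 0. Both quantities are then within one of [dn 0], whence the
    constant. *)
Lemma C1_halfline_prop (n : R -> R) : C1_halfline n -> n 0 = 0 -> exists dn : R -> R,
  (forall x : R, 0 < x -> is_derive x 1 n (dn x)) /\
  exists2 C : R, 0 <= C & exists2 d : R, 0 < d &
    forall x : R, 0 < x -> x < d -> `|n x| <= C * x /\ `|dn x| <= C.
Proof.
move=> [dn dnc Hn] n0; exists dn; split.
  move=> x x0; have H := Hn x (ltW x0).
  have c : h^-1 *: (n (h *: (1 : R) + x) - n x) @[h --> (0 : R)^'] --> dn x.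
    apply/cvgrPdist_lt => eps ep; move/cvgrPdist_lt : H => /(_ eps ep).
    move=> /within_halfline_nbhs[r r0 H].
    have m0 : 0 < Num.min r x by rewrite lt_min r0.
    have : \forall h \near (0 : R)^', `|h| < Num.min r x by exact: dnbhs0_lt.
    have : \forall h \near (0 : R)^', h != 0 by exact: nbhs_dnbhs_neq.
    apply: filterS2 => h h0; rewrite lt_min => /andP[hr hx].
    rewrite [h *: (1 : R)]mulr1; have := H (h + x); rewrite addrK.
    rewrite -subr_eq0 addrK h0 hr => /(_ _ isT isT); rewrite [_ / h]mulrC; apply.
    by move: hx; rewrite ltr_norml => /andP[? _]; lra.
  split; last exact: cvg_lim c.
  by apply/cvg_ex; exists (dn x).
have [d1 d10 H1] := within_continuous0 dn 1 dnc ltr01.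
have := Hn 0 (lexx 0) => /cvgrPdist_lt /(_ 1 ltr01) /within_halfline_nbhs[d2 d20 H2].
exists (`|dn 0| + 1); first by rewrite addr_ge0.
exists (Num.min d1 d2); first by rewrite lt_min d10.
move=> x x0; rewrite lt_min => /andP[xd1 xd2]; split; last first.
  have := H1 x (ltW x0) xd1; rewrite -{2}(subrK (dn 0) (dn x)) => h.
  by apply: le_trans (ler_normD _ _) _; rewrite addrC lerD2l ltW.
have := H2 x (ltW x0) (lt0r_neq0 x0); rewrite n0 !subr0 gtr0_norm// => /(_ xd2) h.
rewrite -[n x](divfK (lt0r_neq0 x0)) normrM (gtr0_norm x0) ler_wpM2r ?(ltW x0)//.
rewrite -{1}(subrK (dn 0) (n x / x)).
by apply: le_trans (ler_normD _ _) _; rewrite addrC lerD2l distrC ltW.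
Qed.

Lemma is_derive1_near_eq (f g : R -> R) (x a b d : R) : a < x -> x < b ->
  (forall y, a < y -> y < b -> f y = g y) -> is_derive x 1 f d -> is_derive x 1 g d.
Proof.
move=> ax xb fg; apply: near_eq_is_derive.
have : \forall y \near x, y \in `]a, b[ by apply: near_in_itvoo; rewrite in_itv/= ax.
by apply: filterS => y; rewrite in_itv/= => /andP[ay yb]; exact: fg.
Qed.

(** Differentiating the left side of the equation gives [A' - 2 u u' = (n'(u) u + 2 n(u)) u u']. The
    bracket is at most [3 C u], which tends to 0 with [x]. *)
Lemma solution_facts (n u A : R -> R) (e : R) : C1_halfline n -> n 0 = 0 ->
  {within `[0, +oo[, continuous u} -> (forall x : R, 0 <= x -> 0 <= u x) -> u 0 = 0 -> 0 < e ->
  (forall x : R, x \in `]0, e[ -> derivable u x 1) ->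
  {in `]0, e[ &, {homo u : x y / x < y}} ->
  (forall x : R, 0 <= x -> (1 + n (u x)) * (u x) ^+ 2 = A x) ->
  let du := (u^`())%classic in
  exists dA : R -> R,
  [/\ forall y : R, 0 < y -> y < e -> is_derive y 1 u (du y),
      forall y : R, 0 < y -> y < e -> is_derive y 1 A (dA y),
      forall eps : R, 0 < eps -> exists2 d : R, 0 < d &
        forall x : R, 0 < x -> x < d -> `|A x - u x ^+ 2| <= eps * u x ^+ 2 &
      forall eps : R, 0 < eps -> exists2 d : R, 0 < d &
        forall x : R, 0 < x -> x < d -> `|dA x - 2 * (u x * du x)| <= eps * (u x * du x)].
Proof.
move=> nC1 n0 uc u0 u00 e0 ud ui uA du.
have [dn [dnd [C C0 [d0 d00 HC]]]] := C1_halfline_prop n nC1 n0.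
have up y : 0 < y -> y < e -> 0 < u y.
  move=> y0 ye; apply: (@le_lt_trans _ _ (u (y / 2))); first by apply: u0; lra.
  by apply: ui; rewrite ?in_itv/=; lra.
have ui' y z : 0 < y -> y < z -> z < e -> u y < u z.
  by move=> y0 yz ze; apply: ui => //; rewrite in_itv/=; lra.
have dud y : 0 < y -> y < e -> is_derive y 1 u (du y).
  by move=> y0 ye; split; [apply: ud; rewrite in_itv/= y0|rewrite /du derive1E].
have us eta : 0 < eta -> exists2 d : R, 0 < d & forall x : R, 0 < x -> x < d -> [/\ 0 < u x, u x < eta & x < e].
  move=> eta0; have [d dp H] := within_continuous0 u eta uc eta0.
  exists (Num.min d e); first by rewrite lt_min dp.
  move=> x x0; rewrite lt_min => /andP[xd xe]; have := H x (ltW x0) xd.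
  by rewrite u00 subr0 gtr0_norm ?up//; split => //; exact: up.
exists (fun y => dn (u y) * du y * u y ^+ 2 + (1 + n (u y)) * (2 * (u y * du y))).
split => //.
- move=> y y0 ye; have uy := up y y0 ye.
  apply: (is_derive1_near_eq (fun x => (1 + n (u x)) * u x ^+ 2) _ _ 0 e) => //.
    by move=> z z0 _; apply: uA; exact: ltW.
  apply: (deq _ (dM (dD (dcst 1 y) (dcomp (dnd _ uy) (dud y y0 ye))) (dX 2 (dud y y0 ye)))).
  by rewrite add0r [2.-1]/= expr1; ring.
- move=> eps ep; have [|d dp H] := us (Num.min d0 (eps / (C + 1))).
    by rewrite lt_min d00 divr_gt0// ltr_wpDl.
  exists d => // x x0 xd; have [ux] := H x x0 xd; rewrite lt_min ltr_pdivlMr ?ltr_wpDl// => /andP[ud0 uC] _.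
  have [h _] := HC _ ux ud0.
  rewrite -uA ?(ltW x0)// mulrDl mul1r addrC addKr normrM [`|_ ^+ 2|]ger0_norm ?sqr_ge0//.
  by rewrite ler_wpM2r ?sqr_ge0//; lra.
move=> eps ep; have [|d dp H] := us (Num.min d0 (eps / (3 * C + 1))).
  by rewrite lt_min d00 divr_gt0// ltr_wpDl// mulr_ge0.
exists d => // x x0 xd; have [ux] := H x x0 xd.
rewrite lt_min ltr_pdivlMr ?ltr_wpDl ?mulr_ge0// => /andP[ud0 uC] xe.
have [h1 h2] := HC _ ux ud0.
have p0 : 0 <= u x * du x by rewrite mulr_ge0 ?(ltW ux)// (du_ge0 u du e ui' dud).
rewrite (_ : _ - _ = (dn (u x) * u x + 2 * n (u x)) * (u x * du x)); last by ring.
rewrite normrM (ger0_norm p0) ler_wpM2r//; apply: le_trans (ler_normD _ _) _.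
rewrite !normrM (gtr0_norm ux) [`|2|]ger0_norm//.
by have := ler_wpM2r (ltW ux) h2; lra.
Qed.

Lemma sqrt_ge_id (r : R) : 0 <= r -> r <= 1 -> r <= Num.sqrt r.
Proof.
by move=> r0 r1; rewrite -{1}(sqrt_sqr r r0) ler_piMl ?sqrtr_ge0// -sqrtr1 ler_wsqrtr.
Qed.

Lemma ratio_cvg_right (f g : R -> R) (l : R) :
  (forall eps : R, 0 < eps -> exists2 d : R, 0 < d & forall x : R, 0 < x -> x < d ->
    0 < g x /\ `|f x - l * g x| <= eps * g x) ->
  f x / g x @[x --> 0^'+] --> l.
Proof.
move=> H; apply/cvgrPdist_le => eps ep; have [d d0 Hd] := H eps ep.
have : \forall x \near (0 : R)^'+, x < d by exact: nbhs_right_lt.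
have : \forall x \near (0 : R)^'+, 0 < x by exact: nbhs_right_gt.
apply: filterS2 => x x0 xd; have [g0 h] := Hd x x0 xd.
rewrite distrC (_ : f x / g x - l = (f x - l * g x) / g x); last by field; rewrite gt_eqF.
by rewrite normrM normfV (gtr0_norm g0) ler_pdivrMr.
Qed.

End SolutionFacts.

Theorem mainTheorem1 (R : realType) (n K S Rem Rem'' u : R -> R)
  (n_C1 : C1_halfline n)
  (n_0 : n 0 = 0)
  (K_L1 : (@lebesgue_measure R).-integrable [set: R] (EFin \o K))
  (K_even : forall x : R, K (- x) = K x)
  (K_pos : forall x : R, x != 0 -> 0 < K x)
  (K_convex : convex_function (`]0, +oo[ : set R) K)
  (K_split : {ae (@lebesgue_measure R), forall x : R, K x = S x + Rem x})
  (S_cases : S = @log_part R \/ S = @sqrt_part R)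
  (Rem_weak : is_weak_derivative 2 Rem Rem'')
  (Rem''_L1 : (@lebesgue_measure R).-integrable [set: R] (EFin \o Rem''))
  (u_cont : {within `[0, +oo[, continuous u})
  (u_bounded : [bounded u x | x in `[0, +oo[])
  (u_nonneg : forall x : R, 0 <= x -> 0 <= u x)
  (u_0 : u 0 = 0)
  (u_near0 : exists2 e : R, 0 < e &
     [/\ forall x : R, x \in `]0, e[ -> derivable u x 1,
         {in `]0, e[, continuous (u^`())%classic} &
         {in `]0, e[ &, {homo u : x y / x < y}}])
  (u_eq : forall x : R, 0 <= x ->
     (1 + n (u x)) * (u x) ^+ 2 =
     \int[(@lebesgue_measure R)]_(y in `[0, +oo[) (central_diff2 K x y * u y)) :
  (S = @log_part R ->
     (u x / (x * ln (1 / x)) @[x --> 0^'+] --> (1 / 2 : R)) /\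
     ((u^`())%classic x / ln (1 / x) @[x --> 0^'+] --> (1 / 2 : R))) /\
  (S = @sqrt_part R ->
     (u x / (x `^ (1 / 2)) @[x --> 0^'+] --> (pi / 2 : R)) /\
     ((u^`())%classic x / (x `^ (- (1 / 2))) @[x --> 0^'+] --> (pi / 4 : R))).
Proof.
have [e e0 [ud udc ui]] := u_near0.
have CR0 : 0 <= 4 * \int[@lebesgue_measure R]_z `|Rem'' z| by rewrite mulr_ge0// Rintegral_ge0.
have u_sub : (`]0, +oo[%classic : set R) `<=` `[0, +oo[%classic.
  by apply: subset_itvr; rewrite bnd_simp.
have [B uB] : exists B : R, forall y : R, 0 < y -> 0 <= u y <= B.
  have [M [_ HM]] := u_bounded; exists (M + 1) => y y0; rewrite u_nonneg ?(ltW y0)//=.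
  apply: le_trans (ler_norm _) _; apply: (HM (M + 1)); first by rewrite ltrDl.
  by rewrite /= in_itv/= (ltW y0).
have u_meas : measurable_fun (`]0, +oo[%classic : set R) u.
  by apply: subspace_continuous_measurable_fun => //; exact: continuous_subspaceW u_cont.
have u_inc y z : 0 < y -> y < z -> z < e -> u y < u z.
  by move=> y0 yz ze; apply: ui => //; rewrite in_itv/=; lra.
have du_c y : 0 < y -> y < e -> {for y, continuous (u^`())%classic}.
  by move=> y0 ye; apply: udc; rewrite in_itv/= y0.
pose A x := \int[@lebesgue_measure R]_(y in `]0, +oo[) (central_diff2 K x y * u y).
have uA x : 0 <= x -> (1 + n (u x)) * u x ^+ 2 = A x.
  (* The equation integrates over the closed half-line; the endpoint is dropped because it is
     null. *)
  move=> x0; rewrite u_eq// /A Rintegral_itv_obnd_cbnd//.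
  apply: (Itg_mulr_bounded _ _ _ B) => //; first exact: Itg_central_diff2.
  by move=> y; rewrite /= in_itv/= andbT => /uB /andP[? ?]; rewrite ger0_norm.
have [dA [u_der A_der A_u dA_u]] :=
  solution_facts n u A e n_C1 n_0 u_cont u_nonneg u_0 e0 ud ui uA.
(* The almost everywhere splitting is transported along [S = S0], so that one remainder estimate
   serves both kernels. *)
have incr S0 (SE : S = S0) := remainder_increment K S0 Rem Rem'' K_L1 K_even K_pos K_convex
  (eq_ind _ (fun T => {ae (@lebesgue_measure R), forall x : R, K x = T x + Rem x}) K_split _ SE)
  Rem_weak Rem''_L1.
split=> SE.
  have asymp := log_asymptotics K _ (fun=> 1) _ K_L1 K_even K_pos K_convex CR0
    (incr _ SE (@measurable_log_part R) (@log_part_continuous R))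
    _ _ _ (@log_part_Itg R) _ _ _ _ u _ dA B e e0 u_meas _ uB u_inc u_der A_der A_u dA_u du_c
    (fun=> erefl) (@central_diff2_log_far R).
  have {}asymp eps : 0 < eps -> exists2 d : R, 0 < d & forall x : R, 0 < x -> x < d ->
    `|u x + x * ln x / 2| <= eps * (x * - ln x) /\ `|(u^`())%classic x + ln x / 2| <= eps * - ln x.
    apply: asymp => //.
    - by move=> a b a0 ab; have b0 := lt_le_trans a0 ab; rewrite !mulr1 -ler_pdivrMr//;
        apply: sqrt_ge_id; rewrite ?divr_ge0 ?ler_pdivrMr ?mul1r// ltW.
    - by move=> m a b m0 ma mb; rewrite div1r; exact: log_part_increment.
    - by move=> rho h z h0 z0 zh zr; rewrite mul1r; exact: log_part_local.
    - move=> x y x0 y0 yx xy; apply: le_trans (central_diff2_log_near x y x0 y0 (ltW yx) xy) _.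
      rewrite mul1r ler_wpM2r ?invr_ge0 ?sqrtr_ge0// sqrtrM// ler_wpM2r ?sqrtr_ge0//.
      by have := four_sqrt2_le R; lra.
    - move=> x x' y x0 xx' xy y0; have /andP[h1 h2] := central_diff2_log_far x x' y x0 xx' ltac:(lra).
      have D0 : 0 <= x' ^+ 2 - x ^+ 2 by rewrite subr_ge0 ler_pXn2r ?nnegrE ?(le_trans x0 xx').
      apply/andP; split; first by apply: le_trans h1; rewrite divr_ge0 ?sqr_ge0.
      have y2 : 0 < y ^+ 2 by rewrite exprn_gt0.
      have x2 : x' ^+ 2 <= 9 / 16 * y ^+ 2.
        rewrite (_ : 9 / 16 * y ^+ 2 = (3 / 4 * y) ^+ 2); last by field.
        by rewrite ler_pXn2r ?nnegrE//; lra.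
      apply: le_trans h2 _; rewrite -mulrA mulrCA ler_wpM2l//.
      have q0 : 0 < y ^+ 2 - x' ^+ 2 by lra.
      by rewrite mulrA mulr1 -[leLHS]div1r ler_pdivrMr// mulrAC ler_pdivlMr//; lra.
  have asymp1 eps : 0 < eps -> exists2 d : R, 0 < d & forall x : R, 0 < x -> x < d ->
    [/\ ln (1 / x) = - ln x, 0 < - ln x,
      `|u x + x * ln x / 2| <= eps * (x * - ln x) & `|(u^`())%classic x + ln x / 2| <= eps * - ln x].
    move=> /asymp[d d0 H]; exists (Num.min d 1); first by rewrite lt_min d0 ltr01.
    move=> x x0; rewrite lt_min => /andP[xd x1]; have [h1 h2] := H x x0 xd.
    by split=> //; [rewrite div1r lnV// posrE|rewrite oppr_gt0 ln_lt0// x0].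
  split; apply: ratio_cvg_right => eps /asymp1[d d0 H]; exists d => // x x0 xd;
    have [-> l0 h1 h2] := H x x0 xd.
    by rewrite mulr_gt0//; split=> //; rewrite (_ : _ - _ = u x + x * ln x / 2)//; ring.
  by split=> //; rewrite (_ : _ - _ = (u^`())%classic x + ln x / 2)//; ring.
have asymp := sqrt_asymptotics K _ (fun a => (Num.sqrt a)^-1) _ K_L1 K_even K_pos K_convex CR0
  (incr _ SE (@measurable_sqrt_part R) (@sqrt_part_continuous R))
  _ _ _ (@sqrt_part_Itg R) _ _ _ _ u _ dA B e e0 u_meas _ uB u_inc u_der A_der A_u dA_u du_c
  (pi / 2) _ (fun=> erefl) (@central_diff2_sqrt_inner R) (@central_diff2_sqrt_outer R)
  (@sqrt_profile R).
have {}asymp eps : 0 < eps -> exists2 d : R, 0 < d & forall x : R, 0 < x -> x < d ->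
  `|u x - pi / 2 * Num.sqrt x| <= eps * Num.sqrt x /\
  `|(u^`())%classic x - pi / 2 / 2 / Num.sqrt x| <= eps / Num.sqrt x.
  apply: asymp.
  - by move=> a a0; rewrite invr_gt0 sqrtr_gt0.
  - by move=> a b a0 ab; rewrite lef_pV2 ?posrE ?sqrtr_gt0 ?(lt_le_trans a0 ab)// ler_wsqrtr.
  - move=> a b a0 ab; have b0 := lt_le_trans a0 ab.
    have [sa sb] : 0 < Num.sqrt a /\ 0 < Num.sqrt b by rewrite !sqrtr_gt0.
    rewrite sqrtrM ?(ltW a0)// sqrtrV ?(ltW b0)// -{1}(sqrt_sqr a (ltW a0)) -{2}(sqrt_sqr b (ltW b0)).
    by rewrite le_eqVlt; apply/orP; left; apply/eqP; field; rewrite !gt_eqF.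
  - move=> m a b m0 ma mb; apply: le_trans (sqrt_part_increment m a b m0 ma mb) _.
    by rewrite invfM [m^-1 * _]mulrC.
  - move=> rho h z h0 z0 zh zr; have r0 : 0 < rho by apply: lt_le_trans zr; rewrite normr_gt0.
    by rewrite mulVf ?gt_eqF ?sqrtr_gt0// mulr1; exact: sqrt_part_local.
  - move=> x y x0 y0 _ _; apply: le_trans (central_diff2_sqrt_near x y x0 y0) _.
    rewrite mulVf ?gt_eqF ?sqrtr_gt0// mulr1 -[leLHS]mul1r ler_wpM2r ?invr_ge0 ?sqrtr_ge0//.
    by rewrite ler1n.
  - move=> x x' y x0 xx' xy y0; have := central_diff2_sqrt_far x x' y x0 xx' xy y0.
    by rewrite invfM [(y ^+ 2)^-1 * _]mulrC.
  - by apply: (measurableT_comp measurable_invr); exact: measurable_sqrt.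
  (* This is [4 / 3 < pi / 2]. *)
  - by have := @pi_gt_8_3 R; lra.
split.
  apply: ratio_cvg_right => eps /asymp[d d0 H]; exists d => // x x0 xd; have [h _] := H x x0 xd.
  by rewrite div1r powR12_sqrt ?(ltW x0)// sqrtr_gt0.
rewrite (_ : pi / 4 = pi / 2 / 2); last by field.
apply: ratio_cvg_right => eps /asymp[d d0 H]; exists d => // x x0 xd; have [_ h] := H x x0 xd.
have := @sqrt_partE R x; rewrite /sqrt_part (gtr0_norm x0) => ->.
by rewrite invr_gt0 sqrtr_gt0.
Qed.
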